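(* There are implicit constants, independent of $T\in(0,1]$, $M_0\ge1$, $a\in[0,T)$ and all functions involved, such that the following hold for functions on $[0,T)\times\mathbb{T}^4$, with all norms $X^s,Y^s$ taken on $[0,T)$. High frequency estimate: $$\Big|\int_0^T\!\!\int_{\mathbb{T}^4}u_1u_2u_3\,g\,dx\,dt\Big|\lesssim\|u_1\|_{Y^{-1}}\|u_2\|_{Y^1}\|u_3\|_{Y^1}\|g\|_{Y^1}.$$ Low frequency estimate: $$\Big|\int_0^T\!\!\int_{\mathbb{T}^4}u_1(P_{\le M_0}u_2)u_3\,g\,dx\,dt\Big|\lesssim T^{\frac17}M_0^{\frac35}\|u_1\|_{Y^{-1}}\|P_{\le M_0}u_2\|_{Y^1}\|u_3\|_{Y^1}\|g\|_{Y^1}.$$ Equivalently (in Duhamel form), $$\Big\|\int_a^te^{i(t-s)\Delta}(u_1u_2u_3)(s)\,ds\Big\|_{X^{-1}([0,T))}\lesssim\|u_1\|_{Y^{-1}}\Big(T^{\frac17}M_0^{\frac35}\|P_{\le M_0}u_2\|_{Y^1}+\|P_{>M_0}u_2\|_{Y^1}\Big)\|u_3\|_{Y^1}$$ and $$\Big\|\int_a^te^{i(t-s)\Delta}(u_1u_2u_3)(s)\,ds\Big\|_{X^{-1}([0,T))}\lesssim\|u_1\|_{Y^{-1}}\|u_2\|_{Y^1}\|u_3\|_{Y^1}.$$ Moreover, if $u_j=e^{it\Delta}f_j$ for some $j$, then the $Y^s$ norm of $u_j$ in the last two estimates can be replaced by the $H^s$ norm of $f_j$ (and the norms of $P_{\le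 M_0}u_2$, $P_{>M_0}u_2$ by those of $P_{\le M_0}f_2$, $P_{>M_0}f_2$).
   Context: $P_{\le M}$, $P_{>M}=1-P_{\le M}$ are Littlewood-Paley projections on $\mathbb{T}^4$; $\langle\xi\rangle=(1+|\xi|^2)^{1/2}$. $U^2_t$ and $V^2_t$ (complex-valued functions of time, standard conventions): a $U^2$-atom is a step function $\sum_{k=1}^K\phi_{k-1}1_{[t_{k-1},t_k)}$ for a finite partition $t_0<\dots<t_K\le\infty$ with $\sum|\phi_{k}|^2=1$; $U^2$ is the atomic space of sums $\sum_j\lambda_ja_j$ with norm $\inf\sum_j|\lambda_j|$. $V^2$ consists of right-continuous functions $v$ with $v(-\infty)=0$ and finite norm $\|v\|_{V^2}=\sup(\sum_k|v(t_k)-v(t_{k-1})|^2)^{1/2}$, the supremum over finite partitions (with $v(\infty):=0$). For a time interval $[0,T)$ the norms are the corresponding restriction norms. Then $$\|u\|_{X^s([0,T))}=\Big(\sum_{\xi\in\mathbb{Z}^4}\langle\xi\rangle^{2s}\big\|\widehat{e^{-it\Delta}u(t,\cdot)}(\xi)\big\|_{U^2_t}^2\Big)^{1/2},\qquad \|u\|_{Y^s([0,T))}=\Big(\sum_{\xi\in\mathbb{Z}^4}\langle\xi\rangle^{2s}\big\|\widehat{e^{-it\Delta}u(t,\cdot)}(\xi)\big\|_{V^2_t}^2\Big)^{1/2}.$$ *)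

(* Defs.v *)
(* [R[i]] carries its topology through the alias [R[i]^o], which is therefore
   used wherever a limit is taken. *)
From HB Require Import structures.
From mathcomp Require Export all_boot all_order all_algebra.
From mathcomp Require Export all_classical all_reals all_analysis.
From mathcomp Require Export complex.

Set Implicit Arguments.
Unset Strict Implicit.
Unset Printing Implicit Defensive.

Export Order.TTheory GRing.Theory Num.Theory.
Export numFieldNormedType.Exports.

Global Open Scope classical_set_scope.
Global Open Scope complex_scope.
Global Open Scope ring_scope.

(* The torus T^4 = (R / 2 pi Z)^4 has frequencies in Z^4.  A distribution on
   T^4 is given by its Fourier coefficients [c : freq -> R[i]], standing for
   sum_xi c xi * e^(i x.xi), and a time-dependent one by [u : R -> freq -> R[i]].
   This is needed because elements of Y^(-1) are only H^(-1)-valued. *)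
Definition freq : Type := (int * int * int * int)%type.

Section Frequencies.
Context {R : realType}.
Implicit Types (xi : freq) (x : R * R * R * R).

Definition sqnorm xi : R :=
  let: (k1, k2, k3, k4) := xi in (k1 ^+ 2 + k2 ^+ 2 + k3 ^+ 2 + k4 ^+ 2)%:~R.

Definition japanese xi : R := Num.sqrt (1 + sqnorm xi).

Definition dotprod xi x : R :=
  let: (k1, k2, k3, k4) := xi in let: (x1, x2, x3, x4) := x in
  k1%:~R * x1 + k2%:~R * x2 + k3%:~R * x3 + k4%:~R * x4.

(* e^(i theta) *)
Definition expi (theta : R) : R[i] := cos theta +i* sin theta.

(* the coefficients of e^(i t Delta) f *)
Definition free (f : freq -> R[i]) (t : R) xi : R[i] :=
  expi (- (t * sqnorm xi)) * f xi.

(* the coefficients of e^(- i t Delta) u(t) *)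
Definition profile (u : R -> freq -> R[i]) (t : R) xi : R[i] :=
  expi (t * sqnorm xi) * u t xi.

(* The admissible cutoffs include both the smooth bumps and the sharp cutoff
   1_(r <= 1); only these properties are imposed. *)
Definition lp_cutoff (eta : R -> R) : Prop :=
  forall r, [/\ 0 <= eta r <= 1, r <= 1 -> eta r = 1 & 2 < r -> eta r = 0].

Definition lp_low (eta : R -> R) (M : R) (c : freq -> R[i]) xi : R[i] :=
  (eta (Num.sqrt (sqnorm xi) / M))%:C * c xi.

Definition lp_high (eta : R -> R) (M : R) (c : freq -> R[i]) xi : R[i] :=
  c xi - lp_low eta M c xi.

End Frequencies.

Section TimeNorms.
Context {R : realType}.
Implicit Types (v : R -> R[i]) (t : nat -> \bar R).

(* t 0 < ... < t K with t 0 real and t K possibly +oo *)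
Definition time_partition (K : nat) t : Prop :=
  [/\ (0 < K)%N, (-oo < t 0%N)%E & forall k, (k < K)%N -> (t k < t k.+1)%E].

Definition U2_atom v : Prop :=
  exists K t (phi : nat -> R[i]),
    [/\ time_partition K t,
        \sum_(0 <= k < K) Normc.normc (phi k) ^+ 2 = 1
      & forall s : R, v s = \sum_(0 <= k < K)
          (if (t k <= s%:E)%E && (s%:E < t k.+1)%E then phi k else 0)].

(* +oo when v is not in U^2 *)
Definition U2_norm v : \bar R :=
  ereal_inf [set (\sum_(0 <= j <oo) (Normc.normc (lambda j))%:E)%E |
    lambda in [set lambda : nat -> R[i] | exists a : nat -> R -> R[i],
      (forall j, U2_atom (a j)) /\
      forall s : R, ((fun n => \sum_(0 <= j < n) lambda j * a j s)
                      : nat -> R[i]^o) @ \oo --> (v s : R[i]^o)]].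

Definition val_ext v (t : \bar R) : R[i] := if t is s%:E then v s else 0.

Definition V2_norm v : \bar R :=
  ereal_sup [set y | exists K t, time_partition K t /\
    y = (Num.sqrt (\sum_(0 <= k < K)
           Normc.normc (val_ext v (t k.+1) - val_ext v (t k)) ^+ 2))%:E].

Definition in_V2 v : Prop :=
  [/\ forall s : R, (v : R -> R[i]^o) @ at_right s --> (v s : R[i]^o),
      (v : R -> R[i]^o) @ -oo --> (0 : R[i]^o)
    & (V2_norm v < +oo)%E].

Definition agree_on (T : R) v w : Prop := forall s : R, 0 <= s < T -> v s = w s.

Definition U2_restr (T : R) v : \bar R :=
  ereal_inf [set U2_norm w | w in [set w | agree_on T w v]].

Definition V2_restr (T : R) v : \bar R :=
  ereal_inf [set V2_norm w | w in [set w | in_V2 w /\ agree_on T w v]].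

End TimeNorms.

Section SpaceTimeNorms.
Context {R : realType}.
Local Open Scope ereal_scope.

Definition weighted_l2 (s : R) (n : freq -> \bar R) : \bar R :=
  sqrte (\esum_(xi in [set: freq])
           ((japanese xi : R) `^ (2 * s))%:E * n xi ^+ 2).

Definition H_norm (s : R) (f : freq -> R[i]) : \bar R :=
  weighted_l2 s (fun xi => (Normc.normc (f xi))%:E).

(* On [0,T): these only depend on u t for 0 <= t < T. *)
Definition X_norm (s T : R) (u : R -> freq -> R[i]) : \bar R :=
  weighted_l2 s (fun xi => U2_restr T (fun t => profile u t xi)).

Definition Y_norm (s T : R) (u : R -> freq -> R[i]) : \bar R :=
  weighted_l2 s (fun xi => V2_restr T (fun t => profile u t xi)).

End SpaceTimeNorms.

Section Integrals.
Context {R : realType}.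
Local Notation mu := (@lebesgue_measure R).
Local Notation mu4 := (mu \x mu \x mu \x mu)%E.

Definition cintegral d (S : measurableType d) (m : {measure set S -> \bar R})
    (D : set S) (f : S -> R[i]) : R[i] :=
  (\int[m]_(x in D) complex.Re (f x)) +i* (\int[m]_(x in D) complex.Im (f x)).

Definition torus : set (R * R * R * R) :=
  `[0, 2 * pi[ `*` `[0, 2 * pi[ `*` `[0, 2 * pi[ `*` `[0, 2 * pi[.

Definition fourier (F : R * R * R * R -> R[i]) (xi : freq) : R[i] :=
  ((2 * pi) ^- 4)%:C *
    cintegral mu4 torus (fun x => F x * expi (- dotprod xi x)).

(* oriented: the lower end a may exceed t *)
Definition cintegral_between (a t : R) (f : R -> R[i]) : R[i] :=
  if a <= t then cintegral mu `[a, t] f else - cintegral mu `[t, a] f.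

(* the coefficients of \int_a^t e^(i (t - s) Delta) F(s) ds *)
Definition duhamel (a : R) (F : R -> R * R * R * R -> R[i])
    (t : R) (xi : freq) : R[i] :=
  cintegral_between a t
    (fun s => expi (- ((t - s) * sqnorm xi)) * fourier (F s) xi).

(* the partial Fourier sum of u over |xi| <= N, as a function of (t, x) *)
Definition partial_sum (N : nat) (u : R -> freq -> R[i])
    (t : R) (x : R * R * R * R) : R[i] :=
  \sum_(xi \in [set xi : freq | sqnorm xi <= N%:R ^+ 2 :> R])
     u t xi * expi (dotprod xi x).

(* When u1 is merely in Y^(-1), products such as u1 u2 u3 g are not functions:
   the multilinear expressions below are limits of their values at partial
   Fourier sums, for which they are ordinary Lebesgue integrals. *)
Definition quad_integral_N (T : R) (u1 u2 u3 g : R -> freq -> R[i])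
    (N : nat) : R[i]^o :=
  cintegral (mu4 \x mu)%E (torus `*` `[0, T[)
    (fun p => partial_sum N u1 p.2 p.1 * partial_sum N u2 p.2 p.1
              * partial_sum N u3 p.2 p.1 * partial_sum N g p.2 p.1).

Definition quad_integral T u1 u2 u3 g : R[i] :=
  limn (quad_integral_N T u1 u2 u3 g).

Definition duhamel3_N (a : R) (u1 u2 u3 : R -> freq -> R[i])
    (t : R) (xi : freq) (N : nat) : R[i]^o :=
  duhamel a (fun s x => partial_sum N u1 s x * partial_sum N u2 s x
                        * partial_sum N u3 s x) t xi.

Definition duhamel3 a u1 u2 u3 (t : R) (xi : freq) : R[i] :=
  limn (duhamel3_N a u1 u2 u3 t xi).

Lemma partial_sum_band_limited (N0 N : nat) u t x : (N0 <= N)%N ->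
  (forall xi : freq, N0%:R ^+ 2 < sqnorm xi :> R -> u t xi = 0) ->
  partial_sum N u t x = partial_sum N0 u t x.
Proof.
move=> N0N u0; rewrite /partial_sum; apply/esym/fsbig_widen.
  move=> xi /= /le_trans; apply.
  by rewrite lerXn2r ?nnegrE ?ler0n ?ler_nat.
move=> xi [_ /= /negP]; rewrite -ltNge => xiN; by rewrite u0 ?mul0r.
Qed.

(* For trigonometric polynomials in x the limit is the Lebesgue integral. *)
Lemma quad_integral_band_limited (N0 : nat) T u1 u2 u3 g :
  (forall u, u \in [:: u1; u2; u3; g] -> forall t (xi : freq),
     N0%:R ^+ 2 < sqnorm xi :> R -> u t xi = 0) ->
  quad_integral T u1 u2 u3 g = quad_integral_N T u1 u2 u3 g N0.
Proof.
move=> u0; rewrite /quad_integral.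
apply: (@lim_near_cst R[i]^o); first exact: norm_hausdorff.
exists N0 => // N /= N0N; rewrite /quad_integral_N.
congr cintegral; apply/funext => p.
by rewrite !(@partial_sum_band_limited N0 N) // => xi; apply: u0;
  rewrite !inE eqxx ?orbT.
Qed.

End Integrals.

(* ||f||_(H^s) when b holds, ||u||_(Y^s([0,T))) otherwise *)
Definition size_norm {R : realType} (b : bool) (s T : R)
    (u : R -> freq -> R[i]) (f : freq -> R[i]) : \bar R :=
  if b then H_norm s f else Y_norm s T u.

Definition is_free_on {R : realType} (T : R) (u : R -> freq -> R[i])
    (f : freq -> R[i]) : Prop :=
  forall t, 0 <= t < T -> forall xi, u t xi = free f t xi.

(* Main.v *)
(* On the Fourier side the quadrilinear form is a time integral of sums over frequencies
   with [A + B + C + D = 0], and by Cauchy-Schwarz it is controlled by the mean squares of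
   products of two factors.  For two free waves such a mean square counts the rectangles of
   [Z^4] with vertices weighted by the data: [A + C = B + D] is the conservation of
   frequency and [(B - A).(D - A) = 0] that of [|A|^2].  There are [O(M^2)] of them, in the
   l^2-weighted sense, in a cube of side [M], and a power of the ratio is gained
   when the two waves live at different dyadic frequencies.  Functions of bounded quadratic
   variation are differences of step functions at geometric scales (stopping times), which
   transfers the bound from free waves to [Y^s], at the cost of part of that gain; what is
   left makes the dyadic sum converge.  A factor of low frequency may instead be estimated
   trivially on the short interval, whence the power of [T].

   In the Duhamel form, testing against functions that are step functions in time for each
   frequency bounds the variation of the profile of the integral along every chain of [n]
   times by [b n^(1/3)]; since [1/3 < 1/2] the same stopping times decompose it into
   U^2-atoms with summable coefficients. *)
From HB Require Import structures.
Require Import Defs.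
From mathcomp Require Import measurable_realfun.
From mathcomp Require Import zify ring lra.

Set Implicit Arguments.
Unset Strict Implicit.
Unset Printing Implicit Defensive.

(** The estimate is scale invariant, so the rectangle count must carry no logarithm. A fixed side
    [v] of size about [M] leaves about [M^3 / |v'|] perpendicular vectors in the cube, where [v'] is
    the primitive vector along [v]; all loss thus comes from sides with a large common divisor [h].
    These are handled modulo [h] as copies of the problem at scale [M / h], and an induction on [M]
    closes because the tail of the sum of [h^(-2)] is small.

    The exponent of the variation condition is a compromise. Let the sum of squares along a chain of
    [n] times grow like [n^alpha]. Jumps of size [1 / L] then number at most [L^(2 / (1 - alpha))],
    and the diagonal terms of the bilinear estimate are summable over the scales if this is below
    [L^4], that is for [alpha < 1/2]. Test functions with [J] steps cost [J^((1 - alpha) / 2)], so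
    the dual variation grows more slowly than [n^(1/2)], as a decomposition into atoms requires, if
    [alpha > 0]. The choice [alpha = 1/3] meets both conditions with room. *)

(** * Lattice points perpendicular to a given vector *)

Definition c1 (u : freq) : int := u.1.1.1.
Definition c2 (u : freq) : int := u.1.1.2.
Definition c3 (u : freq) : int := u.1.2.
Definition c4 (u : freq) : int := u.2.

Definition dot (u v : freq) : int :=
  c1 u * c1 v + c2 u * c2 v + c3 u * c3 v + c4 u * c4 v.

Definition in_cube (m : int) (u : freq) : bool :=
  [&& `|c1 u| <= m, `|c2 u| <= m, `|c3 u| <= m & `|c4 u| <= m].

Lemma freq_eqP (u v : freq) :
  c1 u = c1 v -> c2 u = c2 v -> c3 u = c3 v -> c4 u = c4 v -> u = v.
Proof.
case: u => [[[? ?] ?] ?]; case: v => [[[? ?] ?] ?].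
by rewrite /c1 /c2 /c3 /c4 /= => -> -> -> ->.
Qed.

Lemma c1D u v : c1 (u + v) = c1 u + c1 v. Proof. by []. Qed.
Lemma c2D u v : c2 (u + v) = c2 u + c2 v. Proof. by []. Qed.
Lemma c3D u v : c3 (u + v) = c3 u + c3 v. Proof. by []. Qed.
Lemma c4D u v : c4 (u + v) = c4 u + c4 v. Proof. by []. Qed.
Lemma c1N u : c1 (- u) = - c1 u. Proof. by []. Qed.
Lemma c2N u : c2 (- u) = - c2 u. Proof. by []. Qed.
Lemma c3N u : c3 (- u) = - c3 u. Proof. by []. Qed.
Lemma c4N u : c4 (- u) = - c4 u. Proof. by []. Qed.
Definition cE := (c1D, c2D, c3D, c4D, c1N, c2N, c3N, c4N).

Ltac fring := apply: freq_eqP; rewrite ?cE; ring.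

Lemma size_fibers (S T : eqType) (f : S -> T) (s : seq S) (t : seq T) K :
  (forall x, x \in s -> f x \in t) ->
  (forall y, y \in t -> (count (fun x => f x == y) s <= K)%N) ->
  (size s <= K * size t)%N.
Proof.
elim: t s => [|y t IH] s st sK.
  by case: s st {sK} => // x s /(_ x); rewrite mem_head => /(_ isT).
have -> : size s = (count (fun x => f x == y) s +
    size [seq x <- s | f x != y])%N.
  by rewrite size_filter -(count_predC (fun x => f x == y) s).
rewrite /= mulnS leq_add ?sK ?mem_head //; apply: IH.
  move=> x; rewrite mem_filter => /andP[fxy xs].
  by have := st _ xs; rewrite inE (negPf fxy).
move=> z zt; rewrite count_filter; apply: leq_trans (sK z _).
  by apply: sub_count => x /= /andP[].
by rewrite inE zt orbT.
Qed.

Definition int_range (m : nat) : seq int :=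
  [seq i%:Z - m%:Z | i <- iota 0 (m.*2).+1].

Lemma size_int_range m : size (int_range m) = (m.*2).+1.
Proof. by rewrite size_map size_iota. Qed.

Lemma mem_int_range m (z : int) : (z \in int_range m) = (`|z| <= m%:Z).
Proof.
apply/mapP/idP => [[k kr ->]|zm].
  by move: kr; rewrite mem_iota; lia.
exists (absz (z + m%:Z)); last by lia.
by rewrite mem_iota; lia.
Qed.

Lemma uniq_int_range m : uniq (int_range m).
Proof. by rewrite map_inj_uniq ?iota_uniq // => i j; lia. Qed.

Definition cube_seq (m : nat) : seq freq :=
  [seq (p, d) | p <- [seq (p, c) | p <- [seq (a, b) | a <- int_range m,
     b <- int_range m], c <- int_range m], d <- int_range m].

Lemma size_cube_seq m : size (cube_seq m) = ((m.*2).+1 ^ 4)%N.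
Proof. by rewrite !size_allpairs !size_int_range; lia. Qed.

Lemma mem_pairs (S T : eqType) (s : seq S) (t : seq T) x y :
  ((x, y) \in [seq (a, b) | a <- s, b <- t]) = (x \in s) && (y \in t).
Proof.
apply/allpairsP/andP => [[[a b] /= [? ? [-> ->]]]//|[xs yt]].
by exists (x, y).
Qed.

Lemma uniq_pairs (S T : eqType) (s : seq S) (t : seq T) :
  uniq s -> uniq t -> uniq [seq (a, b) | a <- s, b <- t].
Proof. by move=> us ut; apply: allpairs_uniq => // -[? ?] [? ?]. Qed.

Lemma mem_cube_seq m (u : freq) : (u \in cube_seq m) = in_cube m%:Z u.
Proof.
case: u => [[[a b] c] d]; rewrite /in_cube /c1 /c2 /c3 /c4 /=.
by rewrite !mem_pairs !mem_int_range -!andbA.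
Qed.

Lemma uniq_cube_seq m : uniq (cube_seq m).
Proof. by rewrite !uniq_pairs ?uniq_int_range. Qed.

Definition cube3_seq (m : nat) : seq (int * int * int) :=
  [seq (p, c) | p <- [seq (a, b) | a <- int_range m, b <- int_range m],
     c <- int_range m].

Lemma size_cube3_seq m : size (cube3_seq m) = ((m.*2).+1 ^ 3)%N.
Proof. by rewrite !size_allpairs !size_int_range; lia. Qed.

Lemma mem_cube3_seq m (a b c : int) : ((a, b, c) \in cube3_seq m) =
  [&& `|a| <= m%:Z, `|b| <= m%:Z & `|c| <= m%:Z].
Proof. by rewrite !mem_pairs !mem_int_range -!andbA. Qed.

Definition resid (v : freq) (d : int * int * int) : int :=
  c2 v * d.1.1 + c3 v * d.1.2 + c4 v * d.2.

(* Distinct residues modulo [c1 v] shift the solutions [u] of [dot u v = 0]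
   to disjoint sets. *)
Lemma hyperplane_count (v : freq) (m n : nat) (U : seq freq)
    (D : seq (int * int * int)) :
  c1 v != 0 -> uniq U -> uniq D ->
  (forall u, u \in U -> dot u v = 0 /\ in_cube m%:Z u) ->
  (forall d, d \in D -> [&& `|d.1.1| <= n%:Z, `|d.1.2| <= n%:Z & `|d.2| <= n%:Z]) ->
  (forall d d', d \in D -> d' \in D ->
     (c1 v %| resid v d - resid v d')%Z -> d = d') ->
  (size U * size D <= ((m + n).*2).+1 ^ 3)%N.
Proof.
move=> v0 uU uD Uv Dn Dinj; rewrite -size_cube3_seq.
pose h (u : freq) (d : int * int * int) : int * int * int :=
  (c2 u + d.1.1, c3 u + d.1.2, c4 u + d.2).
rewrite -(size_allpairs h) uniq_leq_size //; last first.
  move=> x /allpairsP[[u [[a b] c]] [/Uv[_ /and4P[? ? ? ?]] /Dn /and3P[? ? ?] ->]].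
  by rewrite /h mem_cube3_seq; cbn [fst snd] in *; apply/and3P; split; lia.
apply: allpairs_uniq => // -[u d] [u' d'] /=.
rewrite !mem_pairs => /andP[uU' dD] /andP[u'U d'D] [e2 e3 e4].
have [[du _] [du' _]] := (Uv _ uU', Uv _ u'U).
have dd : d = d'.
  apply: Dinj => //; apply/dvdzP; exists (c1 u - c1 u').
  move: du du' e2 e3 e4; rewrite /dot /resid.
  set a1 := c1 u; set a2 := c2 u; set a3 := c3 u; set a4 := c4 u.
  set b1 := c1 u'; set b2 := c2 u'; set b3 := c3 u'; set b4 := c4 u'.
  move=> du du' e2 e3 e4.
  have -> : d.1.1 = b2 + d'.1.1 - a2 by rewrite -e2; ring.
  have -> : d.1.2 = b3 + d'.1.2 - a3 by rewrite -e3; ring.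
  have -> : d.2 = b4 + d'.2 - a4 by rewrite -e4; ring.
  by have := congr2 (fun x y => x - y) du du'; rewrite /= subr0; lia.
move: e2 e3 e4; rewrite dd => /addIr e2 /addIr e3 /addIr e4.
congr pair; apply: freq_eqP => //; apply: (mulIf v0).
by move: du du'; rewrite /dot e2 e3 e4; lia.
Qed.

(** Nested so that the partial gcds of [c1, c2] and of [c1, c2, c3] are available: [residue_system]
    eliminates the coordinates one at a time along this chain. *)
Definition gcd4 (v : freq) : nat :=
  gcdn `|c4 v| (gcdn `|c3 v| (gcdn `|c2 v| `|c1 v|)).

Lemma dvdn_div_gcd a e y : (0 < e)%N -> (e %| a * y)%N ->
  (e %/ gcdn a e %| y)%N.
Proof.
move=> e0; set g := gcdn a e.
have g0 : (0 < g)%N by rewrite gcdn_gt0 e0 orbT.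
move=> ey; rewrite -(@Gauss_dvdr _ (a %/ g)); last first.
  rewrite /coprime -(eqn_pmul2r g0) mul1n muln_gcdl !divnK ?dvdn_gcdl ?dvdn_gcdr //.
  by rewrite gcdnC.
rewrite -(dvdn_pmul2r g0) mulnAC !divnK ?dvdn_gcdl ?dvdn_gcdr //.
Qed.

Lemma small_dvdz (f : nat) (z : int) : (f %| `|z|)%N -> `|z| < f%:Z -> z = 0.
Proof.
move=> /dvdnP[k kf] zf; case: k kf => [|k] kf; first by lia.
by move: kf zf; rewrite mulSn; lia.
Qed.

Lemma minn_prod a b c s : (0 < a)%N -> (0 < b)%N -> (0 < c)%N ->
  (minn (a * (b * c)) s <= minn a s * minn b s * minn c s)%N.
Proof.
move=> a0 b0 c0; have [->|s0] := posnP s; first by rewrite minn0.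
have [sa|sa] := leqP s a.
  by rewrite geq_min; apply/orP; right; rewrite -mulnA leq_pmulr // muln_gt0 !leq_min b0 c0 s0.
have [sb|sb] := leqP s b.
  by rewrite geq_min; apply/orP; right; rewrite mulnAC leq_pmull // muln_gt0 !leq_min c0 a0 s0.
have [sc|sc] := leqP s c.
  by rewrite geq_min; apply/orP; right; rewrite leq_pmull // muln_gt0 a0.
by rewrite geq_min mulnA leqnn.
Qed.

(** Mixed-radix digits. Let [q = |c1 v|], let [e] be the gcd of [c2 v] and [q], and [f] that of
    [c3 v] and [e]. Modulo [f] only the last coordinate of [d] contributes to [resid v d], and
    [c4 v] is invertible there because [gcd4 v = 1]; modulo [e] the middle one is then determined up
    to multiples of [e / f], and modulo [q] the first up to multiples of [q / e]. A box with these
    side lengths, each cut at [s], has distinct residues and at least [min q s] points. *)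
Lemma residue_system (v : freq) (s : nat) : c1 v != 0 -> gcd4 v = 1%N ->
  exists D : seq (int * int * int),
  [/\ uniq D,
      (minn `|c1 v| s <= size D)%N,
      forall d, d \in D -> [/\ 0 <= d.1.1 < s%:Z, 0 <= d.1.2 < s%:Z
        & 0 <= d.2 < s%:Z]
    & forall d d', d \in D -> d' \in D ->
     (c1 v %| resid v d - resid v d')%Z -> d = d'].
Proof.
move=> v0 gv.
set q := `|c1 v|%N; set e := gcdn `|c2 v| q; set f := gcdn `|c3 v| e.
have q0 : (0 < q)%N by rewrite absz_gt0.
have e0 : (0 < e)%N by rewrite gcdn_gt0 q0 orbT.
have f0 : (0 < f)%N by rewrite gcdn_gt0 e0 orbT.
have eq : (e %| q)%N by rewrite dvdn_gcdr.
have fe : (f %| e)%N by rewrite dvdn_gcdr.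
pose r n := [seq i%:Z | i <- iota 0 (minn n s)].
have rP n (x : int) : x \in r n -> 0 <= x < s%:Z /\ x < n%:Z.
  by move=> /mapP[k]; rewrite mem_iota => ? ->; lia.
have ur n : uniq (r n) by rewrite map_inj_uniq ?iota_uniq // => i j [].
exists [seq (p, c) | p <- [seq (a, b) | a <- r (q %/ e)%N, b <- r (e %/ f)%N], c <- r f].
split.
- by rewrite !uniq_pairs.
- rewrite !size_allpairs !size_map !size_iota.
  have [q1 q1e] : exists q1, q1 = (q %/ e)%N by exists (q %/ e)%N.
  have [q2 q2e] : exists q2, q2 = (e %/ f)%N by exists (e %/ f)%N.
  rewrite -q1e -q2e.
  have qE : q = (q1 * (q2 * f))%N by rewrite q1e q2e !divnK.
  have q10 : (0 < q1)%N by rewrite q1e divn_gt0 // dvdn_leq.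
  have q20 : (0 < q2)%N by rewrite q2e divn_gt0 // dvdn_leq.
  by rewrite qE minn_prod.
- by move=> [[a b] c]; rewrite !mem_pairs /= => /andP[/andP[/rP[? _] /rP[? _]] /rP[? _]].
move=> [[a b] c] [[a' b'] c']; rewrite !mem_pairs /resid /=.
move=> /andP[/andP[/rP[ha ha1] /rP[hb hb1]] /rP[hc hc1]].
move=> /andP[/andP[/rP[ha' ha1'] /rP[hb' hb1']] /rP[hc' hc1']].
have -> : c2 v * a + c3 v * b + c4 v * c - (c2 v * a' + c3 v * b' + c4 v * c') =
  c2 v * (a - a') + (c3 v * (b - b') + c4 v * (c - c')) by ring.
move=> dq.
have fq : (f %| q)%N by apply: dvdn_trans eq.
have dvz (g : nat) (x : int) : (g%:Z %| x)%Z = (g %| `|x|)%N by rewrite dvdzE.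
have cc : c - c' = 0.
  apply: (@small_dvdz f); last by lia.
  rewrite -(@Gauss_dvdr _ `|c4 v|); last by rewrite coprime_sym /coprime -[gcdn _ _]/(gcd4 v) gv.
  rewrite -abszM -dvz.
  have : (f%:Z %| c2 v * (a - a') + (c3 v * (b - b') + c4 v * (c - c')))%Z.
    by apply: dvdz_trans dq; rewrite dvdzE.
  rewrite rpredDl; last by rewrite dvdz_mulr // dvz (dvdn_trans fe) // dvdn_gcdl.
  by rewrite rpredDl // dvdz_mulr // dvz dvdn_gcdl.
move: dq; rewrite cc mulr0 addr0 => dq.
have bb : b - b' = 0.
  apply: (@small_dvdz (e %/ f)%N); last by lia.
  apply: dvdn_div_gcd => //; rewrite -abszM -dvz.
  have : (e%:Z %| c2 v * (a - a') + c3 v * (b - b'))%Z.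
    by apply: dvdz_trans dq; rewrite dvdzE.
  by rewrite rpredDl // dvdz_mulr // dvz dvdn_gcdl.
move: dq; rewrite bb mulr0 addr0 => dq.
have aa : a - a' = 0.
  apply: (@small_dvdz (q %/ e)%N); last by lia.
  by apply: dvdn_div_gcd => //; rewrite -abszM -dvdzE.
by congr (_, _, _); lia.
Qed.

Definition sw2 (u : freq) : freq := (c2 u, c1 u, c3 u, c4 u).
Definition sw3 (u : freq) : freq := (c3 u, c2 u, c1 u, c4 u).
Definition sw4 (u : freq) : freq := (c4 u, c2 u, c3 u, c1 u).

Definition dvd4 (h : nat) (v : freq) : bool :=
  [&& (h %| `|c1 v|)%N, (h %| `|c2 v|)%N, (h %| `|c3 v|)%N & (h %| `|c4 v|)%N].

Definition primitive (v : freq) : Prop := forall h, dvd4 h v -> h = 1%N.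

Definition sup4 (v : freq) : nat :=
  maxn (maxn `|c1 v| `|c2 v|) (maxn `|c3 v| `|c4 v|).

Lemma in_cubeE m v : in_cube m%:Z v = (sup4 v <= m)%N.
Proof. by rewrite /in_cube /sup4; apply/idP/idP => [/and4P[? ? ? ?]|?]; [|apply/and4P; split]; lia. Qed.

Lemma primitive_gcd4 v : primitive v -> gcd4 v = 1%N.
Proof.
apply; rewrite /dvd4 /gcd4 dvdn_gcdl andbT.
have h1 := dvdn_gcdr `|c4 v| (gcdn `|c3 v| (gcdn `|c2 v| `|c1 v|)).
rewrite (dvdn_trans h1 (dvdn_gcdl _ _)) andbT.
have h2 := dvdn_trans h1 (dvdn_gcdr _ _).
by rewrite !(dvdn_trans h2) ?dvdn_gcdl ?dvdn_gcdr.
Qed.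

Section Swaps.
Variant swap_fun : (freq -> freq) -> Prop :=
  | Sw2 : swap_fun sw2 | Sw3 : swap_fun sw3 | Sw4 : swap_fun sw4.
Context (f : freq -> freq) (sw : swap_fun f).
Lemma swapK : involutive f.
Proof. by case: sw => -[[[a b] c] d]. Qed.
Lemma dot_swap u v : dot (f u) (f v) = dot u v.
Proof. by case: sw; rewrite /dot /=; ring. Qed.
Lemma sup4_swap u : sup4 (f u) = sup4 u.
Proof.
by case: u => [[[a b] c] d]; case: sw;
  rewrite /sup4 /sw2 /sw3 /sw4 /c1 /c2 /c3 /c4; cbn [fst snd]; lia.
Qed.
Lemma dvd4_swap h u : dvd4 h (f u) = dvd4 h u.
Proof.
case: sw; rewrite /dvd4 /c1 /c2 /c3 /c4 /=; by do 4 case: (h %| _)%N.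
Qed.
Lemma primitive_swap u : primitive u -> primitive (f u).
Proof. by move=> pu h; rewrite dvd4_swap; apply: pu. Qed.
End Swaps.

(** Coordinate swaps preserve [dot], [sup4] and primitivity, so [c1] may be taken as the largest
    coordinate; [|c1 v|] is then both the modulus and the size of [v]. *)
Lemma wlog_c1 (P : freq -> Prop) :
  (forall v, `|c1 v|%N = sup4 v -> P v) ->
  (forall f v, swap_fun f -> P (f v) -> P v) -> forall v, P v.
Proof.
move=> P1 Psw v.
have [e|[e|[e|e]]] : `|c1 v|%N = sup4 v \/ `|c2 v|%N = sup4 v \/
  `|c3 v|%N = sup4 v \/ `|c4 v|%N = sup4 v by rewrite /sup4; lia.
- exact: P1.
- by apply: (Psw _ _ Sw2); apply: P1; rewrite (sup4_swap Sw2).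
- by apply: (Psw _ _ Sw3); apply: P1; rewrite (sup4_swap Sw3).
- by apply: (Psw _ _ Sw4); apply: P1; rewrite (sup4_swap Sw4).
Qed.

Definition perp_in (v : freq) (m : nat) (U : seq freq) : Prop :=
  forall u, u \in U -> dot u v = 0 /\ (sup4 u <= m)%N.

Lemma perp_in_swap f v m U : swap_fun f -> perp_in v m U ->
  perp_in (f v) m [seq f u | u <- U].
Proof.
move=> sw Uv u /mapP[w wU ->].
by rewrite (dot_swap sw) (sup4_swap sw); apply: Uv.
Qed.

Lemma swap_uniq f U : swap_fun f -> uniq U -> uniq [seq f u | u <- U].
Proof. by move=> sw uU; rewrite map_inj_uniq //; apply: (inv_inj (swapK sw)). Qed.

(** The shifts must stay of size [m], so that the translated solutions remain in a cube of size
    [2 * m]; this is why at most [m + 1] of the residues modulo [c1 v] are exploited. [perp_count3]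
    removes this cap. *)
Lemma perp_count (v : freq) : primitive v -> v != 0 -> forall m U,
  uniq U -> perp_in v m U ->
  (size U * minn (sup4 v) m.+1 <= (4 * m).+1 ^ 3)%N.
Proof.
elim/wlog_c1: v => [v ev pv v0 m U uU Uv|f v sw IH pv v0 m U uU Uv]; last first.
  have := IH (primitive_swap sw pv) _ m _ (swap_uniq sw uU) (perp_in_swap sw Uv).
  rewrite size_map (sup4_swap sw); apply.
  apply: contraNneq v0 => fv0; rewrite -(swapK sw v) fv0.
  by case: sw.
have v10 : c1 v != 0.
  apply: contraNneq v0 => v10; apply/eqP.
  by apply: freq_eqP; move: ev; rewrite /sup4 v10 /c1 /c2 /c3 /c4 /=; lia.
have [D [uD sD Dm Dinj]] := @residue_system v m.+1 v10 (primitive_gcd4 pv).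
have := @hyperplane_count v m m U D v10 uU uD.
have -> : ((m + m).*2).+1 = (4 * m).+1 by lia.
move=> /(_ _ _ Dinj); rewrite -ev => hc.
apply: leq_trans (hc _ _); first by rewrite leq_mul2l sD orbT.
  by move=> u /Uv[? ?]; rewrite in_cubeE.
by move=> [[a b] c] /Dm; cbn [fst snd] => -[? ? ?]; apply/and3P; split; lia.
Qed.

Definition det3 (u v w : int * int * int) : int :=
  let: (a1, a2, a3) := u in let: (b1, b2, b3) := v in let: (d1, d2, d3) := w in
  a1 * (b2 * d3 - b3 * d2) - a2 * (b1 * d3 - b3 * d1) + a3 * (b1 * d2 - b2 * d1).

Definition proj (u : freq) : int * int * int := (c2 u, c3 u, c4 u).

(** Three elements of [U] with independent projections span a lattice on which [resid v] vanishes
    modulo [c1 v]. A complete residue system can be reduced modulo this lattice into a cube of size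
    [3 * m], however large [c1 v] is. *)
Lemma perp_count3 (v : freq) (m : nat) (U : seq freq) (u1 u2 u3 : freq) :
  primitive v -> c1 v != 0 -> uniq U -> perp_in v m U ->
  u1 \in U -> u2 \in U -> u3 \in U ->
  det3 (proj u1) (proj u2) (proj u3) != 0 ->
  (size U * `|c1 v| <= (8 * m).+1 ^ 3)%N.
Proof.
move=> pv v0 uU Uv uU1 uU2 uU3; set De := det3 _ _ _ => De0.
have [D [uD sD Dm Dinj]] := @residue_system v `|c1 v| v0 (primitive_gcd4 pv).
rewrite minnn in sD.
(* Integer parts of the coordinates of [d] in the basis of the projections of [u1], [u2], [u3], by
   Cramer's rule; [red d] keeps the fractional parts. *)
pose k1 d := (det3 d (proj u2) (proj u3) %/ De)%Z.
pose k2 d := (det3 (proj u1) d (proj u3) %/ De)%Z.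
pose k3 d := (det3 (proj u1) (proj u2) d %/ De)%Z.
pose red (d : int * int * int) : int * int * int :=
  (d.1.1 - k1 d * c2 u1 - k2 d * c2 u2 - k3 d * c2 u3,
   d.1.2 - k1 d * c3 u1 - k2 d * c3 u2 - k3 d * c3 u3,
   d.2 - k1 d * c4 u1 - k2 d * c4 u2 - k3 d * c4 u3).
have dvd_resid u : u \in U -> exists z, resid v (proj u) = z * c1 v.
  move=> /Uv[du _]; exists (- c1 u); move: du; rewrite /dot /resid /=.
  by move=> /eqP; rewrite -!addrA addr_eq0 => /eqP/(congr1 -%R); rewrite opprK; lia.
have red_resid d : (c1 v %| resid v (red d) - resid v d)%Z.
  have [z1 e1] := dvd_resid _ uU1; have [z2 e2] := dvd_resid _ uU2.
  have [z3 e3] := dvd_resid _ uU3.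
  apply/dvdzP; exists (- (k1 d * z1 + k2 d * z2 + k3 d * z3)).
  transitivity (- (k1 d * resid v (proj u1) + k2 d * resid v (proj u2)
    + k3 d * resid v (proj u3))); last by rewrite e1 e2 e3; ring.
  by case: d => [[a b] c]; rewrite /resid /red /=; ring.
have redinj d d' : d \in D -> d' \in D ->
    (c1 v %| resid v (red d) - resid v (red d'))%Z -> d = d'.
  move=> dD d'D dd'; apply: Dinj => //.
  have -> : resid v d - resid v d' = (resid v (red d) - resid v (red d')) -
    (resid v (red d) - resid v d) + (resid v (red d') - resid v d') by ring.
  by rewrite rpredD // rpredB.
have redm d : [&& `|(red d).1.1| <= (3 * m)%N%:Z, `|(red d).1.2| <= (3 * m)%N%:Z
    & `|(red d).2| <= (3 * m)%N%:Z].
  have bd (x x1 x2 x3 y1 y2 y3 : int) :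
      De * x = y1 * x1 + y2 * x2 + y3 * x3 ->
      `|x1| <= m%:Z -> `|x2| <= m%:Z -> `|x3| <= m%:Z ->
      `|x - (y1 %/ De)%Z * x1 - (y2 %/ De)%Z * x2 - (y3 %/ De)%Z * x3| <= (3 * m)%N%:Z.
    move=> ex h1 h2 h3; have De1 : 0 < `|De| by rewrite normr_gt0.
    rewrite -(ler_pM2l De1) -normrM.
    set lhs := De * _.
    have -> : lhs = (y1 %% De)%Z * x1 + (y2 %% De)%Z * x2 + (y3 %% De)%Z * x3.
      rewrite /lhs !mulrBr ex.
      rewrite [in y1 * x1](divz_eq y1 De) [in y2 * x2](divz_eq y2 De).
      by rewrite [in y3 * x3](divz_eq y3 De); ring.
    have r1 : `|(y1 %% De)%Z| <= `|De| by rewrite ger0_norm ?modz_ge0 // ltW // ltz_mod.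
    have r2 : `|(y2 %% De)%Z| <= `|De| by rewrite ger0_norm ?modz_ge0 // ltW // ltz_mod.
    have r3 : `|(y3 %% De)%Z| <= `|De| by rewrite ger0_norm ?modz_ge0 // ltW // ltz_mod.
    rewrite (le_trans (ler_normD _ _)) // PoszM.
    have -> : `|De| * (3%:Z * m%:Z) = `|De| * m%:Z + `|De| * m%:Z + `|De| * m%:Z by ring.
    rewrite lerD ?normrM ?ler_pM //.
    by rewrite (le_trans (ler_normD _ _)) // lerD ?normrM ?ler_pM.
  have cu u : u \in U -> [/\ `|c2 u| <= m%:Z, `|c3 u| <= m%:Z & `|c4 u| <= m%:Z].
    by move=> /Uv[_]; rewrite -in_cubeE => /and4P[].
  have [? ? ?] := cu _ uU1; have [? ? ?] := cu _ uU2; have [? ? ?] := cu _ uU3.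
  case: d => [[a b] c]; rewrite /red /k1 /k2 /k3; cbn [fst snd].
  by apply/and3P; split; apply: bd => //; rewrite /De /det3 /=; ring.
have uD' : uniq [seq red d | d <- D].
  rewrite map_inj_in_uniq // => d d' dD d'D e; apply: redinj => //.
  by rewrite e subrr dvdz0.
have := @hyperplane_count v m (3 * m) U _ v0 uU uD'.
rewrite size_map (_ : ((m + 3 * m).*2).+1 = (8 * m).+1); last by lia.
move=> hc; apply: leq_trans (hc _ _ _).
- by rewrite leq_mul2l sD orbT.
- by move=> u /Uv[? ?]; rewrite in_cubeE.
- by move=> x /mapP[d dD ->].
- move=> x y /mapP[d dD ->] /mapP[d' dD' ->] dd'.
  by congr red; apply: redinj.
Qed.

Notation int3 := (int * int * int)%type.
Definition t1 (w : int3) : int := w.1.1.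
Definition t2 (w : int3) : int := w.1.2.
Definition t3 (w : int3) : int := w.2.

Lemma int3_eqP (w w' : int3) : t1 w = t1 w' -> t2 w = t2 w' -> t3 w = t3 w' -> w = w'.
Proof. by case: w => [[? ?] ?]; case: w' => [[? ?] ?]; rewrite /t1 /t2 /t3 /= => -> -> ->. Qed.

Definition le3 (m : nat) (w : int3) : Prop :=
  [/\ `|t1 w| <= m%:Z, `|t2 w| <= m%:Z & `|t3 w| <= m%:Z].

Definition dot3 (n w : int3) : int := t1 n * t1 w + t2 n * t2 w + t3 n * t3 w.

Definition span_diff (w0 w1 w2 w : int3) : Prop := exists s x y : int,
  [/\ s != 0, s * t1 w = x * (t1 w1 - t1 w0) + y * (t1 w2 - t1 w0),
      s * t2 w = x * (t2 w1 - t2 w0) + y * (t2 w2 - t2 w0)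
    & s * t3 w = x * (t3 w1 - t3 w0) + y * (t3 w2 - t3 w0)].

Definition short_basis (r : nat) (W : seq int3) : Prop := exists w0 w1 w2,
  [/\ w0 \in W, w1 \in W, w2 \in W, le3 (2 * r)%N (w1 - w0) /\ le3 (2 * r)%N (w2 - w0)
    & forall w, w \in W -> span_diff w0 w1 w2 w].

Lemma uniq_size_int_interval (T : eqType) (f : T -> int) (s : seq T) (z : int) (r : nat) :
  uniq s -> {in s &, injective f} -> (forall x, x \in s -> z <= f x < z + r%:Z) ->
  (size s <= r)%N.
Proof.
move=> us finj fs; rewrite -(size_map f) -[r](size_iota 0) -(size_map (fun k => z + k%:Z)).
rewrite uniq_leq_size ?map_inj_in_uniq // => y /mapP[x xs ->].
have := fs _ xs => fx; apply/mapP; exists (absz (f x - z)); last by lia.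
by rewrite mem_iota; lia.
Qed.

(** The plane is a graph over the first two coordinates, with slopes at most one because [t3 n]
    dominates. Cut the coordinate plane into squares of side [r]: one of them receives more than [r]
    points of [W], while a line over it contains at most [r] lattice points. So three points over
    one square are not collinear, and their differences are short. *)
Lemma short_basis_t3 (W : seq int3) (n : int3) (m r : nat) :
  (0 < r)%N -> uniq W -> (forall w, w \in W -> le3 m w /\ dot3 n w = 0) ->
  t3 n != 0 -> `|t1 n| <= `|t3 n| -> `|t2 n| <= `|t3 n| ->
  (r * (((m %/ r).+1).*2.+1 ^ 2) < size W)%N -> short_basis r W.
Proof.
move=> r0 uW Wm n3 n13 n23 sW.
pose box (w : int3) : int * int := ((t1 w %/ r%:Z)%Z, (t2 w %/ r%:Z)%Z).
pose t := [seq (a, b) | a <- int_range (m %/ r).+1, b <- int_range (m %/ r).+1].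
have st : size t = (((m %/ r).+1).*2.+1 ^ 2)%N.
  by rewrite size_allpairs size_int_range mulnn.
have r0Z : 0 < r%:Z by lia.
have boxb (x : int) : `|x| <= m%:Z -> `|(x %/ r%:Z)%Z| <= (m %/ r).+1%:Z.
  move=> xm; have := divz_eq x r%:Z; have := modz_ge0 x (lt0r_neq0 r0Z).
  have := ltz_pmod x r0Z; have := divn_eq m r; have := ltn_pmod m r0.
  move: (x %/ r%:Z)%Z (x %% r%:Z)%Z (m %/ r)%N (m %% r)%N => q p k l; nia.
have [[y /andP[yt /negP yb]]|allb] := pselect (exists y, (y \in t) &&
    ~~ (count (fun w => box w == y) W <= r)%N); last first.
  move: sW; rewrite -st ltnNge => /negP[]; apply: (@size_fibers _ _ box).
    by move=> w /Wm[[? ? ?] _]; rewrite mem_pairs !mem_int_range !boxb.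
  move=> y yt; apply: contrapT => /negP yb; apply: allb.
  by exists y; rewrite yt.
pose F := [seq w <- W | box w == y].
have uF : uniq F by rewrite filter_uniq.
have sF : (r < size F)%N by rewrite size_filter ltnNge; apply/negP.
have FW w : w \in F -> w \in W by rewrite mem_filter => /andP[].
have Fbox w : w \in F -> (y.1 * r%:Z <= t1 w < y.1 * r%:Z + r%:Z) /\
    (y.2 * r%:Z <= t2 w < y.2 * r%:Z + r%:Z).
  rewrite mem_filter => /andP[/eqP <- _] /=.
  have h x : (x %/ r%:Z)%Z * r%:Z <= x < (x %/ r%:Z)%Z * r%:Z + r%:Z.
    have := divz_eq x r%:Z; have := modz_ge0 x (lt0r_neq0 r0Z).
    have := ltz_pmod x r0Z.
    move: (x %/ r%:Z)%Z (x %% r%:Z)%Z => q p; lia.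
  by split; apply: h.
have plane w w' : w \in W -> w' \in W ->
    t3 n * (t3 w - t3 w') = - (t1 n * (t1 w - t1 w') + t2 n * (t2 w - t2 w')).
  move=> /Wm[_ +] /Wm[_]; rewrite /dot3.
  move: (t1 n) (t2 n) (t3 n) (t1 w) (t2 w) (t3 w) (t1 w') (t2 w') (t3 w').
  move=> n1 n2 n3' a b c a' b' c' e e'.
  by have := congr2 (fun x y => x - y) e e'; rewrite subrr; lia.
case eF : F sF uF => [//|w0 F'] sF uF.
have w0F : w0 \in F by rewrite eF mem_head.
pose d2 w w' := (t1 w - t1 w0) * (t2 w' - t2 w0) - (t2 w - t2 w0) * (t1 w' - t1 w0).
have [[w1 [w2 [w1F w2F dne]]]|col] :=
    pselect (exists w1 w2, [/\ w1 \in F, w2 \in F & d2 w1 w2 != 0]).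
  have bd w : w \in F -> le3 (2 * r) (w - w0).
    move=> wF; have [h1 h2] := Fbox _ wF; have [k1 k2] := Fbox _ w0F.
    have h3 := plane _ _ (FW _ wF) (FW _ w0F).
    have e1 : t1 (w - w0) = t1 w - t1 w0 by [].
    have e2 : t2 (w - w0) = t2 w - t2 w0 by [].
    have e3 : t3 (w - w0) = t3 w - t3 w0 by [].
    split; rewrite ?e1 ?e2 ?e3; [lia|lia|].
    have n30 : 0 < `|t3 n| by rewrite normr_gt0.
    rewrite -(ler_pM2l n30) -normrM h3 normrN (le_trans (ler_normD _ _)) //.
    have -> : `|t3 n| * (2 * r)%N%:Z = `|t3 n| * r%:Z + `|t3 n| * r%:Z by rewrite PoszM; ring.
    by rewrite lerD // normrM ler_pM //; lia.
  exists w0, w1, w2; split; rewrite ?FW //; first by split; apply: bd.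
  move=> w wW; exists (d2 w1 w2), (t1 w * (t2 w2 - t2 w0) - t2 w * (t1 w2 - t1 w0)),
    (t2 w * (t1 w1 - t1 w0) - t1 w * (t2 w1 - t2 w0)).
  split=> //; rewrite ?/d2; [ring|ring|].
  apply: (mulfI n3); rewrite mulrDr !mulrA.
  have h1 := plane _ _ (FW _ w1F) (FW _ w0F); have h2 := plane _ _ (FW _ w2F) (FW _ w0F).
  have [_ hw] := Wm _ wW.
  have hw' : t3 n * t3 w = - (t1 n * t1 w + t2 n * t2 w).
    by move: hw; rewrite /dot3; lia.
  transitivity (d2 w1 w2 * (t3 n * t3 w)); first by rewrite /d2; ring.
  set x1 := t1 w * _ - _; set x2 := t2 w * _ - _.
  transitivity (x1 * (t3 n * (t3 w1 - t3 w0)) + x2 * (t3 n * (t3 w2 - t3 w0))).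
    by rewrite hw' h1 h2 /d2 /x1 /x2; ring.
  by ring.
have col0 w w' : w \in F -> w' \in F -> d2 w w' = 0.
  move=> wF w'F; apply/eqP; apply: contrapT => /negP h.
  by apply: col; exists w, w'.
have [w1 w1F w10] : exists2 w1, w1 \in F & w1 != w0.
  case: F' eF sF uF => [|w1 F''] eF sF uF; first by move: sF => /=; lia.
  exists w1; first by rewrite eF !inE eqxx orbT.
  by move: uF; rewrite /= inE negb_or eq_sym => /andP[/andP[]].
have inj3 w w' : w \in F -> w' \in F -> t1 w = t1 w' -> t2 w = t2 w' -> w = w'.
  move=> wF w'F e1 e2; apply: int3_eqP => //.
  have := plane _ _ (FW _ wF) (FW _ w'F); rewrite e1 e2 !subrr !mulr0 addr0 oppr0.
  by move=> /eqP; rewrite mulf_eq0 (negPf n3) /= subr_eq0 => /eqP.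
(* The points of [F] are collinear, so one of the first two coordinates is injective on [F], with
   values in an interval of length [r]. *)
have : (size F <= r)%N.
  rewrite eF -eF; have uF' : uniq F by rewrite eF.
  have [e|ne] := eqVneq (t1 w1) (t1 w0).
    have ne : t2 w1 - t2 w0 != 0.
      by apply: contra_neq w10 => /eqP; rewrite subr_eq0 => /eqP ?; apply: inj3.
    apply: (uniq_size_int_interval (f := t2) (z := y.2 * r%:Z)) => //; last by move=> w /Fbox[].
    move=> w w' wF w'F ee; apply: inj3 => //.
    have := col0 _ _ wF w1F; have := col0 _ _ w'F w1F; rewrite /d2 e subrr !mulr0 !subr0.
    move=> /eqP; rewrite mulf_eq0 (negPf ne) orbF => /eqP h1.
    move=> /eqP; rewrite mulf_eq0 (negPf ne) orbF => /eqP h2.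
    by move: h1 h2 => /eqP; rewrite subr_eq0 => /eqP -> /eqP; rewrite subr_eq0 => /eqP ->.
  have ne' : t1 w1 - t1 w0 != 0 by rewrite subr_eq0.
  apply: (uniq_size_int_interval (f := t1) (z := y.1 * r%:Z)) => //; last by move=> w /Fbox[].
  move=> w w' wF w'F ee; apply: inj3 => //.
  have := col0 _ _ wF w1F; have := col0 _ _ w'F w1F; rewrite /d2 ee.
  move=> h1 h2; have := congr2 (fun x y => x - y) h1 h2; rewrite subrr => h.
  apply/eqP; rewrite -subr_eq0.
  have : (t1 w1 - t1 w0) * (t2 w - t2 w') = 0 by rewrite -h; ring.
  by move/eqP; rewrite mulf_eq0 (negPf ne').
by rewrite leqNgt eF; move: sF => ->.
Qed.

Definition s13 (w : int3) : int3 := (t3 w, t2 w, t1 w).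
Definition s23 (w : int3) : int3 := (t1 w, t3 w, t2 w).
Lemma s13K : involutive s13. Proof. by case=> [[? ?] ?]. Qed.
Lemma s23K : involutive s23. Proof. by case=> [[? ?] ?]. Qed.

Lemma short_basis_swap (f : int3 -> int3) r W : (f = s13 \/ f = s23) ->
  short_basis r [seq f w | w <- W] -> short_basis r W.
Proof.
move=> fs; have fK : involutive f by case: fs => ->; [exact: s13K|exact: s23K].
have fle w w' : le3 (2 * r)%N (f w - f w') -> le3 (2 * r)%N (w - w').
  by case: fs => -> [? ? ?].
have fsp w0 w1 w2 w : span_diff (f w0) (f w1) (f w2) (f w) -> span_diff w0 w1 w2 w.
  by case: fs => -> [s [x [y [s0 ? ? ?]]]]; exists s, x, y.
case=> w0 [w1 [w2 [/mapP[v0 ? ->] /mapP[v1 ? ->] /mapP[v2 ? ->] [/fle ? /fle ?] h]]].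
by exists v0, v1, v2; split=> // w wW; apply: fsp; apply: h; apply: map_f.
Qed.

Lemma plane_short_basis (W : seq int3) (n : int3) (m r : nat) :
  (0 < r)%N -> uniq W -> (forall w, w \in W -> le3 m w /\ dot3 n w = 0) ->
  n != 0 -> (r * (((m %/ r).+1).*2.+1 ^ 2) < size W)%N -> short_basis r W.
Proof.
move=> r0 uW Wm n0 sW.
have [h|[h|h]] : (`|t1 n| <= `|t3 n| /\ `|t2 n| <= `|t3 n|) \/
  ((`|t3 n| <= `|t1 n| /\ `|t2 n| <= `|t1 n|) \/
   (`|t1 n| <= `|t2 n| /\ `|t3 n| <= `|t2 n|)) by lia.
- apply: (@short_basis_t3 W n m r) => //; try tauto.
  apply: contra_neq n0 => e; move: h; rewrite e normr0 !normr_le0 => -[/eqP ? /eqP ?].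
  exact: int3_eqP.
- apply: (@short_basis_swap s13); first by left.
  apply: (@short_basis_t3 _ (s13 n) m r) => //; rewrite ?size_map ?(map_inj_uniq (inv_inj s13K)) //; try tauto.
    move=> ? /mapP[w /Wm[[? ? ?] dw] ->]; split; first by split.
    by rewrite -dw /dot3 /s13 /t1 /t2 /t3 /=; ring.
  apply: contra_neq n0 => e; move: h; rewrite -[t1 n]/(t3 (s13 n)) e normr0 !normr_le0 => -[/eqP ? /eqP ?].
  exact: int3_eqP.
- apply: (@short_basis_swap s23); first by right.
  apply: (@short_basis_t3 _ (s23 n) m r) => //; rewrite ?size_map ?(map_inj_uniq (inv_inj s23K)) //; try tauto.
    move=> ? /mapP[w /Wm[[? ? ?] dw] ->]; split; first by split.
    by rewrite -dw /dot3 /s23 /t1 /t2 /t3 /=; ring.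
  apply: contra_neq n0 => e; move: h; rewrite -[t2 n]/(t3 (s23 n)) e normr0 !normr_le0 => -[/eqP ? /eqP ?].
  exact: int3_eqP.
Qed.

Definition cross (u v : int3) : int3 :=
  (t2 u * t3 v - t3 u * t2 v, t3 u * t1 v - t1 u * t3 v, t1 u * t2 v - t2 u * t1 v).

Lemma dot3_cross u v w : dot3 (cross u v) w = det3 u v w.
Proof.
by case: u => [[? ?] ?]; case: v => [[? ?] ?]; case: w => [[? ?] ?]; rewrite /dot3 /t1 /t2 /t3 /=; ring.
Qed.

(** The normal is the cross product of two independent elements if there are any; otherwise all
    elements are parallel, and a vector perpendicular to a nonzero one serves. *)
Lemma det0_normal (W : seq int3) :
  (forall u v w, u \in W -> v \in W -> w \in W -> det3 u v w = 0) ->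
  exists2 n, n != 0 & forall w, w \in W -> dot3 n w = 0.
Proof.
move=> dW.
have [[u [v [uW vW uv]]]|par] :=
    pselect (exists u v, [/\ u \in W, v \in W & cross u v != 0]).
  by exists (cross u v) => // w wW; rewrite dot3_cross dW.
have {}par u v : u \in W -> v \in W -> cross u v = 0.
  move=> uW vW; apply/eqP; apply: contrapT => /negP h.
  by apply: par; exists u, v.
have [[u uW u0]|W0] := pselect (exists2 u, u \in W & u != 0); last first.
  exists (1, 0, 0) => // w wW; have -> : w = 0; last by [].
  by apply/eqP; apply: contrapT => /negP h; apply: W0; exists w.
have [/andP[/eqP u1 /eqP u2]|h12] := boolP ((t1 u == 0) && (t2 u == 0)).
  exists (1, 0, 0) => // w wW; have := par _ _ uW wW.
  rewrite /cross u1 u2 => -[_ + _]; rewrite mul0r subr0 => /eqP.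
  rewrite mulf_eq0 => /orP[/eqP u3|/eqP e]; last by rewrite /dot3 e /t1 /t2 /t3 /= !mulr0 !mul0r.
  by move: u0; rewrite (_ : u = 0) ?eqxx //; exact: int3_eqP.
exists (- t2 u, t1 u, 0).
  by apply: contra h12 => /eqP[/eqP + ->]; rewrite oppr_eq0 => ->; rewrite eqxx.
move=> w wW; have := par _ _ uW wW; rewrite /cross => -[_ _ e].
by rewrite -[RHS]e /dot3 /t1 /t2 /t3 /=; ring.
Qed.

(** Linear dependence over the rationals, tested against all [w]: this is the form in which it
    passes perpendicularity on from [a], [b] to [u]. *)
Definition in_span (a b u : freq) : Prop := exists s x y : int,
  s != 0 /\ forall w, s * dot u w = x * dot a w + y * dot b w.

(** Too many solutions for [perp_count3] force all determinants to vanish, so the projections lie in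
    a plane and [plane_short_basis] applies. The first coordinate is recovered from [dot u v = 0];
    as [c1 v] dominates, it is at most the sum of the three others, whence [6 * r]. *)
Lemma perp_plane_c1 (v : freq) (m r : nat) (U : seq freq) :
  `|c1 v|%N = sup4 v -> primitive v -> v != 0 ->
  (0 < r)%N -> uniq U -> perp_in v m U ->
  ((8 * m).+1 ^ 3 < size U * sup4 v)%N ->
  (r * (((m %/ r).+1).*2.+1 ^ 2) < size U)%N ->
  exists a b, [/\ (sup4 a <= 6 * r)%N, (sup4 b <= 6 * r)%N, dot a v = 0, dot b v = 0
    & forall u, u \in U -> in_span a b u].
Proof.
move=> ev pv v0 r0 uU Uv sU1 sU2.
have v10 : c1 v != 0.
  apply: contraNneq v0 => v10; apply/eqP.
  by apply: freq_eqP; move: ev; rewrite /sup4 v10 /c1 /c2 /c3 /c4 /=; lia.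
have projinj u u' : dot u v = 0 -> dot u' v = 0 -> proj u = proj u' -> u = u'.
  move=> du du' [e2 e3 e4]; apply: freq_eqP => //; apply: (mulIf v10).
  by move: du du'; rewrite /dot e2 e3 e4; lia.
pose W := [seq proj u | u <- U].
have uW : uniq W.
  by rewrite map_inj_in_uniq // => u u' /Uv[? _] /Uv[? _]; apply: projinj.
have dW u1 u2 u3 : u1 \in W -> u2 \in W -> u3 \in W -> det3 u1 u2 u3 = 0.
  move=> /mapP[w1 w1U ->] /mapP[w2 w2U ->] /mapP[w3 w3U ->].
  apply/eqP; apply: contrapT => /negP h.
  have := perp_count3 pv v10 uU Uv w1U w2U w3U h.
  by rewrite leqNgt ev sU1.
have [n n0 nW] := det0_normal dW.
have Wm w : w \in W -> le3 m w /\ dot3 n w = 0.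
  move=> wW; split; last exact: nW.
  by move: wW => /mapP[u /Uv[_ um] ->]; move: um; rewrite -in_cubeE => /and4P[].
have [w0 [w1 [w2 [w0W w1W w2W [l1 l2] sp]]]] : short_basis r W.
  by apply: (plane_short_basis r0 uW Wm n0); rewrite size_map.
move/mapP: w0W => [u0 u0U e0]; move/mapP: w1W => [u1 u1U e1]; move/mapP: w2W => [u2 u2U e2].
have [du0 _] := Uv _ u0U; have [du1 _] := Uv _ u1U; have [du2 _] := Uv _ u2U.
have dB u u' w : dot (u - u') w = dot u w - dot u' w.
  by rewrite /dot !cE; ring.
have small u : dot u v = 0 -> le3 (2 * r)%N (proj u) -> (sup4 u <= 6 * r)%N.
  move=> du [h2 h3 h4]; rewrite /t1 /t2 /t3 /proj in h2 h3 h4; cbn [fst snd] in *.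
  rewrite -in_cubeE; apply/and4P; split; [|lia|lia|lia].
  have p : 0 < `|c1 v| by rewrite normr_gt0.
  rewrite -(ler_pM2r p) -normrM.
  have -> : c1 u * c1 v = - (c2 u * c2 v + c3 u * c3 v + c4 u * c4 v).
    by move: du; rewrite /dot; lia.
  have v2 : `|c2 v| <= `|c1 v| by move: ev; rewrite /sup4; lia.
  have v3 : `|c3 v| <= `|c1 v| by move: ev; rewrite /sup4; lia.
  have v4 : `|c4 v| <= `|c1 v| by move: ev; rewrite /sup4; lia.
  rewrite normrN (le_trans (ler_normD _ _)) //.
  have -> : (6 * r)%N%:Z * `|c1 v| = (2 * r)%N%:Z * `|c1 v| + (2 * r)%N%:Z * `|c1 v|
     + (2 * r)%N%:Z * `|c1 v| by rewrite !PoszM; ring.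
  rewrite lerD ?normrM ?ler_pM //.
  by rewrite (le_trans (ler_normD _ _)) // lerD ?normrM ?ler_pM.
exists (u1 - u0), (u2 - u0); split.
- by apply: small; [rewrite dB du0 du1 subrr|rewrite e1 e0 in l1].
- by apply: small; [rewrite dB du0 du2 subrr|rewrite e2 e0 in l2].
- by rewrite dB du0 du1 subrr.
- by rewrite dB du0 du2 subrr.
move=> u uU'; have [du _] := Uv _ uU'.
have [s [x [y [s0 h1 h2 h3]]]] := sp _ (map_f _ uU').
exists s, x, y; split=> // w.
rewrite e0 e1 e2 /t1 /t2 /t3 /proj in h1 h2 h3; cbn [fst snd] in *.
apply: (mulfI v10).
have h0 : c1 v * (s * c1 u) = c1 v * (x * (c1 u1 - c1 u0) + y * (c1 u2 - c1 u0)).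
  have g (z : freq) : dot z v = 0 -> c1 v * c1 z = - (c2 z * c2 v + c3 z * c3 v + c4 z * c4 v).
    by rewrite /dot; lia.
  transitivity (s * (c1 v * c1 u)); first by ring.
  rewrite g //; transitivity (- ((s * c2 u) * c2 v + (s * c3 u) * c3 v + (s * c4 u) * c4 v)); first by ring.
  rewrite h1 h2 h3.
  transitivity (x * (c1 v * c1 u1 - c1 v * c1 u0) + y * (c1 v * c1 u2 - c1 v * c1 u0)); last by ring.
  by rewrite !g //; ring.
transitivity ((c1 v * (s * c1 u)) * c1 w + c1 v * ((s * c2 u) * c2 w + (s * c3 u) * c3 w + (s * c4 u) * c4 w)).
  by rewrite /dot; ring.
by rewrite h0 h1 h2 h3 /dot !cE; ring.
Qed.

Lemma perp_plane (v : freq) : primitive v -> v != 0 -> forall (m r : nat) (U : seq freq),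
  (0 < r)%N -> uniq U -> perp_in v m U ->
  ((8 * m).+1 ^ 3 < size U * sup4 v)%N ->
  (r * (((m %/ r).+1).*2.+1 ^ 2) < size U)%N ->
  exists a b, [/\ (sup4 a <= 6 * r)%N, (sup4 b <= 6 * r)%N, dot a v = 0, dot b v = 0
    & forall u, u \in U -> in_span a b u].
Proof.
elim/wlog_c1: v => [v ev pv v0 m r U|f v sw IH pv v0 m r U r0 uU Uv sU1 sU2].
  exact: perp_plane_c1.
have fv0 : f v != 0.
  by apply: contraNneq v0 => fv0; rewrite -(swapK sw v) fv0; case: sw.
have := IH (primitive_swap sw pv) fv0 m r _ r0 (swap_uniq sw uU) (perp_in_swap sw Uv).
rewrite size_map (sup4_swap sw) => /(_ sU1 sU2) [a [b [a6 b6 da db sp]]].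
exists (f a), (f b); rewrite !(sup4_swap sw) -!(dot_swap sw _ v) !(swapK sw).
split=> // u uU'; have [s [x [y [s0 h]]]] := sp _ (map_f f uU').
exists s, x, y; split=> // w.
by have := h (f w); rewrite (dot_swap sw) -(dot_swap sw (f a)) -(dot_swap sw (f b)) !(swapK sw).
Qed.

(** * Cauchy-Schwarz inequalities for finite sums *)

Lemma sum_mul_sqr0_le (R : realFieldType) (I : Type) (r : seq I) (P : pred I)
    (a b : I -> R) : \sum_(i <- r | P i) a i ^+ 2 <= 0 ->
  \sum_(i <- r | P i) a i * b i <= 0.
Proof.
move=> a0; set q := \sum_(i <- r | P i) b i ^+ 2.
have q0 : 0 <= q by apply: sumr_ge0 => i _; rewrite sqr_ge0.
apply/ler_addgt0Pl => t t0; rewrite addr0.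
have q21 : 0 < q + 1 by rewrite ltr_wpDl.
pose l := t / (q + 1); have l0 : 0 < l by rewrite divr_gt0.
apply: (@le_trans _ _ (\sum_(i <- r | P i) (l^-1 * a i ^+ 2 + l * b i ^+ 2))).
  apply: ler_sum => i _.
  have h2 : 0 <= l^-1 * (a i + l * b i) ^+ 2 by rewrite mulr_ge0 ?sqr_ge0 ?invr_ge0 ?ltW.
  have h3 : 0 <= l^-1 * (a i - l * b i) ^+ 2 by rewrite mulr_ge0 ?sqr_ge0 ?invr_ge0 ?ltW.
  have e2 : l^-1 * (a i + l * b i) ^+ 2 = l^-1 * a i ^+ 2 + l * b i ^+ 2 + 2 * (a i * b i).
    by field; rewrite lt0r_neq0.
  have e3 : l^-1 * (a i - l * b i) ^+ 2 = l^-1 * a i ^+ 2 + l * b i ^+ 2 - 2 * (a i * b i).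
    by field; rewrite lt0r_neq0.
  by move: h2 h3; rewrite e2 e3; lra.
rewrite big_split /= -!mulr_sumr -/q.
have h1 : l^-1 * (\sum_(i <- r | P i) a i ^+ 2) <= 0 by rewrite mulr_ge0_le0 ?a0 ?invr_ge0 // ltW.
rewrite (le_trans (lerD h1 (lexx _))) // add0r.
by rewrite /l mulrAC ler_pdivrMr // ler_pM2l // lerDl.
Qed.

Lemma cauchy_schwarz_le (R : realFieldType) (I : Type) (r : seq I) (P : pred I)
    (a b : I -> R) (p q : R) : 0 <= p -> 0 <= q ->
  \sum_(i <- r | P i) a i ^+ 2 <= p ^+ 2 -> \sum_(i <- r | P i) b i ^+ 2 <= q ^+ 2 ->
  \sum_(i <- r | P i) a i * b i <= p * q.
Proof.
move=> p0 q0 ap bq.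
have [p00|p1] := eqVneq p 0; last have [q00|q1] := eqVneq q 0.
- by move: ap; rewrite p00 mul0r expr0n; apply: sum_mul_sqr0_le.
- move: bq; rewrite q00 mulr0 expr0n; under [X in _ -> X <= _]eq_bigr do rewrite mulrC.
  exact: sum_mul_sqr0_le.
have {}p0 : 0 < p by rewrite lt_def p1.
have {}q0 : 0 < q by rewrite lt_def q1.
apply: (@le_trans _ _ (\sum_(i <- r | P i) (2^-1 * (q / p) * a i ^+ 2 + 2^-1 * (p / q) * b i ^+ 2))).
  apply: ler_sum => i _.
  have h : 0 <= 2^-1 * (q / p) * (a i - p / q * b i) ^+ 2.
    by rewrite mulr_ge0 ?sqr_ge0 // mulr_ge0 ?divr_ge0 ?invr_ge0 ?ler0n ?(ltW p0) ?(ltW q0).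
  have e : 2^-1 * (q / p) * (a i - p / q * b i) ^+ 2 =
    2^-1 * (q / p) * a i ^+ 2 + 2^-1 * (p / q) * b i ^+ 2 - a i * b i.
    by field; rewrite p1 q1.
  by move: h; rewrite e subr_ge0.
rewrite big_split /= -!mulr_sumr.
apply: (@le_trans _ _ (2^-1 * (q / p) * p ^+ 2 + 2^-1 * (p / q) * q ^+ 2)).
  by rewrite lerD // ler_pM2l // mulr_gt0 ?divr_gt0 ?invr_gt0.
by rewrite le_eqVlt; apply/orP; left; apply/eqP; field; rewrite p1 q1.
Qed.

(** A sum over pairs with equal keys is diagonal in the key, hence positive semidefinite. The keys
    play the part of Fourier frequencies; rectangles, products of two waves and the quadrilinear
    form are all brought into this shape. *)
Lemma gram_sum (A : comPzRingType) (I J K : eqType) (r : seq I) (r' : seq J)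
    (key : I -> K) (key' : J -> K) (keys : seq K) (a : I -> A) (b : J -> A) :
  uniq keys -> (forall i, i \in r -> key i \in keys) ->
  \sum_(i <- r) \sum_(j <- r' | key i == key' j) a i * b j =
  \sum_(k <- keys) (\sum_(i <- r | key i == k) a i) * (\sum_(j <- r' | key' j == k) b j).
Proof.
move=> uk rk.
under [RHS]eq_bigr => k _.
  rewrite mulr_suml.
  under eq_bigr => i _ do rewrite mulr_sumr.
  rewrite big_mkcond /=.
  over.
rewrite exchange_big /=.
rewrite big_seq_cond [RHS]big_seq_cond; apply: eq_bigr => i; rewrite andbT => ir.
rewrite (bigD1_seq (key i)) ?rk //= eqxx [X in _ + X]big1 ?addr0; last first.
  by move=> k ki; rewrite eq_sym (negPf ki).
by apply: eq_bigl => j; rewrite eq_sym.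
Qed.

Lemma gram_le (R : realFieldType) (I K : eqType) (r : seq I) (key : I -> K)
    (a b : I -> R) (p q : R) : 0 <= p -> 0 <= q ->
  \sum_(i <- r) \sum_(j <- r | key i == key j) a i * a j <= p ^+ 2 ->
  \sum_(i <- r) \sum_(j <- r | key i == key j) b i * b j <= q ^+ 2 ->
  \sum_(i <- r) \sum_(j <- r | key i == key j) a i * b j <= p * q.
Proof.
move=> p0 q0; have uk := undup_uniq (map key r).
have rk i : i \in r -> key i \in undup (map key r).
  by move=> ir; rewrite mem_undup map_f.
by rewrite !(gram_sum _ _ _ _ uk rk) => ap bq; apply: cauchy_schwarz_le.
Qed.

Lemma sum_fibers (R : realFieldType) (I T : eqType) (X : seq I) (P : pred I) (pi : I -> T)
    (t : seq T) (g : T -> R) (K : nat) : uniq t ->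
  (forall y, 0 <= g y) -> (forall x, x \in X -> P x -> pi x \in t) ->
  (forall y, y \in t -> (count (fun x => P x && (pi x == y)) X <= K)%N) ->
  \sum_(x <- X | P x) g (pi x) <= K%:R * \sum_(y <- t) g y.
Proof.
move=> ut g0 Pt cK.
have -> : \sum_(x <- X | P x) g (pi x) =
    \sum_(y <- t) \sum_(x <- X | P x && (pi x == y)) g y.
  rewrite (exchange_big_dep P) /=; last by move=> y x _ /andP[].
  rewrite big_seq_cond [RHS]big_seq_cond; apply: eq_bigr => x /andP[xX Px].
  under eq_bigl do rewrite Px /= eq_sym.
  by rewrite -big_filter filter_pred1_uniq ?Pt // big_seq1.
rewrite mulr_sumr big_seq [leRHS]big_seq; apply: ler_sum => y yt.
rewrite big_const_seq iter_addr_0 -[g y *+ _]mulr_natl.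
by rewrite ler_wpM2r // ler_nat cK.
Qed.

(** * Rectangles in the lattice *)

Section Rectangles.
Context {R : rcfType}.
Implicit Types (s : seq freq) (f : freq -> R) (P : freq -> freq -> bool).

Definition pairs s : seq (freq * freq) := [seq (a, b) | a <- s, b <- s].
Definition quads s : seq (freq * freq * (freq * freq)) :=
  [seq (a, b) | a <- pairs s, b <- pairs s].

Definition rect (x : freq * freq * (freq * freq)) : bool :=
  (x.1.1 + x.2.1 == x.1.2 + x.2.2) && (dot (x.1.2 - x.1.1) (x.2.2 - x.1.1) == 0).

Definition rect_in P (x : freq * freq * (freq * freq)) : bool :=
  rect x && P (x.1.2 - x.1.1) (x.2.2 - x.1.1).

(* The vertices of a rectangle are listed cyclically: its sides at the first
   vertex are [u = B - A] and [v = D - A]. *)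
Definition S4 s P f1 f2 f3 f4 : R :=
  \sum_(x <- quads s | rect_in P x)
    f1 x.1.1 * f2 x.1.2 * f3 x.2.1 * f4 x.2.2.

Definition PT : freq -> freq -> bool := fun _ _ => true.

Lemma uniq_pairs_seq s : uniq s -> uniq (pairs s).
Proof. by move=> us; rewrite uniq_pairs. Qed.
Lemma uniq_quads s : uniq s -> uniq (quads s).
Proof. by move=> us; rewrite uniq_pairs ?uniq_pairs_seq. Qed.
Lemma mem_quads s x : (x \in quads s) =
  [&& x.1.1 \in s, x.1.2 \in s, x.2.1 \in s & x.2.2 \in s].
Proof. by case: x => [[? ?] [? ?]]; rewrite !mem_pairs /= !andbA. Qed.

Lemma sum_quads (V : nmodType) s (F : freq * freq * (freq * freq) -> V) :
  \sum_(x <- quads s) F x =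
  \sum_(A <- s) \sum_(B <- s) \sum_(C <- s) \sum_(D <- s) F ((A, B), (C, D)).
Proof.
rewrite /quads big_allpairs_dep /= /pairs big_allpairs_dep /=.
by apply: eq_bigr => A _; apply: eq_bigr => B _; rewrite big_allpairs_dep.
Qed.

Lemma S4E s P f1 f2 f3 f4 : S4 s P f1 f2 f3 f4 =
  \sum_(A <- s) \sum_(B <- s) \sum_(C <- s) \sum_(D <- s)
   if rect ((A, B), (C, D)) && P (B - A) (D - A) then f1 A * f2 B * f3 C * f4 D else 0.
Proof. by rewrite /S4 /rect_in big_mkcond sum_quads. Qed.

Lemma rectT A B C D : rect ((A, D), (C, B)) = rect ((A, B), (C, D)).
Proof.
rewrite /rect /= [B + D]addrC; congr (_ && (_ == 0)).
by rewrite /dot; ring.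
Qed.

Lemma S4T s P f1 f2 f3 f4 :
  S4 s P f1 f2 f3 f4 = S4 s (fun u v => P v u) f1 f4 f3 f2.
Proof.
rewrite !S4E; apply: eq_bigr => A _; under eq_bigr do rewrite exchange_big /=.
rewrite exchange_big /=; under eq_bigr do rewrite exchange_big /=.
apply: eq_bigr => B _; apply: eq_bigr => C _; apply: eq_bigr => D _.
by rewrite rectT; case: ifP => // _; ring.
Qed.

Lemma eq_S4 s P P' f1 f2 f3 f4 :
  {in s & &, forall A B D, P (B - A) (D - A) = P' (B - A) (D - A)} ->
  S4 s P f1 f2 f3 f4 = S4 s P' f1 f2 f3 f4.
Proof.
move=> PP; rewrite /S4 big_seq_cond [RHS]big_seq_cond; apply: eq_bigl => x.
case xs: (x \in _) => //=; move: xs; rewrite mem_quads => /and4P[? ? ? ?].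
by rewrite /rect_in PP.
Qed.

Lemma S4_cover (H : eqType) (hs : seq H) (Q : H -> freq -> freq -> bool) s P f1 f2 f3 f4 :
  (forall A, 0 <= f1 A) -> (forall A, 0 <= f2 A) ->
  (forall A, 0 <= f3 A) -> (forall A, 0 <= f4 A) ->
  (forall A B D, A \in s -> B \in s -> D \in s -> dot (B - A) (D - A) = 0 ->
     P (B - A) (D - A) -> exists2 h, h \in hs & Q h (B - A) (D - A)) ->
  S4 s P f1 f2 f3 f4 <= \sum_(h <- hs) S4 s (Q h) f1 f2 f3 f4.
Proof.
move=> h1 h2 h3 h4 cov; rewrite /S4 /rect_in (exchange_big_dep rect) /=; last by move=> ? ? _ /andP[].
rewrite big_mkcondr /= big_seq_cond [leRHS]big_seq_cond.
apply: ler_sum => x /andP[xs rx]; case: ifP => [Px|_]; last first.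
  by apply: sumr_ge0 => h _; rewrite !mulr_ge0.
move: xs; rewrite mem_quads => /and4P[As Bs Cs Ds].
have [h hh Qh] := cov _ _ _ As Bs Ds (eqP (proj2 (andP rx))) Px.
rewrite rx /= -big_filter.
have hf : h \in [seq i <- hs | Q i (x.1.2 - x.1.1) (x.2.2 - x.1.1)] by rewrite mem_filter Qh.
rewrite (big_rem h) //= lerDl; apply: sumr_ge0 => k _; by rewrite !mulr_ge0.
Qed.

Lemma count_quads_le s (Pq : pred (freq * freq * (freq * freq)))
    (g : freq * freq * (freq * freq) -> freq) (P : freq -> Prop) (K : nat) : uniq s ->
  (forall U, uniq U -> (forall u, u \in U -> P u) -> (size U <= K)%N) ->
  (forall x y, Pq x -> Pq y -> g x = g y -> x = y) ->
  (forall x, Pq x -> P (g x)) -> (count Pq (quads s) <= K)%N.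
Proof.
move=> us PK ginj gP; rewrite -size_filter -(size_map g); apply: PK.
  rewrite map_inj_in_uniq ?filter_uniq ?uniq_quads // => x y.
  by rewrite !mem_filter => /andP[? _] /andP[? _]; apply: ginj.
by move=> u /mapP[x]; rewrite mem_filter => /andP[? _] ->; apply: gP.
Qed.

Lemma sum_pairs_sqr s (f g : freq -> R) (p q : R) :
  \sum_(A <- s) f A ^+ 2 <= p ^+ 2 -> \sum_(A <- s) g A ^+ 2 <= q ^+ 2 ->
  \sum_(y <- pairs s) (f y.1 * g y.2) ^+ 2 <= (p * q) ^+ 2.
Proof.
move=> fp gq; rewrite big_allpairs_dep /= exprMn.
under eq_bigr do under eq_bigr do rewrite exprMn.
under eq_bigr do rewrite -mulr_sumr.
rewrite -mulr_suml ler_pM // sumr_ge0 // => i _; exact: sqr_ge0.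
Qed.

(** Cauchy-Schwarz over the rectangles, with the four vertices distributed into two pairs: each
    pair, as a function of the rectangle, takes any value at most [K] times. *)
Lemma S4_pairing s P (K : nat) (pi pi' : freq * freq * (freq * freq) -> freq * freq)
    (a1 a2 b1 b2 : freq -> R) f1 f2 f3 f4 (m1 m2 m3 m4 : R) :
  uniq s -> 0 <= m1 -> 0 <= m2 -> 0 <= m3 -> 0 <= m4 ->
  \sum_(A <- s) a1 A ^+ 2 <= m1 ^+ 2 -> \sum_(A <- s) a2 A ^+ 2 <= m2 ^+ 2 ->
  \sum_(A <- s) b1 A ^+ 2 <= m3 ^+ 2 -> \sum_(A <- s) b2 A ^+ 2 <= m4 ^+ 2 ->
  (forall x, x \in quads s -> pi x \in pairs s /\ pi' x \in pairs s) ->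
  (forall x, f1 x.1.1 * f2 x.1.2 * f3 x.2.1 * f4 x.2.2 =
     (a1 (pi x).1 * a2 (pi x).2) * (b1 (pi' x).1 * b2 (pi' x).2)) ->
  (forall y, (count (fun x => rect_in P x && (pi x == y)) (quads s) <= K)%N) ->
  (forall y, (count (fun x => rect_in P x && (pi' x == y)) (quads s) <= K)%N) ->
  S4 s P f1 f2 f3 f4 <= K%:R * (m1 * m2 * m3 * m4).
Proof.
move=> us p1 p2 p3 p4 h1 h2 h3 h4 pis fE c1' c2'.
have us2 := uniq_pairs_seq us.
have K0 : 0 <= K%:R :> R by rewrite ler0n.
have -> : K%:R * (m1 * m2 * m3 * m4) =
    (Num.sqrt K%:R * (m1 * m2)) * (Num.sqrt K%:R * (m3 * m4)) :> R.
  by rewrite mulrACA -expr2 sqr_sqrtr // !mulrA.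
rewrite /S4; under eq_bigr do rewrite fE.
apply: cauchy_schwarz_le; rewrite ?mulr_ge0 ?sqrtr_ge0 //.
- rewrite exprMn sqr_sqrtr //.
  apply: le_trans (sum_fibers (g := fun y => (a1 y.1 * a2 y.2) ^+ 2) us2 _ _ _) _.
  + by move=> y; exact: sqr_ge0.
  + by move=> x xs _; exact: (pis x xs).1.
  + by move=> y _; apply: c1'.
  + by rewrite ler_wpM2l // sum_pairs_sqr.
- rewrite exprMn sqr_sqrtr //.
  apply: le_trans (sum_fibers (g := fun y => (b1 y.1 * b2 y.2) ^+ 2) us2 _ _ _) _.
  + by move=> y; exact: sqr_ge0.
  + by move=> x xs _; exact: (pis x xs).2.
  + by move=> y _; apply: c2'.
  + by rewrite ler_wpM2l // sum_pairs_sqr.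
Qed.

Lemma rectP A B C D : rect ((A, B), (C, D)) -> [/\ C = A + (B - A) + (D - A),
  dot (B - A) (D - A) = 0, C - B = D - A & D - B = (D - A) - (B - A)].
Proof.
move=> /andP[/= /eqP e /eqP d].
have eC : C = B + D - A by rewrite -e addrC addKr.
by split=> //; rewrite ?eC; fring.
Qed.

Section Pairings.
Context (s : seq freq) (P : freq -> freq -> bool) (K : nat).
Context (f1 f2 f3 f4 : freq -> R) (m1 m2 m3 m4 : R).
Context (us : uniq s) (p1 : 0 <= m1) (p2 : 0 <= m2) (p3 : 0 <= m3) (p4 : 0 <= m4).
Context (h1 : \sum_(A <- s) f1 A ^+ 2 <= m1 ^+ 2)
  (h2 : \sum_(A <- s) f2 A ^+ 2 <= m2 ^+ 2) (h3 : \sum_(A <- s) f3 A ^+ 2 <= m3 ^+ 2)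
  (h4 : \sum_(A <- s) f4 A ^+ 2 <= m4 ^+ 2).

(** The vertices are paired along the sides [A D] and [B C], both translates of [v]; once one of
    them is placed, [u] determines the rectangle. *)
Lemma S4_side : (forall v U, uniq U -> (forall u, u \in U -> P u v /\ dot u v = 0) ->
    (size U <= K)%N) ->
  S4 s P f1 f2 f3 f4 <= K%:R * (m1 * m2 * m3 * m4).
Proof.
move=> PK; have -> : m1 * m2 * m3 * m4 = m1 * m4 * m2 * m3 by ring.
apply: (@S4_pairing s P K (fun x => (x.1.1, x.2.2)) (fun x => (x.1.2, x.2.1))
  f1 f4 f2 f3) => //.
- by move=> x; rewrite mem_quads !mem_pairs => /and4P[-> -> -> ->].
- by move=> x; ring.
- move=> [A D]; apply: (count_quads_le (g := fun x => x.1.2 - x.1.1)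
    (P := fun u => P u (D - A) /\ dot u (D - A) = 0)) => //.
  + by move=> U; apply: PK.
  + move=> [[a b] [c d]] [[a' b'] [c' d']] /= /andP[/andP[/rectP[-> _ _ _] _] /eqP[-> ->]].
    move=> /andP[/andP[/rectP[-> _ _ _] _] /eqP[-> ->]] e.
    have eb : b = b' by rewrite -(subrK A b) e subrK.
    by rewrite eb.
  + move=> [[a b] [c d]] /= /andP[/andP[/rectP[_ dd _ _] Px] /eqP[e1 e2]].
    by rewrite -e1 -e2.
- move=> [B C]; apply: (count_quads_le (g := fun x => x.1.2 - x.1.1)
    (P := fun u => P u (C - B) /\ dot u (C - B) = 0)) => //.
  + by move=> U; apply: PK.
  + move=> [[a b] [c d]] [[a' b'] [c' d']] /= /andP[/andP[/rectP[_ _ r1 _] _] /eqP[e1 e2]].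
    move=> /andP[/andP[/rectP[_ _ r2 _] _] /eqP[e1' e2']] e.
    have eb : b = b' by rewrite e1 e1'.
    have ec : c = c' by rewrite e2 e2'.
    have ea : a = a' by move: e; rewrite eb => /addrI /oppr_inj.
    have ed : d = d' by move: r1; rewrite ec eb r2 ea => /addIr.
    by rewrite ea eb ec ed.
  + move=> [[a b] [c d]] /= /andP[/andP[/rectP[_ dd r _] Px] /eqP[e1 e2]].
    by rewrite -e1 -e2 r.
Qed.

(** The vertices are paired along the diagonals. The pair [A C] fixes [u + v] and the pair [B D]
    fixes [v - u], which explains the two counting hypotheses. *)
Lemma S4_diag :
  (forall w U, uniq U -> (forall u, u \in U -> P u (w - u) /\ dot u (w - u) = 0) ->
    (size U <= K)%N) ->
  (forall w U, uniq U -> (forall u, u \in U -> P u (w + u) /\ dot u (w + u) = 0) ->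
    (size U <= K)%N) ->
  S4 s P f1 f2 f3 f4 <= K%:R * (m1 * m2 * m3 * m4).
Proof.
move=> PK PK'; have -> : m1 * m2 * m3 * m4 = m1 * m3 * m2 * m4 by ring.
apply: (@S4_pairing s P K (fun x => (x.1.1, x.2.1)) (fun x => (x.1.2, x.2.2))
  f1 f3 f2 f4) => //.
- by move=> x; rewrite mem_quads !mem_pairs => /and4P[-> -> -> ->].
- by move=> x; ring.
- move=> [A C]; apply: (count_quads_le (g := fun x => x.1.2 - x.1.1)
    (P := fun u => P u ((C - A) - u) /\ dot u ((C - A) - u) = 0)) => //.
  + by move=> U; apply: PK.
  + move=> [[a b] [c d]] [[a' b'] [c' d']] /= /andP[/andP[/rectP[_ _ r1 _] _] /eqP[e1 e2]].
    move=> /andP[/andP[/rectP[_ _ r2 _] _] /eqP[e1' e2']] e.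
    have ea : a = a' by rewrite e1 e1'.
    have ec : c = c' by rewrite e2 e2'.
    have eb : b = b' by move: e; rewrite ea => /addIr.
    have ed : d = d' by move: r1; rewrite ec eb r2 ea => /addIr.
    by rewrite ea eb ec ed.
  + move=> [[a b] [c d]] /= /andP[/andP[/rectP[-> dd r _] Px] /eqP[e1 e2]].
    have -> : C - A - (b - a) = d - a; last by [].
    by rewrite -e1 -e2; fring.
- move=> [B D]; apply: (count_quads_le (g := fun x => x.1.2 - x.1.1)
    (P := fun u => P u ((D - B) + u) /\ dot u ((D - B) + u) = 0)) => //.
  + by move=> U; apply: PK'.
  + move=> [[a b] [c d]] [[a' b'] [c' d']] /= /andP[/andP[/rectP[_ _ r1 _] _] /eqP[e1 e2]].
    move=> /andP[/andP[/rectP[_ _ r2 _] _] /eqP[e1' e2']] e.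
    have eb : b = b' by rewrite e1 e1'.
    have ed : d = d' by rewrite e2 e2'.
    have ea : a = a' by move: e; rewrite eb => /addrI /oppr_inj.
    have ec : c = c' by move: r1; rewrite ed eb ea -r2 => /addIr.
    by rewrite ea eb ec ed.
  + move=> [[a b] [c d]] /= /andP[/andP[/rectP[_ dd r r'] Px] /eqP[e1 e2]].
    by rewrite -e1 -e2 r' subrK.
Qed.
End Pairings.

(** The segments [A D] and [B C] are opposite sides of a rectangle exactly if their direction
    vectors agree and have the same inner product with [A] and with [B]. The sum is therefore a Gram
    form for this key, and Cauchy-Schwarz doubles each side. *)
Lemma S4_holder2 s f1 f2 f3 f4 (p q : R) : 0 <= p -> 0 <= q ->
  S4 s PT f1 f1 f4 f4 <= p ^+ 2 -> S4 s PT f2 f2 f3 f3 <= q ^+ 2 ->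
  S4 s PT f1 f2 f3 f4 <= p * q.
Proof.
pose key (y : freq * freq) := (y.2 - y.1, dot y.1 (y.2 - y.1)).
have E g1 g2 g3 g4 : S4 s PT g1 g2 g3 g4 = \sum_(y <- pairs s)
    \sum_(z <- pairs s | key y == key z) (g1 y.1 * g4 y.2) * (g2 z.1 * g3 z.2).
  rewrite S4E /PT; under [RHS]eq_bigr do rewrite big_mkcond.
  rewrite /pairs big_allpairs_dep /=; apply: eq_bigr => A _.
  under eq_bigr do rewrite exchange_big /=.
  rewrite exchange_big /=; apply: eq_bigr => D _.
  rewrite big_allpairs_dep /=; apply: eq_bigr => B _; apply: eq_bigr => C _.
  rewrite andbT; have -> : rect ((A, B), (C, D)) = (key (A, D) == key (B, C)).
    have -> : (key (A, D) == key (B, C)) =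
      (D - A == C - B) && (dot A (D - A) == dot B (C - B)) by rewrite xpair_eqE.
    have -> : rect ((A, B), (C, D)) = (A + C == B + D) && (dot (B - A) (D - A) == 0) by [].
    have -> : (A + C == B + D) = (D - A == C - B).
      apply/eqP/eqP => e.
        have -> : C = B + D - A by rewrite -e; fring.
        by fring.
      have -> : D = (D - A) + A by fring.
      by rewrite e; fring.
    case: eqP => //= e; rewrite -e.
    have -> : dot (B - A) (D - A) = dot B (D - A) - dot A (D - A) by rewrite /dot !cE; ring.
    by rewrite subr_eq0 eq_sym.
  by case: ifP => // _; ring.
move=> p0 q0; rewrite !E => h1 h2; apply: (gram_le p0 q0).
- exact: h1.
- exact: h2.
Qed.

(** Hölder's inequality in [L^4] for four functions: [S4_holder2] is applied once as it stands and
    once to the transposed rectangles. *)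
Lemma S4_holder4 s f1 f2 f3 f4 (e1 e2 e3 e4 : R) :
  0 <= e1 -> 0 <= e2 -> 0 <= e3 -> 0 <= e4 ->
  S4 s PT f1 f1 f1 f1 <= e1 ^+ 4 -> S4 s PT f2 f2 f2 f2 <= e2 ^+ 4 ->
  S4 s PT f3 f3 f3 f3 <= e3 ^+ 4 -> S4 s PT f4 f4 f4 f4 <= e4 ^+ 4 ->
  S4 s PT f1 f2 f3 f4 <= e1 * e2 * e3 * e4.
Proof.
move=> p1 p2 p3 p4 h1 h2 h3 h4.
have adj (f g : freq -> R) (e d : R) : 0 <= e -> 0 <= d ->
    S4 s PT f f f f <= e ^+ 4 -> S4 s PT g g g g <= d ^+ 4 ->
    S4 s PT f f g g <= (e * d) ^+ 2.
  move=> e0 d0 hf hg; rewrite S4T exprMn.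
  have -> : (fun u v : freq => PT v u) = PT by [].
  by apply: S4_holder2; rewrite ?exprn_ge0 -?exprM.
have -> : e1 * e2 * e3 * e4 = (e1 * e4) * (e2 * e3) by ring.
by apply: S4_holder2; rewrite ?mulr_ge0 ?adj.
Qed.

End Rectangles.

(** * Residue classes and the rectangle count at a single scale *)

Definition box (z : freq) (M : nat) (A : freq) : bool :=
  [&& c1 z <= c1 A < c1 z + M%:Z, c2 z <= c2 A < c2 z + M%:Z,
      c3 z <= c3 A < c3 z + M%:Z & c4 z <= c4 A < c4 z + M%:Z].

Definition res (h : nat) (A : freq) : freq :=
  ((c1 A %% h)%Z, (c2 A %% h)%Z, (c3 A %% h)%Z, (c4 A %% h)%Z).
Definition quo (h : nat) (A : freq) : freq :=
  ((c1 A %/ h)%Z, (c2 A %/ h)%Z, (c3 A %/ h)%Z, (c4 A %/ h)%Z).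

Lemma cMn (u : freq) n : [/\ c1 (u *+ n) = c1 u * n%:Z, c2 (u *+ n) = c2 u * n%:Z,
  c3 (u *+ n) = c3 u * n%:Z & c4 (u *+ n) = c4 u * n%:Z].
Proof.
elim: n => [|n [e1 e2 e3 e4]]; first by rewrite mulr0n !mulr0.
by rewrite mulrS !cE e1 e2 e3 e4; split; lia.
Qed.

Lemma quo_res h A : A = res h A + quo h A *+ h.
Proof.
have [e1 e2 e3 e4] := cMn (quo h A) h.
by apply: freq_eqP; rewrite !cE ?e1 ?e2 ?e3 ?e4 addrC -divz_eq.
Qed.

Lemma res_eq h u v : dvd4 h (u - v) -> res h u = res h v.
Proof.
rewrite /dvd4 !cE => /and4P[h1 h2 h3 h4].
have e (a b : int) : (h %| `|a - b|)%N -> (a %% h)%Z = (b %% h)%Z.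
  by move=> hab; apply/eqP; rewrite eqz_mod_dvd dvdzE.
by rewrite /res (e _ _ h1) (e _ _ h2) (e _ _ h3) (e _ _ h4).
Qed.

Lemma dotMn (u v : freq) (n : nat) : dot (u *+ n) (v *+ n) = dot u v * n%:Z ^+ 2.
Proof.
have [a1 a2 a3 a4] := cMn u n; have [b1 b2 b3 b4] := cMn v n.
by rewrite /dot a1 a2 a3 a4 b1 b2 b3 b4; ring.
Qed.

Lemma mulrn_freq_inj (u v : freq) h : (0 < h)%N -> u *+ h = v *+ h -> u = v.
Proof.
move=> h0 e; have [a1 a2 a3 a4] := cMn u h; have [b1 b2 b3 b4] := cMn v h.
have h0' : h%:Z != 0 by lia.
by apply: freq_eqP; apply: (mulIf h0'); rewrite -?a1 -?a2 -?a3 -?a4 -?b1 -?b2 -?b3 -?b4 e.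
Qed.

Lemma rect_affine b h A B C D : (0 < h)%N ->
  rect ((b + A *+ h, b + B *+ h), (b + C *+ h, b + D *+ h)) = rect ((A, B), (C, D)).
Proof.
move=> h0.
have E X Y Z W : rect ((X, Y), (Z, W)) = (X + Z == Y + W) && (dot (Y - X) (W - X) == 0) by [].
rewrite !E; congr andb.
  have s (X Y : freq) : b + X *+ h + (b + Y *+ h) = b + b + (X + Y) *+ h.
    by rewrite mulrnDl addrACA.
  rewrite !s (inj_eq (addrI _)); apply/eqP/eqP => [e|-> //].
  exact: mulrn_freq_inj e.
have s (X Y : freq) : b + X *+ h - (b + Y *+ h) = (X - Y) *+ h.
  by rewrite mulrnBl opprD addrACA subrr add0r.
by rewrite !s dotMn mulf_eq0 expf_eq0 /=; case: (dot _ _ == 0) => //=; lia.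
Qed.

Section SingleScale.
Context {R : rcfType}.
Implicit Types (s : seq freq) (f : freq -> R).

(** The [L^4] estimate for free waves with frequencies in a cube of side [M], as a weighted
    rectangle count with constant [B]. *)
Definition E4 (M : nat) (B : R) : Prop := forall s z f, uniq s ->
  (forall A, A \in s -> box z M A) -> (forall A, 0 <= f A) ->
  S4 s PT f f f f <= B * (\sum_(A <- s) f A ^+ 2) ^+ 2.

Lemma S4_filter s (p : pred freq) f :
  S4 s PT (fun A => if p A then f A else 0) (fun A => if p A then f A else 0)
    (fun A => if p A then f A else 0) (fun A => if p A then f A else 0) =
  S4 [seq A <- s | p A] PT f f f f.
Proof.
rewrite !S4E /PT /=.
rewrite big_filter [RHS]big_mkcond; apply: eq_bigr => A _; case: ifP => pA; last first.
  by rewrite big1 // => B _; rewrite big1 // => C _; rewrite big1 // => D _; rewrite !mul0r if_same.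
rewrite big_filter [RHS]big_mkcond; apply: eq_bigr => B _; case: ifP => pB; last first.
  by rewrite big1 // => C _; rewrite big1 // => D _; rewrite !(mulr0, mul0r) if_same.
rewrite big_filter [RHS]big_mkcond; apply: eq_bigr => C _; case: ifP => pC; last first.
  by rewrite big1 // => D _; rewrite !(mulr0, mul0r) if_same.
rewrite big_filter [RHS]big_mkcond; apply: eq_bigr => D _.
by case: (p D); rewrite ?mulr0 ?if_same.
Qed.

Lemma S4_affine s b h f : (0 < h)%N ->
  S4 [seq b + A *+ h | A <- s] PT f f f f =
  S4 s PT (fun A => f (b + A *+ h)) (fun A => f (b + A *+ h))
   (fun A => f (b + A *+ h)) (fun A => f (b + A *+ h)).
Proof.
move=> h0; rewrite !S4E /PT big_map; apply: eq_bigr => A _.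
rewrite big_map; apply: eq_bigr => B _; rewrite big_map; apply: eq_bigr => C _.
by rewrite big_map; apply: eq_bigr => D _; rewrite rect_affine.
Qed.

(** A residue class modulo [h] is an affine copy of the lattice under which rectangles correspond,
    and a cube of side [M] shrinks to side at most [M / h + 1]. *)
Lemma E4_class h M (B : R) s (b z : freq) f : (0 < h)%N -> uniq s ->
  E4 (M %/ h).+1 B -> (forall A, 0 <= f A) ->
  (forall A, A \in s -> box z M A /\ res h A = b) ->
  S4 s PT f f f f <= B * (\sum_(A <- s) f A ^+ 2) ^+ 2.
Proof.
move=> h0 us EB f0 sb.
have sE : s = [seq b + A *+ h | A <- [seq quo h A | A <- s]].
  rewrite -map_comp -[LHS]map_id; apply/eq_in_map => A /sb[_ /= <-].
  exact: quo_res.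
rewrite {1}sE S4_affine //.
have -> : \sum_(A <- s) f A ^+ 2 = \sum_(A <- [seq quo h A | A <- s]) f (b + A *+ h) ^+ 2.
  by rewrite {1}sE big_map.
pose zz (a c : int) : int := - ((a - c) %/ h%:Z)%Z.
apply: (EB _ (zz (c1 b) (c1 z), zz (c2 b) (c2 z), zz (c3 b) (c3 z), zz (c4 b) (c4 z))) => //.
  rewrite map_inj_in_uniq // => A A' /sb[_ rA] /sb[_ rA'] e.
  by rewrite (quo_res h A) (quo_res h A') e rA rA'.
move=> _ /mapP[A As ->]; have [+ rA] := sb _ As.
have h0Z : 0 < h%:Z by lia.
have key (a c x y : int) : c <= a < c + M%:Z -> a = x + y * h%:Z ->
    zz x c <= y < zz x c + (M %/ h).+1%:Z.
  move=> aM ea; rewrite /zz.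
  have := divz_eq (x - c) h%:Z; have := modz_ge0 (x - c) (lt0r_neq0 h0Z).
  have := ltz_pmod (x - c) h0Z; have := divn_eq M h; have := ltn_pmod M h0.
  move: ((x - c) %/ h%:Z)%Z ((x - c) %% h%:Z)%Z (M %/ h)%N (M %% h)%N => q p k l.
  move=> *; nia.
have [e1 e2 e3 e4] := cMn (quo h A) h.
have AE := quo_res h A; rewrite rA in AE.
case/and4P => b1 b2 b3 b4; apply/and4P; split.
- by apply: (key _ _ _ _ b1); rewrite -e1 -c1D -AE.
- by apply: (key _ _ _ _ b2); rewrite -e2 -c2D -AE.
- by apply: (key _ _ _ _ b3); rewrite -e3 -c3D -AE.
- by apply: (key _ _ _ _ b4); rewrite -e4 -c4D -AE.
Qed.

Lemma sum_classes (K : eqType) s (r : freq -> K) (g : freq -> R) :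
  \sum_(b <- undup (map r s)) \sum_(A <- s | r A == b) g A = \sum_(A <- s) g A.
Proof.
rewrite (exchange_big_dep xpredT) //= big_seq [RHS]big_seq; apply: eq_bigr => A As.
under eq_bigl do rewrite eq_sym.
rewrite -big_filter filter_pred1_uniq ?undup_uniq ?mem_undup ?map_f //.
by rewrite big_seq1.
Qed.

(** If [h] divides [v = D - A = C - B], then [A, D] lie in one class and [B, C] in another. For each
    pair of classes [S4_holder4] separates the factors, and Cauchy-Schwarz over the classes restores
    the full norms. Each factor is compared only with itself, so the four cubes may lie anywhere. *)
Lemma S4_class (h M : nat) (B : R) s (z1 z2 z3 z4 : freq) f1 f2 f3 f4 (m1 m2 m3 m4 : R) :
  (0 < h)%N -> uniq s -> E4 (M %/ h).+1 B -> 0 <= B ->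
  (forall A, 0 <= f1 A) -> (forall A, 0 <= f2 A) ->
  (forall A, 0 <= f3 A) -> (forall A, 0 <= f4 A) ->
  (forall A, f1 A != 0 -> box z1 M A) -> (forall A, f2 A != 0 -> box z2 M A) ->
  (forall A, f3 A != 0 -> box z3 M A) -> (forall A, f4 A != 0 -> box z4 M A) ->
  0 <= m1 -> 0 <= m2 -> 0 <= m3 -> 0 <= m4 ->
  \sum_(A <- s) f1 A ^+ 2 <= m1 ^+ 2 -> \sum_(A <- s) f2 A ^+ 2 <= m2 ^+ 2 ->
  \sum_(A <- s) f3 A ^+ 2 <= m3 ^+ 2 -> \sum_(A <- s) f4 A ^+ 2 <= m4 ^+ 2 ->
  S4 s (fun u v => dvd4 h v) f1 f2 f3 f4 <= B * (m1 * m2 * m3 * m4).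
Proof.
move=> h0 us EB B0 p1 p2 p3 p4 s1 s2 s3 s4 q1 q2 q3 q4 n1 n2 n3 n4.
pose ind (f : freq -> R) b A := if res h A == b then f A else 0.
pose reps := undup (map (res h) s).
pose nrm (f : freq -> R) b := Num.sqrt (\sum_(A <- s | res h A == b) f A ^+ 2).
pose e := Num.sqrt (Num.sqrt B).
have e4 : e ^+ 4 = B by rewrite -[4%N]/(2 * 2)%N exprM !sqr_sqrtr ?sqrtr_ge0.
have ge_e : 0 <= e by rewrite sqrtr_ge0.
have nn f b : 0 <= nrm f b by rewrite sqrtr_ge0.
have blk f z b : (forall A, 0 <= f A) -> (forall A, f A != 0 -> box z M A) ->
    S4 s PT (ind f b) (ind f b) (ind f b) (ind f b) <= (e * nrm f b) ^+ 4.
  move=> f0 fz.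
  have -> : ind f b = fun A => if (res h A == b) && box z M A then f A else 0.
    apply/funext => A; rewrite /ind; case: ifP => //= _; case: ifP => // bx.
    by apply/eqP; apply: contraFT bx => /fz ->.
  rewrite S4_filter exprMn e4.
  apply: le_trans (@E4_class h M B _ b z f h0 _ EB f0 _) _.
  - by rewrite filter_uniq.
  - by move=> A; rewrite mem_filter => /andP[/andP[/eqP ? ?] _].
  rewrite ler_wpM2l // -[4%N]/(2 * 2)%N exprM sqr_sqrtr ?sumr_ge0 // => [|A _]; last exact: sqr_ge0.
  rewrite ler_sqr ?nnegrE ?sumr_ge0 // => [|A _|A _]; rewrite ?sqr_ge0 //.
  rewrite big_filter [leLHS]big_mkcond [leRHS]big_mkcond /=.
  by apply: ler_sum => A _; case: (res h A == b) => //=; case: ifP => // _; rewrite sqr_ge0.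
apply: (@le_trans _ _ (\sum_(b <- reps) \sum_(b' <- reps)
    S4 s PT (ind f1 b) (ind f2 b') (ind f3 b') (ind f4 b))).
  rewrite /S4; under [leRHS]eq_bigr do rewrite exchange_big /=.
  rewrite [leRHS]exchange_big /=.
  rewrite [leRHS]big_mkcond /=.
  rewrite big_mkcond /= big_seq [leRHS]big_seq; apply: ler_sum => -[[A B'] [C D]].
  rewrite mem_quads /= => /and4P[As Bs Cs Ds]; rewrite /rect_in /PT /= andbT.
  have [rx|_] := boolP (rect _) => //=.
  have [_ _ CB _] := rectP rx.
  case: ifP => [dv|_]; last first.
    by apply: sumr_ge0 => b _; apply: sumr_ge0 => b' _; rewrite /ind !mulr_ge0 //; case: ifP.
  have rD : res h D = res h A by apply: res_eq.
  have rC : res h C = res h B' by apply: res_eq; rewrite CB.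
  rewrite (bigD1_seq (res h A)) ?undup_uniq ?mem_undup ?map_f //=.
  rewrite (bigD1_seq (res h B')) ?undup_uniq ?mem_undup ?map_f //=.
  rewrite /ind rD rC !eqxx -addrA lerDl addr_ge0 //.
    by apply: sumr_ge0 => b' _; rewrite !mulr_ge0 //; case: ifP.
  by apply: sumr_ge0 => b _; apply: sumr_ge0 => b' _; rewrite !mulr_ge0 //; case: ifP.
have step b b' : S4 s PT (ind f1 b) (ind f2 b') (ind f3 b') (ind f4 b) <=
    (e * nrm f1 b) * (e * nrm f2 b') * (e * nrm f3 b') * (e * nrm f4 b).
  by apply: S4_holder4; rewrite ?mulr_ge0 //; apply: blk; eauto.
have cs (f g : freq -> R) (p q : R) : 0 <= p -> 0 <= q ->
    \sum_(A <- s) f A ^+ 2 <= p ^+ 2 -> \sum_(A <- s) g A ^+ 2 <= q ^+ 2 ->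
    \sum_(b <- reps) nrm f b * nrm g b <= p * q.
  move=> p0 q0 fp gq; apply: cauchy_schwarz_le => //.
    rewrite (le_trans _ fp) // -(sum_classes s (res h)) le_eqVlt; apply/orP; left; apply/eqP.
    by apply: eq_bigr => b _; rewrite sqr_sqrtr // sumr_ge0 // => A _; exact: sqr_ge0.
  rewrite (le_trans _ gq) // -(sum_classes s (res h)) le_eqVlt; apply/orP; left; apply/eqP.
  by apply: eq_bigr => b _; rewrite sqr_sqrtr // sumr_ge0 // => A _; exact: sqr_ge0.
apply: (@le_trans _ _ (B * ((\sum_(b <- reps) nrm f1 b * nrm f4 b) *
    (\sum_(b <- reps) nrm f2 b * nrm f3 b)))).
  rewrite mulr_suml mulr_sumr; apply: ler_sum => b _.
  rewrite mulr_sumr mulr_sumr; apply: ler_sum => b' _.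
  apply: le_trans (step b b') _; rewrite -e4 le_eqVlt; apply/orP; left; apply/eqP; ring.
have -> : m1 * m2 * m3 * m4 = (m1 * m4) * (m2 * m3) by ring.
rewrite ler_wpM2l // ler_pM ?cs //.
  by apply: sumr_ge0 => b _; rewrite mulr_ge0.
by apply: sumr_ge0 => b _; rewrite mulr_ge0.
Qed.

End SingleScale.

Lemma dvd4_gcd4 h v : dvd4 h v -> (h %| gcd4 v)%N.
Proof. by case/and4P => h1 h2 h3 h4; rewrite /gcd4 !dvdn_gcd h1 h2 h3 h4. Qed.

Lemma gcd4_dvd v : dvd4 (gcd4 v) v.
Proof.
rewrite /dvd4 /gcd4 dvdn_gcdl andbT.
have h1 := dvdn_gcdr `|c4 v| (gcdn `|c3 v| (gcdn `|c2 v| `|c1 v|)).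
rewrite (dvdn_trans h1 (dvdn_gcdl _ _)) andbT.
have h2 := dvdn_trans h1 (dvdn_gcdr _ _).
by rewrite (dvdn_trans h2 (dvdn_gcdr _ _)) (dvdn_trans h2 (dvdn_gcdl _ _)).
Qed.

Lemma sup4_eq0 v : (sup4 v == 0%N) = (v == 0).
Proof.
apply/eqP/eqP => [|-> //]; rewrite /sup4 => h.
by apply: freq_eqP; rewrite -[RHS]/(0 : int); lia.
Qed.

Lemma primitive_part v : v != 0 -> exists g v',
  [/\ (0 < g)%N, v = v' *+ g, primitive v' & g = gcd4 v] /\
  [/\ v' != 0, sup4 v = (g * sup4 v')%N & forall u, dot u v = 0 -> dot u v' = 0].
Proof.
move=> v0; pose g := gcd4 v; exists g, (quo g v).
have g0 : (0 < g)%N.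
  rewrite lt0n; apply: contraNneq v0 => g0; have := gcd4_dvd v.
  rewrite -/g g0 /dvd4 !dvd0n !absz_eq0 => /and4P[/eqP ? /eqP ? /eqP ? /eqP ?].
  by apply/eqP; apply: freq_eqP.
have vE : v = quo g v *+ g.
  rewrite [LHS](quo_res g) (_ : res g v = 0) ?add0r //.
  have /and4P[d1 d2 d3 d4] := gcd4_dvd v; rewrite -/g in d1 d2 d3 d4.
  have e (a : int) : (g %| `|a|)%N -> (a %% g)%Z = 0.
    by move=> ga; apply/dvdz_mod0P; rewrite dvdzE.
  by rewrite /res !e.
have [e1 e2 e3 e4] := cMn (quo g v) g; rewrite -vE in e1 e2 e3 e4.
split; split=> //.
- move=> h hd; have : (h * g %| g)%N.
    apply: dvd4_gcd4; move: hd => /and4P[d1 d2 d3 d4].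
    by rewrite /dvd4 e1 e2 e3 e4 !abszM !dvdn_mul.
  by rewrite -{2}[g]mul1n dvdn_pmul2r // dvdn1 => /eqP.
- by apply: contraNneq v0 => q0; rewrite vE q0 mul0rn.
- by rewrite /sup4 e1 e2 e3 e4 !abszM /= -!maxnMl mulnC.
- move=> u; rewrite {1}/dot e1 e2 e3 e4 => h.
  have g0Z : g%:Z != 0 by lia.
  by apply: (mulIf g0Z); rewrite mul0r -h /dot; ring.
Qed.

Lemma leq_of_mul_cube (a m K : nat) : (0 < m)%N -> (a * m <= K * m ^ 3)%N -> (a <= K * m ^ 2)%N.
Proof. by move=> m0 h; rewrite -(leq_pmul2r m0) -mulnA -expnSr. Qed.

Lemma leq_4m1_cube m : (0 < m)%N -> ((4 * m).+1 ^ 3 <= 125 * m ^ 3)%N.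
Proof.
move=> m0; rewrite -[125%N]/(5 ^ 3)%N -expnMn leq_exp2r //; lia.
Qed.

Section L4.
Context {R : rcfType}.

Lemma sum_inv_sqr (a M : nat) : (0 < a)%N ->
  \sum_(a.+1 <= k < M) (k%:R ^+ 2)^-1 <= a%:R^-1 :> R.
Proof.
move=> a0; have [Ma|aM] := leqP M a.+1.
  by rewrite big_geq // invr_ge0 ler0n.
apply: (@le_trans _ _ (\sum_(a.+1 <= k < M) ((k.-1)%:R^-1 - k%:R^-1))).
  rewrite big_nat_cond [leRHS]big_nat_cond; apply: ler_sum => k /andP[/andP[k16 _] _].
  have k1 : 0 < (k.-1)%:R :> R by rewrite ltr0n; lia.
  have -> : k%:R = (k.-1)%:R + 1 :> R by rewrite natr1 prednK //; lia.
  move: (k.-1)%:R k1 => x x0.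
  have x1 : x + 1 != 0 by rewrite lt0r_neq0 // addr_gt0.
  have -> : x^-1 - (x + 1)^-1 = (x * (x + 1))^-1 by field; rewrite x1 lt0r_neq0.
  by rewrite lef_pV2 ?posrE ?exprn_gt0 ?mulr_gt0 ?addr_gt0 // expr2 ler_pM2r ?addr_gt0 // lerDl.
rewrite (telescope_sumr_eq (fun k : nat => - ((k.-1)%:R^-1 : R))); first last.
- by move=> k _; rewrite opprK addrC.
- exact: ltnW.
by rewrite opprK /= gerDr oppr_le0 invr_ge0 ler0n.
Qed.

(** The labels of the cover in [rectangle_bound]: 0 for degenerate rectangles, 1 for a longer side
    [y] of content at most 15, any other [k] for a side [y] divisible by [k]. The flag tells which
    of [u], [v] is [y]. *)
Definition side_lab (k : nat) (b : bool) (M : nat) (u v : freq) : bool :=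
  let: (x, y) := if b then (u, v) else (v, u) in
  match k with
  | 0 => (u == 0) || (v == 0)
  | 1 => [&& y != 0, (sup4 x <= sup4 y)%N, (sup4 y < M)%N & (gcd4 y <= 15)%N]
  | _ => dvd4 k y
  end.

Lemma S4_side_lab1 M s (f : freq -> R) n : uniq s -> (forall A, 0 <= f A) -> 0 <= n ->
  \sum_(A <- s) f A ^+ 2 <= n ^+ 2 ->
  S4 s (side_lab 1 true M) f f f f <= (1875 * M ^ 2)%N%:R * (n * n * n * n).
Proof.
move=> us f0 n0 fn; apply: S4_side => // v U uU Uv.
have [->//|U0] := eqVneq U [::].
have [u0 u0U] : exists u, u \in U.
  by case: U U0 {uU Uv} => // u U _; exists u; rewrite mem_head.
have [/and4P[v0 _ vM g15] _] := Uv _ u0U.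
have [g [v' [[g0 vE pv gE] [v'0 sE dv']]]] := primitive_part v0.
have m0 : (0 < sup4 v)%N by rewrite lt0n sup4_eq0.
have h := @perp_count v' pv v'0 (sup4 v) U uU _.
have {h} : (size U * minn (sup4 v') (sup4 v).+1 <= (4 * sup4 v).+1 ^ 3)%N.
  by apply: h => u /Uv[/and4P[_ ? _ _] /dv' ?].
have -> : minn (sup4 v') (sup4 v).+1 = sup4 v'.
  by apply/minn_idPl; rewrite sE; nia.
(* [1875 = 15 * 125]: the primitive part has size at least [sup4 v / 15], and
   [(4 m + 1)^3 <= 125 m^3]. *)
move=> h1; have h2 : (size U * sup4 v <= 1875 * sup4 v ^ 3)%N.
  have -> : (1875 * sup4 v ^ 3 = 15 * (125 * sup4 v ^ 3))%N by lia.
  apply: leq_trans (_ : 15 * (4 * sup4 v).+1 ^ 3 <= _)%N; last first.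
    by rewrite leq_mul2l leq_4m1_cube.
  apply: leq_trans (_ : g * (4 * sup4 v).+1 ^ 3 <= _)%N; last first.
    by rewrite leq_mul2r gE g15 orbT.
  by rewrite {1}sE mulnCA leq_mul2l h1 orbT.
apply: leq_trans (leq_of_mul_cube m0 h2) _.
by rewrite leq_mul2l /= leq_exp2r // ltnW.
Qed.

(** A side is zero, so the vertices of one diagonal determine those of the other up to two
    choices. *)
Lemma S4_side_lab0 M s (f : freq -> R) n b : uniq s -> (forall A, 0 <= f A) -> 0 <= n ->
  \sum_(A <- s) f A ^+ 2 <= n ^+ 2 ->
  S4 s (side_lab 0 b M) f f f f <= 2%:R * (n * n * n * n).
Proof.
move=> us f0 n0 fn; apply: S4_diag => // w U uU Uv.
  apply: (@uniq_leq_size _ U [:: 0; w]) => // u /Uv[+ _].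
  by rewrite /side_lab; case: b {Uv} => /=; rewrite !inE subr_eq0 [w == u]eq_sym.
apply: (@uniq_leq_size _ U [:: 0; - w]) => // u /Uv[+ _].
by rewrite /side_lab; case: b {Uv} => /=; rewrite !inE addrC addr_eq0.
Qed.

Lemma sup4_diff z M A B : box z M A -> box z M B -> (0 < M)%N -> (sup4 (B - A)%R < M)%N.
Proof.
move=> /and4P[a1 a2 a3 a4] /and4P[b1 b2 b3 b4] M0.
rewrite -[(_ < _)%N]/(_.+1 <= _)%N -(prednK M0) ltnS -in_cubeE /in_cube !cE.
by apply/and4P; split; lia.
Qed.

(* Rectangles with a long side of small content are counted by fixing that side; those
   whose long side is divisible by [h] split into classes modulo [h], to each of which
   the induction hypothesis applies at scale [M / h]. *)
Lemma rectangle_bound (M : nat) : @E4 R M ((100 * 100) * M%:R ^+ 2).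
Proof.
elim/ltn_ind: M => M IH s z f us sz f0.
have [M0|M0] := posnP M.
  have -> : s = [::].
    by case: s us sz => // A s _ /(_ A); rewrite mem_head M0 => /(_ isT)/and4P[]; lia.
  by rewrite S4E !big_nil expr0n /= mulr0.
pose n := Num.sqrt (\sum_(A <- s) f A ^+ 2).
have sn : \sum_(A <- s) f A ^+ 2 = n ^+ 2.
  by rewrite sqr_sqrtr // sumr_ge0 // => A _; exact: sqr_ge0.
have n0 : 0 <= n by rewrite sqrtr_ge0.
have sn' : \sum_(A <- s) f A ^+ 2 <= n ^+ 2 by rewrite sn.
(* The threshold 16 lets the constant close up: the sum of [k^(-2)] beyond 15 is at most [1 / 15],
   and [2 * 40000 / 15 + 2 * 1875 + 2 < 10000]. *)
pose hs := [:: (0%N, true); (1%N, true); (1%N, false)] ++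
  [seq (k, true) | k <- index_iota 16 M] ++ [seq (k, false) | k <- index_iota 16 M].
have cov : S4 s PT f f f f <= \sum_(h <- hs) S4 s (side_lab h.1 h.2 M) f f f f.
  apply: S4_cover => // A B D As Bs Ds _ _.
  set u := B - A; set v := D - A.
  have uM : (sup4 u < M)%N by apply: sup4_diff (sz _ As) (sz _ Bs) M0.
  have vM : (sup4 v < M)%N by apply: sup4_diff (sz _ As) (sz _ Ds) M0.
  have [/orP uv0|] := boolP ((u == 0) || (v == 0)).
    by exists (0%N, true); rewrite ?inE //=; apply/orP.
  rewrite negb_or => /andP[u0 v0].
  have long x y : x != 0 -> y != 0 -> (sup4 x <= sup4 y)%N -> (sup4 y < M)%N ->
      (gcd4 y <= 15)%N \/ (gcd4 y \in index_iota 16 M /\ dvd4 (gcd4 y) y).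
    move=> x0 y0 xy yM; case: (leqP (gcd4 y) 15) => g15; [by left|right].
    split; last exact: gcd4_dvd.
    have [g [y' [[g0 yE py gE] [y'0 sE _]]]] := primitive_part y0.
    rewrite mem_index_iota g15 -gE; apply: leq_ltn_trans yM.
    by rewrite sE leq_pmulr // lt0n sup4_eq0.
  have [uv|vu] := leqP (sup4 u) (sup4 v).
    have [g15|[gi gd]] := long u v u0 v0 uv vM.
      by exists (1%N, true); [rewrite !inE eqxx ?orbT|apply/and4P].
    exists (gcd4 v, true); first by rewrite !mem_cat map_f ?orbT //; apply: map_f.
    by move: gi gd; rewrite mem_index_iota /side_lab /=; case: (gcd4 v) => [|[|k]].
  have [g15|[gi gd]] := long v u v0 u0 (ltnW vu) uM.
    by exists (1%N, false); [rewrite !inE eqxx ?orbT|apply/and4P; split=> //; apply: ltnW].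
  exists (gcd4 u, false); first by rewrite !mem_cat [X in _ || (_ || X)]map_f ?orbT.
  by move: gi gd; rewrite mem_index_iota /side_lab /=; case: (gcd4 u) => [|[|k]].
apply: le_trans cov _; rewrite sn.
have tr k : S4 s (side_lab k false M) f f f f <= S4 s (side_lab k true M) f f f f.
  rewrite S4T le_eqVlt; apply/orP; left; apply/eqP.
  by apply: eq_S4 => A B D _ _ _; case: k => [|[|k]]; [exact: orbC| |].
have cls k : k \in index_iota 16 M ->
    S4 s (side_lab k true M) f f f f <= (200 * 200) * M%:R ^+ 2 * (k%:R ^+ 2)^-1 * (n * n * n * n).
  rewrite mem_index_iota => /andP[k16 kM]; have k0 : (0 < k)%N by lia.
  have -> : S4 s (side_lab k true M) f f f f = S4 s (fun u v => dvd4 k v) f f f f.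
    by apply: eq_S4 => A B D _ _ _; case: k k16 {kM k0} => [|[|k]].
  pose fz A := if A \in s then f A else 0.
  have -> : S4 s (fun u v => dvd4 k v) f f f f = S4 s (fun u v => dvd4 k v) fz fz fz fz.
    rewrite /S4 big_seq_cond [RHS]big_seq_cond; apply: eq_bigr => x /andP[+ _].
    by rewrite mem_quads /fz => /and4P[-> -> -> ->].
  have fzz A : fz A != 0 -> box z M A.
    by rewrite /fz; case: ifP => [/sz //|]; rewrite eqxx.
  have fz0 A : 0 <= fz A by rewrite /fz; case: ifP.
  have fzn : \sum_(A <- s) fz A ^+ 2 <= n ^+ 2.
    by rewrite -sn big_seq [leRHS]big_seq; apply: ler_sum => A As; rewrite /fz As.
  have lt : ((M %/ k).+1 < M)%N.
    have : (M %/ k <= M %/ 16)%N by rewrite leq_div2l.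
    have := divn_eq M 16; lia.
  apply: le_trans (@S4_class R k M ((100 * 100) * (M %/ k).+1%:R ^+ 2) s z z z z fz fz fz fz
    n n n n k0 us (IH _ lt) _ fz0 fz0 fz0 fz0 fzz fzz fzz fzz n0 n0 n0 n0 fzn fzn fzn fzn) _.
    by rewrite mulr_ge0 ?sqr_ge0.
  apply: ler_wpM2r; first by rewrite !mulr_ge0.
  have kR : 0 < k%:R :> R by rewrite ltr0n.
  (* Rounding [M / k + 1] up to [2 M / k] costs a factor 4 in the square, which turns [100 * 100]
     into [200 * 200]. *)
  have le2 : (M %/ k).+1%:R <= 2 * M%:R / k%:R :> R.
    have -> : 2 * M%:R = (2 * M)%N%:R :> R by rewrite natrM.
    rewrite ler_pdivlMr // -natrM ler_nat.
    by have := leq_trunc_div M k; lia.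
  have -> : (200 * 200) * M%:R ^+ 2 * (k%:R ^+ 2)^-1 = (100 * 100) * (2 * M%:R / k%:R) ^+ 2 :> R.
    by field; rewrite lt0r_neq0.
  apply: ler_wpM2l; first by rewrite mulr_ge0.
  by rewrite lerXn2r ?nnegrE ?divr_ge0 ?mulr_ge0 ?ler0n.
have N0 : 0 <= n * n * n * n by rewrite !mulr_ge0.
rewrite !big_cons big_cat /= !big_map /=.
have sumk : \sum_(k <- index_iota 16 M) S4 s (side_lab k true M) f f f f <=
    (200 * 200) * M%:R ^+ 2 * 15^-1 * (n * n * n * n).
  case: (leqP 16 M) => M16; last first.
    have -> : index_iota 16 M = [::] by apply/eqP; rewrite -size_eq0 size_iota; lia.
    by rewrite big_nil !mulr_ge0.
  apply: (@le_trans _ _ (\sum_(16 <= k < M) (200 * 200) * M%:R ^+ 2 * (k%:R ^+ 2)^-1 * (n * n * n * n))).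
    by rewrite big_seq [leRHS]big_seq; apply: ler_sum => k; apply: cls.
  rewrite -mulr_suml -mulr_sumr ler_wpM2r // ler_wpM2l ?(@sum_inv_sqr 15) //.
have sumk' : \sum_(k <- index_iota 16 M) S4 s (side_lab k false M) f f f f <=
    (200 * 200) * M%:R ^+ 2 * 15^-1 * (n * n * n * n).
  by apply: le_trans sumk; apply: ler_sum => k _; apply: tr.
have t0 := @S4_side_lab0 M s f n true us f0 n0 sn'.
have t1 := @S4_side_lab1 M s f n us f0 n0 sn'.
have t1' := le_trans (tr 1%N) t1.
have M1 : 1 <= M%:R ^+ 2 :> R by rewrite exprn_ege1 // ler1n.
have e1 : (1875 * M ^ 2)%N%:R = 1875 * M%:R ^+ 2 :> R by rewrite natrM natrX.
rewrite e1 in t1 t1'.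
have -> : (n ^+ 2) ^+ 2 = n * n * n * n by ring.
move: N0 M1 sumk sumk' t0 t1 t1'.
move: (n * n * n * n) (M%:R ^+ 2) => N m2.
move: (\sum_(k <- _) _) (\sum_(k <- _) _) (S4 _ _ _ _ _ _) (S4 _ _ _ _ _ _) (S4 _ _ _ _ _ _).
move=> x1 x2 x3 x4 x5 N0 m1 h1 h2 h3 h4 h5.
have hN : N <= m2 * N by rewrite ler_peMl.
lra.
Qed.

End L4.

Lemma dotDl u u' v : dot (u + u') v = dot u v + dot u' v.
Proof. by rewrite /dot !cE; ring. Qed.
Lemma dotNl u v : dot (- u) v = - dot u v.
Proof. by rewrite /dot !cE; ring. Qed.
Lemma dotDr u v v' : dot u (v + v') = dot u v + dot u v'.
Proof. by rewrite /dot !cE; ring. Qed.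
Lemma dotNr u v : dot u (- v) = - dot u v.
Proof. by rewrite /dot !cE; ring. Qed.

Lemma dot_eq0 u : dot u u = 0 -> u = 0.
Proof.
rewrite /dot => h; apply: freq_eqP; rewrite -[RHS]/(0 : int); nia.
Qed.

(** From [|b| <= |p|] follows [|b (g - g')| <= 2 M], hence [|(a - b) g| <= 4 M < 4 g]. In the
    application [p] is the common largest coordinate of two vectors, and [a], [b] are their entries
    in any one coordinate. *)
Lemma direction_close (p g g' a b : int) (M : nat) : M%:Z < g ->
  `|p * g - p * g'| <= (2 * M)%N%:Z -> `|a * g - b * g'| <= (2 * M)%N%:Z ->
  `|b| <= `|p| -> `|a - b| <= 3.
Proof.
move=> Mg h1 h2 bp.
have h3 : `|b * (g - g')| <= (2 * M)%N%:Z.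
  by apply: le_trans h1; rewrite -mulrBr !normrM ler_wpM2r.
have e : (a - b) * g = (a * g - b * g') - b * (g - g') by ring.
have : `|(a - b) * g| <= (4 * M)%N%:Z.
  rewrite e (le_trans (ler_normB _ _)) //.
  have -> : (4 * M)%N%:Z = (2 * M)%N%:Z + (2 * M)%N%:Z by lia.
  exact: lerD.
rewrite normrM => h; nia.
Qed.

Lemma mulDl4_le (R : realDomainType) (a b c d k A B C D x y : R) :
  a * k <= A * x * y -> b * k <= D * x * y -> c * k <= C * x * y ->
  d * k <= B * x * y -> (a + (b + (c + d))) * k <= (A + B + C + D) * x * y.
Proof. by move=> h1 h2 h3 h4; rewrite !mulrDl; lra. Qed.

Lemma sum_case_labels (R : realDomainType) (F : nat * nat -> R) (l : seq nat) :
  \sum_(h <- [:: (0, 0); (0, 1); (0, 2)]%N ++ [seq (1%N, k) | k <- l]) F h =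
  F (0, 0)%N + (F (0, 1)%N + (F (0, 2)%N + \sum_(k <- l) F (1%N, k))).
Proof. by rewrite big_cat big_map !big_cons big_nil /= addr0 -!addrA. Qed.

(** * Rectangles with sides of different scales *)

Section Gain.
Context {R : rcfType}.

(** Let two rectangles on the same diagonal carry the same label. All products of [u], [u'] with
    [v], [v'] vanish, hence so does that of [u - u'] with [v - v']; on a fixed diagonal this product
    is plus or minus [|u - u'|^2]. So a label determines the rectangle. *)
Lemma S4_diag_labels (T : choiceType) (L : seq T) (lab : T -> freq -> freq -> Prop)
    (s : seq freq) (P : freq -> freq -> bool) (f1 f2 f3 f4 : freq -> R) (m1 m2 m3 m4 : R) :
  uniq s -> 0 <= m1 -> 0 <= m2 -> 0 <= m3 -> 0 <= m4 ->
  \sum_(A <- s) f1 A ^+ 2 <= m1 ^+ 2 -> \sum_(A <- s) f2 A ^+ 2 <= m2 ^+ 2 ->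
  \sum_(A <- s) f3 A ^+ 2 <= m3 ^+ 2 -> \sum_(A <- s) f4 A ^+ 2 <= m4 ^+ 2 ->
  (forall u v, P u v -> dot u v = 0 -> exists2 l, l \in L & lab l u v) ->
  (forall l u v u' v', l \in L -> lab l u v -> lab l u' v' -> dot u v' = 0) ->
  S4 s P f1 f2 f3 f4 <= (size L)%:R * (m1 * m2 * m3 * m4).
Proof.
move=> us p1 p2 p3 p4 h1 h2 h3 h4 PL orth.
have key (vv : freq -> freq) (sg : bool) :
    (forall u u', vv u - vv u' = if sg then u - u' else u' - u) ->
    forall U, uniq U -> (forall u, u \in U -> P u (vv u) /\ dot u (vv u) = 0) ->
    (size U <= size L)%N.
  move=> vvE U uU Uv.
  have [l0|L0] := pselect (exists l0 : T, l0 \in L); last first.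
    case: U uU Uv => // u U _ /(_ u); rewrite mem_head => /(_ isT)[Pu du].
    by have [l lL _] := PL _ _ Pu du; case: L0; exists l.
  have [l0' _] := l0.
  pose F u := xget l0' [set l | l \in L /\ lab l u (vv u)].
  have FP u : u \in U -> F u \in L /\ lab (F u) u (vv u).
    move=> /Uv[Pu du]; have [l lL ll] := PL _ _ Pu du.
    by rewrite /F; case: xgetP => [x -> //|/(_ l)]; case.
  rewrite -[size L]mul1n; apply: (size_fibers (f := F)); first by move=> u /FP[].
  move=> l lL; rewrite -size_filter.
  have : forall u u', u \in [seq x <- U | F x == l] -> u' \in [seq x <- U | F x == l] -> u = u'.
    move=> u u'; rewrite !mem_filter => /andP[/eqP Fu uU1] /andP[/eqP Fu' uU2].
    have [_ lu] := FP _ uU1; have [_ lu'] := FP _ uU2; rewrite Fu in lu; rewrite Fu' in lu'.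
    have o1 := orth _ _ _ _ _ lL lu lu'; have o2 := orth _ _ _ _ _ lL lu' lu.
    have [_ d1] := Uv _ uU1; have [_ d2] := Uv _ uU2.
    apply/eqP; rewrite -subr_eq0; apply/eqP; apply: dot_eq0.
    have z : dot (u - u') (vv u - vv u') = 0.
      by rewrite dotDl dotNl !dotDr !dotNr o1 o2 d1 d2; ring.
    move: z; rewrite vvE; case: (sg) => //.
    have -> : u' - u = - (u - u') by fring.
    by rewrite dotNr => /eqP; rewrite oppr_eq0 => /eqP.
  have := filter_uniq (fun x => F x == l) uU.
  case: [seq x <- U | F x == l] => [|x [|y t]] //= /andP[+ _] h.
  by rewrite (h x y) ?inE ?eqxx ?orbT.
apply: S4_diag => // w U uU Uv.
  by apply: (key (fun u => w - u) false) => // u u'; fring.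
by apply: (key (fun u => w + u) true) => // u u'; fring.
Qed.

Definition bucket (v : freq) : int * nat :=
  if `|c1 v|%N == sup4 v then (c1 v, 1%N) else
  if `|c2 v|%N == sup4 v then (c2 v, 2%N) else
  if `|c3 v|%N == sup4 v then (c3 v, 3%N) else (c4 v, 4%N).

Lemma bucketP v : bucket v = (c1 v, 1%N) /\ `|c1 v|%N = sup4 v \/
  bucket v = (c2 v, 2%N) /\ `|c2 v|%N = sup4 v \/
  bucket v = (c3 v, 3%N) /\ `|c3 v|%N = sup4 v \/
  bucket v = (c4 v, 4%N) /\ `|c4 v|%N = sup4 v.
Proof.
rewrite /bucket; case: eqP => [?|h1]; first by left.
case: eqP => [?|h2]; first by right; left.
case: eqP => [?|h3]; first by right; right; left.
right; right; right; split=> //; move: h1 h2 h3; rewrite /sup4; lia.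
Qed.

(** Vectors sharing a largest coordinate differ by at most 3 in every coordinate, by
    [direction_close]. This leaves [2401 = 7^4] vectors for each of the [4 (2 N + 1)] values and
    positions of that coordinate. *)
Lemma count_directions (M N : nat) (L : seq freq) : uniq L ->
  (forall v', v' \in L -> (sup4 v' <= N)%N) ->
  (forall v' w', v' \in L -> w' \in L -> exists g h : nat,
     (M < g)%N /\ (sup4 (v' *+ g - w' *+ h)%R <= 2 * M)%N) ->
  (size L <= 2401 * (4 * (N.*2).+1))%N.
Proof.
move=> uL LN Lc.
pose t := [seq (a, i) | a <- int_range N, i <- [:: 1; 2; 3; 4]%N].
have -> : (4 * (N.*2).+1)%N = size t by rewrite size_allpairs size_int_range mulnC.
apply: (size_fibers (f := bucket)) => [v vL|y yt].
  have := LN _ vL; have := bucketP v; rewrite /sup4.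
  by case=> [[-> ?]|[[-> ?]|[[-> ?]|[-> ?]]]] ?; rewrite mem_pairs mem_int_range !inE; lia.
rewrite -size_filter.
have uF := filter_uniq (fun x => bucket x == y) uL.
case eF : [seq x <- L | bucket x == y] uF => [//|w F] uF.
have inF x : x \in w :: F -> x \in L /\ bucket x = y.
  by rewrite -eF mem_filter => /andP[/eqP ? ?].
have [wL wy] := inF _ (mem_head _ _).
rewrite -(size_map (fun x => x - w)) -[2401%N]/(((3.*2).+1) ^ 4)%N -(size_cube_seq 3).
apply: uniq_leq_size.
  by rewrite map_inj_uniq // => a b /addIr.
move=> _ /mapP[x /inF[xL xy] ->]; rewrite mem_cube_seq /in_cube !cE.
have [g [h [Mg]]] := Lc _ _ xL wL.
have [e1 e2 e3 e4] := cMn x g; have [d1 d2 d3 d4] := cMn w h.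
rewrite -in_cubeE /in_cube !cE e1 e2 e3 e4 d1 d2 d3 d4 => /and4P[i1 i2 i3 i4].
have MgZ : M%:Z < g%:Z by lia.
have sw (p : int) : `|p|%N = sup4 w -> [/\ `|c1 w| <= `|p|, `|c2 w| <= `|p|,
    `|c3 w| <= `|p| & `|c4 w| <= `|p|].
  have := leqnn (sup4 w); rewrite -{1}[sup4 w]/(sup4 w) -in_cubeE => /and4P[l1 l2 l3 l4] sp.
  by have -> : `|p| = (sup4 w)%:Z by rewrite -sp abszE.
have := bucketP x; have := bucketP w; rewrite xy wy.
case=> [[-> sp]|[[-> sp]|[[-> sp]|[-> sp]]]]; case=> [[[ep] ?]|[[[ep] ?]|[[[ep] ?]|[[ep] ?]]]] //;
  have [s1 s2 s3 s4] := sw _ sp;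
  [have hp : `|c1 w * g%:Z - c1 w * h%:Z| <= (2 * M)%N%:Z by rewrite {1}ep
  |have hp : `|c2 w * g%:Z - c2 w * h%:Z| <= (2 * M)%N%:Z by rewrite {1}ep
  |have hp : `|c3 w * g%:Z - c3 w * h%:Z| <= (2 * M)%N%:Z by rewrite {1}ep
  |have hp : `|c4 w * g%:Z - c4 w * h%:Z| <= (2 * M)%N%:Z by rewrite {1}ep];
  by apply/and4P; split; [exact: direction_close MgZ hp i1 s1|
    exact: direction_close MgZ hp i2 s2|exact: direction_close MgZ hp i3 s3|
    exact: direction_close MgZ hp i4 s4].
Qed.

Lemma quo_mulrn g v : (0 < g)%N -> quo g (v *+ g) = v.
Proof.
move=> g0; have [e1 e2 e3 e4] := cMn v g; have g0' : g%:Z != 0 by lia.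
apply: freq_eqP.
- by rewrite -[c1 (quo _ _)]/((c1 (v *+ g) %/ g)%Z) e1 mulzK.
- by rewrite -[c2 (quo _ _)]/((c2 (v *+ g) %/ g)%Z) e2 mulzK.
- by rewrite -[c3 (quo _ _)]/((c3 (v *+ g) %/ g)%Z) e3 mulzK.
- by rewrite -[c4 (quo _ _)]/((c4 (v *+ g) %/ g)%Z) e4 mulzK.
Qed.

Definition prim v := quo (gcd4 v) v.

Lemma primP v : v != 0 -> [/\ (0 < gcd4 v)%N, v = prim v *+ gcd4 v, primitive (prim v)
   & prim v != 0] /\ (sup4 v = gcd4 v * sup4 (prim v))%N.
Proof.
move=> v0; have [g [v' [[g0 vE pv gE] [v'0 sE _]]]] := primitive_part v0.
have e : prim v = v' by rewrite /prim -gE {1}vE quo_mulrn.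
by rewrite e -gE.
Qed.

Lemma dot_primE u v : v != 0 -> (dot u (prim v) == 0) = (dot u v == 0).
Proof.
move=> /primP[[g0 vE _ _] _]; rewrite [in RHS]vE.
have -> : dot u (prim v *+ gcd4 v) = dot u (prim v) * (gcd4 v)%:Z.
  by have [e1 e2 e3 e4] := cMn (prim v) (gcd4 v); rewrite /dot e1 e2 e3 e4; ring.
have g0' : (gcd4 v)%:Z != 0 by lia.
by rewrite mulf_eq0 (negPf g0') orbF.
Qed.

Definition perp_seq (M : nat) (v : freq) := [seq u <- cube_seq M | dot u v == 0].

(* The directions [prim v] of bounded size with [gcd4 v] large are few; the remaining
   [v] have few perpendicular [u], unless these [u] span a plane of small height. *)
Lemma gain_bound : exists C : R, 0 < C /\
  forall (M V K : nat) (z z3 : freq) (s : seq freq) (f1 f2 f3 f4 : freq -> R) (n1 n2 n3 n4 : R),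
  uniq s ->
  (forall A, 0 <= f1 A) -> (forall A, 0 <= f2 A) ->
  (forall A, 0 <= f3 A) -> (forall A, 0 <= f4 A) ->
  (forall A, f1 A != 0 -> box z M A) -> (forall A, f2 A != 0 -> box z M A) ->
  (forall A, f3 A != 0 -> box z3 M A) -> (forall A, f4 A != 0 -> box z3 M A) ->
  0 <= n1 -> 0 <= n2 -> 0 <= n3 -> 0 <= n4 ->
  \sum_(A <- s) f1 A ^+ 2 <= n1 ^+ 2 -> \sum_(A <- s) f2 A ^+ 2 <= n2 ^+ 2 ->
  \sum_(A <- s) f3 A ^+ 2 <= n3 ^+ 2 -> \sum_(A <- s) f4 A ^+ 2 <= n4 ^+ 2 ->
  (0 < K)%N -> (K ^ 9 <= M)%N -> (K ^ 2 * M <= V)%N ->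
  (forall A D, box z M A -> box z3 M D -> (V <= sup4 (D - A)%R)%N) ->
  S4 s PT f1 f2 f3 f4 * K%:R <= C * M%:R ^+ 2 * (n1 * n2 * n3 * n4).
Proof.
have [c8 c8E] : exists c : R, c = 13%:R ^+ 8 by exists (13%:R ^+ 8).
have c80 : 0 < c8 by rewrite c8E; apply: exprn_gt0; rewrite ltr0n.
exists (729 + 200 * 200 + 2401 * 12 + c8); split.
  apply: ltr_wpDl c80; apply: addr_ge0; last by apply: mulr_ge0; exact: ler0n.
  by apply: addr_ge0; [exact: ler0n|apply: mulr_ge0; exact: ler0n].
move=> M V K z z3 s f1 f2 f3 f4 n1 n2 n3 n4 us p1 p2 p3 p4 s1 s2 s3 s4 q1 q2 q3 q4
  h1 h2 h3 h4 K0 KM KV sep.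
have N0 : 0 <= n1 * n2 * n3 * n4 by rewrite !mulr_ge0.
have M0 : (0 < M)%N by apply: leq_trans KM; rewrite expn_gt0 K0.
have V0 : (0 < V)%N by apply: leq_trans KV; rewrite muln_gt0 expn_gt0 K0.
have K2M : (K ^ 2 <= M)%N by apply: leq_trans KM; rewrite leq_pexp2l.
have KM1 : (K <= M)%N by apply: leq_trans KM; rewrite -{1}[K]expn1 leq_pexp2l.
(* The supports confine [u] to a cube around 0 and [v] to one around [z3 - z], with [v] of size at
   least [V]. *)
pose P (u v : freq) := [&& (sup4 u < M)%N, (sup4 (v - (z3 - z))%R < M)%N & (V <= sup4 v)%N].
have -> : S4 s PT f1 f2 f3 f4 = S4 s P f1 f2 f3 f4.
  rewrite /S4 [LHS]big_mkcond [RHS]big_mkcond; apply: eq_bigr => -[[A B] [C D]] _ /=.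
  rewrite /rect_in /PT /= andbT; case: (rect _) => //=.
  have [e|] := eqVneq (f1 A * f2 B * f3 C * f4 D) 0; first by rewrite e if_same.
  rewrite !mulf_eq0 !negb_or => /andP[/andP[/andP[/s1 bA /s2 bB] /s3 bC] /s4 bD].
  rewrite ifT //; apply/and3P; split; [exact: sup4_diff bA bB M0| |exact: sep].
  have -> : D - A - (z3 - z) = (z - A) + (D - z3) by fring.
  move: bA bD => /and4P[a1 a2 a3 a4] /and4P[b1 b2 b3 b4].
  rewrite -[(_ < _)%N]/(_.+1 <= _)%N -(prednK M0) ltnS -in_cubeE /in_cube !cE.
  by clear -a1 a2 a3 a4 b1 b2 b3 b4 M0; apply/and4P; split; lia.
have v0P v : (V <= sup4 v)%N -> v != 0.
  by move=> h; rewrite -sup4_eq0 -lt0n; apply: leq_trans h.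
(* Cases [(0, 0)] and [(0, 1)] have a long primitive part, with few or many perpendicular [u]; case
   [(0, 2)] has a short one and content above [M]. Contents [k] from [K + 1] to [M] are treated
   modulo [k], and the sum of [k^(-2)] beyond [K] is at most [1 / K]. A short primitive part with
   content up to [K] is excluded by [V >= K^2 M]. *)
pose Q (h : nat * nat) (u v : freq) : bool :=
  if h.1 is 0%N then
    if h.2 is 0%N then
      [&& P u v, (K * M <= sup4 (prim v))%N & (size (perp_seq M v) * K <= 729 * M ^ 2)%N]
    else if h.2 is 1%N then
      [&& P u v, (K * M <= sup4 (prim v))%N & (729 * M ^ 2 < size (perp_seq M v) * K)%N]
    else [&& P u v, (sup4 (prim v) < K * M)%N & (M < gcd4 v)%N]
  else dvd4 h.2 v.
pose hs := [:: (0, 0); (0, 1); (0, 2)]%N ++ [seq (1%N, h) | h <- index_iota K.+1 M.+1].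
have cov : S4 s P f1 f2 f3 f4 <= \sum_(h <- hs) S4 s (Q h) f1 f2 f3 f4.
  apply: S4_cover => // A B D _ _ _ _; set u := B - A; set v := D - A => Puv.
  have /and3P[_ _ Vv] := Puv.
  have [_ sE] := primP (v0P _ Vv).
  have [qs|ql] := leqP (K * M) (sup4 (prim v)).
    have [hU|hU] := leqP (size (perp_seq M v) * K) (729 * M ^ 2).
      by exists (0%N, 0%N); [rewrite !inE|apply/and3P].
    by exists (0%N, 1%N); [rewrite !inE|apply/and3P].
  have [gM|Mg] := leqP (gcd4 v) M; last first.
    by exists (0%N, 2%N); [rewrite !inE|apply/and3P].
  exists (1%N, gcd4 v); last exact: gcd4_dvd.
  rewrite mem_cat; apply/orP; right; apply: map_f.
  rewrite mem_index_iota ltnS gM andbT ltnNge; apply/negP => gK.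
  have : (V < K * (K * M))%N.
    apply: leq_ltn_trans Vv _; rewrite sE; apply: leq_ltn_trans (_ : K * sup4 (prim v) < _)%N.
      by rewrite leq_mul2r gK orbT.
    by rewrite ltn_pmul2l.
  by rewrite mulnA mulnn ltnNge KV.
have Sa : S4 s (Q (0, 0)%N) f1 f2 f3 f4 * K%:R <= 729 * M%:R ^+ 2 * (n1 * n2 * n3 * n4).
  have : S4 s (Q (0, 0)%N) f1 f2 f3 f4 <= (729 * M ^ 2 %/ K)%N%:R * (n1 * n2 * n3 * n4).
    apply: S4_side => // v U uU Uv.
    have [->//|U0] := eqVneq U [::].
    have [u0 u0U] : exists u, u \in U.
      by case: U U0 {uU Uv} => // u U _; exists u; rewrite mem_head.
    have [/and3P[_ _ sz] _] := Uv _ u0U.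
    rewrite leq_divRL //; apply: leq_trans sz; rewrite leq_mul2r; apply/orP; right.
    apply: uniq_leq_size => // u uU1; have [/and3P[/and3P[uM _ _] _ _] du] := Uv _ uU1.
    by rewrite mem_filter du eqxx mem_cube_seq in_cubeE ltnW.
  move=> h; apply: (@le_trans _ _ ((729 * M ^ 2 %/ K)%N%:R * (n1 * n2 * n3 * n4) * K%:R)).
    by rewrite ler_wpM2r.
  rewrite mulrAC -natrM; apply: ler_wpM2r => //.
  have -> : 729 * M%:R ^+ 2 = (729 * M ^ 2)%N%:R :> R by rewrite natrM natrX.
  by rewrite ler_nat leq_trunc_div.
(* The labels are pairs of short vectors [a], [b] perpendicular to [v] with [u] in their span; equal
   labels force [u] to be perpendicular to [v']. There are [(12 K + 1)^8] pairs, and [K^9 <= M]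
   absorbs this number times [K]. *)
have Sd : S4 s (Q (0, 1)%N) f1 f2 f3 f4 * K%:R <= c8 * M%:R ^+ 2 * (n1 * n2 * n3 * n4).
  pose L := [seq (a, b) | a <- cube_seq (6 * K), b <- cube_seq (6 * K)].
  have : S4 s (Q (0, 1)%N) f1 f2 f3 f4 <= (size L)%:R * (n1 * n2 * n3 * n4).
    apply: (@S4_diag_labels _ L (fun ab u v => [/\ dot ab.1 v = 0, dot ab.2 v = 0
      & in_span ab.1 ab.2 u])) => //.
      move=> u v /and3P[/and3P[uM _ Vv] qs sz] du.
      have v0 := v0P _ Vv; have [[g0 vE pv pv0] sE] := primP v0.
      have uP : uniq (perp_seq M v) by rewrite filter_uniq ?uniq_cube_seq.
      have Pp : perp_in (prim v) M (perp_seq M v).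
        move=> w; rewrite mem_filter mem_cube_seq in_cubeE => /andP[/eqP dw ?]; split=> //.
        by apply/eqP; rewrite dot_primE // dw.
      have [||a [b [a6 b6 da db sp]]] := perp_plane pv pv0 K0 uP Pp.
      - apply: leq_trans (_ : size (perp_seq M v) * (K * M) <= _)%N; last by rewrite leq_mul2l qs orbT.
        rewrite mulnA; apply: leq_ltn_trans (_ : (9 * M) ^ 3 < _)%N.
          by rewrite leq_exp2r //; clear -M0; lia.
        have -> : ((9 * M) ^ 3 = 729 * M ^ 2 * M)%N by rewrite expnMn (expnSr M 2) mulnA.
        by rewrite ltn_pmul2r.
      - rewrite -(ltn_pmul2r K0); apply: leq_ltn_trans sz.
        have -> : (K * (M %/ K).+1.*2.+1 ^ 2 * K = (K * (M %/ K).+1.*2.+1) ^ 2)%N.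
          by rewrite expnMn mulnAC mulnn.
        have -> : (729 * M ^ 2 = (27 * M) ^ 2)%N by rewrite expnMn.
        rewrite leq_exp2r //; have := leq_trunc_div M K; clear -KM1; nia.
      exists (a, b) => /=; first by rewrite mem_pairs !mem_cube_seq !in_cubeE a6 b6.
      split; [by apply/eqP; rewrite -dot_primE // da|by apply/eqP; rewrite -dot_primE // db|].
      by apply: sp; rewrite mem_filter du eqxx mem_cube_seq in_cubeE ltnW.
    move=> [a b] u v u' v' _ /= [_ _ [x [y [t [x0 h]]]]] [da db _].
    have := h v'; rewrite da db !mulr0 addr0 => /eqP.
    by rewrite mulf_eq0 (negPf x0) => /eqP.
  move=> h; apply: (@le_trans _ _ ((size L)%:R * (n1 * n2 * n3 * n4) * K%:R)).
    by rewrite ler_wpM2r.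
  rewrite mulrAC -natrM; apply: ler_wpM2r => //.
  rewrite c8E -!natrX -!natrM ler_nat.
  rewrite size_allpairs !size_cube_seq.
  apply: leq_trans (_ : 13 ^ 8 * K ^ 9 <= _)%N.
    rewrite -expnD [in (K ^ 9)%N]expnSr mulnA leq_mul2r -expnMn leq_exp2r //.
    by apply/orP; right; clear -K0; lia.
  rewrite leq_mul2l; apply/orP; right; apply: leq_trans KM _.
  by rewrite -{1}[M]expn1 leq_pexp2l.
(* The label is the direction [prim v], on which alone perpendicularity to [v] depends. All [v] lie
   in one cube, so any two directions have multiples that are [2 M]-close, and [count_directions]
   leaves a number of order [K M]. *)
have Sc : S4 s (Q (0, 2)%N) f1 f2 f3 f4 * K%:R <= 2401 * 12 * M%:R ^+ 2 * (n1 * n2 * n3 * n4).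
  pose W := [seq v <- [seq (z3 - z) + x | x <- cube_seq M] |
    [&& (V <= sup4 v)%N, (sup4 (prim v) < K * M)%N & (M < gcd4 v)%N]].
  pose L := undup [seq prim v | v <- W].
  have : S4 s (Q (0, 2)%N) f1 f2 f3 f4 <= (size L)%:R * (n1 * n2 * n3 * n4).
    apply: (@S4_diag_labels _ L (fun l u v => [/\ v != 0, prim v = l & dot u v = 0])) => //.
      move=> u v /and3P[/and3P[uM vz Vv] qs sz] du.
      exists (prim v); last by split=> //; exact: v0P.
      rewrite mem_undup map_f // mem_filter; apply/andP; split; first exact/and3P.
      apply/mapP.
      by exists (v - (z3 - z)); [rewrite mem_cube_seq in_cubeE ltnW|fring].
    move=> l u v u' v' _ [v0 lv duv] [v'0 lv' _].
    by apply/eqP; rewrite -dot_primE // lv' -lv dot_primE // duv.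
  move=> h; have sL : (size L <= 2401 * (4 * ((K * M).*2).+1))%N.
    apply: (@count_directions M); first exact: undup_uniq.
      by move=> v'; rewrite mem_undup => /mapP[v]; rewrite mem_filter => /andP[/and3P[_ /ltnW ? _] _] ->.
    move=> v' w'; rewrite !mem_undup => /mapP[v vW ->] /mapP[w wW ->]; move: vW wW.
    rewrite !mem_filter => /andP[/and3P[Vv _ gv] /mapP[x xM vx]].
    move=> /andP[/and3P[Vw _ gw] /mapP[y yM wy]].
    exists (gcd4 v), (gcd4 w); split=> //.
    have [[_ <- _ _] _] := primP (v0P _ Vv); have [[_ <- _ _] _] := primP (v0P _ Vw).
    rewrite vx wy; have -> : z3 - z + x - (z3 - z + y) = x - y by fring.
    move: xM yM; rewrite !mem_cube_seq /in_cube -in_cubeE /in_cube !cE.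
    by clear; move=> /and4P[? ? ? ?] /and4P[? ? ? ?]; apply/and4P; split; lia.
  apply: (@le_trans _ _ ((size L)%:R * (n1 * n2 * n3 * n4) * K%:R)).
    by rewrite ler_wpM2r.
  rewrite mulrAC -[(size L)%:R * K%:R]natrM; apply: ler_wpM2r => //.
  have -> : 2401 * 12 * M%:R ^+ 2 = (2401 * (12 * M ^ 2))%N%:R :> R by rewrite natrM natrM natrX !mulrA.
  rewrite ler_nat; apply: leq_trans (_ : 2401 * (4 * (K * M).*2.+1) * K <= _)%N.
    by rewrite leq_mul2r sL orbT.
  rewrite -mulnA leq_mul2l /=.
  apply: leq_trans (_ : 12 * (K ^ 2 * M) <= _)%N; first by clear -K0 M0; nia.
  by rewrite leq_mul2l /= -[in leqRHS]mulnn leq_mul2r K2M orbT.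
have Sb : (\sum_(k <- index_iota K.+1 M.+1) S4 s (Q (1, k)%N) f1 f2 f3 f4) * K%:R <=
    200 * 200 * M%:R ^+ 2 * (n1 * n2 * n3 * n4).
  have cls k : k \in index_iota K.+1 M.+1 -> S4 s (Q (1, k)%N) f1 f2 f3 f4 <=
      (200 * 200) * M%:R ^+ 2 * (k%:R ^+ 2)^-1 * (n1 * n2 * n3 * n4).
    rewrite mem_index_iota => /andP[k16 kM]; have k0 : (0 < k)%N by apply: leq_ltn_trans k16.
    apply: le_trans (@S4_class R k M ((100 * 100) * (M %/ k).+1%:R ^+ 2) s z z z3 z3 f1 f2 f3 f4
      n1 n2 n3 n4 k0 us (@rectangle_bound _ _) _ p1 p2 p3 p4 s1 s2 s3 s4 q1 q2 q3 q4 h1 h2 h3 h4) _.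
      by rewrite mulr_ge0 ?sqr_ge0.
    apply: ler_wpM2r => //.
    have kR : 0 < k%:R :> R by rewrite ltr0n.
    have le2 : (M %/ k).+1%:R <= 2 * M%:R / k%:R :> R.
      have -> : 2 * M%:R = (2 * M)%N%:R :> R by rewrite natrM.
      rewrite ler_pdivlMr // -natrM ler_nat.
      by have := leq_trunc_div M k; clear -kM; lia.
    have -> : (200 * 200) * M%:R ^+ 2 * (k%:R ^+ 2)^-1 = (100 * 100) * (2 * M%:R / k%:R) ^+ 2 :> R.
      by field; rewrite lt0r_neq0.
    apply: ler_wpM2l; first by rewrite mulr_ge0.
    by rewrite lerXn2r ?nnegrE ?divr_ge0 ?mulr_ge0 ?ler0n.
  have KR : 0 < K%:R :> R by rewrite ltr0n.
  apply: (@le_trans _ _ ((\sum_(K.+1 <= k < M.+1)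
      (200 * 200) * M%:R ^+ 2 * (k%:R ^+ 2)^-1 * (n1 * n2 * n3 * n4)) * K%:R)).
    rewrite ler_wpM2r // big_seq [leRHS]big_seq; apply: ler_sum => k; exact: cls.
  have X0 : 0 <= M%:R ^+ 2 * (n1 * n2 * n3 * n4) by rewrite mulr_ge0 ?sqr_ge0.
  rewrite -mulr_suml -mulr_sumr.
  have := ler_wpM2r (ltW KR) (@sum_inv_sqr R K M.+1 K0).
  rewrite mulVf ?lt0r_neq0 //; set S := \sum_(_ <= _ < _) _ => hS.
  have [c2 c2E] : exists c2 : R, c2 = 200 * 200 by exists (200 * 200).
  have c20 : 0 <= c2 by rewrite c2E; apply: mulr_ge0; exact: ler0n.
  rewrite -c2E.
  have -> : c2 * M%:R ^+ 2 * S * (n1 * n2 * n3 * n4) * K%:R =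
    c2 * ((M%:R ^+ 2 * (n1 * n2 * n3 * n4)) * (S * K%:R)) by ring.
  by rewrite -[leRHS]mulrA; apply: ler_wpM2l => //; apply: ler_piMr.
apply: le_trans (ler_wpM2r (ler0n _ K) cov) _.
rewrite /hs sum_case_labels.
exact: mulDl4_le Sa Sd Sc Sb.
Qed.

End Gain.

Notation normc := Normc.normc.
Notation Cre := complex.Re.
Notation Cim := complex.Im.

(** * Bounded measurable functions *)

Section ComplexBasics.
Context {R : realType}.
Implicit Types (z w : R[i]).

Lemma CreD z w : Cre (z + w) = Cre z + Cre w. Proof. by case: z; case: w. Qed.
Lemma CimD z w : Cim (z + w) = Cim z + Cim w. Proof. by case: z; case: w. Qed.
Lemma CreN z : Cre (- z) = - Cre z. Proof. by case: z. Qed.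
Lemma CimN z : Cim (- z) = - Cim z. Proof. by case: z. Qed.
Lemma CreM z w : Cre (z * w) = Cre z * Cre w - Cim z * Cim w.
Proof. by case: z; case: w. Qed.
Lemma CimM z w : Cim (z * w) = Cre z * Cim w + Cim z * Cre w.
Proof. by case: z; case: w => a b c d /=; rewrite addrC [c * b]mulrC. Qed.
Lemma Cre_conj z : Cre z^*%C = Cre z. Proof. by case: z. Qed.
Lemma Cim_conj z : Cim z^*%C = - Cim z. Proof. by case: z. Qed.
Lemma Cre_real (x : R) : Cre x%:C = x. Proof. by []. Qed.
Lemma Cim_real (x : R) : Cim x%:C = 0. Proof. by []. Qed.
Lemma Ceq z w : Cre z = Cre w -> Cim z = Cim w -> z = w.
Proof. by case: z; case: w => ? ? ? ? /= -> ->. Qed.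

Lemma Cre_sum (I : Type) (r : seq I) (P : pred I) (F : I -> R[i]) :
  Cre (\sum_(i <- r | P i) F i) = \sum_(i <- r | P i) Cre (F i).
Proof. by elim/big_rec2: _ => // k x y _ <-; rewrite CreD. Qed.
Lemma Cim_sum (I : Type) (r : seq I) (P : pred I) (F : I -> R[i]) :
  Cim (\sum_(i <- r | P i) F i) = \sum_(i <- r | P i) Cim (F i).
Proof. by elim/big_rec2: _ => // k x y _ <-; rewrite CimD. Qed.

Lemma sqr_normc z : normc z ^+ 2 = Cre z ^+ 2 + Cim z ^+ 2.
Proof. by case: z => a b /=; rewrite sqr_sqrtr // addr_ge0 ?sqr_ge0. Qed.
Lemma normc_ge0 z : 0 <= normc z.
Proof. by case: z => a b /=; rewrite sqrtr_ge0. Qed.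
Lemma normc_conj z : normc z^*%C = normc z.
Proof. by case: z => a b /=; rewrite sqrrN. Qed.
Lemma normcM z w : normc (z * w) = normc z * normc w.
Proof. exact: Normc.normcM. Qed.
Lemma normcD z w : normc (z + w) <= normc z + normc w.
Proof. exact: le_normcD. Qed.
Lemma normcN z : normc (- z) = normc z.
Proof. by case: z => a b /=; rewrite !sqrrN. Qed.
Lemma normc0 : normc (0 : R[i]) = 0. Proof. exact: Normc.normc0. Qed.
Lemma normc_distC z w : normc (z - w) = normc (w - z).
Proof. by rewrite -normcN opprB. Qed.
Lemma normc_sum (I : Type) (r : seq I) (P : pred I) (F : I -> R[i]) :
  normc (\sum_(i <- r | P i) F i) <= \sum_(i <- r | P i) normc (F i).
Proof.
elim/big_ind2: _ => //; first by rewrite normc0.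
by move=> x1 x2 y1 y2 h1 h2; apply: le_trans (normcD _ _) _; exact: lerD.
Qed.
Lemma normc_real (x : R) : normc x%:C = `|x|.
Proof. by rewrite /= expr0n /= addr0 sqrtr_sqr. Qed.
Lemma normc_eq0 z : (normc z == 0) = (z == 0).
Proof. by apply/eqP/eqP => [/Normc.eq0_normc|->]; rewrite ?normc0. Qed.
Lemma mulc_conj z : z * z^*%C = (normc z ^+ 2)%:C.
Proof. by apply: Ceq; rewrite ?CreM ?CimM ?Cre_conj ?Cim_conj ?Cre_real ?Cim_real ?sqr_normc; ring. Qed.
Lemma Cre_le_normc z : `|Cre z| <= normc z.
Proof.
rewrite -(@ler_pXn2r _ 2) ?nnegrE ?normc_ge0 // sqr_normc real_normK ?num_real //.
by rewrite lerDl sqr_ge0.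
Qed.
Lemma Cim_le_normc z : `|Cim z| <= normc z.
Proof.
rewrite -(@ler_pXn2r _ 2) ?nnegrE ?normc_ge0 // sqr_normc real_normK ?num_real //.
by rewrite lerDr sqr_ge0.
Qed.
Lemma normc_le_ReIm z : normc z <= `|Cre z| + `|Cim z|.
Proof.
rewrite -(@ler_pXn2r _ 2) ?nnegrE ?normc_ge0 ?addr_ge0 // sqr_normc sqrrD.
rewrite !real_normK ?num_real // addrAC lerDl mulrn_wge0 // mulr_ge0 //.
Qed.
Lemma conjcM z w : ((z * w)^*%C = z^*%C * w^*%C).
Proof. by apply: Ceq; rewrite !(CreM, CimM, Cre_conj, Cim_conj); ring. Qed.
Lemma conjc_sum (I : Type) (r : seq I) (P : pred I) (F : I -> R[i]) :
  (\sum_(i <- r | P i) F i)^*%C = \sum_(i <- r | P i) (F i)^*%C.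
Proof.
by apply: Ceq; rewrite !(Cre_conj, Cim_conj, Cre_sum, Cim_sum) -?sumrN;
  apply: eq_bigr => k _; rewrite !(Cre_conj, Cim_conj).
Qed.

Lemma normc_expi (x : R) : normc (expi x) = 1.
Proof. by rewrite /= cos2Dsin2 sqrtr1. Qed.
Lemma expiD (x y : R) : expi (x + y) = expi x * expi y.
Proof. by apply: Ceq; rewrite ?CreM ?CimM /= ?cosD ?sinD; ring. Qed.
Lemma expi0 : expi (0 : R) = 1.
Proof. by apply: Ceq; rewrite /= ?cos0 ?sin0. Qed.
Lemma expiNK (x : R) : expi (- x) * expi x = 1.
Proof. by rewrite -expiD addNr expi0. Qed.
Lemma conj_expi (x : R) : (expi x)^*%C = expi (- x).
Proof. by apply: Ceq; rewrite ?Cre_conj ?Cim_conj /= ?cosN ?sinN. Qed.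
End ComplexBasics.

Section BoundedMeasurable.
Context d (S : measurableType d) (R : realType) (m : {measure set S -> \bar R})
  (D : set S) (mD : measurable D) (fD : (m D < +oo)%E).

(** On a set of finite measure this class is an algebra of integrable functions, so products of
    several factors need no separate integrability argument. *)
Definition bm (f : S -> R) : Prop :=
  measurable_fun D f /\ exists M, forall x, D x -> `|f x| <= M.

Lemma bm_integrable f : bm f -> m.-integrable D (EFin \o f).
Proof.
case=> mf [M fM]; apply: measurable_bounded_integrable => //.
exists M; split; first exact: num_real.
by move=> x xM y /= Dy; apply: le_trans (fM _ Dy) (ltW xM).
Qed.

Lemma bm_cst c : bm (fun _ => c).
Proof. by split; [exact: measurable_cst|exists `|c|]. Qed.
Lemma bmD f g : bm f -> bm g -> bm (fun x => f x + g x).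
Proof.
move=> [mf [M fM]] [mg [N gN]]; split; first exact: measurable_funD.
by exists (M + N) => x Dx; apply: le_trans (ler_normD _ _) _; rewrite lerD ?fM ?gN.
Qed.
Lemma bmM f g : bm f -> bm g -> bm (fun x => f x * g x).
Proof.
move=> [mf [M fM]] [mg [N gN]]; split; first exact: measurable_funM.
by exists (M * N) => x Dx; rewrite normrM ler_pM ?fM ?gN.
Qed.
Lemma bmN f : bm f -> bm (fun x => - f x).
Proof.
move=> [mf [M fM]]; split; first exact: measurable_funN.
by exists M => x Dx; rewrite normrN fM.
Qed.
Lemma bmB f g : bm f -> bm g -> bm (fun x => f x - g x).
Proof. by move=> bf bg; apply: bmD => //; exact: bmN. Qed.
Lemma bm_sum (I : Type) (r : seq I) (P : pred I) (F : I -> S -> R) :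
  (forall i, P i -> bm (F i)) -> bm (fun x => \sum_(i <- r | P i) F i x).
Proof.
move=> bF; elim: r => [|i r IH].
  by under eq_fun do rewrite big_nil; exact: bm_cst.
have [Pi|Pi] := boolP (P i).
  by under eq_fun do rewrite big_cons Pi; exact: bmD (bF _ Pi) IH.
by under eq_fun do rewrite big_cons (negPf Pi).
Qed.
Lemma bm_eq f g : (forall x, D x -> f x = g x) -> bm f -> bm g.
Proof.
move=> fg [mf [M fM]]; split; last by exists M => x Dx; rewrite -fg // fM.
by apply: eq_measurable_fun mf => x; rewrite inE; exact: fg.
Qed.
Lemma bmX f n : bm f -> bm (fun x => f x ^+ n).
Proof.
move=> bf; elim: n => [|n IH]; first exact: bm_cst.
by under eq_fun do rewrite exprS; apply: bmM.
Qed.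

Local Notation I f := (Rintegral m D f).

Lemma bm_intD f g : bm f -> bm g -> I (fun x => f x + g x) = I f + I g.
Proof. by move=> /bm_integrable ? /bm_integrable ?; rewrite RintegralD. Qed.
Lemma bm_intZ c f : bm f -> I (fun x => c * f x) = c * I f.
Proof. by move=> /bm_integrable ?; rewrite RintegralZl. Qed.
Lemma bm_intN f : bm f -> I (fun x => - f x) = - I f.
Proof.
move=> bf; rewrite -[RHS]mulN1r -bm_intZ //.
by congr Rintegral; apply/funext => x; rewrite mulN1r.
Qed.
Lemma bm_int0 : I (fun _ => 0) = 0.
Proof. by rewrite Rintegral_cst // mul0r. Qed.
Lemma bm_int_sum (J : Type) (r : seq J) (P : pred J) (F : J -> S -> R) :
  (forall i, P i -> bm (F i)) ->
  I (fun x => \sum_(i <- r | P i) F i x) = \sum_(i <- r | P i) I (F i).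
Proof.
move=> bF; elim: r => [|i r IH].
  by under eq_fun do rewrite big_nil; rewrite big_nil bm_int0.
rewrite big_cons; have [Pi|Pi] := boolP (P i).
  under eq_fun do rewrite big_cons Pi.
  by rewrite bm_intD ?IH //; [exact: bF|exact: bm_sum].
by under eq_fun do rewrite big_cons (negPf Pi).
Qed.
Lemma bm_int_le f g : bm f -> bm g -> (forall x, D x -> f x <= g x) -> I f <= I g.
Proof. by move=> /bm_integrable ? /bm_integrable ? fg; apply: le_Rintegral. Qed.
Lemma bm_int_cst c : I (fun _ => c) = c * fine (m D).
Proof. exact: Rintegral_cst. Qed.
Lemma bm_int_eq f g : (forall x, D x -> f x = g x) -> I f = I g.
Proof. by move=> fg; apply: eq_Rintegral => x; rewrite inE; exact: fg. Qed.

Definition cbm (F : S -> R[i]) : Prop :=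
  bm (fun x => Cre (F x)) /\ bm (fun x => Cim (F x)).

Local Notation CI := (cintegral m D).

Lemma cbm_cst c : cbm (fun _ => c).
Proof. by split; exact: bm_cst. Qed.
Lemma cbmD F G : cbm F -> cbm G -> cbm (fun x => F x + G x).
Proof.
move=> [? ?] [? ?]; split; [under eq_fun do rewrite CreD|under eq_fun do rewrite CimD];
  exact: bmD.
Qed.
Lemma cbmM F G : cbm F -> cbm G -> cbm (fun x => F x * G x).
Proof.
move=> [? ?] [? ?]; split; [under eq_fun do rewrite CreM|under eq_fun do rewrite CimM].
  by apply: bmB; apply: bmM.
by apply: bmD; apply: bmM.
Qed.
Lemma cbm_conj F : cbm F -> cbm (fun x => (F x)^*%C).
Proof.
move=> [? ?]; split; [under eq_fun do rewrite Cre_conj|under eq_fun do rewrite Cim_conj] => //.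
exact: bmN.
Qed.
Lemma cbm_sum (J : Type) (r : seq J) (P : pred J) (F : J -> S -> R[i]) :
  (forall i, P i -> cbm (F i)) -> cbm (fun x => \sum_(i <- r | P i) F i x).
Proof.
move=> bF; split; [under eq_fun do rewrite Cre_sum|under eq_fun do rewrite Cim_sum];
  by apply: bm_sum => k /bF[].
Qed.
Lemma cbm_eq F G : (forall x, D x -> F x = G x) -> cbm F -> cbm G.
Proof. by move=> FG [? ?]; split; [apply: bm_eq (_ : bm (fun x => Cre (F x)))
  |apply: bm_eq (_ : bm (fun x => Cim (F x)))] => // x Dx; rewrite FG. Qed.
Lemma bm_sqr_normc F : cbm F -> bm (fun x => normc (F x) ^+ 2).
Proof. by move=> [? ?]; under eq_fun do rewrite sqr_normc; apply: bmD; apply: bmX. Qed.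

Lemma cint_Re F : Cre (CI F) = I (fun x => Cre (F x)). Proof. by []. Qed.
Lemma cint_Im F : Cim (CI F) = I (fun x => Cim (F x)). Proof. by []. Qed.

Lemma cintD F G : cbm F -> cbm G -> CI (fun x => F x + G x) = CI F + CI G.
Proof.
move=> [? ?] [? ?]; apply: Ceq; rewrite ?CreD ?CimD ?cint_Re ?cint_Im -bm_intD //;
  by apply: bm_int_eq => x _; rewrite ?CreD ?CimD.
Qed.
Lemma cintZ c F : cbm F -> CI (fun x => c * F x) = c * CI F.
Proof.
move=> [b1 b2]; apply: Ceq; rewrite ?CreM ?CimM ?cint_Re ?cint_Im.
  transitivity (I (fun x => Cre c * Cre (F x) + (- Cim c) * Cim (F x))).
    by apply: bm_int_eq => x _; rewrite CreM mulNr.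
  by rewrite bm_intD ?bm_intZ ?mulNr //; apply: bmM => //; exact: bm_cst.
transitivity (I (fun x => Cre c * Cim (F x) + Cim c * Cre (F x))).
  by apply: bm_int_eq => x _; rewrite CimM.
by rewrite bm_intD ?bm_intZ //; apply: bmM => //; exact: bm_cst.
Qed.
Lemma cint_eq F G : (forall x, D x -> F x = G x) -> CI F = CI G.
Proof.
by move=> FG; apply: Ceq; rewrite ?cint_Re ?cint_Im; apply: bm_int_eq => x Dx; rewrite FG.
Qed.
Lemma cint0 : CI (fun _ => 0) = 0.
Proof. by apply: Ceq; rewrite ?cint_Re ?cint_Im bm_int0. Qed.
Lemma cint_sum (J : Type) (r : seq J) (P : pred J) (F : J -> S -> R[i]) :
  (forall i, P i -> cbm (F i)) ->
  CI (fun x => \sum_(i <- r | P i) F i x) = \sum_(i <- r | P i) CI (F i).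
Proof.
move=> bF; apply: Ceq; rewrite ?Cre_sum ?Cim_sum ?cint_Re ?cint_Im -bm_int_sum;
  try by move=> k /bF[].
  by apply: bm_int_eq => x _; rewrite Cre_sum.
by apply: bm_int_eq => x _; rewrite Cim_sum.
Qed.
Lemma bm_norm f : bm f -> bm (fun x => `|f x|).
Proof.
move=> [mf [M fM]]; split; first exact: measurableT_comp.
by exists M => x Dx; rewrite normr_id fM.
Qed.

Lemma normc_cint_le F g : cbm F -> bm g -> (forall x, D x -> normc (F x) <= g x) ->
  normc (CI F) <= 2 * I g.
Proof.
move=> [b1 b2] bg Fg; apply: le_trans (normc_le_ReIm _) _; rewrite cint_Re cint_Im.
have h f : bm f -> (forall x, D x -> `|f x| <= normc (F x)) -> `|I f| <= I g.
  move=> bf fF; apply: le_trans (le_normr_Rintegral mD (bm_integrable bf)) _.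
  apply: bm_int_le => //; first exact: bm_norm.
  by move=> x Dx; apply: le_trans (fF _ Dx) (Fg _ Dx).
rewrite mulr_natl mulr2n lerD ?h // => x _; [exact: Cre_le_normc|exact: Cim_le_normc].
Qed.

End BoundedMeasurable.

(** * Products of two free waves *)

Section Bilinear.
Context {R : realType}.
Implicit Types (s : seq freq) (f g h e : freq -> R[i]).

(** The Fourier coefficient at [k] of the product of the functions with coefficients [f] and [h] on
    [s]. *)
Definition conv s f h (k : freq) : R[i] :=
  \sum_(y <- pairs s | y.1 + y.2 == k) f y.1 * h y.2.

Definition sums s : seq freq := undup [seq y.1 + y.2 | y <- pairs s].

(* With [u = sum_A f A e^(i x.A)] and [w = sum_C h C e^(i x.C)] over [s], this is the
   mean over the torus of [|u w|^2]. *)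
Definition H s f h : R := \sum_(k <- sums s) normc (conv s f h k) ^+ 2.

Lemma H_ge0 s f h : 0 <= H s f h.
Proof. by apply: sumr_ge0 => k _; rewrite sqr_ge0. Qed.

Lemma conv0 s f h k : k \notin sums s -> conv s f h k = 0.
Proof.
move=> ks; rewrite /conv big_seq_cond big1 // => y /andP[ys /eqP yk].
by move: ks; rewrite mem_undup => /negP[]; apply/mapP; exists y.
Qed.

Lemma H_keys s f h (K : seq freq) : uniq K ->
  \sum_(k <- K) normc (conv s f h k) ^+ 2 <= H s f h.
Proof.
move=> uK; rewrite /H (bigID (mem (sums s))) /= addrC big1 ?add0r => [|k ks]; last first.
  by rewrite conv0 // normc0 expr0n.
rewrite -big_filter [leRHS](bigID (mem K)) /= -[leLHS]addr0 lerD ?sumr_ge0 // => [|k _]; last exact: sqr_ge0.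
rewrite -[leRHS]big_filter le_eqVlt; apply/orP; left; apply/eqP; apply: perm_big.
by apply: uniq_perm; rewrite ?filter_uniq ?undup_uniq // => k; rewrite !mem_filter andbC.
Qed.

(* Opposite sides carry the factors [f, f] and [h, h]. *)
Lemma HE s f h : (H s f h)%:C = \sum_(y <- pairs s) \sum_(z <- pairs s | y.1 + y.2 == z.1 + z.2)
  (f y.1 * h y.2) * ((f z.1)^*%C * (h z.2)^*%C).
Proof.
pose key (y : freq * freq) := y.1 + y.2.
have rk y : y \in pairs s -> key y \in sums s by move=> ys; rewrite mem_undup (map_f key).
rewrite (@gram_sum _ _ _ _ (pairs s) (pairs s) key key (sums s) (fun y => f y.1 * h y.2)
  (fun y => (f y.1)^*%C * (h y.2)^*%C) (undup_uniq _) rk).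
have e k : (normc (conv s f h k) ^+ 2)%:C = conv s f h k * \sum_(j <- pairs s | key j == k)
    (f j.1)^*%C * (h j.2)^*%C.
  by rewrite -mulc_conj conjc_sum; congr (_ * _); apply: eq_bigr => y _; rewrite conjcM.
under [RHS]eq_bigr => k _ do rewrite -[X in X * _]/(conv s f h k) -e.
by apply: Ceq; rewrite ?Cre_sum ?Cim_sum ?Cre_real ?Cim_real //= big1.
Qed.

Lemma HE4 s f h : (H s f h)%:C = \sum_(A <- s) \sum_(B <- s) \sum_(C <- s) \sum_(D <- s)
  if A + C == B + D then (f A * h C) * ((f B)^*%C * (h D)^*%C) else 0.
Proof.
rewrite HE; under eq_bigr do rewrite big_mkcond.
rewrite big_allpairs_dep /=; apply: eq_bigr => A _.
by rewrite [RHS]exchange_big /=; apply: eq_bigr => C _; rewrite big_allpairs_dep.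
Qed.

Lemma half_amgm (a b l : R) : 0 < l -> a * b <= 2^-1 * (l * a ^+ 2 + l^-1 * b ^+ 2).
Proof.
move=> l0; have h : 0 <= l^-1 * (l * a - b) ^+ 2 by rewrite mulr_ge0 ?sqr_ge0 ?invr_ge0 ?ltW.
have e : l^-1 * (l * a - b) ^+ 2 = l * a ^+ 2 + l^-1 * b ^+ 2 - 2 * (a * b).
  by field; rewrite lt0r_neq0.
by move: h; rewrite e; lra.
Qed.

(** Grouping each function with its own conjugate turns the mean of [|u w|^2] into a pairing of the
    coefficients of [|u|^2] and [|w|^2], to which the weighted arithmetic-geometric mean inequality
    applies. *)
Lemma H_le_mean s f h (l : R) : 0 < l ->
  H s f h <= 2^-1 * (l * H s f f + l^-1 * H s h h).
Proof.
move=> l0; pose key (y : freq * freq) : freq := y.1 - y.2.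
pose keys : seq freq := undup [seq key y | y <- pairs s].
have rk y : y \in pairs s -> key y \in keys by move=> ys; rewrite mem_undup map_f.
pose a (f : freq -> R[i]) (y : freq * freq) : R[i] := f y.1 * (f y.2)^*%C.
pose G f (k : freq) : R[i] := \sum_(y <- pairs s | key y == k) a f y.
have E f1 h1 : (H s f1 h1)%:C = \sum_(k <- keys) G f1 k * (G h1 k)^*%C.
  transitivity (\sum_(y <- pairs s) \sum_(z <- pairs s | key y == key z) a f1 y * (a h1 z)^*%C).
    rewrite HE4; under [RHS]eq_bigr do rewrite big_mkcond.
    rewrite [RHS]big_allpairs_dep /=; apply: eq_bigr => A _; apply: eq_bigr => B _.
    rewrite big_allpairs_dep /= exchange_big /=; apply: eq_bigr => D _; apply: eq_bigr => C _.
    have -> : (A + C == B + D) = (key (A, B) == key (D, C)).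
      by rewrite /key /= -subr_eq0 -[RHS]subr_eq0; congr (_ == 0); fring.
    by case: ifP => // _; rewrite /a /= conjcM conjcK; ring.
  rewrite (@gram_sum _ _ _ _ (pairs s) (pairs s) key key keys (a f1) (fun y => (a h1 y)^*%C)
    (undup_uniq _) rk); apply: eq_bigr => k _; congr (_ * _).
  by rewrite /G conjc_sum.
have E1 f1 : H s f1 f1 = \sum_(k <- keys) normc (G f1 k) ^+ 2.
  rewrite -[LHS]Cre_real E Cre_sum; apply: eq_bigr => k _; by rewrite mulc_conj.
rewrite -[leLHS]Cre_real E !E1 Cre_sum !mulr_sumr -big_split /= mulr_sumr.
apply: ler_sum => k _; apply: le_trans (half_amgm _ _ l0).
by apply: le_trans (ler_norm _) _; apply: le_trans (Cre_le_normc _) _; rewrite normcM normc_conj.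
Qed.

(** The coefficients of the complex conjugate function. *)
Definition refl f : freq -> R[i] := fun A => (f (- A))^*%C.

Lemma H_refl s f h : (forall A, (- A \in s) = (A \in s)) -> uniq s -> H s f (refl h) = H s f h.
Proof.
move=> sN us; rewrite -[LHS]Cre_real -[RHS]Cre_real !HE4; congr Cre.
apply: eq_bigr => A _; apply: eq_bigr => B _.
have rN (F : freq -> R[i]) : \sum_(C <- s) F (- C) = \sum_(C <- s) F C.
  rewrite -(big_map (fun C => - C) xpredT F); apply: perm_big; apply: uniq_perm => //.
    by rewrite map_inj_uniq //; exact: oppr_inj.
  move=> C; apply/mapP/idP => [[D Ds ->]|Cs]; first by rewrite sN.
  by exists (- C); rewrite ?sN ?opprK.
rewrite exchange_big /= -rN; apply: eq_bigr => C _; rewrite -rN; apply: eq_bigr => D _.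
have -> : (A - D == B - C) = (A + C == B + D).
  by rewrite -subr_eq0 -[RHS]subr_eq0; congr (_ == 0); fring.
by case: ifP => // _; rewrite /refl !opprK conjcK; ring.
Qed.

Lemma sqr_sum_weight (I : Type) (r : seq I) (w a : I -> R) : (forall i, 0 < w i) ->
  (\sum_(i <- r) a i) ^+ 2 <= (\sum_(i <- r) w i) * (\sum_(i <- r) (w i)^-1 * a i ^+ 2).
Proof.
move=> w0; set W := \sum_(i <- r) w i; set X := \sum_(i <- r) _^-1 * _.
have W0 : 0 <= W by apply: sumr_ge0 => i _; exact: ltW.
have X0 : 0 <= X by apply: sumr_ge0 => i _; rewrite mulr_ge0 ?sqr_ge0 ?invr_ge0 ?ltW.
have key (b : I -> R) : (forall i, b i ^+ 2 = a i ^+ 2) -> \sum_(i <- r) b i <= Num.sqrt W * Num.sqrt X.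
  move=> ba; under eq_bigr => i _.
    have -> : b i = Num.sqrt (w i) * ((Num.sqrt (w i))^-1 * b i).
      by rewrite mulrA mulfV ?mul1r // sqrtr_eq0 -ltNge.
    over.
  apply: cauchy_schwarz_le; rewrite ?sqrtr_ge0 // ?sqr_sqrtr //.
    by rewrite le_eqVlt; apply/orP; left; apply/eqP; apply: eq_bigr => i _; rewrite sqr_sqrtr // ltW.
  rewrite le_eqVlt; apply/orP; left; apply/eqP; apply: eq_bigr => i _.
  by rewrite exprMn exprVn sqr_sqrtr ?ba // ltW.
have k1 := key a (fun _ => erefl _).
have k2 := key (fun i => - a i) (fun i => sqrrN _).
rewrite sumrN in k2.
have -> : W * X = (Num.sqrt W * Num.sqrt X) ^+ 2 by rewrite exprMn !sqr_sqrtr.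
rewrite -[leLHS](real_normK (num_real _)) lerXn2r ?nnegrE ?mulr_ge0 ?sqrtr_ge0 //.
by rewrite ler_norml lerNl k2 k1.
Qed.

Lemma conv_suml (I : Type) (r : seq I) s (F : I -> freq -> R[i]) h k :
  conv s (fun A => \sum_(i <- r) F i A) h k = \sum_(i <- r) conv s (F i) h k.
Proof.
rewrite /conv exchange_big /=; apply: eq_bigr => y _; by rewrite mulr_suml.
Qed.
Lemma conv_sumr (I : Type) (r : seq I) s f (F : I -> freq -> R[i]) k :
  conv s f (fun A => \sum_(i <- r) F i A) k = \sum_(i <- r) conv s f (F i) k.
Proof.
rewrite /conv exchange_big /=; apply: eq_bigr => y _; by rewrite mulr_sumr.
Qed.

(** Weighted Cauchy-Schwarz at each output frequency: with summable weights, decay of the separate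
    terms yields a bound for the sum. *)
Lemma H_sum_weight (I J : Type) (r : seq I) (r' : seq J) s (F : I -> freq -> R[i])
    (G : J -> freq -> R[i]) (w : I * J -> R) : (forall x, 0 < w x) ->
  H s (fun A => \sum_(i <- r) F i A) (fun A => \sum_(j <- r') G j A) <=
  (\sum_(i <- r) \sum_(j <- r') w (i, j)) *
  (\sum_(i <- r) \sum_(j <- r') (w (i, j))^-1 * H s (F i) (G j)).
Proof.
move=> w0; rewrite [X in X * _](_ : _ = \sum_(x <- [seq (i, j) | i <- r, j <- r']) w x); last first.
  by rewrite big_allpairs_dep.
have -> : \sum_(i <- r) \sum_(j <- r') (w (i, j))^-1 * H s (F i) (G j) =
    \sum_(k <- sums s) \sum_(x <- [seq (i, j) | i <- r, j <- r'])
      (w x)^-1 * normc (conv s (F x.1) (G x.2) k) ^+ 2.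
  rewrite [RHS]exchange_big /= big_allpairs_dep /=.
  by apply: eq_bigr => i _; apply: eq_bigr => j _; rewrite mulr_sumr.
rewrite mulr_sumr; apply: ler_sum => k _.
apply: le_trans (sqr_sum_weight _ _ w0).
rewrite lerXn2r ?nnegrE ?normc_ge0 ?sumr_ge0 // => [x _|]; first exact: normc_ge0.
rewrite conv_suml; under eq_bigr do rewrite conv_sumr.
rewrite big_allpairs_dep /=; apply: le_trans (normc_sum _ _ _) _; apply: ler_sum => i _.
exact: normc_sum.
Qed.

(** The mean over the torus of the product of four functions. *)
Definition quad s (f1 f2 f3 f4 : freq -> R[i]) : R[i] :=
  \sum_(A <- s) \sum_(B <- s) \sum_(C <- s) \sum_(D <- s | A + B + C + D == 0)
    f1 A * f2 B * f3 C * f4 D.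

(** The output frequencies of [f1 f3] and [f2 f4] are opposite. The parameter [l] is kept free
    because it can be optimized only after integration in time. *)
Lemma normc_quad_le s (f1 f2 f3 f4 : freq -> R[i]) (l : R) : 0 < l ->
  normc (quad s f1 f2 f3 f4) <= 2^-1 * (l * H s f1 f3 + l^-1 * H s f2 f4).
Proof.
move=> l0; pose key (y : freq * freq) : freq := y.1 + y.2; pose key' (y : freq * freq) : freq := - (y.1 + y.2).
have rk y : y \in pairs s -> key y \in sums s by move=> ys; rewrite mem_undup (map_f key).
have -> : quad s f1 f2 f3 f4 = \sum_(y <- pairs s) \sum_(z <- pairs s | key y == key' z)
    (f1 y.1 * f3 y.2) * (f2 z.1 * f4 z.2).
  under [RHS]eq_bigr do rewrite big_mkcond.
  rewrite [RHS]big_allpairs_dep /=; apply: eq_bigr => A _.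
  rewrite exchange_big /=; apply: eq_bigr => C _.
  rewrite big_allpairs_dep /=; apply: eq_bigr => B _; rewrite big_mkcond /=; apply: eq_bigr => D _.
  have -> : (A + B + C + D == 0) = (key (A, C) == key' (B, D)).
    by rewrite /key /key' /= -addr_eq0; congr (_ == 0); fring.
  by case: ifP => // _; ring.
rewrite (@gram_sum _ _ _ _ (pairs s) (pairs s) key key' (sums s) (fun y => f1 y.1 * f3 y.2)
  (fun z => f2 z.1 * f4 z.2) (undup_uniq _) rk).
apply: le_trans (normc_sum _ _ _) _.
have h2 : \sum_(k <- sums s) normc (\sum_(j <- pairs s | key' j == k) f2 j.1 * f4 j.2) ^+ 2
    <= H s f2 f4.
  apply: le_trans (@H_keys s f2 f4 [seq - k | k <- sums s] _); last first.
    by rewrite map_inj_uniq ?undup_uniq //; exact: oppr_inj.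
  rewrite big_map le_eqVlt; apply/orP; left; apply/eqP; apply: eq_bigr => k _.
  congr (normc _ ^+ 2); rewrite /conv; apply: eq_bigl => y; rewrite /key'.
  by rewrite eqr_oppLR.
have ll : 0 <= l^-1 by rewrite invr_ge0 ltW.
apply: le_trans (_ : _ <= 2^-1 * (l * H s f1 f3 + l^-1 *
   \sum_(k <- sums s) normc (\sum_(j <- pairs s | key' j == k) f2 j.1 * f4 j.2) ^+ 2)) _; last first.
  by rewrite ler_wpM2l ?invr_ge0 // lerD2l ler_wpM2l.
rewrite !mulr_sumr -big_split /= mulr_sumr; apply: ler_sum => k _.
by rewrite normcM; exact: half_amgm.
Qed.

(* Only boundedly many cubes of side [M] interact with a given output frequency. *)
Lemma H_cubes s f h (M : nat) : (0 < M)%N -> (forall A, A \in s -> h A != 0 -> (sup4 A < M)%N) ->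
  H s f h <= 81 * \sum_(q <- undup (map (quo M) s))
     H s (fun A => if quo M A == q then f A else 0) h.
Proof.
move=> M0 hM; set qs := undup _.
rewrite [X in _ * X](_ : _ = \sum_(k <- sums s) \sum_(q <- qs)
  normc (conv s (fun A => if quo M A == q then f A else 0) h k) ^+ 2); last exact: exchange_big.
rewrite mulr_sumr; apply: ler_sum => k _.
have -> : conv s f h k = \sum_(q <- qs) conv s (fun A => if quo M A == q then f A else 0) h k.
  rewrite -conv_suml /conv big_seq_cond [RHS]big_seq_cond; apply: eq_bigr => y /andP[ys _].
  congr (_ * _); rewrite -big_mkcond /=.
  under eq_bigl do rewrite eq_sym.
  rewrite -big_filter filter_pred1_uniq ?undup_uniq ?big_seq1 //.
  by rewrite mem_undup map_f //; move: ys; case: (y) => a b; rewrite mem_pairs => /andP[].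
set a := fun q => conv s (fun A => if quo M A == q then f A else 0) h k.
(* A frequency of size below [M] changes [quo M] by at most one in each coordinate, which leaves
   [3^4 = 81] cubes. *)
pose near := [seq q <- qs | sup4 (q - quo M k)%R <= 1]%N.
have a0 q : q \notin near -> q \in qs -> a q = 0.
  move=> qn qq; rewrite /a /conv big_seq_cond big1 // => -[A C] /andP[].
  rewrite mem_pairs /= => /andP[As Cs] /eqP AC.
  case: ifP => [/eqP qA|_]; last by rewrite mul0r.
  have [hC|hC] := eqVneq (h C) 0; first by rewrite hC mulr0.
  exfalso; move/negP: qn; apply; rewrite mem_filter qq andbT.
  have : (sup4 C <= M.-1)%N by rewrite -ltnS prednK //; exact: hM.
  rewrite -in_cubeE => /and4P[k1 k2 k3 k4].
  have key (x y : int) : `|y| <= M.-1%:Z -> `|(x %/ M)%Z - ((x + y) %/ M)%Z| <= 1.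
    move=> ym; have M0Z : 0 < M%:Z by lia.
    have := divz_eq x M%:Z; have := modz_ge0 x (lt0r_neq0 M0Z); have := ltz_pmod x M0Z.
    have := divz_eq (x + y) M%:Z; have := modz_ge0 (x + y) (lt0r_neq0 M0Z).
    have := ltz_pmod (x + y) M0Z.
    move: (x %/ M)%Z (x %% M)%Z ((x + y) %/ M)%Z ((x + y) %% M)%Z => p r p' r'.
    move=> h1 h2 h3 h4 h5 h6; have : `|(p - p') * M%:Z| < 2 * M%:Z by lia.
    by clear -M0Z; nia.
  rewrite -in_cubeE -qA -AC; apply/and4P; split; rewrite !cE; exact: key.
have sn : (size near <= 81)%N.
  rewrite -(size_map (fun q => q - quo M k)) -[81%N]/(((1.*2).+1) ^ 4)%N -(size_cube_seq 1).
  apply: uniq_leq_size.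
    by rewrite map_inj_uniq ?filter_uniq ?undup_uniq // => x y /addIr.
  by move=> x /mapP[q]; rewrite mem_filter => /andP[qn _] ->; rewrite mem_cube_seq in_cubeE.
have -> : \sum_(q <- qs) a q = \sum_(q <- near) a q.
  rewrite [LHS](bigID (fun q => q \in near)) /= [X in _ + X]big_seq_cond [X in _ + X]big1 ?addr0.
    by rewrite -big_filter; apply: perm_big; apply: uniq_perm;
      rewrite ?filter_uniq ?undup_uniq // => q; rewrite !mem_filter; case: (q \in qs); rewrite ?andbF ?andbT.
  by move=> q /andP[qq qn]; apply: a0.
apply: le_trans (_ : _ <= (\sum_(q <- near) normc (a q)) ^+ 2) _.
  by rewrite lerXn2r ?nnegrE ?normc_ge0 ?sumr_ge0 ?normc_sum // => q _; exact: normc_ge0.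
apply: le_trans (sqr_sum_weight near _ (fun _ => ltr01)) _.
rewrite big_const_seq count_predT iter_addr_0 invr1.
under eq_bigr do rewrite mul1r.
apply: ler_pM; rewrite ?ler0n ?ler_nat //; first by apply: sumr_ge0 => q _; exact: sqr_ge0.
rewrite /near big_filter [leRHS](bigID (fun q => (sup4 (q - quo M k)%R <= 1)%N)) /= lerDl.
by apply: sumr_ge0 => q _; exact: sqr_ge0.
Qed.

End Bilinear.

(** * Time integrals over a period *)

Section Period.
Context {R : realType}.
Local Notation mu := (@lebesgue_measure R).
Local Notation T2 := (`[0, 2 * pi[%classic : set R).

Lemma continuous_measurableT (f : R -> R) (D : set R) : measurable D -> continuous f -> measurable_fun D f.
Proof.
move=> mD cf; apply: measurable_funS (measurableT) (@subsetT _ _) _.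
exact: continuous_measurable_fun.
Qed.

Lemma lebesgue_itv_finite (a b : R) : (mu `[a, b[%classic < +oo)%E.
Proof. by rewrite lebesgue_measure_itv /=; case: ifP => // _; rewrite ltry. Qed.

Lemma pi2_gt0 : 0 < 2 * pi :> R. Proof. by rewrite mulr_gt0 ?pi_gt0. Qed.

Lemma fine_itv (a b : R) : a <= b -> fine (mu `[a, b[%classic) = b - a.
Proof.
move=> ab; rewrite lebesgue_measure_itv /= lte_fin.
by case: ltP => // ba; apply/esym/eqP; rewrite subr_eq0 eq_le ba ab.
Qed.

Lemma expi_int2pi (n : int) : expi (n%:~R * (2 * pi)) = 1 :> R[i].
Proof.
have pos (m : nat) : expi (m%:R * (2 * pi)) = 1 :> R[i].
  elim: m => [|m IH]; first by rewrite mul0r expi0.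
  rewrite -addn1 natrD mulrDl mul1r expiD IH mul1r.
  by apply: Ceq; rewrite /= mulr_natl ?cos2pi ?sin2pi.
case: n => m; first exact: pos.
rewrite NegzE mulrNz mulNr; have h := expiNK (m.+1%:R * (2 * pi) : R).
by rewrite (pos m.+1) mulr1 in h.
Qed.

Lemma expi_bm (c : R) (D : set R) : measurable D -> cbm D (fun t => expi (t * c)).
Proof.
move=> mD; have cc : continuous (fun t : R => t * c) by move=> x; apply: cvgMl; exact: cvg_id.
split; split.
- apply: (continuous_measurableT (f := fun t => cos (t * c))) => // x; apply: continuous_comp (cc x) _.
  exact: continuous_cos.
- by exists 1 => x _ /=; rewrite ler_norml cos_geN1 cos_le1.
- apply: (continuous_measurableT (f := fun t => sin (t * c))) => // x; apply: continuous_comp (cc x) _.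
  exact: continuous_sin.
- by exists 1 => x _ /=; rewrite ler_norml sin_geN1 sin_le1.
Qed.

Lemma Rintegral_derive (F f : R -> R) (a b : R) : a < b -> bm `[a, b[ f -> continuous f ->
  (forall x : R, is_derive x (1 : R) (F : R -> R) (f x)) -> Rintegral mu `[a, b[ f = F b - F a.
Proof.
move=> ab bf cf dF; rewrite Rintegral_itv_bndo_bndc; last first.
  by apply: bm_integrable => //; exact: lebesgue_itv_finite.
have cF : continuous F.
  by move=> x; apply/differentiable_continuous/derivable1_diffP; exact: ex_derive.
have lr : derivable_oo_LRcontinuous F a b.
  split; first by move=> x _; exact: ex_derive.
    by apply: cvg_at_right_filter; exact: cF.
  by apply: cvg_at_left_filter; exact: cF.
have F'f : {in `]a, b[, F^`()%classic =1 f}.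
  by move=> x _; rewrite derive1E; exact: derive_val.
by rewrite /Rintegral (continuous_FTC2 ab (continuous_subspaceT cf) lr F'f).
Qed.

Lemma cint_expi (n : int) : cintegral mu T2 (fun t => expi (t * n%:~R)) =
  if n == 0 then (2 * pi)%:C else 0.
Proof.
have [->|n0] := eqVneq n 0.
  apply: Ceq; rewrite ?cint_Re ?cint_Im.
    under [LHS]eq_Rintegral do rewrite mulr0 /= cos0.
    by rewrite Rintegral_cst //= mul1r fine_itv ?subr0 // ltW ?pi2_gt0.
  under [LHS]eq_Rintegral do rewrite mulr0 /= sin0.
  by rewrite Rintegral_cst //= mul0r.
have n0' : n%:~R != 0 :> R by rewrite intr_eq0.
have [e1 e2] : cos (n%:~R * (2 * pi)) = 1 :> R /\ sin (n%:~R * (2 * pi)) = 0 :> R.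
  by have [? ?] := expi_int2pi n.
have cc : continuous (fun t : R => t * n%:~R) by move=> x; apply: cvgMl; exact: cvg_id.
have dd (x : R) : is_derive x (1 : R) (fun t : R => t * n%:~R) n%:~R.
  by apply: is_derive_eq; rewrite scaler0 add0r /GRing.scale /= mulr1.
have [bc bs] := expi_bm (n%:~R : R) (measurable_itv `[0, 2 * pi[).
have dZ (g g' : R -> R) (c : R) : (forall y : R, is_derive y (1 : R) g (g' y)) ->
    forall x : R, is_derive x (1 : R) (fun t : R => c * g (t * n%:~R)) (c * (n%:~R * g' (x * n%:~R))).
  move=> dg x; have h := is_derive1_comp (dg _) (dd x).
  by rewrite [n%:~R * _]mulrC; exact: (is_deriveZ c h).
have ds (x : R) : is_derive x (1 : R) (fun t : R => n%:~R^-1 * sin (t * n%:~R)) (cos (x * n%:~R)).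
  by have := dZ _ _ n%:~R^-1 (fun y => is_derive_sin y) x; rewrite mulKf.
have dc (x : R) : is_derive x (1 : R) (fun t : R => (- n%:~R)^-1 * cos (t * n%:~R)) (sin (x * n%:~R)).
  have := dZ _ _ (- n%:~R)^-1 (fun y => is_derive_cos y) x.
  by rewrite mulrN -mulNr mulKf // oppr_eq0.
apply: Ceq; rewrite ?cint_Re ?cint_Im /=.
  rewrite (Rintegral_derive pi2_gt0 bc _ ds).
    by rewrite mul0r sin0 [2 * pi * _]mulrC e2 !mulr0 subr0.
  by move=> x; apply: continuous_comp (cc x) _; exact: continuous_cos.
rewrite (Rintegral_derive pi2_gt0 bs _ dc).
  by rewrite mul0r cos0 [2 * pi * _]mulrC e1 subrr.
by move=> x; apply: continuous_comp (cc x) _; exact: continuous_sin.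
Qed.

End Period.

Section FreeIntegral.
Context {R : realType}.
Local Notation mu := (@lebesgue_measure R).
Local Notation T2 := (`[0, 2 * pi[%classic : set R).
Implicit Types (V W : freq -> R[i]).

Definition sq (A : freq) : int := c1 A ^+ 2 + c2 A ^+ 2 + c3 A ^+ 2 + c4 A ^+ 2.

Lemma sqnormE A : sqnorm A = (sq A)%:~R :> R.
Proof. by case: A => [[[a b] c] d]. Qed.

Lemma cbm_conv (D : set R) s (f h : R -> freq -> R[i]) k :
  (forall A, cbm D (fun t => f t A)) -> (forall A, cbm D (fun t => h t A)) ->
  cbm D (fun t => conv s (f t) (h t) k).
Proof. by move=> bf bh; apply: cbm_sum => y _; exact: cbmM. Qed.

Lemma bm_H (D : set R) s (f h : R -> freq -> R[i]) :
  (forall A, cbm D (fun t => f t A)) -> (forall A, cbm D (fun t => h t A)) ->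
  bm D (fun t => H s (f t) (h t)).
Proof. by move=> bf bh; apply: bm_sum => k _; apply: bm_sqr_normc; exact: cbm_conv. Qed.

Lemma rect_sq A B C D : (A + C == B + D) && (sq A + sq C == sq B + sq D) = rect ((A, B), (C, D)).
Proof.
rewrite /rect /=; case: eqP => //= e.
have -> : C = B + D - A by rewrite -e; fring.
have -> : (sq A + sq (B + D - A) == sq B + sq D) = (2 * dot (B - A) (D - A) == 0).
  by rewrite -subr_eq0; congr (_ == 0); rewrite /sq /dot !cE; ring.
by rewrite mulf_eq0.
Qed.

(** The time frequencies are integers, so integration over the period [2 pi] keeps exactly the terms
    in which the sums of [sq] over opposite vertices agree. *)
Lemma int_H_free s V W : Rintegral mu T2 (fun t => H s (free V t) (free W t)) <=
  2 * pi * S4 s PT (fun A => normc (V A)) (fun A => normc (V A)) (fun A => normc (W A)) (fun A => normc (W A)).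
Proof.
have mT : measurable T2 := measurable_itv _.
have fT : (mu T2 < +oo)%E := lebesgue_itv_finite _ _.
pose c (x : freq * freq * (freq * freq)) : R[i] :=
  if x.1.1 + x.2.1 == x.1.2 + x.2.2 then (V x.1.1 * W x.2.1) * ((V x.1.2)^*%C * (W x.2.2)^*%C) else 0.
pose n (x : freq * freq * (freq * freq)) : int := sq x.1.2 + sq x.2.2 - sq x.1.1 - sq x.2.1.
have E t : H s (free V t) (free W t) = Cre (\sum_(x <- quads s) c x * expi (t * (n x)%:~R)).
  rewrite -[LHS]Cre_real HE4 sum_quads; congr Cre.
  apply: eq_bigr => A _; apply: eq_bigr => B _; apply: eq_bigr => C _; apply: eq_bigr => D _.
  rewrite /c /=; case: ifP => _; last by rewrite mul0r.
  rewrite /free !conjcM !conj_expi !sqnormE !opprK.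
  have -> : expi (t * (n ((A, B), (C, D)))%:~R) = expi (- (t * (sq A)%:~R)) * expi (- (t * (sq C)%:~R))
     * (expi (t * (sq B)%:~R) * expi (t * (sq D)%:~R)) :> R[i].
    have -> : n ((A, B), (C, D)) = sq B + sq D - sq A - sq C by [].
    by move: (sq A) (sq B) (sq C) (sq D) => a b c' d; rewrite -!expiD; congr expi; ring.
  by ring.
have bc x : cbm T2 (fun t => c x * expi (t * (n x)%:~R)).
  by apply: cbmM; [exact: cbm_cst|exact: expi_bm].
under eq_Rintegral do rewrite E.
rewrite -(cint_Re mu T2 (fun t => \sum_(x <- quads s) c x * expi (t * (n x)%:~R))).
rewrite (cint_sum (m := mu) mT fT); last by move=> x _; exact: bc.
rewrite Cre_sum /S4 [in leRHS]big_mkcond mulr_sumr; apply: ler_sum => x _.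
rewrite (cintZ (m := mu) mT fT); last exact: expi_bm.
rewrite cint_expi /c /n /rect_in /PT andbT; case: x => [[A B] [C D]]; cbn [fst snd].
rewrite -rect_sq; have -> : (sq B + sq D - sq A - sq C == 0) = (sq A + sq C == sq B + sq D).
  by rewrite -addrA -opprD subr_eq0 eq_sym.
case: eqP => _; cbn [andb]; last by rewrite mul0r mulr0.
case: eqP => _; cbn [andb]; last by rewrite mulr0 mulr0.
apply: le_trans (ler_norm _) _; apply: le_trans (Cre_le_normc _) _.
rewrite !normcM !normc_conj normc_real (ger0_norm (ltW pi2_gt0)) mulrC ler_pM2l ?pi2_gt0 //.
by rewrite le_eqVlt; apply/orP; left; apply/eqP; ring.
Qed.

(* Cauchy--Schwarz over the at most [n] frequencies of [h]. *)
Lemma H_trivial s (f h : freq -> R[i]) (t : seq freq) : uniq s -> uniq t ->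
  (forall A, A \in s -> h A != 0 -> A \in t) ->
  H s f h <= (size t)%:R * ((\sum_(A <- s) normc (f A) ^+ 2) * (\sum_(A <- s) normc (h A) ^+ 2)).
Proof.
move=> us ut ht.
have step k : normc (conv s f h k) ^+ 2 <= (size t)%:R *
    \sum_(y <- pairs s | y.1 + y.2 == k) normc (f y.1) ^+ 2 * normc (h y.2) ^+ 2.
  pose r := [seq y <- pairs s | (y.1 + y.2 == k) && (y.2 \in t)].
  have -> : conv s f h k = \sum_(y <- r) f y.1 * h y.2.
    rewrite /conv big_filter big_seq_cond [RHS]big_seq_cond [LHS](bigID (fun y => y.2 \in t)) /=.
    rewrite [X in _ + X]big1 ?addr0 => [|y]; first by apply: eq_bigl => y; rewrite andbA.
    case: y => A C /=; rewrite mem_pairs /= => /andP[/andP[/andP[_ Cs] _] Ct].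
    have [->|hC] := eqVneq (h C) 0; first by rewrite mulr0.
    by rewrite (ht _ Cs hC) in Ct.
  have sr : (size r <= size t)%N.
    rewrite -(size_map snd); apply: uniq_leq_size => [|x /mapP[y]]; last first.
      by rewrite mem_filter => /andP[/andP[_ yt] _] ->.
    rewrite map_inj_in_uniq ?filter_uniq ?uniq_pairs_seq // => -[A C] [A' C'].
    rewrite !mem_filter /= => /andP[/andP[/eqP e _] _] /andP[/andP[/eqP e' _] _] eC.
    by move: e'; rewrite -eC -e => /addIr ->.
  apply: le_trans (_ : _ <= (\sum_(y <- r) normc (f y.1 * h y.2)) ^+ 2) _.
    by rewrite lerXn2r ?nnegrE ?normc_ge0 ?sumr_ge0 ?normc_sum // => q _; exact: normc_ge0.
  apply: le_trans (sqr_sum_weight r _ (fun _ => ltr01)) _.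
  rewrite big_const_seq count_predT iter_addr_0 invr1.
  apply: ler_pM; rewrite ?ler0n ?ler_nat //; first by apply: sumr_ge0 => q _; rewrite mul1r sqr_ge0.
  rewrite big_filter [leRHS](bigID (fun y => y.2 \in t)) /= -[leLHS]addr0 lerD ?sumr_ge0 //.
    by rewrite le_eqVlt; apply/orP; left; apply/eqP; apply: eq_bigr => y _; rewrite mul1r normcM exprMn.
  by move=> y _; rewrite mulr_ge0 ?sqr_ge0.
apply: le_trans (ler_sum _ (fun k _ => step k)) _.
rewrite -mulr_sumr ler_wpM2l // le_eqVlt; apply/orP; left; apply/eqP.
transitivity (\sum_(y <- pairs s) normc (f y.1) ^+ 2 * normc (h y.2) ^+ 2); last first.
  rewrite big_allpairs_dep /= mulr_suml; apply: eq_bigr => A _; by rewrite mulr_sumr.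
under eq_bigr do rewrite big_mkcond /=.
rewrite exchange_big /= big_seq_cond [RHS]big_seq_cond; apply: eq_bigr => y /andP[ys _].
rewrite -big_mkcond /=; under eq_bigl do rewrite eq_sym.
rewrite -big_filter filter_pred1_uniq ?undup_uniq ?big_seq1 // mem_undup.
by apply/mapP; exists y.
Qed.

End FreeIntegral.

(** * Functions of bounded variation *)

Section Labels.
Context {R : realType}.
Implicit Types (T : R) (t : nat -> R).

Definition chain T (J : R -> R -> Prop) n t : Prop :=
  (forall k, (k <= n)%N -> 0 <= t k < T) /\
  (forall k, (k < n)%N -> t k < t k.+1 /\ J (t k) (t k.+1)).

(* The label of a time is the maximal length of a chain of [J]-jumps up to it. *)
Lemma labelling T (J : R -> R -> Prop) (N : nat) :
  (forall n t, chain T J n t -> (n <= N)%N) ->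
  exists l : R -> nat, [/\ forall x, (l x <= N)%N, {homo l : x y / x <= y >-> (x <= y)%N} &
    forall x y, 0 <= x -> x <= y -> y < T -> l x = l y ->
      exists2 r, 0 <= r < T & (r = x \/ ~ J r x) /\ (r = y \/ ~ J r y)].
Proof.
move=> bN; pose P x n := n = 0%N \/ exists t, chain T J n t /\ t n <= x.
have ub x n : P x n -> (n <= N)%N by case=> [-> //|[t [ct _]]]; exact: bN ct.
have ex x : exists n, `[< P x n >] by exists 0%N; apply/asboolP; left.
have ub' x n : `[< P x n >] -> (n <= N)%N by move/asboolP; exact: ub.
pose l x := ex_maxn (ex x) (ub' x).
have lP x : P x (l x) /\ forall n, P x n -> (n <= l x)%N.
  rewrite /l; case: ex_maxnP => n /asboolP Pn mn; split=> // m Pm; apply: mn; exact/asboolP.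
exists l; split.
- by move=> x; apply: ub (lP x).1.
- move=> x y xy; apply: (lP y).2; have [[->|[t [ct tx]]] _] := lP x; first by left.
  by right; exists t; split=> //; exact: le_trans tx xy.
move=> x y x0 xy yT lxy.
have xT : 0 <= x < T by rewrite x0 (le_lt_trans xy).
have yT' : 0 <= y < T by rewrite (le_trans x0 xy).
have [t [[tT tJ] tx]] : exists t, chain T J (l x) t /\ t (l x) <= x.
  by have [[e|//] _] := lP x; exists (fun _ => x); rewrite e; split=> //; split=> [k _ //|k].
have ext z : 0 <= z < T -> t (l x) <= z -> l z = l x -> t (l x) = z \/ ~ J (t (l x)) z.
  move=> zT tz lz; have [|tz'] := eqVneq (t (l x)) z; [by left|right=> Jz].
  suff: P z (l x).+1 by move/(lP z).2; rewrite lz ltnn.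
  right; exists (fun k => if (k <= l x)%N then t k else z); split; last by rewrite ltnn.
  split=> k kl; first by case: ifP => kx //; exact: tT.
  rewrite ltnS in kl; rewrite kl; case: ltnP => kx; first exact: tJ.
  have -> : k = l x by apply/eqP; rewrite eqn_leq kl kx.
  by split=> //; rewrite lt_neqAle tz'.
(* The last point of a longest chain up to [x] serves both times: a jump from it to a time with the
   same label would lengthen the chain. *)
exists (t (l x)); first exact: tT.
by split; apply: ext => //; exact: le_trans xy.
Qed.

Definition crt (n : nat) : R := n%:R `^ 3^-1.

Lemma crt3 n : crt n ^+ 3 = n%:R.
Proof. by rewrite /crt -powR_mulrn ?powR_ge0 // -powRrM mulVf ?powRr1. Qed.

Lemma crt_ge0 n : 0 <= crt n. Proof. exact: powR_ge0. Qed.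

(* A weak form of the cubic variation [V^3], implied by the quadratic variation;
   step functions with [N] pieces of size [1] have it with [B = 4 N^(2/3)]. *)
Definition wvar T (B : R) (v : R -> R[i]) : Prop :=
  (forall x, 0 <= x < T -> normc (v x) ^+ 2 <= B) /\
  forall n t, chain T (fun _ _ => True) n t ->
    \sum_(k < n) normc (v (t k.+1) - v (t k)) ^+ 2 <= B * crt n.

Lemma sqr_normcD (z w : R[i]) : normc (z + w) ^+ 2 <= 2 * normc z ^+ 2 + 2 * normc w ^+ 2.
Proof.
have := normcD z w; move: (normc_ge0 (z + w)) (normc_ge0 z) (normc_ge0 w).
move: (normc _) (normc z) (normc w) => a b c a0 b0 c0 abc.
apply: le_trans (_ : _ <= (b + c) ^+ 2) _; first by rewrite lerXn2r ?nnegrE ?addr_ge0.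
by rewrite -subr_ge0; have := sqr_ge0 (b - c); congr (0 <= _); ring.
Qed.

Lemma sqr_normcB (z w : R[i]) : normc (z - w) ^+ 2 <= 2 * normc z ^+ 2 + 2 * normc w ^+ 2.
Proof. by rewrite -(normcN w); exact: sqr_normcD. Qed.

Definition n2 (s : seq freq) (f : freq -> R[i]) : R := \sum_(A <- s) normc (f A) ^+ 2.

Lemma n2_ge0 s f : 0 <= n2 s f.
Proof. by apply: sumr_ge0 => A _; exact: sqr_ge0. Qed.

Lemma n2B s f g : n2 s (fun A => f A - g A) <= 2 * n2 s f + 2 * n2 s g.
Proof.
rewrite /n2 !mulr_sumr -big_split /=; apply: ler_sum => A _; exact: sqr_normcB.
Qed.

Lemma n2_distC s f g : n2 s (fun A => f A - g A) = n2 s (fun A => g A - f A).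
Proof. by apply: eq_bigr => A _; rewrite normc_distC. Qed.

(** Each jump contributes more than [B / L^2], and all of them together at most [B n^(1/3)]; hence
    [n^(2/3) <= L^2]. *)
Lemma chain_jumps T s (v : R -> freq -> R[i]) (Bx : freq -> R) (B : R) (L n : nat) t :
  0 < B -> (0 < L)%N -> (forall A, A \in s -> wvar T (Bx A) (fun x => v x A)) ->
  \sum_(A <- s) Bx A <= B ->
  chain T (fun x y => B / L%:R ^+ 2 < n2 s (fun A => v y A - v x A)) n t -> (n <= L ^ 3)%N.
Proof.
move=> B0 L0 wv sB [tT tJ]; have L0' : 0 < L%:R :> R by rewrite ltr0n.
have h1 : n%:R * (B / L%:R ^+ 2) <= B * crt n.
  apply: le_trans (_ : _ <= \sum_(k < n) n2 s (fun A => v (t k.+1) A - v (t k) A)) _.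
    rewrite mulr_natl -[n in X in X <= _]card_ord -sumr_const; apply: ler_sum => k _.
    by have [_ /ltW] := tJ k (ltn_ord k).
  rewrite /n2 exchange_big /=.
  apply: le_trans (_ : _ <= \sum_(A <- s) Bx A * crt n) _; last first.
    by rewrite -mulr_suml ler_wpM2r ?crt_ge0.
  rewrite big_seq [leRHS]big_seq; apply: ler_sum => A As.
  by apply: (wv A As).2; split=> // k kn; have [] := tJ k kn.
have h2 : n%:R <= L%:R ^+ 2 * crt n.
  rewrite -ler_pdivrMl ?exprn_gt0 // -(ler_pM2l B0); apply: le_trans h1.
  by rewrite le_eqVlt; apply/orP; left; apply/eqP; field; rewrite lt0r_neq0.
have [->//|n0] := posnP n; have n0' : 0 < n%:R :> R by rewrite ltr0n.
have h3 : n%:R ^+ 3 <= L%:R ^+ 6 * n%:R :> R.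
  have -> : L%:R ^+ 6 * n%:R = (L%:R ^+ 2 * crt n) ^+ 3 by rewrite exprMn crt3 -exprM.
  by rewrite lerXn2r ?nnegrE ?mulr_ge0 ?exprn_ge0 ?crt_ge0.
have h4 : (n%:R ^+ 2 <= (L%:R ^+ 3) ^+ 2 :> R).
  by rewrite -(ler_pM2r n0') -exprSr -exprM.
by rewrite ler_pXn2r ?nnegrE ?exprn_ge0 // -natrX ler_nat in h4.
Qed.

(** The jumps are measured in the [l^2] norm over all frequencies of [s], so that one partition of
    time serves every frequency. *)
Lemma step_approx T s (v : R -> freq -> R[i]) (Bx : freq -> R) (B : R) (L : nat) :
  0 < B -> (0 < L)%N -> (forall A, A \in s -> wvar T (Bx A) (fun x => v x A)) ->
  \sum_(A <- s) Bx A <= B ->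
  exists (l : R -> nat) (rep : nat -> R),
    [/\ forall x, (l x <= L ^ 3)%N, {homo l : x y / x <= y >-> (x <= y)%N},
     (forall x, 0 <= x < T -> 0 <= rep (l x) < T) &
     (forall x, 0 <= x < T -> n2 s (fun A => v x A - v (rep (l x)) A) <= 4 * (B / L%:R ^+ 2))].
Proof.
move=> B0 L0 wv sB.
have [l [lN lm lJ]] := labelling (fun n t => @chain_jumps T s v Bx B L n t B0 L0 wv sB).
pose rep a : R := xget 0 [set x | 0 <= x < T /\ l x = a].
have repP x : 0 <= x < T -> 0 <= rep (l x) < T /\ l (rep (l x)) = l x.
  move=> xT; have h : [set y | 0 <= y < T /\ l y = l x] x by [].
  exact: (xgetI 0 h).
exists l, rep; split=> // [x /repP[] //|x xT]; have [rT lr] := repP x xT.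
have key y z : 0 <= y < T -> 0 <= z < T -> y <= z -> l y = l z ->
    n2 s (fun A => v y A - v z A) <= 4 * (B / L%:R ^+ 2).
  move=> /andP[y0 _] /andP[_ zT] yz lyz; have [r _ [hy hz]] := lJ y z y0 yz zT lyz.
  have E0 : 0 <= B / L%:R ^+ 2 by rewrite divr_ge0 ?exprn_ge0 // ltW.
  have small w : r = w \/ ~ B / L%:R ^+ 2 < n2 s (fun A => v w A - v r A) ->
      n2 s (fun A => v w A - v r A) <= B / L%:R ^+ 2.
    case=> [->|/negP]; last by rewrite -leNgt.
    by rewrite /n2 big1 // => A _; rewrite subrr normc0 expr0n.
  have -> : n2 s (fun A => v y A - v z A) = n2 s (fun A => (v y A - v r A) - (v z A - v r A)).
    by apply: eq_bigr => A _; congr (normc _ ^+ 2); ring.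
  apply: le_trans (n2B _ _ _) _; have := small _ hy; have := small _ hz; lra.
case: (leP x (rep (l x))) => [xr|/ltW rx]; first exact: key.
by rewrite n2_distC; exact: key.
Qed.

Local Notation DT T := (`[0, T[%classic : set R).

Lemma label_cbm T (l : R -> nat) N (g : nat -> R[i]) : (forall x, (l x <= N)%N) ->
  {homo l : x y / x <= y >-> (x <= y)%N} -> cbm (DT T) (fun x => g (l x)).
Proof.
move=> lN lm; have mD : measurable (DT T) := measurable_itv _.
have ml : measurable_fun setT (fun x => (l x)%:R : R).
  by apply: nondecreasing_measurable => // x y xy; rewrite ler_nat lm.
have key (h : nat -> R) : bm (DT T) (fun x => h (l x)).
  apply: bm_eq (_ : bm _ (fun x => \sum_(a < N.+1) h a * \1_[set y | (l y)%:R = a%:R :> R] x)).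
    move=> x _; rewrite (bigD1 (Ordinal (lN x : (l x < N.+1)%N))) //= big1 ?addr0 => [|a al].
      by rewrite indicE mem_set ?mulr1.
    rewrite indicE memNset ?mulr0 //= => /eqP; rewrite eqr_nat => /eqP e.
    by move/eqP: al; apply; apply: val_inj.
  apply: bm_sum => a _; apply: bmM; first exact: bm_cst.
  split; last by exists 1 => x _; rewrite indicE; case: (_ \in _); rewrite ?normr1 ?normr0.
  apply: measurable_indic; have := ml measurableT _ (measurable_set1 a%:R).
  by rewrite setTI.
by split; [exact: (key (fun a => Cre (g a)))|exact: (key (fun a => Cim (g a)))].
Qed.

(** Measurability comes from [step_approx] at a single frequency: the function is a uniform limit of
    functions of monotone labels. *)
Lemma wvar_cbm T (B : R) (v : R -> R[i]) : wvar T B v -> cbm (DT T) v.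
Proof.
move=> wv; have mD : measurable (DT T) := measurable_itv _.
have vB x : 0 <= x < T -> normc (v x) ^+ 2 <= B by exact: wv.1.
have [T0|T0] := leP T 0.
  have h (f : R -> R) : bm (DT T) f.
    apply: bm_eq (bm_cst _ 0) => x /=; rewrite in_itv /= => /andP[x0 xT].
    by have := le_lt_trans x0 (lt_le_trans xT T0); rewrite ltxx.
  by split; exact: h.
have B0 : 0 <= B by apply: le_trans (vB 0 _); rewrite ?sqr_ge0 // lexx T0.
have ap (n : nat) : exists g : R -> R[i], cbm (DT T) g /\
    forall x, 0 <= x < T -> normc (v x - g x) ^+ 2 <= 4 * ((B + 1) / n.+1%:R ^+ 2).
  have sB : \sum_(A <- [:: 0 : freq]) B <= B + 1 by rewrite big_seq1 lerDl.
  have [l [rep [lN lm _ hl]]] := @step_approx T [:: 0] (fun x _ => v x) (fun _ => B) (B + 1) n.+1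
    (ltr_wpDl B0 ltr01) (ltn0Sn _) (fun _ _ => wv) sB.
  exists (fun x => v (rep (l x))); split; first exact: (@label_cbm T l _ (fun a => v (rep a)) lN lm).
  by move=> x xT; have := hl x xT; rewrite /n2 big_seq1.
have [g hg] := choice ap.
have conv x : 0 <= x < T -> (fun n => normc (v x - g n x)) @ \oo --> (0 : R).
  move=> xT; apply/cvgrPdist_le => /= e e0; near=> n.
  rewrite sub0r normrN ger0_norm ?normc_ge0 //.
  rewrite -(@ler_pXn2r _ 2) ?nnegrE ?normc_ge0 ?(ltW e0) //; apply: le_trans ((hg n).2 x xT) _.
  have n1 : 1 <= n.+1%:R :> R by rewrite ler1n.
  have h2 : 4 * (B + 1) / e ^+ 2 <= n.+1%:R.
    by apply: le_trans (_ : _ <= n%:R) _; rewrite ?ler_nat //; near: n; exact: nbhs_infty_ger.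
  rewrite ler_pdivrMr ?exprn_gt0 // in h2; rewrite mulrA ler_pdivrMr ?exprn_gt0 //.
  apply: le_trans h2 _; rewrite mulrC ler_wpM2l ?exprn_ge0 ?(ltW e0) //.
  by rewrite expr2 ler_peMr ?ler0n.
have lim (p : R[i] -> R) : (forall z w, `|p z - p w| <= normc (z - w)) ->
    (forall n, bm (DT T) (fun x => p (g n x))) -> bm (DT T) (fun x => p (v x)).
  move=> pl pg; split.
    apply: (@measurable_fun_cvg _ _ _ _ (fun n x => p (g n x))) => [n|x]; first by have [] := pg n.
    rewrite /= in_itv /= => xT; apply/cvgrPdist_le => /= e e0.
    have /cvgrPdist_le /(_ e e0) := conv x xT; apply: filterS => n.
    by rewrite sub0r normrN ger0_norm ?normc_ge0 //; exact: le_trans.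
  exists (B + 1 + `|p 0|) => x; rewrite /= in_itv /= => xT.
  have -> : p (v x) = (p (v x) - p 0) + p 0 by ring.
  apply: le_trans (ler_normD _ _) _; rewrite lerD2r; apply: le_trans (pl _ _) _; rewrite subr0.
  have := vB x xT; move: (normc_ge0 (v x)); move: (normc (v x)) => y y0 yB.
  have : 0 <= (y - 1) ^+ 2 by exact: sqr_ge0.
  by rewrite sqrrB1; lra.
split; [apply: (lim (fun z => Cre z)) => [z w|n]|apply: (lim (fun z => Cim z)) => [z w|n]].
- by rewrite -CreN -CreD; exact: Cre_le_normc.
- by have [[]] := hg n.
- by rewrite -CimN -CimD; exact: Cim_le_normc.
- by have [[]] := hg n.
Unshelve. all: end_near.
Qed.

(** The last clause confines the values to the frequency support of [V], so that hypotheses on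
    frequency cubes pass to each value. *)
Definition stepd T s (N : nat) (e : R) (V : R -> freq -> R[i]) : Prop :=
  exists (l : R -> nat) (Vr : nat -> freq -> R[i]),
    [/\ forall x, 0 <= x < T -> (l x < N)%N /\ V x = Vr (l x),
     forall a, n2 s (Vr a) <= e &
     forall a A, Vr a A != 0 -> exists x, 0 <= x < T /\ V x A != 0].

Lemma stepdP T s N e V (l : R -> nat) : 0 <= e -> (forall x, (l x < N)%N) ->
  (forall x y, 0 <= x < T -> 0 <= y < T -> l x = l y -> V x = V y) ->
  (forall x, 0 <= x < T -> n2 s (V x) <= e) -> stepd T s N e V.
Proof.
move=> e0 lN lV Ve; pose rep a : option R := if pselect (exists x, 0 <= x < T /\ l x = a) is left h
  then Some (sval (cid h)) else None.
pose Vr a := if rep a is Some x then V x else fun _ => 0.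
have repP a : if rep a is Some x then 0 <= x < T /\ l x = a else forall x, 0 <= x < T -> l x <> a.
  rewrite /rep; case: pselect => [h|h]; first by case: cid.
  by move=> x xT lx; apply: h; exists x.
exists l, Vr; split.
- move=> x xT; split; first exact: lN.
  rewrite /Vr; have := repP (l x); case: (rep _) => [y [yT ly]|/(_ x xT)//].
  exact: lV.
- move=> a; rewrite /Vr; have := repP a; case: (rep _) => [y [yT _]|_]; first exact: Ve.
  by rewrite /n2 big1 // => A _; rewrite normc0 expr0n.
- move=> a A; rewrite /Vr; have := repP a; case: (rep _) => [y [yT _] h|_]; first by exists y.
  by rewrite eqxx.
Qed.

(** [V 0] is the coarsest step approximation and [V n] the difference of those at the scales [L^n]
    and [L^(n-1)], so the sum up to [m] telescopes to the approximation at scale [L^m]. *)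
Lemma level_decomposition T s (v : R -> freq -> R[i]) (Bx : freq -> R) (B : R) (L m : nat) :
  0 < B -> (0 < L)%N -> (forall A, A \in s -> wvar T (Bx A) (fun x => v x A)) ->
  \sum_(A <- s) Bx A <= B ->
  exists V : nat -> R -> freq -> R[i],
    [/\ forall n, stepd T s (3 * (L ^ n) ^ 3) (16 * B * L%:R ^+ 2 / ((L ^ n)%N)%:R ^+ 2) (V n),
     forall n A, cbm (DT T) (fun x => V n x A),
     forall n x A, 0 <= x < T -> V n x A != 0 -> exists y, 0 <= y < T /\ v y A != 0 &
     forall x, 0 <= x < T -> n2 s (fun A => v x A - \sum_(n < m.+1) V n x A)
       <= 4 * (B / ((L ^ m)%N)%:R ^+ 2)].
Proof.
move=> B0 L0 wv sB; have Ln n : (0 < L ^ n)%N by rewrite expn_gt0 L0.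
have ap n := step_approx B0 (Ln n) wv sB.
have [l hl] := choice ap; have [rep {}hl] := choice hl.
pose p n x := v (rep n (l n x)).
pose V n x A := if n is n'.+1 then p n x A - p n' x A else p 0%N x A.
have pT n x : 0 <= x < T -> 0 <= rep n (l n x) < T by have [_ _ h _] := hl n; exact: h.
have LnR n : 0 < ((L ^ n)%N)%:R :> R by rewrite ltr0n.
have LR : 0 < L%:R :> R by rewrite ltr0n.
have L1 : 1 <= L%:R :> R by rewrite ler1n.
have eE n : 16 * B * L%:R ^+ 2 / ((L ^ n.+1)%N)%:R ^+ 2 = 16 * (B / ((L ^ n)%N)%:R ^+ 2).
  by rewrite expnS natrM; field; rewrite !lt0r_neq0.
have small n : B / ((L ^ n.+1)%N)%:R ^+ 2 <= B / ((L ^ n)%N)%:R ^+ 2.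
  rewrite ler_pM2l // lef_pV2 ?posrE ?exprn_gt0 // lerXn2r ?nnegrE ?ler0n // ler_nat.
  by rewrite expnS leq_pmull.
exists V; split.
- case=> [|n].
    have [lN lm _ _] := hl 0%N; apply: (stepdP (l := l 0%N)).
    + by rewrite divr_ge0 ?mulr_ge0 ?exprn_ge0 ?ler0n // ltW.
    + by move=> x; apply: leq_ltn_trans (lN x) _; rewrite expn0 exp1n.
    + by move=> x y _ _ e; rewrite /V /p e.
    + move=> x xT; apply: le_trans (_ : _ <= B) _.
        apply: le_trans sB; rewrite /n2 big_seq [leRHS]big_seq; apply: ler_sum => A As.
        by apply: (wv A As).1; exact: pT.
      rewrite expn0 expr1n divr1 -mulrA mulrCA ler_peMr ?(ltW B0) //.
      apply: le_trans (_ : 1 <= L%:R ^+ 2) _; first by rewrite exprn_ege1.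
      by rewrite ler_peMl ?exprn_ge0 ?ler0n // ler1n.
  have [lN lm _ h1] := hl n.+1; have [lN' lm' _ h2] := hl n.
  apply: (stepdP (l := fun x => (l n.+1 x + l n x)%N)).
  + by rewrite divr_ge0 ?mulr_ge0 ?exprn_ge0 ?ler0n // ltW.
  + move=> x; have := lN x; have := lN' x; have : (L ^ n <= L ^ n.+1)%N by rewrite expnS leq_pmull.
    move: (Ln n.+1); move: (L ^ n.+1)%N (L ^ n)%N (l n.+1 x) (l n x) => a b c d a0 ba cb db.
    have : (b ^ 3 <= a ^ 3)%N by rewrite leq_exp2r.
    have : (0 < a ^ 3)%N by rewrite expn_gt0 a0.
    by lia.
  (* Both labels are monotone, so their sum determines each of them: the numbers of pieces add up
     instead of being multiplied. *)
  + move=> x y _ _ e; have [e1 e2] : l n.+1 x = l n.+1 y /\ l n x = l n y.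
      case: (leP x y) => [xy|/ltW xy]; have := lm _ _ xy; have := lm' _ _ xy; lia.
    by rewrite /V /p e1 e2.
  + move=> x xT; rewrite eE; have {h1} := h1 x xT; have {h2} := h2 x xT; rewrite -/(p n x) -/(p n.+1 x).
    have -> : n2 s (V n.+1 x) = n2 s (fun A => (v x A - p n x A) - (v x A - p n.+1 x A)).
      by apply: eq_bigr => A _; congr (normc _ ^+ 2); rewrite /V; ring.
    move=> h2 h1; apply: le_trans (n2B _ _ _) _; have := small n; lra.
- have pb n A : cbm (DT T) (fun x => p n x A).
    have [lN lm _ _] := hl n; exact: (@label_cbm T (l n) _ (fun a => v (rep n a) A) lN lm).
  case=> [|n] A; first exact: pb.
  apply: cbm_eq (_ : cbm _ (fun x => p n.+1 x A + (- 1) * p n x A)).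
    by move=> x _; rewrite mulN1r.
  by apply: cbmD => //; apply: cbmM => //; exact: cbm_cst.
- have pn n x A : 0 <= x < T -> p n x A != 0 -> exists y, 0 <= y < T /\ v y A != 0.
    by move=> xT h; exists (rep n (l n x)); split=> //; exact: pT.
  case=> [|n] x A xT; first exact: pn.
  rewrite /V; have [->|h _] := eqVneq (p n x A) 0; last exact: pn h.
  by rewrite subr0; exact: pn.
- move=> x xT; have -> : n2 s (fun A => v x A - \sum_(n < m.+1) V n x A) = n2 s (fun A => v x A - p m x A).
    apply: eq_bigr => A _; congr (normc (_ - _) ^+ 2).
    elim: m => [|m IH]; first by rewrite big_ord_recl big_ord0 addr0.
    by rewrite big_ord_recr /= IH /V addrC subrK.
  by have [_ _ _ h] := hl m; exact: h.
Qed.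

End Labels.

(** * From free waves to functions of bounded variation *)

Section BilinearBound.
Context {R : realType}.
Local Notation mu := (@lebesgue_measure R).
Local Notation DT T := (`[0, T[%classic : set R).
Local Notation T2 := (`[0, 2 * pi[%classic : set R).

Lemma HDl s (f g h : freq -> R[i]) : H s (fun A => f A + g A) h <= 2 * H s f h + 2 * H s g h.
Proof.
rewrite /H !mulr_sumr -big_split /=; apply: ler_sum => k _.
apply: le_trans (sqr_normcD _ _); rewrite /conv -big_split /= le_eqVlt; apply/orP; left; apply/eqP.
by congr (normc _ ^+ 2); apply: eq_bigr => y _; rewrite mulrDl.
Qed.

Lemma HDr s (f g h : freq -> R[i]) : H s h (fun A => f A + g A) <= 2 * H s h f + 2 * H s h g.
Proof.
rewrite /H !mulr_sumr -big_split /=; apply: ler_sum => k _.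
apply: le_trans (sqr_normcD _ _); rewrite /conv -big_split /= le_eqVlt; apply/orP; left; apply/eqP.
by congr (normc _ ^+ 2); apply: eq_bigr => y _; rewrite mulrDr.
Qed.

Lemma n2_free s (V : freq -> R[i]) t : n2 s (free V t) = n2 s V.
Proof. by apply: eq_bigr => A _; rewrite /free normcM normc_expi mul1r. Qed.

Lemma eq_H s (f f' h h' : freq -> R[i]) : f =1 f' -> h =1 h' -> H s f h = H s f' h'.
Proof. by move=> /funext -> /funext ->. Qed.

Lemma Rint_subset (f : R -> R) (T : R) : T <= 2 * pi -> bm T2 f -> (forall x, 0 <= f x) ->
  Rintegral mu (DT T) f <= Rintegral mu T2 f.
Proof.
move=> TT bf f0; have mD : measurable (DT T) := measurable_itv _.
have mT : measurable T2 := measurable_itv _.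
have sub : DT T `<=` T2.
  by move=> x; rewrite /= !in_itv /= => /andP[-> xT]; rewrite (lt_le_trans xT).
have i2 := bm_integrable (m := mu) mT (lebesgue_itv_finite _ _) bf.
have i1 : mu.-integrable (DT T) (EFin \o f) by apply: integrableS i2.
rewrite /Rintegral fine_le ?integrable_fin_num //.
apply: ge0_subset_integral => //; last by move=> x _; rewrite lee_fin.
exact: measurable_int i2.
Qed.

Lemma bm_H_free s (V W : R -> freq -> R[i]) (D : set R) : measurable D ->
  (forall A, cbm D (fun x => V x A)) -> (forall A, cbm D (fun x => W x A)) ->
  bm D (fun t => H s (free (V t) t) (free (W t) t)).
Proof.
move=> mD bV bW; apply: bm_H => A; rewrite /free; apply: cbmM => //;
  by have := expi_bm (- sqnorm A) mD; under eq_fun do rewrite mulrN.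
Qed.

Lemma pi2_ge1 : 1 <= 2 * pi :> R.
Proof. by have := @pi_ge2 R; lra. Qed.

(** Each pair of values is extended to free waves on a whole period, at the cost of one term for
    each of the [N N'] pairs of pieces. *)
Lemma int_H_step T s (N N' : nat) (e e' Q : R) (V W : R -> freq -> R[i]) (P P' : freq -> Prop) :
  T <= 1 -> stepd T s N e V -> stepd T s N' e' W ->
  (forall A, cbm (DT T) (fun x => V x A)) -> (forall A, cbm (DT T) (fun x => W x A)) ->
  (forall x A, 0 <= x < T -> V x A != 0 -> P A) -> (forall x A, 0 <= x < T -> W x A != 0 -> P' A) ->
  (forall V0 W0 : freq -> R[i], (forall A, V0 A != 0 -> P A) -> (forall A, W0 A != 0 -> P' A) ->
    n2 s V0 <= e -> n2 s W0 <= e' ->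
    S4 s PT (fun A => normc (V0 A)) (fun A => normc (V0 A)) (fun A => normc (W0 A)) (fun A => normc (W0 A)) <= Q) ->
  Rintegral mu (DT T) (fun t => H s (free (V t) t) (free (W t) t)) <= N%:R * N'%:R * (2 * pi * Q).
Proof.
move=> T1 [l [Vr [lN Ve Vs]]] [l' [Wr [lN' We Ws]]] bV bW PV PW S.
have mD : measurable (DT T) := measurable_itv _.
have fD : (mu (DT T) < +oo)%E := lebesgue_itv_finite _ _.
have mT : measurable T2 := measurable_itv _.
have fT : (mu T2 < +oo)%E := lebesgue_itv_finite _ _.
pose h (a b : nat) t : R := H s (free (Vr a) t) (free (Wr b) t).
have bh (D : set R) a b : measurable D -> bm D (h a b).
  by move=> mD'; apply: (bm_H_free s (V := fun _ => Vr a) (W := fun _ => Wr b)) => // A; exact: cbm_cst.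
apply: le_trans (_ : _ <= Rintegral mu (DT T) (fun t => \sum_(a < N) \sum_(b < N') h a b t)) _.
  apply: (bm_int_le (m := mu) mD fD).
  - exact: bm_H_free.
  - by apply: bm_sum => a _; apply: bm_sum => b _; exact: bh.
  move=> t; rewrite /= in_itv /= => tT; have [la ->] := lN t tT; have [lb ->] := lN' t tT.
  rewrite (bigD1 (Ordinal la)) //= (bigD1 (Ordinal lb)) //= -addrA lerDl addr_ge0 ?sumr_ge0 // => a _.
    exact: H_ge0.
  by apply: sumr_ge0 => b _; exact: H_ge0.
rewrite (bm_int_sum (m := mu) mD fD); last by move=> a _; apply: bm_sum => b _; exact: bh.
rewrite -mulrA -[N in leRHS]card_ord mulr_natl -sumr_const; apply: ler_sum => a _.
rewrite (bm_int_sum (m := mu) mD fD); last by move=> b _; exact: bh.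
rewrite -[N' in leRHS]card_ord mulr_natl -sumr_const; apply: ler_sum => b _.
apply: le_trans (_ : _ <= Rintegral mu T2 (h a b)) _.
  apply: Rint_subset; [exact: le_trans T1 pi2_ge1|exact: bh|by move=> x; exact: H_ge0].
apply: le_trans (int_H_free _ _ _) _; rewrite ler_pM2l ?pi2_gt0 //; apply: S => // [A|A].
- by move=> /Vs [x [xT]]; exact: PV.
- by move=> /Ws [x [xT]]; exact: PW.
Qed.

(** Both factors take their values on the same pieces, so [N] terms occur instead of [N^2]. This is
    what gives decay at high levels. *)
Lemma int_H_step_diag T s (N : nat) (e Q : R) (V : R -> freq -> R[i]) (P : freq -> Prop) :
  T <= 1 -> stepd T s N e V ->
  (forall A, cbm (DT T) (fun x => V x A)) ->
  (forall x A, 0 <= x < T -> V x A != 0 -> P A) ->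
  (forall V0 : freq -> R[i], (forall A, V0 A != 0 -> P A) -> n2 s V0 <= e ->
    S4 s PT (fun A => normc (V0 A)) (fun A => normc (V0 A)) (fun A => normc (V0 A)) (fun A => normc (V0 A)) <= Q) ->
  Rintegral mu (DT T) (fun t => H s (free (V t) t) (free (V t) t)) <= N%:R * (2 * pi * Q).
Proof.
move=> T1 [l [Vr [lN Ve Vs]]] bV PV S.
have mD : measurable (DT T) := measurable_itv _.
have fD : (mu (DT T) < +oo)%E := lebesgue_itv_finite _ _.
have mT : measurable T2 := measurable_itv _.
pose h (a : nat) t : R := H s (free (Vr a) t) (free (Vr a) t).
have bh (D : set R) a : measurable D -> bm D (h a).
  by move=> mD'; apply: (bm_H_free s (V := fun _ => Vr a) (W := fun _ => Vr a)) => // A; exact: cbm_cst.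
apply: le_trans (_ : _ <= Rintegral mu (DT T) (fun t => \sum_(a < N) h a t)) _.
  apply: (bm_int_le (m := mu) mD fD).
  - exact: bm_H_free.
  - by apply: bm_sum => a _; exact: bh.
  move=> t; rewrite /= in_itv /= => tT; have [la ->] := lN t tT.
  by rewrite (bigD1 (Ordinal la)) //= lerDl sumr_ge0 // => a _; exact: H_ge0.
rewrite (bm_int_sum (m := mu) mD fD); last by move=> a _; exact: bh.
rewrite -[N in leRHS]card_ord mulr_natl -sumr_const; apply: ler_sum => a _.
apply: le_trans (_ : _ <= Rintegral mu T2 (h a)) _.
  apply: Rint_subset; [exact: le_trans T1 pi2_ge1|exact: bh|by move=> x; exact: H_ge0].
apply: le_trans (int_H_free _ _ _) _; rewrite ler_pM2l ?pi2_gt0 //; apply: S => // A.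
by move=> /Vs [x [xT]]; exact: PV.
Qed.

(** Interpolation between a bound with the gain [th^4] that grows in [Y] and one without gain that
    decays: if [x Y > K th], the second gives [th Y^3 < 1], and then the first contradicts the
    assumption. *)
Lemma min_powers (x K th Y : R) : 0 <= K -> 0 < th -> 0 < Y ->
  x <= K * (th ^+ 4 * Y ^+ 8) -> x * Y ^+ 4 <= K -> x * Y <= K * th.
Proof.
move=> K0 t0 Y0 h1 h2; case: (leP (x * Y) (K * th)) => // h3.
have [K00|K1] := eqVneq K 0.
  by move: h1 h3; rewrite K00 !mul0r => h1; rewrite ltNge => /negP[]; exact: mulr_le0_ge0 h1 (ltW Y0).
have {}K0 : 0 < K by rewrite lt_neqAle eq_sym K1.
have h4 : th * Y ^+ 3 < 1.
  rewrite -(ltr_pM2l K0) mulr1; apply: lt_le_trans h2.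
  have -> : x * Y ^+ 4 = x * Y * Y ^+ 3 by ring.
  by rewrite mulrA ltr_pM2r ?exprn_gt0.
have h5 : (th * Y ^+ 3) ^+ 3 <= 1 by rewrite exprn_ile1 ?mulr_ge0 ?exprn_ge0 // ltW.
have h6 : x * Y <= K * (th * (th * Y ^+ 3) ^+ 3).
  apply: le_trans (_ : _ <= K * (th ^+ 4 * Y ^+ 8) * Y) _; first by rewrite ler_pM2r.
  by rewrite le_eqVlt; apply/orP; left; apply/eqP; ring.
have h7 : K * (th * (th * Y ^+ 3) ^+ 3) <= K * th by rewrite ler_pM2l // ler_piMr // ltW.
by have := le_trans h6 h7; rewrite leNgt h3.
Qed.

Lemma fine_itv_le1 T : T <= 1 -> fine (mu (DT T)) <= 1.
Proof.
move=> T1; have [T0|T0] := ltP T 0; last by rewrite fine_itv // subr0.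
by rewrite lebesgue_measure_itv /= lte_fin ltNge (ltW T0).
Qed.

Lemma geo_half m : \sum_(n < m) (2 ^- n : R) <= 2.
Proof.
suff -> : \sum_(n < m) (2 ^- n : R) = 2 - 2 * 2 ^- m.
  by rewrite lerBlDr lerDl mulr_ge0 // invr_ge0 exprn_ge0.
elim: m => [|m IH]; first by rewrite big_ord0 expr0 invr1 mulr1 subrr.
rewrite big_ord_recr /= IH exprS invfM; set y := 2 ^- m.
by field.
Qed.

(** [G] is the rectangle constant and [th^4] the gain for the mixed form. Level [n] has about
    [L^(3n)] pieces of squared size [L^(-2n)]. Pairing all pieces of levels [n] and [n'] keeps the
    gain but grows like [L^(n+n')]; the mean of the diagonal terms has no gain but decays like
    [L^(-(n+n')/2)]. [min_powers] combines the two into a geometric double series. *)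
Lemma bilinear_bound : exists C : R, 0 < C /\
  forall T s (v w : R -> freq -> R[i]) (Bv Bw : freq -> R) (B B' G th : R),
  T <= 1 -> uniq s -> 0 < B -> 0 < B' -> 0 <= G -> 0 < th ->
  (forall A, A \in s -> wvar T (Bv A) (fun x => v x A)) ->
  (forall A, A \in s -> wvar T (Bw A) (fun x => w x A)) ->
  (forall A, A \notin s -> forall x, v x A = 0) -> (forall A, A \notin s -> forall x, w x A = 0) ->
  \sum_(A <- s) Bv A <= B -> \sum_(A <- s) Bw A <= B' ->
  (forall (V W : freq -> R[i]) (e e' : R), 0 <= e -> 0 <= e' ->
    (forall A, V A != 0 -> exists x, 0 <= x < T /\ v x A != 0) ->
    (forall A, W A != 0 -> exists x, 0 <= x < T /\ w x A != 0) ->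
    n2 s V <= e -> n2 s W <= e' ->
    [/\ S4 s PT (fun A => normc (V A)) (fun A => normc (V A)) (fun A => normc (W A)) (fun A => normc (W A))
        <= G * th ^+ 4 * (e * e'),
     S4 s PT (fun A => normc (V A)) (fun A => normc (V A)) (fun A => normc (V A)) (fun A => normc (V A))
        <= G * e ^+ 2 &
     S4 s PT (fun A => normc (W A)) (fun A => normc (W A)) (fun A => normc (W A)) (fun A => normc (W A))
        <= G * e' ^+ 2]) ->
  Rintegral mu (DT T) (fun t => H s (free (v t) t) (free (w t) t)) <= C * G * th * (B * B').
Proof.
have [q [q1 qE]] : exists q : nat, (1 < q)%N /\ q%:R = 4 ^+ 4 :> R.
  by exists 256%N; split=> //; ring.
(* [L = 4^8], so that [L^n] is the eighth and its square root the fourth power of [4^n], as in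
   [min_powers]. *)
pose L := (q ^ 2)%N; have L1 : (1 < L)%N by rewrite /L -mulnn; exact: leq_trans q1 (leq_pmulr q (ltnW q1)).
have L0 : (0 < L)%N := ltnW L1.
have LR0 : 0 < L%:R :> R by rewrite ltr0n.
pose c1 : R := 2 * pi * (3 * 16 * L%:R ^+ 2) ^+ 2.
have c10 : 0 < c1 by rewrite mulr_gt0 ?pi2_gt0 // exprn_gt0 // !mulr_gt0 ?exprn_gt0.
exists (64 * c1); split; first by rewrite mulr_gt0.
move=> T s v w Bv Bw B B' G th T1 us B0 B'0 G0 th0 wv ww v0 w0 sB sB' S.
have mD : measurable (DT T) := measurable_itv _.
have fD : (mu (DT T) < +oo)%E := lebesgue_itv_finite _ _.
have cb (u : R -> freq -> R[i]) (Bu : freq -> R) :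
    (forall A, A \in s -> wvar T (Bu A) (fun x => u x A)) ->
    (forall A, A \notin s -> forall x, u x A = 0) -> forall A, cbm (DT T) (fun x => u x A).
  move=> wu u0 A; have [As|As] := boolP (A \in s); first exact: wvar_cbm (wu A As).
  by apply: cbm_eq (cbm_cst _ 0) => x _; rewrite u0.
have cv := cb _ _ wv v0; have cw := cb _ _ ww w0.
pose HI f h := Rintegral mu (DT T) (fun t => H s (free (f t) t) (free (h t) t)).
(* The remainder after level [m] is of order [L^(-2m)], with a constant depending on [s]; it
   disappears because [m] is arbitrary. *)
suff key m : HI v w <= 64 * c1 * G * th * (B * B') + 168 * (size s)%:R * (B * B') / ((L ^ m)%N)%:R ^+ 2.
  rewrite -/(HI v w) leNgt; apply/negP => gt.
  set a := 64 * c1 * G * th * (B * B') in gt key; set b := 168 * (size s)%:R * (B * B') in key.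
  have b0 : 0 <= b by rewrite !mulr_ge0 ?ler0n ?(ltW B0) ?(ltW B'0).
  have d0 : 0 < HI v w - a by rewrite subr_gt0.
  pose m := Num.Def.truncn (b / (HI v w - a)).
  have hm : b / (HI v w - a) < m.+1%:R.
    by have := @truncnS_gt R (b / (HI v w - a)).
  have Lm : m.+1%:R <= ((L ^ m)%N)%:R ^+ 2 :> R.
    have : (m.+1 <= L ^ m)%N by exact: ltn_expl.
    rewrite -(ler_nat R) => /le_trans; apply; rewrite expr2 ler_peMr ?ler0n // ler1n expn_gt0 L0 //.
  have Lm0 : 0 < ((L ^ m)%N)%:R ^+ 2 :> R by rewrite exprn_gt0 // ltr0n expn_gt0 L0.
  have k1 : (HI v w - a) * ((L ^ m)%N)%:R ^+ 2 <= b.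
    by rewrite -ler_pdivlMr // lerBlDl; exact: key.
  rewrite ltr_pdivrMr // in hm; have := le_lt_trans k1 hm.
  by rewrite mulrC ltr_pM2r // ltNge Lm.
have [V [sV cV pV rV]] := level_decomposition m B0 L0 wv sB.
have [W [sW cW pW rW]] := level_decomposition m B'0 L0 ww sB'.
pose VN t A := \sum_(n < m.+1) V n t A; pose WN t A := \sum_(n < m.+1) W n t A.
have cVN A : cbm (DT T) (fun x => VN x A) by apply: cbm_sum => n _; exact: cV.
have cWN A : cbm (DT T) (fun x => WN x A) by apply: cbm_sum => n _; exact: cW.
have LE n : ((L ^ n)%N)%:R = (4 ^+ n) ^+ 8 :> R.
  have ee (x : R) : ((x ^+ 4) ^+ 2) ^+ n = (x ^+ n) ^+ 8.
    by rewrite -!exprM mulnA [(n * 8)%N]mulnC.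
  by rewrite natrX natrX qE ee.
have y0 n : 0 < 4 ^+ n :> R by rewrite exprn_gt0.
have NE n : ((3 * (L ^ n) ^ 3)%N)%:R = 3 * ((4 ^+ n) ^+ 8) ^+ 3 :> R by rewrite natrM natrX LE.
have piR : 0 < 2 * pi :> R := pi2_gt0.
have K0 : 0 <= c1 * G * (B * B').
  by apply: mulr_ge0; apply: mulr_ge0 => //; exact: ltW.
pose P A := exists x, 0 <= x < T /\ v x A != 0; pose P' A := exists x, 0 <= x < T /\ w x A != 0.
have eP (b : R) n : 0 < b -> 0 <= 16 * b * L%:R ^+ 2 / ((L ^ n)%N)%:R ^+ 2.
  by move=> b0; rewrite divr_ge0 ?mulr_ge0 ?exprn_ge0 ?ler0n // ltW.
have n20 e : 0 <= e -> n2 s (fun _ => 0 : R[i]) <= e.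
  by move=> e0; rewrite /n2 big1 // => A _; rewrite normc0 expr0n.
have level n n' : HI (V n) (W n') * (4 ^+ n * 4 ^+ n') <= c1 * G * (B * B') * th.
  have [y0n y0n'] := (y0 n, y0 n').
  apply: (min_powers K0 th0 (mulr_gt0 y0n y0n')).
    apply: le_trans (@int_H_step T s _ _ _ _ _ _ _ P P' T1 (sV n) (sW n') (cV n) (cW n') (pV n) (pW n')
      (fun V0 W0 PV0 PW0 e1 e2 => let: And3 h _ _ := S V0 W0 _ _ (eP _ n B0) (eP _ n' B'0) PV0 PW0 e1 e2 in h)) _.
    rewrite !NE !LE /c1; move: (4 ^+ n) (4 ^+ n') y0n y0n' => y y' y1 y1'.
    rewrite le_eqVlt; apply/orP; left; apply/eqP.
    move: L%:R pi => l p; field; by rewrite !lt0r_neq0.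
  (* This value balances the diagonal terms, which are of order [B^2 L^(-n)] and [B'^2 L^(-n')]. *)
  pose l : R := B' / B * (4 ^+ n / 4 ^+ n') ^+ 4.
  have l0 : 0 < l by rewrite /l mulr_gt0 ?exprn_gt0 ?divr_gt0.
  have bVV : bm (DT T) (fun t => H s (free (V n t) t) (free (V n t) t)) by exact: bm_H_free.
  have bWW : bm (DT T) (fun t => H s (free (W n' t) t) (free (W n' t) t)) by exact: bm_H_free.
  have bVW : bm (DT T) (fun t => H s (free (V n t) t) (free (W n' t) t)) by exact: bm_H_free.
  have h1 := @int_H_step_diag T s _ _ _ _ P T1 (sV n) (cV n) (pV n)
      (fun V0 PV0 e1 => let: And3 _ h _ := S V0 (fun=> 0) _ 0 (eP _ n B0) (lexx _) PV0
        (fun A h0 => False_rect _ (negP h0 (eqxx _))) e1 (n20 0 (lexx 0)) in h).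
  have h2 := @int_H_step_diag T s _ _ _ _ P' T1 (sW n') (cW n') (pW n')
      (fun W0 PW0 e1 => let: And3 _ _ h := S (fun=> 0) W0 0 _ (lexx _) (eP _ n' B'0)
        (fun A h0 => False_rect _ (negP h0 (eqxx _))) PW0 (n20 0 (lexx 0)) e1 in h).
  have h3 : HI (V n) (W n') <= 2^-1 * (l * HI (V n) (V n) + l^-1 * HI (W n') (W n')).
    have bZ (c : R) (f : R -> R) : bm (DT T) f -> bm (DT T) (fun x => c * f x) by move=> bf; apply: bmM => //; exact: bm_cst.
    rewrite /HI -(bm_intZ (m := mu) mD fD _ bVV) -(bm_intZ (m := mu) mD fD _ bWW).
    rewrite -(bm_intD (m := mu) mD fD (bZ _ _ bVV) (bZ _ _ bWW)).
    rewrite -(bm_intZ (m := mu) mD fD _ (bmD (bZ _ _ bVV) (bZ _ _ bWW))).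
    apply: (bm_int_le (m := mu) mD fD bVW (bZ _ _ (bmD (bZ _ _ bVV) (bZ _ _ bWW)))) => t _.
    exact: H_le_mean.
  apply: le_trans (_ : _ <= 3^-1 * (c1 * G * (B * B'))) _; last by rewrite ler_piMl // invf_le1 // ler1n.
  rewrite -ler_pdivlMr ?exprn_gt0 ?mulr_gt0 //; apply: le_trans h3 _.
  apply: le_trans (_ : _ <= 2^-1 * (l * (3 * ((4 ^+ n) ^+ 8) ^+ 3 * (2 * pi * (G * (16 * B * L%:R ^+ 2 / ((4 ^+ n) ^+ 8) ^+ 2) ^+ 2)))
     + l^-1 * (3 * ((4 ^+ n') ^+ 8) ^+ 3 * (2 * pi * (G * (16 * B' * L%:R ^+ 2 / ((4 ^+ n') ^+ 8) ^+ 2) ^+ 2))))) _.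
    rewrite ler_pM2l ?invr_gt0 // lerD // ler_pM2l ?invr_gt0 //.
      by move: h1; rewrite NE LE.
    by move: h2; rewrite NE LE.
  rewrite /l /c1; move: (4 ^+ n) (4 ^+ n') y0n y0n' => y y' y1 y1'.
  rewrite le_eqVlt; apply/orP; left; apply/eqP.
  move: L%:R pi => l1 p; field; by rewrite !lt0r_neq0.
have main : HI VN WN <= 16 * (c1 * G * (B * B') * th).
  (* The bound for a pair of levels is of the order of the square of this weight: one power makes up
     for the inverse weight of Cauchy-Schwarz, the other is summed. *)
  pose wt (x : 'I_m.+1 * 'I_m.+1) : R := 2 ^- x.1 * 2 ^- x.2.
  have wt0 x : 0 < wt x by rewrite mulr_gt0 // invr_gt0 exprn_gt0.
  have swt : \sum_(i < m.+1) \sum_(j < m.+1) wt (i, j) <= 4.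
    have -> : \sum_(i < m.+1) \sum_(j < m.+1) wt (i, j) = (\sum_(i < m.+1) 2 ^- i) * (\sum_(i < m.+1) 2 ^- i).
      by rewrite mulr_suml; apply: eq_bigr => i _; rewrite mulr_sumr.
    have -> : 4 = 2 * 2 :> R by ring.
    have g0 : 0 <= \sum_(i < m.+1) (2 ^- i : R) by apply: sumr_ge0 => i _; rewrite invr_ge0 exprn_ge0.
    by apply: ler_pM => //; exact: geo_half.
  have bij i j : bm (DT T) (fun t => (wt (i, j))^-1 * H s (free (V i t) t) (free (W j t) t)).
    by apply: bmM; [exact: bm_cst|exact: bm_H_free].
  apply: le_trans (_ : _ <= Rintegral mu (DT T) (fun t => 4 * \sum_(i < m.+1) \sum_(j < m.+1)
     (wt (i, j))^-1 * H s (free (V i t) t) (free (W j t) t))) _.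
    apply: (bm_int_le (m := mu) mD fD); first exact: bm_H_free.
      by apply: bmM; [exact: bm_cst|apply: bm_sum => i _; apply: bm_sum => j _; exact: bij].
    move=> t _; apply: le_trans (_ : _ <= H s (fun A => \sum_(i < m.+1) free (V i t) t A)
        (fun A => \sum_(i < m.+1) free (W i t) t A)) _.
      rewrite (@eq_H s _ (fun A => \sum_(i < m.+1) free (V i t) t A) _ (fun A => \sum_(i < m.+1) free (W i t) t A)) // => A;
        by rewrite /free mulr_sumr.
    apply: le_trans (H_sum_weight _ _ _ (fun i => free (V (nat_of_ord i) t) t) (fun i => free (W (nat_of_ord i) t) t) wt0) _.
    apply: ler_wpM2r swt; apply: sumr_ge0 => i _; apply: sumr_ge0 => j _.
    by rewrite mulr_ge0 ?H_ge0 // invr_ge0 ltW.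
  rewrite (bm_intZ (m := mu) mD fD); last by apply: bm_sum => i _; apply: bm_sum => j _; exact: bij.
  rewrite (bm_int_sum (m := mu) mD fD); last by move=> i _; apply: bm_sum => j _; exact: bij.
  have -> : 16 = 4 * 4 :> R by ring.
  rewrite -mulrA ler_pM2l //.
  apply: le_trans (_ : _ <= (\sum_(i < m.+1) \sum_(j < m.+1) wt (i, j)) * (c1 * G * (B * B') * th)) _; last first.
    by apply: ler_wpM2r swt; rewrite mulr_ge0 // ltW.
  rewrite mulr_suml; apply: ler_sum => i _.
  rewrite (bm_int_sum (m := mu) mD fD); last by move=> j _; exact: bij.
  rewrite mulr_suml; apply: ler_sum => j _; rewrite (bm_intZ (m := mu) mD fD); last exact: bm_H_free.
  rewrite ler_pdivrMl //; apply: le_trans (_ : _ <= c1 * G * (B * B') * th / (4 ^+ i * 4 ^+ j)) _.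
    by rewrite ler_pdivlMr ?mulr_gt0 //; exact: level.
  rewrite le_eqVlt; apply/orP; left; apply/eqP; rewrite /wt /=.
  have -> : 4 = 2 ^+ 2 :> R by ring.
  rewrite -!exprM ![(2 * _)%N]mulnC !exprM.
  have : 2 ^+ i != 0 :> R by rewrite lt0r_neq0 ?exprn_gt0.
  have : 2 ^+ j != 0 :> R by rewrite lt0r_neq0 ?exprn_gt0.
  by move: (2 ^+ i) (2 ^+ j) => a b a0 b0; field; rewrite a0 b0.
pose rv t A := v t A - VN t A; pose rw t A := w t A - WN t A.
have ns (f h : freq -> R[i]) : H s f h <= (size s)%:R * (n2 s f * n2 s h) by apply: (H_trivial f us us) => A As _.
pose Kr : R := 168 * (size s)%:R * (B * B') / ((L ^ m)%N)%:R ^+ 2.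
have Kr0 : 0 <= Kr by rewrite /Kr divr_ge0 ?exprn_ge0 // !mulr_ge0 ?ler0n // ltW.
have pt t : 0 <= t < T -> H s (free (v t) t) (free (w t) t) <= 4 * H s (free (VN t) t) (free (WN t) t) + Kr.
  move=> tT; have e1 : free (v t) t =1 (fun A => free (VN t) t A + free (rv t) t A).
    by move=> A; rewrite /free -mulrDr /rv; congr (_ * _); ring.
  have e2 : free (w t) t =1 (fun A => free (WN t) t A + free (rw t) t A).
    by move=> A; rewrite /free -mulrDr /rw; congr (_ * _); ring.
  have d0 : 0 < ((L ^ m)%N)%:R ^+ 2 :> R by rewrite exprn_gt0 // ltr0n expn_gt0 L0.
  have d1 : 1 <= ((L ^ m)%N)%:R ^+ 2 :> R by rewrite exprn_ege1 // ler1n expn_gt0 L0.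
  have nv : n2 s (v t) <= B.
    by apply: le_trans sB; rewrite /n2 big_seq [leRHS]big_seq; apply: ler_sum => A As; exact: (wv A As).1.
  have nw : n2 s (w t) <= B'.
    by apply: le_trans sB'; rewrite /n2 big_seq [leRHS]big_seq; apply: ler_sum => A As; exact: (ww A As).1.
  have nrv : n2 s (rv t) <= 4 * (B / ((L ^ m)%N)%:R ^+ 2) by exact: rV.
  have nrw : n2 s (rw t) <= 4 * (B' / ((L ^ m)%N)%:R ^+ 2) by exact: rW.
  have nVN : n2 s (VN t) <= 10 * B.
    have -> : n2 s (VN t) = n2 s (fun A => v t A - rv t A).
      by apply: eq_bigr => A _; congr (normc _ ^+ 2); rewrite /rv; ring.
    apply: le_trans (n2B _ _ _) _.
    have : B / ((L ^ m)%N)%:R ^+ 2 <= B by rewrite ler_pdivrMr // ler_peMr // ltW.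
    by move: nv nrv; lra.
  rewrite (eq_H s e1 (frefl (free (w t) t))); apply: le_trans (HDl _ _ _ _) _.
  rewrite (eq_H s (frefl (free (VN t) t)) e2).
  have h1 := HDr s (free (WN t) t) (free (rw t) t) (free (VN t) t).
  have h2 := ns (free (rv t) t) (free (w t) t); have h3 := ns (free (VN t) t) (free (rw t) t).
  rewrite !n2_free in h2 h3.
  have h4 : n2 s (rv t) * n2 s (w t) <= 4 * (B / ((L ^ m)%N)%:R ^+ 2) * B' by apply: ler_pM => //; exact: n2_ge0.
  have h5 : n2 s (VN t) * n2 s (rw t) <= 10 * B * (4 * (B' / ((L ^ m)%N)%:R ^+ 2)).
    by apply: ler_pM => //; exact: n2_ge0.
  have s0 : 0 <= (size s)%:R :> R by [].
  have h6 := ler_wpM2l s0 h4; have h7 := ler_wpM2l s0 h5.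
  have e6 : (size s)%:R * (4 * (B / ((L ^ m)%N)%:R ^+ 2) * B') * 2 + (size s)%:R * (10 * B * (4 * (B' / ((L ^ m)%N)%:R ^+ 2))) * 4 = Kr.
    by rewrite /Kr; ring.
  rewrite -e6; move: h1 h2 h3 h6 h7; move: (H s _ _) (H s _ _) (H s _ _) (H s _ _) => a1 a2 a3 a4.
  by move: ((size s)%:R * _) ((size s)%:R * _) ((size s)%:R * _) ((size s)%:R * _) => *; lra.
have bH4 : bm (DT T) (fun t => 4 * H s (free (VN t) t) (free (WN t) t)).
  by apply: bmM; [exact: bm_cst|exact: bm_H_free].
apply: le_trans (_ : _ <= Rintegral mu (DT T) (fun t => 4 * H s (free (VN t) t) (free (WN t) t) + Kr)) _.
  apply: (bm_int_le (m := mu) mD fD); first exact: bm_H_free.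
    by apply: bmD => //; exact: bm_cst.
  by move=> t; rewrite /= in_itv /=; exact: pt.
rewrite (bm_intD (m := mu) mD fD) //; last exact: bm_cst.
rewrite (bm_intZ (m := mu) mD fD); last exact: bm_H_free.
rewrite (bm_int_cst mu mD) lerD //.
  apply: le_trans (_ : _ <= 4 * (16 * (c1 * G * (B * B') * th))) _; first by rewrite ler_pM2l.
  by rewrite le_eqVlt; apply/orP; left; apply/eqP; ring.
by rewrite ler_piMr // fine_itv_le1.
Qed.

End BilinearBound.

(** * Bilinear estimates for dyadic blocks *)

Section BlockBound.
Context {R : realType}.
Local Notation mu := (@lebesgue_measure R).
Local Notation DT T := (`[0, T[%classic : set R).
Local Notation nrm V := (fun A => normc (V A)).

(** Level 0 consists of the frequency 0; for [k > 0], level [k] is [2^(k-1) <= sup4 A < 2^k]. *)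
Definition lev (A : freq) : nat := up_log 2 (sup4 A).+1.

Lemma lev_lt A : (sup4 A < 2 ^ lev A)%N.
Proof. exact: up_logP. Qed.

Lemma lev_ge A k : (k < lev A)%N -> (2 ^ k <= sup4 A)%N.
Proof.
move=> kA; rewrite leqNgt; apply/negP => h; have := up_log_min (isT : 1 < 2)%N h.
by rewrite leqNgt kA.
Qed.

Lemma S4_box s z (M : nat) (f : freq -> R) : uniq s -> (forall A, 0 <= f A) ->
  (forall A, f A != 0 -> box z M A) ->
  S4 s PT f f f f <= (100 * 100) * M%:R ^+ 2 * (\sum_(A <- s) f A ^+ 2) ^+ 2.
Proof.
move=> us f0 fz.
have e : f = (fun A => if box z M A then f A else 0).
  by apply/funext => A; case: ifPn => // /negP bA; apply/eqP; case: eqP => // /eqP /fz.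
rewrite {1 2 3 4}e S4_filter; have us' : uniq [seq A <- s | box z M A] by exact: filter_uniq.
have bs A : A \in [seq A <- s | box z M A] -> box z M A by rewrite mem_filter => /andP[].
apply: le_trans (@rectangle_bound R M _ z f us' bs f0) _.
rewrite ler_wpM2l ?mulr_ge0 ?exprn_ge0 ?mulr_ge0 ?ler0n //.
have le : \sum_(A <- s | box z M A) f A ^+ 2 <= \sum_(A <- s) f A ^+ 2.
  by rewrite [leRHS](bigID (box z M)) /= lerDl sumr_ge0 // => A _; exact: sqr_ge0.
by rewrite big_filter lerXn2r ?nnegrE ?sumr_ge0 // => A _; exact: sqr_ge0.
Qed.

Lemma S4_box2 s z z' (M : nat) (V W : freq -> R[i]) (G e e' : R) : uniq s ->
  0 <= e -> 0 <= e' -> 0 <= G ->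
  S4 s PT (nrm V) (nrm V) (nrm V) (nrm V) <= G * e ^+ 2 ->
  S4 s PT (nrm W) (nrm W) (nrm W) (nrm W) <= G * e' ^+ 2 ->
  (forall A, V A != 0 -> box z M A) -> (forall A, W A != 0 -> box z' M A) ->
  S4 s PT (nrm V) (nrm V) (nrm W) (nrm W) <= G * (e * e').
Proof.
move=> us e0 e0' G0 hV hW _ _.
pose r (x : R) := Num.sqrt (Num.sqrt G * x).
have r0 x : 0 <= r x by exact: sqrtr_ge0.
have r4 x : 0 <= x -> r x ^+ 4 = G * x ^+ 2.
  move=> x0; rewrite -[4%N]/(2 * 2)%N exprM sqr_sqrtr ?mulr_ge0 ?sqrtr_ge0 //.
  by rewrite exprMn sqr_sqrtr.
apply: le_trans (S4_holder4 (r0 e) (r0 e) (r0 e') (r0 e') _ _ _ _) _; rewrite ?r4 //.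
rewrite -mulrA -!expr2 !sqr_sqrtr ?mulr_ge0 ?sqrtr_ge0 // mulrACA -expr2 sqr_sqrtr //.
Qed.

Lemma n2_sum_sqr s (V : freq -> R[i]) : n2 s V = \sum_(A <- s) nrm V A ^+ 2.
Proof. by []. Qed.

(** If the bounds of one factor add up to zero, that factor vanishes on [[0, T)]; so the sums
    themselves can stand on the right-hand side. *)
Lemma bilinear_bound0 : exists C : R, 0 < C /\
  forall T s (v w : R -> freq -> R[i]) (Bv Bw : freq -> R) (G th : R),
  T <= 1 -> uniq s -> 0 <= G -> 0 < th ->
  (forall A, 0 <= Bv A) -> (forall A, 0 <= Bw A) ->
  (forall A, A \in s -> wvar T (Bv A) (fun x => v x A)) ->
  (forall A, A \in s -> wvar T (Bw A) (fun x => w x A)) ->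
  (forall A, A \notin s -> forall x, v x A = 0) -> (forall A, A \notin s -> forall x, w x A = 0) ->
  (forall (V W : freq -> R[i]) (e e' : R), 0 <= e -> 0 <= e' ->
    (forall A, V A != 0 -> exists x, 0 <= x < T /\ v x A != 0) ->
    (forall A, W A != 0 -> exists x, 0 <= x < T /\ w x A != 0) ->
    n2 s V <= e -> n2 s W <= e' ->
    [/\ S4 s PT (nrm V) (nrm V) (nrm W) (nrm W) <= G * th ^+ 4 * (e * e'),
     S4 s PT (nrm V) (nrm V) (nrm V) (nrm V) <= G * e ^+ 2 &
     S4 s PT (nrm W) (nrm W) (nrm W) (nrm W) <= G * e' ^+ 2]) ->
  Rintegral mu (DT T) (fun t => H s (free (v t) t) (free (w t) t)) <=
    C * G * th * ((\sum_(A <- s) Bv A) * (\sum_(A <- s) Bw A)).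
Proof.
have [C [C0 bb]] := @bilinear_bound R; exists C; split=> // T s v w Bv Bw G th T1 us G0 th0 Bv0 Bw0 wv ww v0 w0 S.
have mD : measurable (DT T) := measurable_itv _.
have fD : (mu (DT T) < +oo)%E := lebesgue_itv_finite _ _.
have sv : 0 <= \sum_(A <- s) Bv A by exact: sumr_ge0.
have sw : 0 <= \sum_(A <- s) Bw A by exact: sumr_ge0.
have R0 : 0 <= C * G * th * ((\sum_(A <- s) Bv A) * (\sum_(A <- s) Bw A)).
  by apply: mulr_ge0; [apply: mulr_ge0; [apply: mulr_ge0; first exact: ltW|exact: ltW]|exact: mulr_ge0].
have zero (u : R -> freq -> R[i]) (Bu : freq -> R) x : (forall A, 0 <= Bu A) ->
    (forall A, A \in s -> wvar T (Bu A) (fun x => u x A)) ->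
    (forall A, A \notin s -> forall x, u x A = 0) -> \sum_(A <- s) Bu A <= 0 -> 0 <= x < T ->
    forall A, free (u x) x A = 0.
  move=> Bu0 wu u0 z xT A; rewrite /free; have [As|As] := boolP (A \in s); last by rewrite u0 // mulr0.
  have hA : normc (u x A) ^+ 2 <= 0.
    apply: le_trans z; apply: le_trans ((wu A As).1 x xT) _.
    by rewrite (big_rem A) //= lerDl sumr_ge0.
  move: hA; rewrite exprn_even_le0 //= normc_eq0 => /eqP ->; exact: mulr0.
have [pv|zv] := ltP 0 (\sum_(A <- s) Bv A); last first.
  rewrite (@bm_int_eq _ _ _ mu (DT T) _ (fun _ => 0)) ?(bm_int0 mu mD) // => x /=.
  rewrite in_itv /= => xT; rewrite /H big1 // => k _; rewrite /conv big1 ?normc0 ?expr0n // => y _.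
  by rewrite (zero v Bv) // mul0r.
have [pw|zw] := ltP 0 (\sum_(A <- s) Bw A); last first.
  rewrite (@bm_int_eq _ _ _ mu (DT T) _ (fun _ => 0)) ?(bm_int0 mu mD) // => x /=.
  rewrite in_itv /= => xT; rewrite /H big1 // => k _; rewrite /conv big1 ?normc0 ?expr0n // => y _.
  by rewrite (zero w Bw) // mulr0.
exact: (bb T s v w Bv Bw _ _ G th).
Qed.

(** For [j = gam K k] the gain in [gain_bound] is taken to be [2^(16 j) = (16^j)^4]. Its ninth power
    must not exceed the side [2^(k+1)] of the cubes, whence [144 = 9 * 16] and the minimum with [k];
    the minimum with [K - k] keeps the cubes apart. *)
Definition gam (K k : nat) : nat := (minn (K - k) k %/ 144)%N.

Lemma cube_bilinear : exists C : R, 0 < C /\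
  forall T s (v w : R -> freq -> R[i]) (Bv Bw : freq -> R) (K k : nat) q,
  T <= 1 -> uniq s -> (k <= K)%N ->
  (forall A, 0 <= Bv A) -> (forall A, 0 <= Bw A) ->
  (forall A, A \in s -> wvar T (Bv A) (fun x => v x A)) ->
  (forall A, A \in s -> wvar T (Bw A) (fun x => w x A)) ->
  (forall x A, v x A != 0 -> [/\ A \in s, lev A = K & quo (2 ^ k) A = q]) ->
  (forall x A, w x A != 0 -> A \in s /\ lev A = k) ->
  Rintegral mu (DT T) (fun t => H s (free (v t) t) (free (w t) t)) <=
    C * 4 ^+ k * 16 ^- gam K k * ((\sum_(A <- s) Bv A) * (\sum_(A <- s) Bw A)).
Proof.
have [Cb [Cb0 bb]] := bilinear_bound0; have [Cg [Cg0 gg]] := @gain_bound R.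
exists (Cb * ((Cg + 100 * 100) * 4)); split.
  by apply: mulr_gt0 => //; apply: mulr_gt0 => //; apply: addr_gt0 => //; apply: mulr_gt0.
move=> T s v w Bv Bw K k q T1 us kK Bv0 Bw0 wv ww v0 w0.
pose M := (2 ^ k)%N; pose M2 := (2 ^ k.+1)%N; have M0 : (0 < M)%N by rewrite expn_gt0.
have MM : M2 = (M + M)%N by rewrite /M2 expnS mul2n addnn.
pose G : R := (Cg + 100 * 100) * M2%:R ^+ 2.
have c100 : 0 <= 100 * 100 :> R by apply: mulr_ge0.
have GE : G = (Cg + 100 * 100) * 4 * 4 ^+ k.
  rewrite /G /M2 expnS natrM natrX exprMn -exprM [(k * 2)%N]mulnC exprM -mulrA; congr (_ * _).
  by congr (_ * _); [|congr (_ ^+ _)]; ring.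
have G0 : 0 <= G by apply: mulr_ge0; [apply: addr_ge0 => //; exact: ltW|apply: exprn_ge0].
pose j := gam K k.
have th0 : 0 < 16 ^- j :> R by rewrite invr_gt0 exprn_gt0.
have vs A : A \notin s -> forall x, v x A = 0.
  by move=> As x; apply/eqP; apply: contraNT As => /v0[].
have ws A : A \notin s -> forall x, w x A = 0.
  by move=> As x; apply/eqP; apply: contraNT As => /w0[].
pose zq : freq := q *+ M; pose zw : freq := (- M%:Z, - M%:Z, - M%:Z, - M%:Z).
have boxq A : quo M A = q -> box zq M2 A.
  move=> qA; have [e1 e2 e3 e4] := cMn q M; rewrite /box /zq e1 e2 e3 e4 -qA /quo.
  have M0Z : 0 < M%:Z by lia.
  have h (x : int) : (x %/ M)%Z * M%:Z <= x < (x %/ M)%Z * M%:Z + M2%:Z.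
    have := divz_eq x M%:Z; have := modz_ge0 x (lt0r_neq0 M0Z); have := ltz_pmod x M0Z.
    by rewrite MM; lia.
  by apply/and4P; split; exact: h.
have boxw A : lev A = k -> box zw M2 A.
  move=> lA; have := lev_lt A; rewrite lA -/M => sA.
  have : in_cube (M.-1)%:Z A by rewrite in_cubeE -ltnS prednK.
  rewrite /in_cube /box /zw MM; move: M0; clear; move: M => m m0 /and4P[h1 h2 h3 h4].
  have h (x : int) : `|x| <= m.-1 -> (- m%:Z <= x < - m%:Z + (m + m)%N%:Z) by clear -m0; lia.
  by apply/and4P; split; apply: h.
apply: le_trans (bb T s v w Bv Bw G (16 ^- j) T1 us G0 th0 Bv0 Bw0 wv ww vs ws _) _; last first.
  rewrite GE -/j le_eqVlt; apply/orP; left; apply/eqP.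
  by move: (4 ^+ k) (16 ^- j) => a b; ring.
move=> V W e e' e0 e0' Vv Ww nV nW.
have Vq A : V A != 0 -> lev A = K /\ quo M A = q by move=> /Vv[x [_ /v0[]]].
have Wk A : W A != 0 -> lev A = k by move=> /Ww[x [_ /w0[]]].
have Vbox A : nrm V A != 0 -> box zq M2 A.
  by rewrite normc_eq0 => /Vq[_ /boxq].
have Wbox A : nrm W A != 0 -> box zw M2 A.
  by rewrite normc_eq0 => /Wk /boxw.
have nn (U : freq -> R[i]) A : 0 <= nrm U A by exact: normc_ge0.
have hG (z : freq) (U : freq -> R[i]) (d : R) : (forall A, nrm U A != 0 -> box z M2 A) -> n2 s U <= d ->
    S4 s PT (nrm U) (nrm U) (nrm U) (nrm U) <= G * d ^+ 2.
  move=> Ub nU; apply: le_trans (S4_box us (nn U) Ub) _; rewrite -n2_sum_sqr.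
  apply: ler_pM; rewrite ?sqr_ge0 ?mulr_ge0 //.
    by rewrite /G ler_wpM2r ?exprn_ge0 ?ler0n // lerDr ltW.
  by rewrite lerXn2r ?nnegrE ?n2_ge0 // (le_trans (n2_ge0 _ _) nU).
split; [|exact: hG Vbox nV|exact: hG Wbox nW].
(* Without gain the diagonal estimates suffice. For [j > 0] one has [K >= k + 144], so the cube of
   [v] is far from the one around 0 that holds the frequencies of [w]. *)
have [j0|j0] := posnP j.
  rewrite j0 expr0 invr1 expr1n mulr1.
  apply: (@S4_box2 s zq zw M2) => //; [exact: hG Vbox nV|exact: hG Wbox nW| |].
    by move=> A; rewrite -normc_eq0; exact: Vbox.
  by move=> A; rewrite -normc_eq0; exact: Wbox.
have S0 : 0 <= G * (16 ^- j) ^+ 4 * (e * e').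
  apply: mulr_ge0; last exact: mulr_ge0.
  by apply: mulr_ge0 => //; apply: exprn_ge0; exact: ltW.
have [[A0 VA0]|noA] := pselect (exists A, V A != 0); last first.
  have V0 A : V A = 0 by apply/eqP; apply: contra_notT noA => VA; exists A.
  by rewrite /S4 big1 // => x _; rewrite V0 normc0 !mul0r.
have jb : (144 * j <= minn (K - k) k)%N by rewrite mulnC leq_trunc_div.
have jK : (144 * j <= K - k)%N by apply: leq_trans jb (geq_minl _ _).
have jk : (144 * j <= k)%N by apply: leq_trans jb (geq_minr _ _).
pose kap := (2 ^ (16 * j))%N.
have [lA0 qA0] := Vq _ VA0.
have h1 : (kap ^ 9 <= M2)%N by rewrite /kap -expnM; apply: leq_pexp2l => //; move: jk; clear; lia.
have h2 : (kap ^ 2 * M2 <= 2 ^ (K - 2))%N by rewrite /kap -expnM -expnD; apply: leq_pexp2l => //; move: jK j0 kK; clear; lia.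
have h3 : forall A D, box zq M2 A -> box zw M2 D -> (2 ^ (K - 2) <= sup4 (D - A)%R)%N.
  move=> A D bA bD; rewrite leqNgt; apply/negP => hs.
  have s1 := sup4_diff (boxq _ qA0) bA _; have {}s1 : (sup4 (A - A0)%R < M2)%N by apply: s1; rewrite expn_gt0.
  have s2 : (2 ^ K.-1 <= sup4 A0)%N by apply: lev_ge; rewrite lA0; move: jK j0; clear; lia.
  have s3 : (sup4 D <= M)%N.
    move: bD; rewrite /box /zw MM -in_cubeE /in_cube; clear; move: M => m /and4P[h1 h2 h3 h4].
    have h (x : int) : - m%:Z <= x < - m%:Z + (m + m)%N%:Z -> `|x| <= m by clear; lia.
    by apply/and4P; split; apply: h.
  have tri : (sup4 A0 <= sup4 (A - A0)%R + sup4 (D - A)%R + sup4 D)%N.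
    have cb u : in_cube (sup4 u)%:Z u by rewrite in_cubeE.
    have := cb (A - A0); have := cb (D - A); have := cb D.
    rewrite -in_cubeE /in_cube !cE; move: (sup4 D) (sup4 (D - A)) (sup4 (A - A0)) => x y z; clear.
    have h (a b d : int) : `|d| <= x -> `|d - b| <= y -> `|b - a| <= z -> `|a| <= (z + y + x)%N by lia.
    move=> /and4P[x1 x2 x3 x4] /and4P[y1 y2 y3 y4] /and4P[z1 z2 z3 z4]; apply/and4P.
    by split; [exact: h x1 y1 z1|exact: h x2 y2 z2|exact: h x3 y3 z3|exact: h x4 y4 z4].
  have p1 : (2 ^ K.-1 = 2 * 2 ^ (K - 2))%N by rewrite -expnS; congr (2 ^ _)%N; move: jK j0; clear; lia.
  have p2 : (2 ^ (k + 2) <= 2 ^ (K - 2))%N by apply: leq_pexp2l => //; move: jK j0; clear; lia.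
  have p3 : (2 ^ (k + 2) = 4 * M)%N by rewrite /M addnC expnD.
  by move: s1 s2 s3 tri hs p1 p2 p3 MM M0; clear; lia.
pose r := Num.sqrt e; pose r' := Num.sqrt e'.
have nV' : \sum_(A <- s) nrm V A ^+ 2 <= r ^+ 2 by rewrite sqr_sqrtr.
have nW' : \sum_(A <- s) nrm W A ^+ 2 <= r' ^+ 2 by rewrite sqr_sqrtr.
have kap0 : (0 < kap)%N by rewrite expn_gt0.
have := gg M2 (2 ^ (K - 2))%N kap zq zw s (nrm V) (nrm V) (nrm W) (nrm W) r r r' r' us
  (nn V) (nn V) (nn W) (nn W) Vbox Vbox Wbox Wbox (sqrtr_ge0 _) (sqrtr_ge0 _) (sqrtr_ge0 _) (sqrtr_ge0 _)
  nV' nV' nW' nW' kap0 h1 h2 h3.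
have kE : kap%:R = (16 ^+ j) ^+ 4 :> R.
  have ee (x : R) : x ^+ (16 * j) = ((x ^+ 4) ^+ j) ^+ 4 by rewrite -!exprM [(j * 4)%N]mulnC mulnA.
  by rewrite /kap natrX ee; congr ((_ ^+ _) ^+ _); ring.
have rr : r * r * r' * r' = e * e' by rewrite -mulrA -!expr2 !sqr_sqrtr.
have k0 : 0 < (16 ^+ j) ^+ 4 :> R by rewrite !exprn_gt0.
rewrite kE rr -ler_pdivlMr // => /le_trans; apply.
have CG : Cg * M2%:R ^+ 2 <= G by rewrite /G; apply: ler_wpM2r; [exact: exprn_ge0|rewrite lerDl].
rewrite exprVn; move: CG k0; move: ((16 ^+ j) ^+ 4) (Cg * _) => x y yG x0.
have -> : G * x^-1 * (e * e') = G * (e * e') / x by ring.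
by rewrite ler_wpM2r ?invr_ge0 ?(ltW x0) // ler_wpM2r // mulr_ge0.
Qed.

(** The higher block is cut into cubes of side [2^k], almost orthogonal by [H_cubes]; apart from the
    gain the constant thus depends on the lower level only. *)
Lemma block_bilinear : exists C : R, 0 < C /\
  forall T s (v w : R -> freq -> R[i]) (Bv Bw : freq -> R) (K k : nat),
  T <= 1 -> uniq s -> (k <= K)%N ->
  (forall A, 0 <= Bv A) -> (forall A, 0 <= Bw A) ->
  (forall A, A \in s -> wvar T (Bv A) (fun x => v x A)) ->
  (forall A, A \in s -> wvar T (Bw A) (fun x => w x A)) ->
  (forall x A, v x A != 0 -> A \in s /\ lev A = K) ->
  (forall x A, w x A != 0 -> A \in s /\ lev A = k) ->
  Rintegral mu (DT T) (fun t => H s (free (v t) t) (free (w t) t)) <=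
    C * 4 ^+ k * 16 ^- gam K k * ((\sum_(A <- s) Bv A) * (\sum_(A <- s) Bw A)).
Proof.
have [C [C0 cb]] := cube_bilinear; exists (81 * C); split; first exact: mulr_gt0.
move=> T s v w Bv Bw K k T1 us kK Bv0 Bw0 wv ww v0 w0.
have mD : measurable (DT T) := measurable_itv _.
have fD : (mu (DT T) < +oo)%E := lebesgue_itv_finite _ _.
have cbm_of (u : R -> freq -> R[i]) (Bu : freq -> R) :
    (forall A, A \in s -> wvar T (Bu A) (fun x => u x A)) ->
    (forall x A, u x A != 0 -> A \in s) -> forall A, cbm (DT T) (fun x => u x A).
  move=> wu u0 A; have [As|As] := boolP (A \in s); first exact: wvar_cbm (wu A As).
  by apply: cbm_eq (cbm_cst _ 0) => x _; apply/esym/eqP; apply: contraNT As; exact: u0.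
have M0 : (0 < 2 ^ k)%N by rewrite expn_gt0.
pose vq q x A : R[i] := if quo (2 ^ k) A == q then v x A else 0.
pose Bq q A : R := if quo (2 ^ k) A == q then Bv A else 0.
have cv := cbm_of _ _ wv (fun x A h => (v0 x A h).1).
have cw := cbm_of _ _ ww (fun x A h => (w0 x A h).1).
have cvq q A : cbm (DT T) (fun x => vq q x A).
  by rewrite /vq; case: (quo (2 ^ k) A == q) => //; exact: cbm_cst.
set qs := undup [seq quo (2 ^ k) A | A <- s].
have bq q : bm (DT T) (fun t => H s (free (vq q t) t) (free (w t) t)) by exact: bm_H_free.
apply: le_trans (_ : _ <= Rintegral mu (DT T)
   (fun t => 81 * \sum_(q <- qs) H s (free (vq q t) t) (free (w t) t))) _.
  apply: (bm_int_le (m := mu) mD fD); first exact: bm_H_free.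
    by apply: bmM; [exact: bm_cst|apply: bm_sum => q _; exact: bq].
  move=> t _; apply: le_trans (H_cubes (M := 2 ^ k) _ M0 _) _.
    move=> A As; rewrite /free mulf_eq0 negb_or => /andP[_ /w0[_ <-]]; exact: lev_lt.
  rewrite ler_pM2l //; apply: ler_sum => q _.
  rewrite (@eq_H R s _ (free (vq q t) t) _ (free (w t) t)) // => A.
  by rewrite /free /vq; case: ifP => _ //; rewrite mulr0.
rewrite (bm_intZ (m := mu) mD fD); last by apply: bm_sum => q _; exact: bq.
rewrite (bm_int_sum (m := mu) mD fD); last by move=> q _; exact: bq.
apply: le_trans (_ : _ <= 81 * \sum_(q <- qs) C * 4 ^+ k * 16 ^- gam K k *
    ((\sum_(A <- s) Bq q A) * (\sum_(A <- s) Bw A))) _.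
  rewrite ler_pM2l //; apply: ler_sum => q _; apply: (cb T s (vq q) w (Bq q) Bw K k q) => //.
  - by move=> A; rewrite /Bq; case: ifP.
  - move=> A As; rewrite /Bq /vq; case: (quo (2 ^ k) A == q); first exact: wv.
    split=> [x _|n t _]; first by rewrite normc0 expr0n.
    by rewrite mul0r big1 // => i _; rewrite subr0 normc0 expr0n.
  - by move=> x A; rewrite /vq; case: ifP => [/eqP e /v0[]|]; rewrite ?eqxx.
rewrite -mulr_sumr -mulr_suml !mulrA le_eqVlt; apply/orP; left; apply/eqP; congr (_ * _ * _).
rewrite exchange_big /=; rewrite big_seq [RHS]big_seq; apply: eq_bigr => A As.
rewrite /Bq -big_mkcond /=; under eq_bigl do rewrite eq_sym.
by rewrite -big_filter filter_pred1_uniq ?undup_uniq ?big_seq1 // mem_undup map_f.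
Qed.

(** [H_trivial] at each time, with the [O(16^k)] frequencies of level [k]: compared with
    [block_bilinear] a further factor [4^k] is lost, but a factor [T] is gained. *)
Lemma block_bilinear_time : exists C : R, 0 < C /\
  forall T s (v w : R -> freq -> R[i]) (Bv Bw : freq -> R) (k : nat),
  0 < T -> uniq s ->
  (forall A, 0 <= Bv A) -> (forall A, 0 <= Bw A) ->
  (forall A, A \in s -> wvar T (Bv A) (fun x => v x A)) ->
  (forall A, A \in s -> wvar T (Bw A) (fun x => w x A)) ->
  (forall x A, v x A != 0 -> A \in s) ->
  (forall x A, w x A != 0 -> A \in s /\ lev A = k) ->
  Rintegral mu (DT T) (fun t => H s (free (v t) t) (free (w t) t)) <=
    C * 4 ^+ k * (T * 4 ^+ k) * ((\sum_(A <- s) Bv A) * (\sum_(A <- s) Bw A)).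
Proof.
exists 81; split=> // T s v w Bv Bw k T0 us Bv0 Bw0 wv ww v0 w0.
have mD : measurable (DT T) := measurable_itv _.
have fD : (mu (DT T) < +oo)%E := lebesgue_itv_finite _ _.
have cbm_of (u : R -> freq -> R[i]) (Bu : freq -> R) :
    (forall A, A \in s -> wvar T (Bu A) (fun x => u x A)) ->
    (forall x A, u x A != 0 -> A \in s) -> forall A, cbm (DT T) (fun x => u x A).
  move=> wu u0 A; have [As|As] := boolP (A \in s); first exact: wvar_cbm (wu A As).
  by apply: cbm_eq (cbm_cst _ 0) => x _; apply/esym/eqP; apply: contraNT As; exact: u0.
have cv := cbm_of _ _ wv v0.
have cw := cbm_of _ _ ww (fun x A h => (w0 x A h).1).
set BB := (\sum_(A <- s) Bv A) * _.
apply: le_trans (_ : _ <= Rintegral mu (DT T) (fun _ => 81 * 4 ^+ k * 4 ^+ k * BB)) _; last first.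
  rewrite (bm_int_cst mu mD) (fine_itv (ltW T0)) subr0 le_eqVlt; apply/orP; left; apply/eqP.
  by move: (4 ^+ k) BB => a b; ring.
apply: (bm_int_le (m := mu) mD fD); [exact: bm_H_free|exact: bm_cst|].
move=> t; rewrite /= in_itv /= => tT.
apply: le_trans (H_trivial (free (v t) t) us (uniq_cube_seq (2 ^ k)) _) _.
  move=> A As; rewrite /free mulf_eq0 negb_or => /andP[_ /w0[_ lA]].
  by rewrite mem_cube_seq in_cubeE -lA ltnW // lev_lt.
have nb (u : R -> freq -> R[i]) (Bu : freq -> R) :
    (forall A, A \in s -> wvar T (Bu A) (fun x => u x A)) -> n2 s (free (u t) t) <= \sum_(A <- s) Bu A.
  move=> wu; rewrite n2_free /n2 big_seq [leRHS]big_seq; apply: ler_sum => A As; exact: (wu A As).1.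
have h1 := nb _ _ wv; have h2 := nb _ _ ww.
rewrite size_cube_seq; apply: ler_pM => //; first by rewrite mulr_ge0 ?n2_ge0.
  have -> : 81 * 4 ^+ k * 4 ^+ k = (3 * 2 ^+ k) ^+ 4 :> R.
    have -> : 4 = 2 ^+ 2 :> R by ring.
    by rewrite -exprM mulnC exprM; move: (2 ^+ k) => a; ring.
  rewrite natrX lerXn2r ?nnegrE ?mulr_ge0 ?exprn_ge0 //.
  have -> : 3 * 2 ^+ k = (3 * 2 ^ k)%:R :> R by rewrite natrM natrX.
  rewrite ler_nat; have : (0 < 2 ^ k)%N by rewrite expn_gt0.
  by move: (2 ^ k)%N => a; clear; lia.
by apply: ler_pM; rewrite ?n2_ge0.
Qed.

End BlockBound.

(** * Summation over dyadic frequencies *)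

Section DyadicSums.
Context {R : realType}.

(** The fourth root of the gain [16^(-gam)] of [block_bilinear], made symmetric in the two
    levels. *)
Definition del (i j : nat) : R := 2 ^- gam (maxn i j) (minn i j).

Lemma del_gt0 i j : 0 < del i j.
Proof. by rewrite invr_gt0 exprn_gt0. Qed.

Lemma delC i j : del i j = del j i.
Proof. by rewrite /del maxnC minnC. Qed.

Lemma sum_floor (d n : nat) : (0 < d)%N -> \sum_(0 <= k < n) 2 ^- (k %/ d) <= 2 * d%:R :> R.
Proof.
move=> d0; apply: le_trans (_ : _ <= \sum_(0 <= k < n * d) 2 ^- (k %/ d)) _.
  have nd : (n <= n * d)%N by rewrite leq_pmulr.
  rewrite [leRHS](big_cat_nat (leq0n _) nd) /= lerDl; apply: sumr_ge0 => k _.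
  by rewrite invr_ge0 exprn_ge0.
suff -> : \sum_(0 <= k < n * d) 2 ^- (k %/ d) = 2 * d%:R - 2 * d%:R * 2 ^- n :> R.
  by rewrite lerBlDr lerDl mulr_ge0 ?mulr_ge0 ?ler0n // invr_ge0 exprn_ge0.
elim: n => [|n IH]; first by rewrite mul0n big_geq // expr0 invr1 mulr1 subrr.
have nd : (n * d <= n.+1 * d)%N by rewrite leq_mul2r leqnSn orbT.
rewrite (big_cat_nat (leq0n _) nd) /= IH.
have -> : \sum_(n * d <= k < n.+1 * d) 2 ^- (k %/ d) = \sum_(n * d <= k < n.+1 * d) 2 ^- n :> R.
  apply: eq_big_nat => k /andP[k1 k2]; congr (_ ^- _).
  by apply/eqP; rewrite eqn_leq leq_divRL // k1 andbT -ltnS ltn_divLR.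
rewrite sumr_const_nat mulSn addnK -[_ *+ d]mulr_natl exprS invfM; move: (2 ^- n) => y.
by field.
Qed.

Definition Sd : R := 2 * 144 + 2 * 144.

Lemma Sd_ge0 : 0 <= Sd.
Proof. by apply: addr_ge0; apply: mulr_ge0; exact: ler0n. Qed.

(** The exponent grows linearly with the distance of [k] from either end of the range from 0 to [K],
    so two geometric series dominate the sum, uniformly in [K]. *)
Lemma sum_del K n : \sum_(0 <= k < n | (k <= K)%N) del K k <= Sd.
Proof.
have e k : (k <= K)%N -> del K k <= 2 ^- (k %/ 144) + 2 ^- ((K - k) %/ 144).
  move=> kK; rewrite /del (maxn_idPl kK) (minn_idPr kK) /gam.
  have [h|h] := leqP (K - k) k.
    by rewrite lerDr invr_ge0 exprn_ge0.
  by rewrite lerDl invr_ge0 exprn_ge0.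
have wid (h : nat -> R) : (forall k, 0 <= h k) ->
    \sum_(0 <= k < n | (k <= K)%N) h k <= \sum_(0 <= k < K.+1) h k.
  move=> h0; have l1 : (n <= n + K.+1)%N := leq_addr _ _.
  have l2 : (K.+1 <= n + K.+1)%N := leq_addl _ _.
  rewrite (big_nat_widen _ _ _ _ _ l1) (big_nat_widen _ _ _ _ _ l2) /=.
  rewrite big_mkcond [leRHS]big_mkcond /=; apply: ler_sum => k _.
  by rewrite ltnS; case: (k <= K)%N => //=; case: ifP.
have g0 k : 0 <= 2 ^- (k %/ 144) :> R by rewrite invr_ge0 exprn_ge0.
apply: le_trans (_ : _ <= \sum_(0 <= k < n | (k <= K)%N) (2 ^- (k %/ 144) + 2 ^- ((K - k) %/ 144))) _.
  exact: ler_sum.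
rewrite big_split /=.
apply: lerD; apply: le_trans (wid _ _) _ => //; first exact: sum_floor.
rewrite big_nat_rev /= (eq_big_nat _ _ (F2 := fun k => 2 ^- (k %/ 144))); first exact: sum_floor.
by move=> k /andP[_ kK]; rewrite add0n subSS subKn.
Qed.

Section Sequences.
Context (N : nat) (p q : nat -> R) (P Q : R).
Context (p0 : forall i, 0 <= p i) (q0 : forall i, 0 <= q i) (P0 : 0 <= P) (Q0 : 0 <= Q)
  (pP : \sum_(i < N) p i ^+ 2 <= P ^+ 2) (qQ : \sum_(i < N) q i ^+ 2 <= Q ^+ 2).

Lemma le_of_l2 (f : nat -> R) (F : R) (i : 'I_N) : (forall i, 0 <= f i) -> 0 <= F ->
  \sum_(i < N) f i ^+ 2 <= F ^+ 2 -> f i <= F.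
Proof.
move=> f0 F0 fF; rewrite -(@ler_pXn2r _ 2) ?nnegrE //; apply: le_trans fF.
by rewrite (bigD1 i) //= lerDl sumr_ge0 // => j _; exact: sqr_ge0.
Qed.

Definition level_sum (m : nat) : R :=
  \sum_(x : 'I_N * 'I_N | maxn x.1 x.2 == m) del x.1 x.2 * (p x.1 * q x.2).

(** One of the two indices equals [m]. Over the other one [del] is summed, its sequence being
    bounded termwise by its [l^2] norm; what remains is square summable in [m]. *)
Lemma level_sum_le (m : 'I_N) : level_sum m <= Sd * (p m * Q + q m * P).
Proof.
have t0 (x : 'I_N * 'I_N) : 0 <= del x.1 x.2 * (p x.1 * q x.2).
  by rewrite !mulr_ge0 // ltW // del_gt0.
have -> : level_sum m = \sum_(i < N) \sum_(j < N | maxn i j == m) del i j * (p i * q j).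
  by rewrite /level_sum pair_big_dep.
apply: le_trans (_ : _ <= \sum_(i < N) \sum_(j < N) ((if (i == m) && (j <= m)%N then del m j * (p m * Q) else 0)
   + (if (j == m) && (i <= m)%N then del m i * (q m * P) else 0))) _.
  apply: ler_sum => i _; rewrite big_mkcond; apply: ler_sum => j _.
  have [e|_] := eqVneq (maxn i j) m; last first.
    by rewrite addr_ge0 //; case: ifP => // _; rewrite mulr_ge0 ?mulr_ge0 // ltW // del_gt0.
  have [ij|/ltnW ij] := leqP j i.
    have im : i = m by apply: val_inj; rewrite /= -e; apply/esym/maxn_idPl.
    rewrite im eqxx -im ij /= -[leLHS]addr0 lerD //.
      by rewrite ler_pM2l ?del_gt0 // ler_wpM2l // (le_of_l2 j q0 Q0 qQ).
    by case: ifP => // _; rewrite mulr_ge0 ?mulr_ge0 // ltW // del_gt0.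
  have jm : j = m by apply: val_inj; rewrite /= -e; apply/esym/maxn_idPr.
  rewrite jm eqxx -jm ij /= -[leLHS]add0r lerD //.
    by case: ifP => // _; rewrite mulr_ge0 ?mulr_ge0 // ltW // del_gt0.
  by rewrite delC ler_pM2l ?del_gt0 // mulrC ler_wpM2l // (le_of_l2 i p0 P0 pP).
have half (c : R) : 0 <= c -> \sum_(j < N | (j <= m)%N) del m j * c <= Sd * c.
  move=> c0; rewrite -mulr_suml ler_wpM2r //.
  by have := sum_del m N; rewrite big_mkord.
under eq_bigr do rewrite big_split /=.
rewrite big_split /= mulrDr lerD //.
  rewrite (bigD1 m) //= eqxx [X in _ + X]big1 ?addr0 => [|i im]; last first.
    by rewrite big1 // => j _; rewrite (negPf im).
  by rewrite -big_mkcond /=; apply: half; exact: mulr_ge0.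
rewrite exchange_big /= (bigD1 m) //= eqxx [X in _ + X]big1 ?addr0 => [|i im]; last first.
  by rewrite big1 // => j _; rewrite (negPf im).
by rewrite -big_mkcond /=; apply: half; exact: mulr_ge0.
Qed.

Lemma level_sum_ge0 m : 0 <= level_sum m.
Proof. by apply: sumr_ge0 => x _; rewrite !mulr_ge0 // ltW // del_gt0. Qed.

Lemma level_sum_l2 : \sum_(m < N) level_sum m ^+ 2 <= (2 * Sd * (P * Q)) ^+ 2.
Proof.
have := Sd_ge0; have := level_sum_le; move: Sd => S hS S0.
apply: le_trans (_ : _ <= \sum_(m < N) 2 * S ^+ 2 * (Q ^+ 2 * p m ^+ 2 + P ^+ 2 * q m ^+ 2)) _.
  apply: ler_sum => m _.
  apply: le_trans (_ : _ <= (S * (p m * Q + q m * P)) ^+ 2) _.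
    rewrite lerXn2r ?nnegrE ?level_sum_ge0 //.
    by rewrite mulr_ge0 // addr_ge0 // mulr_ge0.
  have h : 0 <= S ^+ 2 * (p m * Q - q m * P) ^+ 2 by rewrite mulr_ge0 ?sqr_ge0.
  by rewrite -subr_ge0; apply: le_trans h _; rewrite le_eqVlt; apply/orP; left; apply/eqP; ring.
rewrite -mulr_sumr big_split /= -!mulr_sumr.
have S2 : 0 <= 2 * S ^+ 2 by rewrite mulr_ge0 ?sqr_ge0.
apply: le_trans (_ : _ <= 2 * S ^+ 2 * (Q ^+ 2 * P ^+ 2 + P ^+ 2 * Q ^+ 2)) _.
  by rewrite ler_wpM2l // lerD // ler_wpM2l ?sqr_ge0.
by rewrite le_eqVlt; apply/orP; left; apply/eqP; ring.
Qed.

End Sequences.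

Lemma count_near (N m : nat) : \sum_(j < N | ((m <= j + 2) && (j <= m + 2))%N) 1 <= 5 :> R.
Proof.
rewrite -(big_mkord (fun j => (m <= j + 2) && (j <= m + 2))%N (fun _ => 1)) -big_filter.
rewrite big_const_seq count_predT iter_addr_0 -[5]/(5%:R) ler_nat.
rewrite -(size_iota (m - 2) 5); apply: uniq_leq_size; first by rewrite filter_uniq ?iota_uniq.
by move=> j; rewrite mem_filter !mem_iota => /andP[/andP[h1 h2] _]; lia.
Qed.

(** The sum is grouped by the two maxima. Each maximum has at most 5 partners, so Cauchy-Schwarz in
    the maxima reduces to [level_sum_l2]. *)
Lemma dyadic_sum (N : nat) (p q p' q' : nat -> R) (P Q P' Q' : R) :
  (forall i, 0 <= p i) -> (forall i, 0 <= q i) -> (forall i, 0 <= p' i) -> (forall i, 0 <= q' i) ->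
  0 <= P -> 0 <= Q -> 0 <= P' -> 0 <= Q' ->
  \sum_(i < N) p i ^+ 2 <= P ^+ 2 -> \sum_(i < N) q i ^+ 2 <= Q ^+ 2 ->
  \sum_(i < N) p' i ^+ 2 <= P' ^+ 2 -> \sum_(i < N) q' i ^+ 2 <= Q' ^+ 2 ->
  \sum_(x : ('I_N * 'I_N) * ('I_N * 'I_N) |
      (maxn x.1.1 x.1.2 <= maxn x.2.1 x.2.2 + 2)%N && (maxn x.2.1 x.2.2 <= maxn x.1.1 x.1.2 + 2)%N)
    (del x.1.1 x.1.2 * (p x.1.1 * q x.1.2)) * (del x.2.1 x.2.2 * (p' x.2.1 * q' x.2.2))
  <= (3 * (2 * Sd)) ^+ 2 * (P * Q * (P' * Q')).
Proof.
move=> p0 q0 p0' q0' P0 Q0 P0' Q0' pP qQ pP' qQ'.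
pose near (i j : nat) := ((i <= j + 2) && (j <= i + 2))%N.
pose mx (x : 'I_N * 'I_N) : 'I_N := if (x.1 <= x.2)%N then x.2 else x.1.
have mxE x : mx x = maxn x.1 x.2 :> nat.
  by rewrite /mx; case: leqP.
pose X (x : 'I_N * 'I_N) := del x.1 x.2 * (p x.1 * q x.2).
pose X' (x : 'I_N * 'I_N) := del x.1 x.2 * (p' x.1 * q' x.2).
have fib (F : 'I_N * 'I_N -> R) : \sum_x F x = \sum_(m < N) \sum_(x : 'I_N * 'I_N | maxn x.1 x.2 == m) F x.
  rewrite (partition_big mx xpredT) //=; apply: eq_bigr => m _; apply: eq_bigl => x.
  by rewrite -mxE.
have -> : \sum_(x : ('I_N * 'I_N) * ('I_N * 'I_N) |
      (maxn x.1.1 x.1.2 <= maxn x.2.1 x.2.2 + 2)%N && (maxn x.2.1 x.2.2 <= maxn x.1.1 x.1.2 + 2)%N)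
    (del x.1.1 x.1.2 * (p x.1.1 * q x.1.2)) * (del x.2.1 x.2.2 * (p' x.2.1 * q' x.2.2)) =
    \sum_(y : 'I_N * 'I_N | near y.1 y.2) level_sum N p q y.1 * level_sum N p' q' y.2.
  transitivity (\sum_(x : 'I_N * 'I_N) \sum_(x' : 'I_N * 'I_N | near (maxn x.1 x.2) (maxn x'.1 x'.2)) X x * X' x').
    by rewrite pair_big_dep.
  rewrite fib -(pair_big_dep xpredT (fun i j : 'I_N => near i j) (fun i j : 'I_N => level_sum N p q i * level_sum N p' q' j)) /=.
  apply: eq_bigr => m _; rewrite /level_sum.
  transitivity (\sum_(x : 'I_N * 'I_N | maxn x.1 x.2 == m) \sum_(x' : 'I_N * 'I_N | near m (maxn x'.1 x'.2)) X x * X' x').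
    by apply: eq_bigr => x /eqP ->.
  rewrite exchange_big /= big_mkcond fib [RHS]big_mkcond /=; apply: eq_bigr => m' _.
  case: ifP => nm; last by rewrite big1 // => x /eqP ->; rewrite nm.
  transitivity (\sum_(x' : 'I_N * 'I_N | maxn x'.1 x'.2 == m') \sum_(x : 'I_N * 'I_N | maxn x.1 x.2 == m) X x * X' x').
    by apply: eq_bigr => x /eqP ->; rewrite nm.
  by rewrite exchange_big /= mulr_suml; apply: eq_bigr => x _; rewrite mulr_sumr.
have near9 : 5 <= 3 ^+ 2 :> R by lra.
have cs (f : nat -> R) (F : R) : 0 <= F -> \sum_(m < N) f m ^+ 2 <= F ^+ 2 ->
    \sum_(y : 'I_N * 'I_N | near y.1 y.2) f y.1 ^+ 2 <= (3 * F) ^+ 2.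
  move=> F0 fF; rewrite -(pair_big_dep xpredT (fun i j : 'I_N => near i j) (fun i _ => f i ^+ 2)) /=.
  apply: le_trans (_ : _ <= \sum_(i < N) 5 * f i ^+ 2) _.
    apply: ler_sum => i _; have := count_near N i; rewrite -/(near i _) => h.
    apply: le_trans (ler_wpM2r (sqr_ge0 (f i)) h); rewrite mulr_suml; apply: ler_sum => j _.
    by rewrite mul1r.
  by rewrite -mulr_sumr exprMn ler_pM ?sumr_ge0 // => i _; exact: sqr_ge0.
have k1 : 0 <= 2 * Sd * (P * Q) by apply: mulr_ge0; apply: mulr_ge0 => //; exact: Sd_ge0.
have k2 : 0 <= 2 * Sd * (P' * Q') by apply: mulr_ge0; apply: mulr_ge0 => //; exact: Sd_ge0.
apply: le_trans (cauchy_schwarz_le (p := 3 * (2 * Sd * (P * Q))) (q := 3 * (2 * Sd * (P' * Q'))) _ _ _ _) _.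
- by rewrite mulr_ge0.
- by rewrite mulr_ge0.
- apply: (cs (level_sum N p q)) => //.
  exact: level_sum_l2.
- have h : \sum_(y : 'I_N * 'I_N | near y.1 y.2) level_sum N p' q' y.1 ^+ 2 <= (3 * (2 * Sd * (P' * Q'))) ^+ 2.
    by apply: (cs (level_sum N p' q')) => //; exact: level_sum_l2.
  apply: le_trans h; rewrite le_eqVlt; apply/orP; left; apply/eqP.
  rewrite (reindex_inj (h := fun y : 'I_N * 'I_N => (y.2, y.1))) /=.
    by apply: eq_bigl => y; rewrite /near andbC.
  by move=> [a b] [c d] /= [-> ->].
by rewrite le_eqVlt; apply/orP; left; apply/eqP; move: Sd => c; ring.
Qed.

End DyadicSums.

(** * The quadrilinear form *)

Section QuadBound.
Context {R : realType}.
Local Notation mu := (@lebesgue_measure R).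
Local Notation DT T := (`[0, T[%classic : set R).
Implicit Types (v w : R -> freq -> R[i]).

(** The flag conjugates the last factor: without it one has the quadrilinear integral, with it the
    duality pairing of the Duhamel form. *)
Definition sg (b : bool) (f : freq -> R[i]) := if b then refl f else f.

Definition resk (V : nmodType) (k : nat) (f : freq -> V) (A : freq) : V :=
  if lev A == k then f A else 0.

Lemma H_sym s (f h : freq -> R[i]) : H s f h = H s h f.
Proof.
apply: eq_bigr => k _; congr (normc _ ^+ 2); rewrite /conv big_mkcond [RHS]big_mkcond.
rewrite !big_allpairs_dep exchange_big /=; apply: eq_bigr => A _; apply: eq_bigr => B _.
by rewrite addrC mulrC.
Qed.

Lemma H_sg s b (f h : freq -> R[i]) : (forall A, (- A \in s) = (A \in s)) -> uniq s ->
  H s f (sg b h) = H s f h.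
Proof. by case: b => // sN us; exact: H_refl. Qed.

(** If [d <= r], then [d^4 <= d^2 r^2]; otherwise [r < d <= 1] and [r^7 <= r^4 <= d^2 r^2]. Thus
    half of the dyadic gain survives next to the gain in time; [r = 1] stands for no gain in
    time. *)
Lemma min_del (x a d r : R) : 0 <= a -> 0 < d <= 1 -> 0 < r ->
  x <= a * d ^+ 4 -> r = 1 \/ x <= a * r ^+ 7 -> x <= a * (d * r) ^+ 2.
Proof.
move=> a0 /andP[d0 d1] r0 h1 h2.
have d41 : d ^+ 4 <= d ^+ 2 by rewrite ler_wiXn2l // ltW.
case: h2 => [->|h2].
  by rewrite mulr1; apply: le_trans h1 _; rewrite ler_wpM2l.
have [dr|rd] := leP d r.
  apply: le_trans h1 _; rewrite ler_wpM2l // exprMn -[4%N]/(2 + 2)%N exprD ler_wpM2l ?exprn_ge0 ?(ltW d0) //.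
  by rewrite lerXn2r ?nnegrE ?(ltW d0) ?(ltW r0).
apply: le_trans h2 _; rewrite ler_wpM2l // exprMn.
apply: le_trans (_ : _ <= r ^+ 4) _; first by rewrite ler_wiXn2l ?(ltW r0) // (le_trans (ltW rd) d1).
by rewrite -[4%N]/(2 + 2)%N exprD ler_wpM2r ?exprn_ge0 ?(ltW r0) // lerXn2r ?nnegrE ?(ltW d0) ?(ltW r0) ?(ltW rd).
Qed.

Lemma del_le1 i j : del i j <= 1 :> R.
Proof. by rewrite /del invf_le1 ?exprn_gt0 // exprn_ege1 // ler1n. Qed.

Lemma pair_bound : exists C : R, 0 < C /\
  forall T s v w (Bv Bw : freq -> R) (i j : nat) (r : R),
  0 < T <= 1 -> uniq s -> 0 < r ->
  (forall A, 0 <= Bv A) -> (forall A, 0 <= Bw A) ->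
  (forall A, A \in s -> wvar T (Bv A) (fun x => v x A)) ->
  (forall A, A \in s -> wvar T (Bw A) (fun x => w x A)) ->
  (forall x A, v x A != 0 -> A \in s /\ lev A = i) ->
  (forall x A, w x A != 0 -> A \in s /\ lev A = j) ->
  r = 1 \/ T * 4 ^+ minn i j <= r ^+ 7 ->
  Rintegral mu (DT T) (fun t => H s (free (v t) t) (free (w t) t)) <=
    C * 4 ^+ minn i j * (del i j * r) ^+ 2 * ((\sum_(A <- s) Bv A) * (\sum_(A <- s) Bw A)).
Proof.
have [C1 [C10 b1]] := @block_bilinear R; have [C2 [C20 b2]] := @block_bilinear_time R.
exists (C1 + C2); split; first exact: addr_gt0.
have key T s v w (Bv Bw : freq -> R) (i j : nat) (r : R) : (j <= i)%N ->
  0 < T <= 1 -> uniq s -> 0 < r ->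
  (forall A, 0 <= Bv A) -> (forall A, 0 <= Bw A) ->
  (forall A, A \in s -> wvar T (Bv A) (fun x => v x A)) ->
  (forall A, A \in s -> wvar T (Bw A) (fun x => w x A)) ->
  (forall x A, v x A != 0 -> A \in s /\ lev A = i) ->
  (forall x A, w x A != 0 -> A \in s /\ lev A = j) ->
  r = 1 \/ T * 4 ^+ minn i j <= r ^+ 7 ->
  Rintegral mu (DT T) (fun t => H s (free (v t) t) (free (w t) t)) <=
    (C1 + C2) * 4 ^+ minn i j * (del i j * r) ^+ 2 * ((\sum_(A <- s) Bv A) * (\sum_(A <- s) Bw A)).
  move=> ji /andP[T0 T1] us r0 Bv0 Bw0 wv ww v0 w0 hr.
  set BB := (\sum_(A <- s) Bv A) * _; have BB0 : 0 <= BB by rewrite mulr_ge0 ?sumr_ge0.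
  have h1 := b1 T s v w Bv Bw i j T1 us ji Bv0 Bw0 wv ww v0 w0.
  have h2 := b2 T s v w Bv Bw j T0 us Bv0 Bw0 wv ww (fun x A h => (v0 x A h).1) w0.
  move: h1 h2; rewrite -/BB; set X := Rintegral _ _ _ => h1 h2.
  move: hr; rewrite (minn_idPr ji) => hr.
  set c := (C1 + C2) * 4 ^+ j.
  have c4 : 0 <= 4 ^+ j :> R by exact: exprn_ge0.
  have c0 : 0 <= c * BB by apply: mulr_ge0 => //; apply: mulr_ge0 => //; apply: ltW; exact: addr_gt0.
  have -> : c * (del i j * r) ^+ 2 * BB = c * BB * (del i j * r) ^+ 2 by rewrite mulrAC.
  apply: min_del => //; first by rewrite del_gt0 del_le1.
    have -> : del i j ^+ 4 = 16 ^- gam i j :> R.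
      rewrite /del (maxn_idPl ji) (minn_idPr ji) exprVn -exprM mulnC exprM; congr ((_ ^+ _)^-1); ring.
    apply: le_trans h1 _; rewrite [leRHS]mulrAC ler_wpM2r // ler_wpM2r ?invr_ge0 ?exprn_ge0 //.
    by rewrite /c ler_wpM2r // lerDl ltW.
  case: hr => [->|hr]; [by left|right].
  apply: le_trans h2 _; rewrite [leRHS]mulrAC ler_wpM2r //; apply: ler_pM => //.
  - by rewrite mulr_ge0 // ltW.
  - by rewrite mulr_ge0 // ltW.
  by rewrite /c ler_wpM2r // lerDr ltW.
move=> T s v w Bv Bw i j r T01 us r0 Bv0 Bw0 wv ww v0 w0 hr.
have [ji|ij] : (j <= i)%N \/ (i <= j)%N by apply/orP; exact: leq_total.
  exact: (key T s v w Bv Bw i j r ji T01 us r0 Bv0 Bw0 wv ww v0 w0 hr).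
have e : (fun t => H s (free (v t) t) (free (w t) t)) = (fun t => H s (free (w t) t) (free (v t) t)).
  by apply/funext => t; exact: H_sym.
rewrite minnC in hr; have := key T s w v Bw Bv j i r ij T01 us r0 Bw0 Bv0 ww wv w0 v0 hr.
by rewrite -e [minn j i]minnC [del j i]delC [(\sum_(A <- s) Bw A) * _]mulrC.
Qed.

Lemma two_sided (X p q : R) : 0 <= p -> 0 <= q ->
  (forall l, 0 < l -> X <= l * p ^+ 2 + l^-1 * q ^+ 2) -> X <= 2 * (p * q).
Proof.
move=> p0 q0 h; have [pz|pn] := eqVneq p 0.
  rewrite pz mul0r mulr0 leNgt; apply/negP => X0.
  have l0 : 0 < q ^+ 2 / X + 1 by rewrite ltr_wpDl // divr_ge0 ?sqr_ge0 // ltW.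
  have := h _ l0; rewrite pz expr0n mulr0 add0r leNgt => /negP; apply.
  by rewrite mulrC ltr_pdivrMr // mulrDr mulr1 mulrCA mulfV ?lt0r_neq0 // mulr1 ltrDl.
have pp : 0 < p by rewrite lt_neqAle eq_sym pn.
have [qz|qn] := eqVneq q 0.
  rewrite qz !mulr0 leNgt; apply/negP => X0.
  have l0 : 0 < X / (2 * p ^+ 2) by rewrite divr_gt0 // mulr_gt0 // exprn_gt0.
  have := h _ l0; rewrite qz expr0n mulr0 addr0.
  have -> : X / (2 * p ^+ 2) * p ^+ 2 = X / 2 by field; rewrite pn.
  by move=> hX; lra.
have qq : 0 < q by rewrite lt_neqAle eq_sym qn.
have l0 : 0 < q / p by rewrite divr_gt0.
apply: le_trans (h _ l0) _; rewrite le_eqVlt; apply/orP; left; apply/eqP.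
by field; rewrite pn qn.
Qed.

Lemma cbm_free_gen (D : set R) v : measurable D -> (forall A, cbm D (fun x => v x A)) ->
  forall A, cbm D (fun t => free (v t) t A).
Proof.
move=> mD bv A; rewrite /free; apply: cbmM => //.
by have := expi_bm (- sqnorm A) mD; under eq_fun do rewrite mulrN.
Qed.

Lemma cbm_free T v : (forall A, cbm (DT T) (fun x => v x A)) -> forall A, cbm (DT T) (fun t => free (v t) t A).
Proof. exact: cbm_free_gen. Qed.

Lemma cbm_sg T b v : (forall A, cbm (DT T) (fun x => v x A)) -> forall A, cbm (DT T) (fun t => sg b (v t) A).
Proof. by move=> bv A; case: b; [exact: (cbm_conj (bv (- A)))|exact: bv]. Qed.

Lemma cbm_quad T s (f1 f2 f3 f4 : R -> freq -> R[i]) :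
  (forall A, cbm (DT T) (fun x => f1 x A)) -> (forall A, cbm (DT T) (fun x => f2 x A)) ->
  (forall A, cbm (DT T) (fun x => f3 x A)) -> (forall A, cbm (DT T) (fun x => f4 x A)) ->
  cbm (DT T) (fun t => quad s (f1 t) (f2 t) (f3 t) (f4 t)).
Proof.
move=> b1 b2 b3 b4; do 3 (apply: cbm_sum => ? _); apply: cbm_sum => ? _.
by apply: cbmM => //; apply: cbmM => //; apply: cbmM.
Qed.

Lemma wvar_cbm_all T (s : seq freq) v (B : freq -> R) :
  (forall A, A \in s -> wvar T (B A) (fun x => v x A)) ->
  (forall x A, v x A != 0 -> A \in s) -> forall A, cbm (DT T) (fun x => v x A).
Proof.
move=> wu u0 A; have [As|As] := boolP (A \in s); first exact: wvar_cbm (wu A As).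
by apply: cbm_eq (cbm_cst _ 0) => x _; apply/esym/eqP; apply: contraNT As; exact: u0.
Qed.

Lemma quad_block : exists C : R, 0 < C /\
  forall T s b v1 v2 v3 v4 (B1 B2 B3 B4 : freq -> R) (k1 k2 k3 k4 : nat) (r r' : R),
  0 < T <= 1 -> uniq s -> (forall A, (- A \in s) = (A \in s)) -> 0 < r -> 0 < r' ->
  (forall A, 0 <= B1 A) -> (forall A, 0 <= B2 A) -> (forall A, 0 <= B3 A) -> (forall A, 0 <= B4 A) ->
  (forall A, A \in s -> wvar T (B1 A) (fun x => v1 x A)) ->
  (forall A, A \in s -> wvar T (B2 A) (fun x => v2 x A)) ->
  (forall A, A \in s -> wvar T (B3 A) (fun x => v3 x A)) ->
  (forall A, A \in s -> wvar T (B4 A) (fun x => v4 x A)) ->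
  (forall x A, v1 x A != 0 -> A \in s /\ lev A = k1) ->
  (forall x A, v2 x A != 0 -> A \in s /\ lev A = k2) ->
  (forall x A, v3 x A != 0 -> A \in s /\ lev A = k3) ->
  (forall x A, v4 x A != 0 -> A \in s /\ lev A = k4) ->
  r = 1 \/ T * 4 ^+ minn k1 k3 <= r ^+ 7 ->
  r' = 1 \/ T * 4 ^+ minn k2 k4 <= r' ^+ 7 ->
  normc (cintegral mu (DT T) (fun t => quad s (free (v1 t) t) (free (v2 t) t) (free (v3 t) t)
     (sg b (free (v4 t) t)))) <=
  C * (r * r') * 2 ^+ (minn k1 k3 + minn k2 k4) * (del k1 k3 * del k2 k4) *
    (Num.sqrt (\sum_(A <- s) B1 A) * Num.sqrt (\sum_(A <- s) B2 A) *
     Num.sqrt (\sum_(A <- s) B3 A) * Num.sqrt (\sum_(A <- s) B4 A)).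
Proof.
have [C [C0 pb]] := pair_bound; exists (2 * C); split; first exact: mulr_gt0.
move=> T s b v1 v2 v3 v4 B1 B2 B3 B4 k1 k2 k3 k4 r r' T01 us sN r0 r'0 B10 B20 B30 B40 w1 w2 w3 w4 u1 u2 u3 u4 hr hr'.
have mD : measurable (DT T) := measurable_itv _.
have fD : (mu (DT T) < +oo)%E := lebesgue_itv_finite _ _.
have h13 := pb T s v1 v3 B1 B3 k1 k3 r T01 us r0 B10 B30 w1 w3 u1 u3 hr.
have h24 := pb T s v2 v4 B2 B4 k2 k4 r' T01 us r'0 B20 B40 w2 w4 u2 u4 hr'.
have c1 := wvar_cbm_all w1 (fun x A h => (u1 x A h).1).
have c2 := wvar_cbm_all w2 (fun x A h => (u2 x A h).1).
have c3 := wvar_cbm_all w3 (fun x A h => (u3 x A h).1).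
have c4 := wvar_cbm_all w4 (fun x A h => (u4 x A h).1).
have s1 : 0 <= \sum_(A <- s) B1 A by exact: sumr_ge0.
have s2 : 0 <= \sum_(A <- s) B2 A by exact: sumr_ge0.
have s3 : 0 <= \sum_(A <- s) B3 A by exact: sumr_ge0.
have s4 : 0 <= \sum_(A <- s) B4 A by exact: sumr_ge0.
pose p : R := Num.sqrt C * 2 ^+ minn k1 k3 * (del k1 k3 * r) * (Num.sqrt (\sum_(A <- s) B1 A) * Num.sqrt (\sum_(A <- s) B3 A)).
pose q : R := Num.sqrt C * 2 ^+ minn k2 k4 * (del k2 k4 * r') * (Num.sqrt (\sum_(A <- s) B2 A) * Num.sqrt (\sum_(A <- s) B4 A)).
have four n : 4 ^+ n = (2 ^+ n) ^+ 2 :> R.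
  by rewrite -exprM mulnC exprM; congr (_ ^+ _); ring.
have p2 : p ^+ 2 = C * 4 ^+ minn k1 k3 * (del k1 k3 * r) ^+ 2 * ((\sum_(A <- s) B1 A) * (\sum_(A <- s) B3 A)).
  by rewrite /p !exprMn !sqr_sqrtr ?(ltW C0) // four.
have q2 : q ^+ 2 = C * 4 ^+ minn k2 k4 * (del k2 k4 * r') ^+ 2 * ((\sum_(A <- s) B2 A) * (\sum_(A <- s) B4 A)).
  by rewrite /q !exprMn !sqr_sqrtr ?(ltW C0) // four.
have p0 : 0 <= p by rewrite /p !mulr_ge0 ?sqrtr_ge0 ?exprn_ge0 ?(ltW r0) ?(ltW (del_gt0 _ _)).
have q0 : 0 <= q by rewrite /q !mulr_ge0 ?sqrtr_ge0 ?exprn_ge0 ?(ltW r'0) ?(ltW (del_gt0 _ _)).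
have -> : 2 * C * (r * r') * 2 ^+ (minn k1 k3 + minn k2 k4) * (del k1 k3 * del k2 k4) *
    (Num.sqrt (\sum_(A <- s) B1 A) * Num.sqrt (\sum_(A <- s) B2 A) *
     Num.sqrt (\sum_(A <- s) B3 A) * Num.sqrt (\sum_(A <- s) B4 A)) = 2 * (p * q).
  rewrite /p /q exprD -{1}(@sqr_sqrtr _ C) ?(ltW C0) //; move: (Num.sqrt C) (2 ^+ _) (2 ^+ _) => x y z.
  by ring.
apply: two_sided => // l l0.
rewrite p2 q2.
have bH w w' : (forall A, cbm (DT T) (fun x => w x A)) -> (forall A, cbm (DT T) (fun x => w' x A)) ->
  bm (DT T) (fun t => H s (free (w t) t) (free (w' t) t)) by move=> *; exact: bm_H_free.
have bZ (c : R) (f : R -> R) : bm (DT T) f -> bm (DT T) (fun x => c * f x) by move=> bf; apply: bmM => //; exact: bm_cst.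
have b13 := bH _ _ c1 c3; have b24 := bH _ _ c2 c4.
apply: le_trans (normc_cint_le (m := mu) mD fD (g := fun t => 2^-1 * (l * H s (free (v1 t) t) (free (v3 t) t) + l^-1 *
   H s (free (v2 t) t) (free (v4 t) t))) _ _ _) _.
- by apply: cbm_quad; try exact: cbm_free; apply: cbm_sg; exact: cbm_free.
- exact: (bZ _ _ (bmD (bZ _ _ b13) (bZ _ _ b24))).
- by move=> t _; rewrite -(H_sg b (free (v2 t) t) (free (v4 t) t) sN us); exact: normc_quad_le.
rewrite (bm_intZ (m := mu) mD fD _ (bmD (bZ _ _ b13) (bZ _ _ b24))) mulVKf ?pnatr_eq0 //.
rewrite (bm_intD (m := mu) mD fD (bZ _ _ b13) (bZ _ _ b24)).
rewrite (bm_intZ (m := mu) mD fD _ b13) (bm_intZ (m := mu) mD fD _ b24).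
by apply: lerD; rewrite ler_pM2l ?invr_gt0.
Qed.

Lemma quadE s (f1 f2 f3 f4 : freq -> R[i]) : quad s f1 f2 f3 f4 =
  \sum_(x <- quads s | x.1.1 + x.1.2 + x.2.1 + x.2.2 == 0) f1 x.1.1 * f2 x.1.2 * f3 x.2.1 * f4 x.2.2.
Proof.
rewrite [RHS]big_mkcond sum_quads /quad; apply: eq_bigr => A _; apply: eq_bigr => B _.
by apply: eq_bigr => C _; rewrite [LHS]big_mkcond.
Qed.

Lemma quad_swap12 s (f1 f2 f3 f4 : freq -> R[i]) : quad s f1 f2 f3 f4 = quad s f2 f1 f3 f4.
Proof.
rewrite /quad exchange_big /=; apply: eq_bigr => A _; apply: eq_bigr => B _.
apply: eq_bigr => C _; apply: eq_big => [D|D _]; first by rewrite [B + A]addrC.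
by rewrite [f1 _ * _]mulrC.
Qed.

Lemma quad_swap23 s (f1 f2 f3 f4 : freq -> R[i]) : quad s f1 f2 f3 f4 = quad s f1 f3 f2 f4.
Proof.
rewrite /quad; apply: eq_bigr => A _; rewrite exchange_big /=; apply: eq_bigr => B _.
apply: eq_bigr => C _; apply: eq_big => [D|D _]; first by rewrite [A + C + B]addrAC.
by rewrite [f1 _ * _ * _]mulrAC.
Qed.

Lemma sup4N A : sup4 (- A) = sup4 A.
Proof. by case: A => [[[a b] c] d]; rewrite /sup4 !cE /c1 /c2 /c3 /c4; cbn [fst snd]; rewrite !abszN. Qed.

Lemma levN A : lev (- A) = lev A. Proof. by rewrite /lev sup4N. Qed.

Lemma sup4D A B : (sup4 (A + B)%R <= sup4 A + sup4 B)%N.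
Proof.
have cb u : in_cube (sup4 u)%:Z u by rewrite in_cubeE.
have := cb A; have := cb B.
rewrite -in_cubeE /in_cube !cE; move: (sup4 A) (sup4 B) => x y; clear.
have h (a b : int) : `|b| <= y -> `|a| <= x -> `|a + b| <= (x + y)%N by lia.
move=> /and4P[y1 y2 y3 y4] /and4P[x1 x2 x3 x4]; apply/and4P.
by split; [exact: h y1 x1|exact: h y2 x2|exact: h y3 x3|exact: h y4 x4].
Qed.

(** Three frequencies of size below [2^m] add up to one of size below [2^(m+2)]. *)
Lemma lev_sum0 A B C D : A + B + C + D = 0 -> (lev A <= maxn (lev B) (maxn (lev C) (lev D)) + 2)%N.
Proof.
move=> e; set m := maxn _ _; apply: up_log_min => //.
have eA : A = - (B + C + D) by apply/eqP; rewrite -subr_eq0 opprK !addrA e.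
have h X : (lev X <= m)%N -> (sup4 X < 2 ^ m)%N.
  by move=> Xm; apply: leq_trans (lev_lt X) _; rewrite leq_exp2l.
have hB := h B (leq_maxl _ _); have hC := h C (leq_trans (leq_maxl _ _) (leq_maxr _ _)).
have hD := h D (leq_trans (leq_maxr _ _) (leq_maxr _ _)).
have s1 := sup4D (B + C) D; have s2 := sup4D B C.
rewrite eA sup4N addnC expnD; move: hB hC hD s1 s2; clear.
by move: (2 ^ m)%N (sup4 _) (sup4 _) (sup4 _) (sup4 _) (sup4 _) => *; lia.
Qed.

End QuadBound.

Section QuadLevels.
Context {R : realType}.
Local Notation mu := (@lebesgue_measure R).
Local Notation DT T := (`[0, T[%classic : set R).
Implicit Types (v w : R -> freq -> R[i]).

Lemma sum_lev (V : nmodType) (N : nat) (s : seq freq) (F : freq -> V) :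
  (forall A, A \in s -> (lev A < N)%N) ->
  \sum_(k < N) \sum_(A <- s) resk k F A = \sum_(A <- s) F A.
Proof.
move=> sN; rewrite exchange_big /= big_seq [RHS]big_seq; apply: eq_bigr => A As.
rewrite (bigD1 (Ordinal (sN A As))) //= /resk eqxx big1 ?addr0 // => k kA.
by rewrite ifN //; apply: contra kA => /eqP e; apply/eqP/val_inj.
Qed.

Lemma resk_sum (V : nmodType) (N : nat) (F : freq -> V) A : (lev A < N)%N ->
  \sum_(k < N) resk k F A = F A.
Proof.
move=> AN; rewrite (bigD1 (Ordinal AN)) //= /resk eqxx big1 ?addr0 // => k kA.
by rewrite ifN //; apply: contra kA => /eqP e; apply/eqP/val_inj.
Qed.

Local Notation four N := (('I_N * 'I_N) * ('I_N * 'I_N))%type.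

Lemma quad_levels (N : nat) s (f1 f2 f3 f4 : freq -> R[i]) :
  (forall A, A \in s -> (lev A < N)%N) ->
  quad s f1 f2 f3 f4 = \sum_(x : four N)
    quad s (resk x.1.1 f1) (resk x.2.1 f2) (resk x.1.2 f3) (resk x.2.2 f4).
Proof.
move=> sN; rewrite quadE; under [RHS]eq_bigr do rewrite quadE.
rewrite [RHS]exchange_big /= big_seq_cond [RHS]big_seq_cond; apply: eq_bigr => y /andP[].
rewrite mem_quads => /and4P[y1 y2 y3 y4] _.
rewrite -(resk_sum f1 (sN _ y1)) -(resk_sum f2 (sN _ y2)) -(resk_sum f3 (sN _ y3)) -(resk_sum f4 (sN _ y4)).
have h (a b c d : R[i]) : a * b * c * d = (a * c) * (b * d) by ring.
have d (I J : finType) (a : I -> R[i]) (c : J -> R[i]) :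
    (\sum_i a i) * (\sum_j c j) = \sum_(x : I * J) a x.1 * c x.2.
  rewrite mulr_suml -(pair_bigA _ (fun i j => a i * c j)) /=; apply: eq_bigr => i _.
  by rewrite mulr_sumr.
rewrite h (d _ _ (fun k : 'I_N => resk k f1 _)) (d _ _ (fun k : 'I_N => resk k f2 _)).
rewrite (d _ _ (fun z : 'I_N * 'I_N => resk z.1 f1 y.1.1 * resk z.2 f3 y.2.1)).
by apply: eq_bigr => x _; rewrite h.
Qed.

Lemma resk_free k (f : freq -> R[i]) t : resk k (free f t) = free (resk k f) t.
Proof. by apply/funext => A; rewrite /resk /free; case: ifP; rewrite ?mulr0. Qed.

Lemma resk_sg b k (f : freq -> R[i]) : resk k (sg b f) = sg b (resk k f).
Proof.
case: b => //; apply/funext => A; rewrite /= /resk /refl levN; case: ifP => //.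
by rewrite conjc0.
Qed.

Lemma resk_neq0 k (v : R -> freq -> R[i]) (s : seq freq) : (forall x A, v x A != 0 -> A \in s) ->
  forall x A, resk k (v x) A != 0 -> A \in s /\ lev A = k.
Proof.
by move=> vs x A; rewrite /resk; case: (lev A =P k) => [e h|_]; [split=> //; exact: vs h|rewrite eqxx].
Qed.

Lemma wvar0 T : wvar T 0 (fun _ : R => 0 : R[i]).
Proof.
split=> [x _|n t _]; first by rewrite normc0 expr0n.
by rewrite mul0r big1 // => i _; rewrite subr0 normc0 expr0n.
Qed.

Lemma resk_wvar T k v (B : freq -> R) (s : seq freq) :
  (forall A, A \in s -> wvar T (B A) (fun x => v x A)) ->
  forall A, A \in s -> wvar T (resk k B A) (fun x => resk k (v x) A).
Proof.
move=> wv A As; rewrite /resk; case: (lev A == k); [exact: wv|exact: wvar0].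
Qed.

Lemma resk_ge0 k (B : freq -> R) : (forall A, 0 <= B A) -> forall A, 0 <= resk k B A.
Proof. by move=> B0 A; rewrite /resk; case: ifP. Qed.

Lemma sqrt_four_mul (n : nat) (x : R) : Num.sqrt (4 ^+ n * x) = 2 ^+ n * Num.sqrt x.
Proof.
have e : 4 ^+ n = (2 ^+ n) ^+ 2 :> R by rewrite -exprM mulnC exprM; congr (_ ^+ _); ring.
by rewrite e sqrtrM ?sqr_ge0 // sqrtr_sqr ger0_norm // exprn_ge0.
Qed.

Lemma sqrt_four_div (n : nat) (x : R) : Num.sqrt (4 ^- n * x) = 2 ^- n * Num.sqrt x.
Proof.
have e : 4 ^- n = (2 ^- n) ^+ 2 :> R.
  rewrite exprVn -exprM mulnC exprM; congr ((_ ^+ _)^-1); ring.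
by rewrite e sqrtrM ?sqr_ge0 // sqrtr_sqr ger0_norm // invr_ge0 exprn_ge0.
Qed.

Definition near_levels (i j k l : nat) : bool :=
  ((maxn i j <= maxn k l + 2) && (maxn k l <= maxn i j + 2))%N.

(** The two highest levels differ by at most 2, and a pairing that separates them has comparable
    maxima; two of the three pairings do. *)
Lemma near_some (i j k l : nat) : (i <= maxn j (maxn k l) + 2)%N -> (j <= maxn i (maxn k l) + 2)%N ->
  (k <= maxn i (maxn j l) + 2)%N -> (l <= maxn i (maxn j k) + 2)%N ->
  [|| near_levels i k j l, near_levels i j k l | near_levels j k i l].
Proof. rewrite /near_levels; lia. Qed.

(* With [k1] the level of the factor of negative order, the weights lose at most [4]. *)
Lemma weight_loss (k1 k2 k3 k4 m : nat) (a y1 y2 y3 y4 : R) :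
  0 <= a -> 0 <= y1 -> 0 <= y2 -> 0 <= y3 -> 0 <= y4 ->
  (m + k1 <= k2 + k3 + k4 + 2)%N ->
  a * 2 ^+ m * ((2 ^+ k1 * y1) * (2 ^- k2 * y2) * (2 ^- k3 * y3) * (2 ^- k4 * y4)) <=
  4 * a * (y1 * y2 * y3 * y4).
Proof.
move=> a0 y10 y20 y30 y40 h.
have h2 : 2 ^+ m * 2 ^+ k1 <= 4 * (2 ^+ k2 * 2 ^+ k3 * 2 ^+ k4) :> R.
  have -> : 4 = 2 ^+ 2 :> R by ring.
  by rewrite -!exprD ler_eXn2l ?ltr1n //; move: h; clear; lia.
have p n : 0 < 2 ^+ n :> R by rewrite exprn_gt0.
move: h2 (p k2) (p k3) (p k4); move: (2 ^+ m) (2 ^+ k1) (2 ^+ k2) (2 ^+ k3) (2 ^+ k4) => b c d e f h2 d0 e0 f0.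
have -> : a * b * ((c * y1) * (d^-1 * y2) * (e^-1 * y3) * (f^-1 * y4)) =
   (b * c / (d * e * f)) * (a * (y1 * y2 * y3 * y4)).
  by field; rewrite !lt0r_neq0.
rewrite -[leRHS]mulrA ler_wpM2r //; first by apply: mulr_ge0 => //; rewrite !mulr_ge0.
by rewrite ler_pdivrMr // !mulr_gt0.
Qed.

Lemma quad_bound : exists C : R, 0 < C /\
  forall T s b v1 v2 v3 v4 (B1 B2 B3 B4 : freq -> R) (r : R),
  0 < T <= 1 -> uniq s -> (forall A, (- A \in s) = (A \in s)) -> 0 < r ->
  (forall A, 0 <= B1 A) -> (forall A, 0 <= B2 A) -> (forall A, 0 <= B3 A) -> (forall A, 0 <= B4 A) ->
  (forall A, A \in s -> wvar T (B1 A) (fun x => v1 x A)) ->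
  (forall A, A \in s -> wvar T (B2 A) (fun x => v2 x A)) ->
  (forall A, A \in s -> wvar T (B3 A) (fun x => v3 x A)) ->
  (forall A, A \in s -> wvar T (B4 A) (fun x => v4 x A)) ->
  (forall x A, v1 x A != 0 -> A \in s) -> (forall x A, v2 x A != 0 -> A \in s) ->
  (forall x A, v3 x A != 0 -> A \in s) -> (forall x A, v4 x A != 0 -> A \in s) ->
  r = 1 \/ (forall x A, v2 x A != 0 -> T * 4 ^+ lev A <= r ^+ 7) ->
  normc (cintegral mu (DT T) (fun t => quad s (free (v1 t) t) (free (v2 t) t) (free (v3 t) t)
     (sg b (free (v4 t) t)))) <=
  C * r * (Num.sqrt (\sum_(A <- s) 4 ^- lev A * B1 A) * Num.sqrt (\sum_(A <- s) 4 ^+ lev A * B2 A) *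
     Num.sqrt (\sum_(A <- s) 4 ^+ lev A * B3 A) * Num.sqrt (\sum_(A <- s) 4 ^+ lev A * B4 A)).
Proof.
have [C [C0 qb]] := @quad_block R.
exists (3 * (4 * C) * (3 * (2 * Sd)) ^+ 2 + 1); split.
  apply: ltr_wpDl => //; apply: mulr_ge0; last exact: sqr_ge0.
  by apply: mulr_ge0 => //; apply: mulr_ge0 => //; exact: ltW.
move=> T s b v1 v2 v3 v4 B1 B2 B3 B4 r T01 us sN r0 B10 B20 B30 B40 w1 w2 w3 w4 u1 u2 u3 u4 hr.
have mD : measurable (DT T) := measurable_itv _.
have fD : (mu (DT T) < +oo)%E := lebesgue_itv_finite _ _.
have T0 : 0 < T by case/andP: T01.
pose N := (\max_(A <- s) lev A).+1.
have sNl A : A \in s -> (lev A < N)%N.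
  by move=> As; rewrite ltnS; exact: (leq_bigmax_seq (F := lev)).
pose b1 k := \sum_(A <- s) resk k B1 A; pose b2 k := \sum_(A <- s) resk k B2 A.
pose b3 k := \sum_(A <- s) resk k B3 A; pose b4 k := \sum_(A <- s) resk k B4 A.
pose y1 k := 2 ^- k * Num.sqrt (b1 k); pose y2 k := 2 ^+ k * Num.sqrt (b2 k).
pose y3 k := 2 ^+ k * Num.sqrt (b3 k); pose y4 k := 2 ^+ k * Num.sqrt (b4 k).
have p2 n : 0 < 2 ^+ n :> R by rewrite exprn_gt0.
have y10 k : 0 <= y1 k by rewrite mulr_ge0 ?sqrtr_ge0 // invr_ge0 ltW.
have y20 k : 0 <= y2 k by rewrite mulr_ge0 ?sqrtr_ge0 // ltW.
have y30 k : 0 <= y3 k by rewrite mulr_ge0 ?sqrtr_ge0 // ltW.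
have y40 k : 0 <= y4 k by rewrite mulr_ge0 ?sqrtr_ge0 // ltW.
have e1 k : Num.sqrt (b1 k) = 2 ^+ k * y1 k by rewrite /y1 mulVKf // lt0r_neq0.
have e2 k : Num.sqrt (b2 k) = 2 ^- k * y2 k by rewrite /y2 mulKf // lt0r_neq0.
have e3 k : Num.sqrt (b3 k) = 2 ^- k * y3 k by rewrite /y3 mulKf // lt0r_neq0.
have e4 k : Num.sqrt (b4 k) = 2 ^- k * y4 k by rewrite /y4 mulKf // lt0r_neq0.
set Y1 := \sum_(A <- s) 4 ^- lev A * B1 A; set Y2 := \sum_(A <- s) 4 ^+ lev A * B2 A.
set Y3 := \sum_(A <- s) 4 ^+ lev A * B3 A; set Y4 := \sum_(A <- s) 4 ^+ lev A * B4 A.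
have p4 n : 0 < 4 ^+ n :> R by rewrite exprn_gt0.
have Y10 : 0 <= Y1 by apply: sumr_ge0 => A _; rewrite mulr_ge0 // invr_ge0 ltW.
have Yge (B : freq -> R) : (forall A, 0 <= B A) -> 0 <= \sum_(A <- s) 4 ^+ lev A * B A.
  by move=> B0; apply: sumr_ge0 => A _; rewrite mulr_ge0 // ltW.
have bge k (B : freq -> R) : (forall A, 0 <= B A) -> 0 <= \sum_(A <- s) resk k B A.
  by move=> B0; apply: sumr_ge0 => A _; exact: resk_ge0.
have q1 : \sum_(k < N) y1 k ^+ 2 <= Num.sqrt Y1 ^+ 2.
  rewrite sqr_sqrtr // le_eqVlt; apply/orP; left; apply/eqP.
  rewrite /Y1 -(sum_lev (fun A => 4 ^- lev A * B1 A) sNl); apply: eq_bigr => k _.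
  rewrite /y1 -sqrt_four_div sqr_sqrtr; last by rewrite mulr_ge0 ?bge // invr_ge0 ltW.
  rewrite mulr_sumr; apply: eq_bigr => A _; rewrite /resk; case: eqP => [->//|_]; exact: mulr0.
have q' (B : freq -> R) : (forall A, 0 <= B A) ->
    \sum_(k < N) (2 ^+ k * Num.sqrt (\sum_(A <- s) resk k B A)) ^+ 2 <=
    Num.sqrt (\sum_(A <- s) 4 ^+ lev A * B A) ^+ 2.
  move=> B0; rewrite sqr_sqrtr ?Yge // le_eqVlt; apply/orP; left; apply/eqP.
  rewrite -(sum_lev (fun A => 4 ^+ lev A * B A) sNl); apply: eq_bigr => k _.
  rewrite -sqrt_four_mul sqr_sqrtr; last by rewrite mulr_ge0 ?bge // ltW.
  rewrite mulr_sumr; apply: eq_bigr => A _; rewrite /resk; case: eqP => [->//|_]; exact: mulr0.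
have q2 := q' _ B20; have q3 := q' _ B30; have q4 := q' _ B40.
pose f1 t := free (v1 t) t; pose f2 t := free (v2 t) t; pose f3 t := free (v3 t) t.
pose f4 t := sg b (free (v4 t) t).
pose Q (x : four N) t := quad s (resk x.1.1 (f1 t)) (resk x.2.1 (f2 t)) (resk x.1.2 (f3 t)) (resk x.2.2 (f4 t)).
have cv k v B : (forall A, A \in s -> wvar T (B A) (fun x => v x A)) -> (forall x A, v x A != 0 -> A \in s) ->
    forall A, cbm (DT T) (fun t => free (resk k (v t)) t A).
  move=> wv vs; apply: (@cbm_free R T (fun t => resk k (v t))).
  by apply: wvar_cbm_all (resk_wvar k wv) _ => x A /(resk_neq0 vs)[].
have QE x : Q x = fun t => quad s (free (resk x.1.1 (v1 t)) t) (free (resk x.2.1 (v2 t)) t)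
    (free (resk x.1.2 (v3 t)) t) (sg b (free (resk x.2.2 (v4 t)) t)).
  by apply/funext => t; rewrite /Q /f1 /f2 /f3 /f4 resk_sg !resk_free.
have cQ x : cbm (DT T) (Q x).
  rewrite QE; apply: cbm_quad; [exact: cv w1 u1|exact: cv w2 u2|exact: cv w3 u3|].
  by apply: (@cbm_sg R T b (fun t => free (resk x.2.2 (v4 t)) t)); exact: cv w4 u4.
pose D (i j k l : nat) (z1 z2 z3 z4 : R) := del i j * (z1 * z2) * (del k l * (z3 * z4)).
pose E13 (x : four N) := if near_levels x.1.1 x.1.2 x.2.1 x.2.2 then
  D x.1.1 x.1.2 x.2.1 x.2.2 (y1 x.1.1) (y3 x.1.2) (y2 x.2.1) (y4 x.2.2) else 0.
pose E12 (x : four N) := if near_levels x.1.1 x.2.1 x.1.2 x.2.2 then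
  D x.1.1 x.2.1 x.1.2 x.2.2 (y1 x.1.1) (y2 x.2.1) (y3 x.1.2) (y4 x.2.2) else 0.
pose E23 (x : four N) := if near_levels x.2.1 x.1.2 x.1.1 x.2.2 then
  D x.2.1 x.1.2 x.1.1 x.2.2 (y2 x.2.1) (y3 x.1.2) (y1 x.1.1) (y4 x.2.2) else 0.
have D0 i j k l z1 z2 z3 z4 : 0 <= z1 -> 0 <= z2 -> 0 <= z3 -> 0 <= z4 -> 0 <= D i j k l z1 z2 z3 z4.
  by move=> *; apply: mulr_ge0; apply: mulr_ge0; rewrite ?mulr_ge0 ?(ltW (del_gt0 _ _)).
have E130 x : 0 <= E13 x by rewrite /E13; case: ifP => // _; exact: D0.
have E120 x : 0 <= E12 x by rewrite /E12; case: ifP => // _; exact: D0.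
have E230 x : 0 <= E23 x by rewrite /E23; case: ifP => // _; exact: D0.
have Cr : 0 <= 4 * C * r by apply: mulr_ge0; [apply: mulr_ge0 => //; exact: ltW|exact: ltW].
(* If no quadruple of sum zero meets the four supports, the form vanishes; otherwise such a
   quadruple relates the levels, and [near_some] selects a pairing. The pair with the second factor
   uses [r], as its lower level is at most that of this factor; the other pair uses 1. *)
have term x : normc (cintegral mu (DT T) (Q x)) <= 4 * C * r * (E13 x + E12 x + E23 x).
  have [[t0 [[[A1 A2] [A3 A4]] [sum0 [n1 n2 n3 n4]]]]|zero] := pselect (exists t (y : freq * freq * (freq * freq)),
      y.1.1 + y.1.2 + y.2.1 + y.2.2 = 0 /\
      [/\ resk x.1.1 (f1 t) y.1.1 != 0, resk x.2.1 (f2 t) y.1.2 != 0,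
       resk x.1.2 (f3 t) y.2.1 != 0 & resk x.2.2 (f4 t) y.2.2 != 0]); last first.
    have -> : Q x = fun _ => 0.
      apply/funext => t; rewrite /Q quadE big1 // => y /eqP y0; apply/eqP.
      apply: contra_notT zero; rewrite !mulf_eq0 !negb_or => /andP[/andP[/andP[z1 z2] z3] z4].
      by exists t, y.
    by rewrite (cint0 mu mD) normc0 mulr_ge0 // !addr_ge0.
  cbn [fst snd] in sum0, n1, n2, n3, n4.
  have lk k (f : freq -> R[i]) A : resk k f A != 0 -> lev A = k.
    by rewrite /resk; case: (lev A =P k) => // _; rewrite eqxx.
  have [l1 l2 l3 l4] := And4 (lk _ _ _ n1) (lk _ _ _ n2) (lk _ _ _ n3) (lk _ _ _ n4).
  have d1 := lev_sum0 sum0.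
  have d2 : (lev A2 <= maxn (lev A1) (maxn (lev A3) (lev A4)) + 2)%N.
    by apply: lev_sum0; rewrite -sum0; fring.
  have d3 : (lev A3 <= maxn (lev A1) (maxn (lev A2) (lev A4)) + 2)%N.
    by apply: lev_sum0; rewrite -sum0; fring.
  have d4 : (lev A4 <= maxn (lev A1) (maxn (lev A2) (lev A3)) + 2)%N.
    by apply: lev_sum0; rewrite -sum0; fring.
  rewrite l1 l2 l3 l4 in d1 d2 d3 d4.
  have T2 : r = 1 \/ T * 4 ^+ x.2.1 <= r ^+ 7.
    case: hr => [->|hr]; [by left|right].
    rewrite -l2; apply: (hr t0); move: n2; rewrite /resk l2 eqxx /f2 /free.
    by rewrite mulf_eq0 negb_or => /andP[].
  have T2m (m : nat) : (m <= x.2.1)%N -> r = 1 \/ T * 4 ^+ m <= r ^+ 7.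
    move=> mx; case: T2 => [->|h]; [by left|right]; apply: le_trans h.
    by rewrite ler_pM2l // ler_weXn2l // ler1n.
  have one (m : nat) : 1 = 1 :> R \/ T * 4 ^+ m <= 1 ^+ 7 by left.
  have R1 := resk_wvar _ w1; have R2 := resk_wvar _ w2; have R3 := resk_wvar _ w3; have R4 := resk_wvar _ w4.
  have S1 k := @resk_neq0 k v1 s u1; have S2 k := @resk_neq0 k v2 s u2.
  have S3 k := @resk_neq0 k v3 s u3; have S4 k := @resk_neq0 k v4 s u4.
  have Z1 := resk_ge0 _ B10; have Z2 := resk_ge0 _ B20; have Z3 := resk_ge0 _ B30; have Z4 := resk_ge0 _ B40.
  rewrite QE; have := near_some d1 d2 d3 d4; case/or3P => nr.
  - apply: le_trans (_ : _ <= 4 * C * r * E13 x) _; last first.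
      by rewrite ler_wpM2l // -addrA lerDl addr_ge0.
    rewrite /E13 nr.
    apply: le_trans (qb T s b (fun t => resk x.1.1 (v1 t)) (fun t => resk x.2.1 (v2 t)) (fun t => resk x.1.2 (v3 t))
      (fun t => resk x.2.2 (v4 t)) _ _ _ _ _ _ _ _ 1 r T01 us sN ltr01 r0 (Z1 _) (Z2 _) (Z3 _) (Z4 _)
      (R1 _) (R2 _) (R3 _) (R4 _) (S1 _) (S2 _) (S3 _) (S4 _) (one _) (T2m _ (geq_minl _ _))) _.
    rewrite -/(b1 _) -/(b2 _) -/(b3 _) -/(b4 _) e1 e2 e3 e4 mul1r.
    have hd : 0 <= C * r * (del x.1.1 x.1.2 * del x.2.1 x.2.2).
      by rewrite !mulr_ge0 ?(ltW C0) ?(ltW r0) ?(ltW (del_gt0 _ _)).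
    have hn : ((minn x.1.1 x.1.2 + minn x.2.1 x.2.2) + x.1.1 <= x.2.1 + x.1.2 + x.2.2 + 2)%N.
      by move: nr; rewrite /near_levels; clear; move: (nat_of_ord _) (nat_of_ord _) (nat_of_ord _) (nat_of_ord _) => *; lia.
    have hw := weight_loss hd (y10 x.1.1) (y20 x.2.1) (y30 x.1.2) (y40 x.2.2) hn.
    rewrite /D [C * r * _ * _]mulrAC; apply: le_trans hw _.
    by rewrite le_eqVlt; apply/orP; left; apply/eqP; ring.
  - apply: le_trans (_ : _ <= 4 * C * r * E12 x) _; last first.
      by rewrite ler_wpM2l // addrAC lerDr addr_ge0.
    rewrite /E12 nr.
    have -> : (fun t => quad s (free (resk x.1.1 (v1 t)) t) (free (resk x.2.1 (v2 t)) t)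
        (free (resk x.1.2 (v3 t)) t) (sg b (free (resk x.2.2 (v4 t)) t))) =
       (fun t => quad s (free (resk x.1.1 (v1 t)) t) (free (resk x.1.2 (v3 t)) t)
        (free (resk x.2.1 (v2 t)) t) (sg b (free (resk x.2.2 (v4 t)) t))).
      by apply/funext => t; exact: quad_swap23.
    apply: le_trans (qb T s b (fun t => resk x.1.1 (v1 t)) (fun t => resk x.1.2 (v3 t)) (fun t => resk x.2.1 (v2 t))
      (fun t => resk x.2.2 (v4 t)) _ _ _ _ _ _ _ _ r 1 T01 us sN r0 ltr01 (Z1 _) (Z3 _) (Z2 _) (Z4 _)
      (R1 _) (R3 _) (R2 _) (R4 _) (S1 _) (S3 _) (S2 _) (S4 _) (T2m _ (geq_minr _ _)) (one _)) _.
    rewrite -/(b1 _) -/(b2 _) -/(b3 _) -/(b4 _) e1 e2 e3 e4 mulr1.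
    have hd : 0 <= C * r * (del x.1.1 x.2.1 * del x.1.2 x.2.2).
      by rewrite !mulr_ge0 ?(ltW C0) ?(ltW r0) ?(ltW (del_gt0 _ _)).
    have hn : ((minn x.1.1 x.2.1 + minn x.1.2 x.2.2) + x.1.1 <= x.1.2 + x.2.1 + x.2.2 + 2)%N.
      by move: nr; rewrite /near_levels; clear; move: (nat_of_ord _) (nat_of_ord _) (nat_of_ord _) (nat_of_ord _) => *; lia.
    have hw := weight_loss hd (y10 x.1.1) (y30 x.1.2) (y20 x.2.1) (y40 x.2.2) hn.
    rewrite /D [C * r * _ * _]mulrAC; apply: le_trans hw _.
    by rewrite le_eqVlt; apply/orP; left; apply/eqP; ring.
  - apply: le_trans (_ : _ <= 4 * C * r * E23 x) _; last first.
      by rewrite ler_wpM2l // lerDr addr_ge0.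
    rewrite /E23 nr.
    have -> : (fun t => quad s (free (resk x.1.1 (v1 t)) t) (free (resk x.2.1 (v2 t)) t)
        (free (resk x.1.2 (v3 t)) t) (sg b (free (resk x.2.2 (v4 t)) t))) =
       (fun t => quad s (free (resk x.2.1 (v2 t)) t) (free (resk x.1.1 (v1 t)) t)
        (free (resk x.1.2 (v3 t)) t) (sg b (free (resk x.2.2 (v4 t)) t))).
      by apply/funext => t; exact: quad_swap12.
    apply: le_trans (qb T s b (fun t => resk x.2.1 (v2 t)) (fun t => resk x.1.1 (v1 t)) (fun t => resk x.1.2 (v3 t))
      (fun t => resk x.2.2 (v4 t)) _ _ _ _ _ _ _ _ r 1 T01 us sN r0 ltr01 (Z2 _) (Z1 _) (Z3 _) (Z4 _)
      (R2 _) (R1 _) (R3 _) (R4 _) (S2 _) (S1 _) (S3 _) (S4 _) (T2m _ (geq_minl _ _)) (one _)) _.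
    rewrite -/(b1 _) -/(b2 _) -/(b3 _) -/(b4 _) [Num.sqrt (b2 _) * Num.sqrt (b1 _)]mulrC e1 e2 e3 e4 mulr1.
    have hd : 0 <= C * r * (del x.2.1 x.1.2 * del x.1.1 x.2.2).
      by rewrite !mulr_ge0 ?(ltW C0) ?(ltW r0) ?(ltW (del_gt0 _ _)).
    have hn : ((minn x.2.1 x.1.2 + minn x.1.1 x.2.2) + x.1.1 <= x.2.1 + x.1.2 + x.2.2 + 2)%N.
      by move: nr; rewrite /near_levels; clear; move: (nat_of_ord _) (nat_of_ord _) (nat_of_ord _) (nat_of_ord _) => *; lia.
    have hw := weight_loss hd (y10 x.1.1) (y20 x.2.1) (y30 x.1.2) (y40 x.2.2) hn.
    rewrite /D [C * r * _ * _]mulrAC; apply: le_trans hw _.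
    by rewrite le_eqVlt; apply/orP; left; apply/eqP; ring.
pose YY := Num.sqrt Y1 * Num.sqrt Y2 * Num.sqrt Y3 * Num.sqrt Y4.
have YY0 : 0 <= YY by rewrite /YY !mulr_ge0 ?sqrtr_ge0.
have s13 : \sum_x E13 x <= (3 * (2 * Sd)) ^+ 2 * YY.
  rewrite -big_mkcond /=.
  apply: le_trans (dyadic_sum y10 y30 y20 y40 (sqrtr_ge0 _) (sqrtr_ge0 _) (sqrtr_ge0 _) (sqrtr_ge0 _) q1 q3 q2 q4) _.
  by rewrite /YY le_eqVlt; apply/orP; left; apply/eqP; move: Sd => c; ring.
have s12 : \sum_x E12 x <= (3 * (2 * Sd)) ^+ 2 * YY.
  rewrite (reindex_inj (h := fun z : four N => ((z.1.1, z.2.1), (z.1.2, z.2.2)))); last first.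
    by move=> [[? ?] [? ?]] [[? ?] [? ?]] /= [-> -> -> ->].
  rewrite -big_mkcond /=.
  apply: le_trans (dyadic_sum y10 y20 y30 y40 (sqrtr_ge0 _) (sqrtr_ge0 _) (sqrtr_ge0 _) (sqrtr_ge0 _) q1 q2 q3 q4) _.
  by rewrite /YY le_eqVlt; apply/orP; left; apply/eqP; move: Sd => c; ring.
have s23 : \sum_x E23 x <= (3 * (2 * Sd)) ^+ 2 * YY.
  rewrite (reindex_inj (h := fun z : four N => ((z.2.1, z.1.2), (z.1.1, z.2.2)))); last first.
    by move=> [[? ?] [? ?]] [[? ?] [? ?]] /= [-> -> -> ->].
  rewrite -big_mkcond /=.
  apply: le_trans (dyadic_sum y20 y30 y10 y40 (sqrtr_ge0 _) (sqrtr_ge0 _) (sqrtr_ge0 _) (sqrtr_ge0 _) q2 q3 q1 q4) _.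
  by rewrite /YY le_eqVlt; apply/orP; left; apply/eqP; move: Sd => c; ring.
have -> : (fun t => quad s (free (v1 t) t) (free (v2 t) t) (free (v3 t) t) (sg b (free (v4 t) t))) =
   (fun t => \sum_(x : four N) Q x t).
  by apply/funext => t; rewrite (quad_levels (N := N)).
rewrite (cint_sum (m := mu) mD fD); last by move=> x _; exact: cQ.
apply: le_trans (normc_sum _ _ _) _; apply: le_trans (ler_sum _ (fun x _ => term x)) _.
rewrite -mulr_sumr !big_split /= -/YY.
apply: le_trans (_ : _ <= 4 * C * r * (3 * ((3 * (2 * Sd)) ^+ 2 * YY))) _.
  by rewrite ler_wpM2l //; move: s13 s12 s23; move: (_ * YY) => z; lra.
rewrite -subr_ge0; have : 0 <= r * YY by rewrite mulr_ge0 // ltW.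
by clearbody YY; congr (0 <= _); move: Sd => c; ring.
Qed.

End QuadLevels.

(** * The norms *)

Section NormBounds.
Context {R : realType}.
Implicit Types (T : R) (u : R -> freq -> R[i]).

Lemma V2_norm_ge0 (v : R -> R[i]) : (0 <= V2_norm v)%E.
Proof.
apply: le_trans (_ : _ <= (Num.sqrt (\sum_(0 <= k < 1)
   normc (val_ext v ((k.+1)%:R%:E) - val_ext v (k%:R%:E)) ^+ 2))%:E)%E _.
  by rewrite lee_fin sqrtr_ge0.
apply: ereal_sup_ubound; exists 1%N, (fun k => (k%:R%:E)); split=> //; split=> //.
  by rewrite ltNyr.
by move=> k _; rewrite lte_fin ltr_nat.
Qed.

Lemma V2_restr_ge0 T (v : R -> R[i]) : (0 <= V2_restr T v)%E.
Proof. by apply: le_ereal_inf_tmp => _ [w _ <-]; exact: V2_norm_ge0. Qed.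

Lemma crt_ge1 n : (0 < n)%N -> 1 <= crt n :> R.
Proof.
move=> n0; rewrite leNgt; apply/negP => c1.
have : crt n ^+ 3 < 1 :> R by rewrite exprn_ilt1 // crt_ge0.
by rewrite crt3 ltNge ler1n n0.
Qed.

Lemma V2_restr_le T (v : R -> R[i]) (y : R) :
  (forall w, agree_on T w v -> y%:E <= V2_norm w)%E -> (y%:E <= V2_restr T v)%E.
Proof. by move=> h; apply: le_ereal_inf_tmp => _ [w [_ aw] <-]; exact: h. Qed.

(** A chain is a finite partition, and [n^(1/3) >= 1] for [n > 0]. The pointwise bound comes from
    the partition [x < +oo] and the value 0 at infinity. *)
Lemma V2_restr_wvar T (v : R -> R[i]) : (V2_restr T v < +oo)%E ->
  wvar T (fine (V2_restr T v) ^+ 2) v.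
Proof.
move=> fv; have finv : V2_restr T v \is a fin_num by rewrite ge0_fin_numE // V2_restr_ge0.
have m0 : 0 <= fine (V2_restr T v) by rewrite fine_ge0 // V2_restr_ge0.
have key (X : R) : 0 <= X -> ((Num.sqrt X)%:E <= V2_restr T v)%E -> X <= fine (V2_restr T v) ^+ 2.
  move=> X0; rewrite -{1}(fineK finv) lee_fin => h.
  by rewrite -[leLHS]sqr_sqrtr // lerXn2r ?nnegrE ?sqrtr_ge0.
split=> [x xT|n t [tT tlt]].
  apply: key; first exact: sqr_ge0.
  apply: V2_restr_le => w wv; apply: ereal_sup_ubound.
  exists 1%N, (fun k => if k is 0%N then x%:E else +oo%E); split.
    by split=> //= [|[|//] _]; rewrite ?ltNyr ?ltry.
  by rewrite big_nat1 /= sub0r normcN wv.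
have [->|n0] := posnP n; first by rewrite big_ord0 mulr_ge0 ?sqr_ge0 // crt_ge0.
have S0 : 0 <= \sum_(k < n) normc (v (t k.+1) - v (t k)) ^+ 2.
  by apply: sumr_ge0 => k _; exact: sqr_ge0.
apply: le_trans (_ : _ <= fine (V2_restr T v) ^+ 2) _; last first.
  by rewrite ler_peMr ?sqr_ge0 // crt_ge1.
apply: key => //; apply: V2_restr_le => w wv; apply: ereal_sup_ubound.
exists n, (fun k => (t k)%:E); split.
  by split=> // [|k kn]; rewrite ?ltNyr // lte_fin; have [] := tlt k kn.
congr (Num.sqrt _)%:E; rewrite big_mkord; apply: eq_bigr => k _ /=.
by rewrite !wv //; apply: tT; rewrite // ltnW.
Qed.

Lemma weighted_l2_finite (s : R) (n : freq -> \bar R) : (forall A, 0 <= n A)%E ->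
  (weighted_l2 s n < +oo)%E -> (forall A, n A < +oo)%E /\
  forall S : seq freq, uniq S ->
    \sum_(A <- S) japanese A `^ (2 * s) * fine (n A) ^+ 2 <= fine (weighted_l2 s n) ^+ 2.
Proof.
move=> n0; rewrite /weighted_l2; set F := fun A => _; set E := \esum_(A in _) _ => fE.
have F0 A : (0 <= F A)%E by rewrite /F mule_ge0 ?lee_fin ?powR_ge0 // expe_ge0.
have E0 : (0 <= E)%E by apply: esum_ge0 => A _; exact: F0.
have Ef : E \is a fin_num by rewrite -(sqrte_fin_num E0) ge0_fin_numE ?sqrte_ge0.
have sumE (S : seq freq) : uniq S -> (\sum_(A <- S) F A <= E)%E.
  move=> uS; apply: esum_ge; exists [set` S]; first by split=> //; exact: finite_seq.
  by rewrite fsbig_seq.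
have j0 (A : freq) : 0 < (japanese A : R) `^ (2 * s).
  apply: powR_gt0; rewrite sqrtr_gt0 ltr_wpDr ?ltr01 //.
  by case: A => [[[a b] c] d]; rewrite /sqnorm ler0z !addr_ge0 ?sqr_ge0.
have nf A : (n A < +oo)%E.
  rewrite ltey; apply/eqP => nA; have := sumE [:: A] isT; rewrite big_seq1 /F nA.
  rewrite expe2 mulyy gt0_muley ?lte_fin // leye_eq => /eqP e.
  by rewrite e in Ef.
split=> // S uS.
have -> : fine (sqrte E) ^+ 2 = fine E.
  by rewrite -(fineK Ef) /= sqr_sqrtr ?fine_ge0.
rewrite -lee_fin (fineK Ef); apply: le_trans (sumE S uS); rewrite -sumEFin le_eqVlt.
apply/orP; left; apply/eqP; apply: eq_bigr => A _; rewrite /F EFinM; congr (_ * _)%E.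
have nA : n A \is a fin_num by rewrite ge0_fin_numE.
by rewrite EFin_expe fineK.
Qed.

(* Both [Y^s] functions and free evolutions of [H^s] data provide such bounds. *)
Definition ybound (s T : R) u (n : R) : Prop :=
  exists B : freq -> R, [/\ forall A, 0 <= B A,
    forall A, wvar T (B A) (fun t => profile u t A) &
    forall S : seq freq, uniq S -> \sum_(A <- S) japanese A `^ (2 * s) * B A <= n ^+ 2].

Lemma Y_norm_ybound s T u : (Y_norm s T u < +oo)%E -> ybound s T u (fine (Y_norm s T u)).
Proof.
move=> fY; have [nf nS] := weighted_l2_finite (fun A => V2_restr_ge0 T (fun t => profile u t A)) fY.
exists (fun A => fine (V2_restr T (fun t => profile u t A)) ^+ 2); split=> //.
  by move=> A; exact: sqr_ge0.
by move=> A; exact: V2_restr_wvar.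
Qed.

Lemma expi_add_opp (x : R) : expi x * expi (- x) = 1.
Proof. by rewrite mulrC expiNK. Qed.

Lemma wvar_cst T (v : R -> R[i]) (c : R[i]) : (forall t, 0 <= t < T -> v t = c) -> wvar T (normc c ^+ 2) v.
Proof.
move=> vc; split=> [x xT|n t [tT _]]; first by rewrite vc.
rewrite big1 => [|k _]; first by apply: mulr_ge0; [exact: sqr_ge0|exact: crt_ge0].
by rewrite !vc ?subrr ?normc0 ?expr0n //; apply: tT; rewrite // ltnW.
Qed.

(** The profile of a free evolution is constant on [[0, T)], so its variation vanishes and only its
    size counts. *)
Lemma H_norm_ybound s T u f : is_free_on T u f -> (H_norm s f < +oo)%E ->
  ybound s T u (fine (H_norm s f)).
Proof.
move=> fr fH; have n0 A : (0 <= (normc (f A))%:E)%E by rewrite lee_fin normc_ge0.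
have [_ nS] := weighted_l2_finite n0 fH.
exists (fun A => normc (f A) ^+ 2); split=> [A|A|S uS]; [exact: sqr_ge0| |exact: nS].
by apply: wvar_cst => t tT; rewrite /profile fr // /free mulrA expi_add_opp mul1r.
Qed.

Lemma size_norm_ybound (b : bool) s T u f : (b -> is_free_on T u f) -> (size_norm b s T u f < +oo)%E ->
  ybound s T u (fine (size_norm b s T u f)).
Proof. by case: b => [/(_ isT)|_]; [exact: H_norm_ybound|exact: Y_norm_ybound]. Qed.

Lemma weighted_l2_ge0 s (n : freq -> \bar R) : (0 <= weighted_l2 s n)%E.
Proof. exact: sqrte_ge0. Qed.

Lemma size_norm_ge0 b s T u f : (0 <= size_norm b s T u f)%E.
Proof. by case: b; exact: weighted_l2_ge0. Qed.

Lemma weighted_l2_le (s : R) (n : freq -> \bar R) (K : R) : 0 <= K -> (forall A, 0 <= n A)%E ->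
  (forall S : seq freq, uniq S -> (\sum_(A <- S) (japanese A `^ (2 * s))%:E * n A ^+ 2 <= (K ^+ 2)%:E)%E) ->
  (weighted_l2 s n <= K%:E)%E.
Proof.
move=> K0 n0 h; rewrite /weighted_l2.
have -> : K%:E = sqrte (K ^+ 2)%:E by rewrite /= sqrtr_sqr ger0_norm.
rewrite lee_sqrt ?lee_fin ?sqr_ge0 //; apply: ge_ereal_sup => _ [X [fX _] <-].
rewrite fsbig_finite //=; apply: h; exact: finmap.fset_uniq.
Qed.

Lemma sqnorm_ge0 (A : freq) : 0 <= sqnorm A :> R.
Proof. by case: A => [[[a b] c] d]; rewrite /sqnorm ler0z !addr_ge0 ?sqr_ge0. Qed.

Lemma japanese_gt0 (A : freq) : 0 < japanese A :> R.
Proof. by rewrite sqrtr_gt0 ltr_wpDr ?ltr01 // sqnorm_ge0. Qed.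

Lemma japanese2 (A : freq) : (japanese A : R) `^ (2 * 1) = 1 + sqnorm A.
Proof.
by rewrite mulr1 -[2]/(2%:R) powR_mulrn ?(ltW (japanese_gt0 _)) // sqr_sqrtr // addr_ge0 // sqnorm_ge0.
Qed.

Lemma japaneseN2 (A : freq) : (japanese A : R) `^ (2 * -1) = (1 + sqnorm A)^-1.
Proof. by rewrite mulrN powRN japanese2. Qed.

Lemma sqnorm_sup4 (A : freq) : ((sup4 A)%:R ^+ 2 <= sqnorm A :> R) /\ (sqnorm A <= 4 * (sup4 A)%:R ^+ 2 :> R).
Proof.
rewrite sqnormE -[(sup4 A)%:R]/((sup4 A)%:Z%:~R) -!rmorphXn /= -[4]/(4%:~R) -intrM !ler_int.
have : in_cube (sup4 A)%:Z A by rewrite in_cubeE.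
rewrite /in_cube /sq => /and4P[h1 h2 h3 h4].
have e : [\/ `|c1 A| = sup4 A :> int, `|c2 A| = sup4 A :> int, `|c3 A| = sup4 A :> int | `|c4 A| = sup4 A :> int].
  have : `|c1 A| = sup4 A :> int \/ `|c2 A| = sup4 A :> int \/ `|c3 A| = sup4 A :> int \/ `|c4 A| = sup4 A :> int.
    by rewrite /sup4; clear; lia.
  by case=> [|[|[|]]] ?; [constructor 1|constructor 2|constructor 3|constructor 4].
have n2 (x : int) : `|x| ^+ 2 = x ^+ 2 by rewrite real_normK ?num_real.
have le (x : int) : `|x| <= sup4 A -> x ^+ 2 <= (sup4 A)%:Z ^+ 2.
  by move=> h; rewrite -n2 lerXn2r ?nnegrE.
have p := @sqr_ge0 int.
have := le _ h1; have := le _ h2; have := le _ h3; have := le _ h4.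
have := p (c1 A); have := p (c2 A); have := p (c3 A); have := p (c4 A).
have : [\/ c1 A ^+ 2 = (sup4 A)%:Z ^+ 2, c2 A ^+ 2 = (sup4 A)%:Z ^+ 2, c3 A ^+ 2 = (sup4 A)%:Z ^+ 2 | c4 A ^+ 2 = (sup4 A)%:Z ^+ 2].
  by case: e => e; [constructor 1|constructor 2|constructor 3|constructor 4]; rewrite -n2 e.
clear; move: (c1 A ^+ 2) (c2 A ^+ 2) (c3 A ^+ 2) (c4 A ^+ 2) (_ ^+ 2) => a b c d e.
by case=> ->; split; lia.
Qed.

Lemma four_sq n : 4 ^+ n = (2 ^+ n) ^+ 2 :> R.
Proof. by rewrite -exprM mulnC exprM; congr (_ ^+ _); ring. Qed.

Lemma lev_japanese (A : freq) : 1 + sqnorm A <= 5 * 4 ^+ lev A :> R.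
Proof.
have [_ h] := sqnorm_sup4 A; have l1 : 1 <= 4 ^+ lev A :> R by rewrite exprn_ege1 // ler1n.
have h2 : (sup4 A)%:R ^+ 2 <= 4 ^+ lev A :> R.
  by rewrite four_sq lerXn2r ?nnegrE ?exprn_ge0 // -natrX ler_nat ltnW // lev_lt.
by move: h h2 l1; move: (_ ^+ 2) (4 ^+ _) (sqnorm A) => a b c; lra.
Qed.

Lemma japanese_lev (A : freq) : 4 ^+ lev A <= 4 * (1 + sqnorm A) :> R.
Proof.
have [h _] := sqnorm_sup4 A; have := sqnorm_ge0 A; case e : (lev A) => [|k] s0; first by rewrite expr0; lra.
have h2 : 4 ^+ k <= (sup4 A)%:R ^+ 2 :> R.
  by rewrite four_sq lerXn2r ?nnegrE ?exprn_ge0 // -natrX ler_nat; apply: lev_ge; rewrite e.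
by rewrite exprS; move: h h2 s0; move: (_ ^+ 2) (4 ^+ _) (sqnorm A) => a b c; lra.
Qed.

End NormBounds.

(** * Integrals over the torus *)

Section ProductIntegral.
Context d1 d2 (S1 : measurableType d1) (S2 : measurableType d2) (R : realType)
  (m1 : {sigma_finite_measure set S1 -> \bar R}) (m2 : {sigma_finite_measure set S2 -> \bar R})
  (X : set S1) (Y : set S2) (mX : measurable X) (mY : measurable Y)
  (fX : (m1 X < +oo)%E) (fY : (m2 Y < +oo)%E).

Lemma prod_measurable : measurable (X `*` Y). Proof. exact: measurableX. Qed.

Lemma prod_finite : ((m1 \x m2)%E (X `*` Y) < +oo)%E.
Proof. by rewrite product_measure1E // lte_mul_pinfty // ge0_fin_numE. Qed.

Lemma bm_prod (f : S1 -> R) (g : S2 -> R) : bm X f -> bm Y g ->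
  bm (X `*` Y) (fun z => f z.1 * g z.2).
Proof.
move=> [mf [M fM]] [mg [N gN]]; apply: bmM; split.
- move=> _ B mB; rewrite (_ : _ `&` _ = (X `&` f @^-1` B) `*` Y).
    by apply: measurableX => //; exact: mf.
  by apply/seteqP; split=> -[x y] /= [[]].
- by exists M => -[x y] [Xx _]; exact: fM.
- move=> _ B mB; rewrite (_ : _ `&` _ = X `*` (Y `&` g @^-1` B)).
    by apply: measurableX => //; exact: mg.
  by apply/seteqP; split=> -[x y] /= [] => [[]|? []].
- by exists N => -[x y] [_ Yy]; exact: gN.
Qed.

Lemma Rint_prod (f : S1 -> R) (g : S2 -> R) : bm X f -> bm Y g ->
  Rintegral (m1 \x m2)%E (X `*` Y) (fun z => f z.1 * g z.2) = Rintegral m1 X f * Rintegral m2 Y g.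
Proof.
move=> bf bg; pose F (z : S1 * S2) := f z.1 * g z.2.
have bF : bm (X `*` Y) F := bm_prod bf bg.
have iF := bm_integrable (m := (m1 \x m2)%E) prod_measurable prod_finite bF.
have ig := bm_integrable (m := m2) mY fY bg.
have iF' : (m1 \x m2)%E.-integrable setT ((EFin \o F) \_ (X `*` Y)).
  by apply/integrable_restrict; rewrite ?setTI //; exact: prod_measurable.
rewrite [LHS]/Rintegral integral_mkcond -(integral12_prod_meas1 iF') /fubini_F.
have -> : (fun x => \int[m2]_y ((EFin \o F) \_ (X `*` Y)) (x, y))%E =
    (fun x => (Rintegral m2 Y g * f x)%:E) \_ X.
  apply/funext => x; rewrite patchE; case: ifPn => xX.
    transitivity (\int[m2]_(y in Y) ((f x)%:E * (g y)%:E))%E.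
      rewrite [RHS]integral_mkcond; apply: eq_integral => y _; rewrite !patchE.
      by rewrite in_setX /= xX /=; case: ifP.
    rewrite integralZl // EFinM muleC /Rintegral fineK //; exact: integrable_fin_num.
  by rewrite integral0_eq // => y _; rewrite patchE in_setX /= (negPf xX).
rewrite -integral_mkcond -[LHS]/(Rintegral m1 X (fun x => Rintegral m2 Y g * f x)).
by rewrite (bm_intZ (m := m1) mX fX) // mulrC.
Qed.

Lemma cbm_prod (f : S1 -> R[i]) (g : S2 -> R[i]) : cbm X f -> cbm Y g ->
  cbm (X `*` Y) (fun z => f z.1 * g z.2).
Proof.
move=> [b1 b2] [b3 b4]; split.
  by under eq_fun do rewrite CreM; exact: (bmB (bm_prod b1 b3) (bm_prod b2 b4)).
by under eq_fun do rewrite CimM; exact: (bmD (bm_prod b1 b4) (bm_prod b2 b3)).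
Qed.

Lemma cint_prod (f : S1 -> R[i]) (g : S2 -> R[i]) : cbm X f -> cbm Y g ->
  cintegral (m1 \x m2)%E (X `*` Y) (fun z => f z.1 * g z.2) = cintegral m1 X f * cintegral m2 Y g.
Proof.
move=> [b1 b2] [b3 b4].
have mP := prod_measurable; have fP := prod_finite.
have bp (p : S1 -> R) (q : S2 -> R) := @bm_prod p q.
apply: Ceq; rewrite ?CreM ?CimM !(cint_Re, cint_Im).
  rewrite -(Rint_prod b1 b3) -(Rint_prod b2 b4) -(bm_intN (m := (m1 \x m2)%E) mP fP (bm_prod b2 b4)).
  rewrite -(bm_intD (m := (m1 \x m2)%E) mP fP (bm_prod b1 b3) (bmN (bm_prod b2 b4))).
  by apply: bm_int_eq => z _; rewrite CreM.
rewrite -(Rint_prod b1 b4) -(Rint_prod b2 b3).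
rewrite -(bm_intD (m := (m1 \x m2)%E) mP fP (bm_prod b1 b4) (bm_prod b2 b3)).
by apply: bm_int_eq => z _; rewrite CimM.
Qed.

End ProductIntegral.

Section ProductSigmaFinite.
Context d1 d2 (S1 : measurableType d1) (S2 : measurableType d2) (R : realType)
  (m1 : {sigma_finite_measure set S1 -> \bar R}) (m2 : {sigma_finite_measure set S2 -> \bar R}).

Lemma product_sigma_finite : sigma_finite setT (m1 \x m2)%E.
Proof.
have /sigma_finiteP[F [TF ndF fF]] := sigma_finiteT m1.
have /sigma_finiteP[G [TG ndG fG]] := sigma_finiteT m2.
exists (fun n => F n `*` G n) => [|n]; last first.
  have [[mF hF] [mG hG]] := (fF n, fG n).
  by split; [exact: measurableX|exact: prod_finite].
apply/esym/seteqP; split=> // -[x y] _.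
have [i _ Fx] : (\bigcup_i F i) x by rewrite -TF.
have [j _ Gy] : (\bigcup_j G j) y by rewrite -TG.
exists (maxn i j) => //; split.
  by move: Fx; apply/subsetPset/ndF/leq_maxl.
by move: Gy; apply/subsetPset/ndG/leq_maxr.
Qed.

(* The library only registers products of finite measures as sigma-finite. *)
Definition prod_sf : {sigma_finite_measure set (S1 * S2)%type -> \bar R} :=
  HB.pack (m1 \x m2)%E (Measure_isSigmaFinite.Build _ _ _ (m1 \x m2)%E product_sigma_finite).

End ProductSigmaFinite.

Section Torus.
Context {R : realType}.
Local Notation mu := (@lebesgue_measure R).
Local Notation mu4 := (mu \x mu \x mu \x mu)%E.
Local Notation T2 := (`[0, 2 * pi[%classic : set R).
Local Notation DT T := (`[0, T[%classic : set R).
Definition mu_sf : {sigma_finite_measure set (measurableTypeR R) -> \bar R} := mu.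
Local Notation mm2 := (prod_sf mu_sf mu_sf).
Local Notation mm3 := (prod_sf mm2 mu_sf).

Lemma dotprodE (A : freq) (x : R * R * R * R) : expi (dotprod A x) =
  expi (x.1.1.1 * (c1 A)%:~R) * expi (x.1.1.2 * (c2 A)%:~R) * expi (x.1.2 * (c3 A)%:~R) * expi (x.2 * (c4 A)%:~R).
Proof.
case: A x => [[[a b] c] d] [[[x y] z] w]; rewrite /dotprod /c1 /c2 /c3 /c4 -!expiD; congr expi.
by cbn [fst snd]; ring.
Qed.

Lemma torus_cbm (A : freq) : cbm (@torus R) (fun x => expi (dotprod A x)).
Proof.
under eq_fun do rewrite dotprodE.
have e (k : int) : cbm T2 (fun t : R => expi (t * k%:~R)) := expi_bm _ (measurable_itv _).
have m := measurable_itv `[(0 : R), 2 * pi[.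
rewrite /torus.
have h1 := cbm_prod m m (e (c1 A)) (e (c2 A)).
have h2 := cbm_prod (measurableX m m) m h1 (e (c3 A)).
exact: (cbm_prod (measurableX (measurableX m m) m) m h2 (e (c4 A))).
Qed.

Lemma torus_int (A : freq) : cintegral mu4 (@torus R) (fun x => expi (dotprod A x)) =
  if A == 0 then ((2 * pi) ^+ 4)%:C else 0.
Proof.
under eq_fun do rewrite dotprodE.
have e (k : int) : cbm T2 (fun t : R => expi (t * k%:~R)) := expi_bm _ (measurable_itv _).
have m := measurable_itv `[(0 : R), 2 * pi[.
have f : (mu T2 < +oo)%E := lebesgue_itv_finite _ _.
have f2 := prod_finite (m1 := mu_sf) (m2 := mu_sf) m m f f.
have m2 := measurableX m m.
have f3 := prod_finite (m1 := mm2) (m2 := mu_sf) m2 m f2 f.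
have m3 := measurableX m2 m.
have h1 := cbm_prod m m (e (c1 A)) (e (c2 A)).
have h2 := cbm_prod m2 m h1 (e (c3 A)).
rewrite /torus (cint_prod (m1 := mm3) (m2 := mu_sf) m3 m f3 f h2 (e (c4 A))).
rewrite (cint_prod (m1 := mm2) (m2 := mu_sf) m2 m f2 f h1 (e (c3 A))).
rewrite (cint_prod (m1 := mu_sf) (m2 := mu_sf) m m f f (e (c1 A)) (e (c2 A))).
rewrite !cint_expi.
have -> : (A == 0) = [&& c1 A == 0, c2 A == 0, c3 A == 0 & c4 A == 0].
  apply/eqP/and4P => [->//|[/eqP ? /eqP ? /eqP ? /eqP ?]]; exact: freq_eqP.
case: (c1 A == 0); case: (c2 A == 0); case: (c3 A == 0); case: (c4 A == 0); rewrite ?mulr0 ?mul0r //=.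
by apply: Ceq; rewrite !(CreM, CimM, Cre_real, Cim_real); ring.
Qed.

Lemma mu4_finite : (mu4 (@torus R) < +oo)%E /\ measurable (@torus R).
Proof.
have m := measurable_itv `[(0 : R), 2 * pi[.
have f : (mu T2 < +oo)%E := lebesgue_itv_finite _ _.
have f2 := prod_finite (m1 := mu_sf) (m2 := mu_sf) m m f f.
have m2 := measurableX m m.
have f3 := prod_finite (m1 := mm2) (m2 := mu_sf) m2 m f2 f.
have m3 := measurableX m2 m.
by split; [exact: (prod_finite (m1 := mm3) (m2 := mu_sf) m3 m f3 f)|exact: measurableX].
Qed.

Definition ball (N : nat) : seq freq := [seq A <- cube_seq N | sqnorm A <= N%:R ^+ 2 :> R].

Lemma uniq_ball N : uniq (ball N). Proof. by rewrite filter_uniq // uniq_cube_seq. Qed.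

Lemma mem_ball N A : (A \in ball N) = (sqnorm A <= N%:R ^+ 2 :> R).
Proof.
rewrite mem_filter mem_cube_seq in_cubeE; case: leP => //= h.
rewrite -(ler_nat R) -(@ler_pXn2r _ 2) ?nnegrE //.
by apply: le_trans h; have [] := @sqnorm_sup4 R A.
Qed.

Lemma partial_sumE N (u : R -> freq -> R[i]) t x :
  partial_sum N u t x = \sum_(A <- ball N) u t A * expi (dotprod A x).
Proof.
rewrite [RHS]fsbig_seq ?uniq_ball // /partial_sum.
have -> : [set xi : freq | sqnorm xi <= N%:R ^+ 2 :> R] = [set` ball N]; last by [].
by apply/seteqP; split=> A; rewrite /= mem_ball.
Qed.

Lemma dotprod_c (A : freq) (x : R * R * R * R) : dotprod A x =
  (c1 A)%:~R * x.1.1.1 + (c2 A)%:~R * x.1.1.2 + (c3 A)%:~R * x.1.2 + (c4 A)%:~R * x.2.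
Proof. by case: A x => [[[a b] c] d] [[[x y] z] w]. Qed.

Lemma dotprodD (A B : freq) (x : R * R * R * R) : dotprod (A + B) x = dotprod A x + dotprod B x.
Proof. by rewrite !dotprod_c !cE !intrD; ring. Qed.

Lemma dotprodN (A : freq) (x : R * R * R * R) : dotprod (- A) x = - dotprod A x.
Proof. by rewrite !dotprod_c !cE !mulrNz; ring. Qed.

Definition tr (N : nat) (f : freq -> R[i]) (A : freq) : R[i] := if A \in ball N then f A else 0.

Lemma sum_tr N (s : seq freq) (f g : freq -> R[i]) : uniq s -> {subset ball N <= s} ->
  \sum_(A <- s) tr N f A * g A = \sum_(A <- ball N) f A * g A.
Proof.
move=> us sub; rewrite (bigID (fun A => A \in ball N)) /= [X in _ + X]big1 ?addr0; last first.
  by move=> A nA; rewrite /tr (negPf nA) mul0r.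
rewrite -big_filter (perm_big (ball N)) /=.
  by rewrite big_seq [RHS]big_seq; apply: eq_bigr => A h; rewrite /tr h.
apply: uniq_perm; [exact: filter_uniq|exact: uniq_ball|move=> A; rewrite mem_filter].
by apply/andP/idP => [[]//|h]; split=> //; exact: sub.
Qed.

Lemma sum_prod3 (s : seq freq) (a b c : freq -> R[i]) :
  (\sum_(A <- s) a A) * (\sum_(B <- s) b B) * (\sum_(C <- s) c C) =
  \sum_(A <- s) \sum_(B <- s) \sum_(C <- s) a A * b B * c C.
Proof.
rewrite mulr_suml mulr_suml; apply: eq_bigr => A _.
rewrite [a A * _]mulr_sumr mulr_suml; apply: eq_bigr => B _.
by rewrite mulr_sumr.
Qed.

Lemma sum_prod4 (s : seq freq) (a b c d : freq -> R[i]) :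
  (\sum_(A <- s) a A) * (\sum_(B <- s) b B) * (\sum_(C <- s) c C) * (\sum_(D <- s) d D) =
  \sum_(A <- s) \sum_(B <- s) \sum_(C <- s) \sum_(D <- s) a A * b B * c C * d D.
Proof.
rewrite sum_prod3 mulr_suml; apply: eq_bigr => A _.
rewrite mulr_suml; apply: eq_bigr => B _; rewrite mulr_suml; apply: eq_bigr => C _.
by rewrite mulr_sumr.
Qed.

(** The integrand is a trigonometric polynomial in [x] with coefficients depending on [t]; the space
    integral keeps the terms of total frequency zero. *)
Lemma quad_integral_NE T (u1 u2 u3 u4 : R -> freq -> R[i]) N :
  (forall A, cbm (DT T) (fun t => u1 t A)) -> (forall A, cbm (DT T) (fun t => u2 t A)) ->
  (forall A, cbm (DT T) (fun t => u3 t A)) -> (forall A, cbm (DT T) (fun t => u4 t A)) ->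
  quad_integral_N T u1 u2 u3 u4 N =
  ((2 * pi) ^+ 4)%:C * cintegral mu (DT T) (fun t => quad (ball N) (u1 t) (u2 t) (u3 t) (u4 t)).
Proof.
move=> b1 b2 b3 b4; rewrite /quad_integral_N.
have mT : measurable (DT T) := measurable_itv _.
have fT : (mu (DT T) < +oo)%E := lebesgue_itv_finite _ _.
have [f4 m4] := mu4_finite.
pose mm4 := prod_sf mm3 mu_sf.
have mP := measurableX m4 mT.
have fP := prod_finite (m1 := mm4) (m2 := mu_sf) m4 mT f4 fT.
pose S (y : freq * freq * (freq * freq)) := y.1.1 + y.1.2 + y.2.1 + y.2.2.
pose c (y : freq * freq * (freq * freq)) t := u1 t y.1.1 * u2 t y.1.2 * u3 t y.2.1 * u4 t y.2.2.
have cc y : cbm (DT T) (c y) by apply: cbmM => //; apply: cbmM => //; apply: cbmM.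
have -> : (fun p => partial_sum N u1 p.2 p.1 * partial_sum N u2 p.2 p.1
              * partial_sum N u3 p.2 p.1 * partial_sum N u4 p.2 p.1) =
   (fun p : (R * R * R * R) * R => \sum_(y <- quads (ball N)) expi (dotprod (S y) p.1) * c y p.2).
  apply/funext => -[x t]; cbn [fst snd]; rewrite !partial_sumE sum_quads sum_prod4.
  do 4 (apply: eq_bigr => ? _); rewrite /c /S; cbn [fst snd].
  by rewrite !dotprodD !expiD; ring.
have bb y := cbm_prod m4 mT (torus_cbm (S y)) (cc y).
transitivity (cintegral (prod_sf mm4 mu_sf) (@torus R `*` DT T)
    (fun p => \sum_(y <- quads (ball N)) expi (dotprod (S y) p.1) * c y p.2)); first by [].
rewrite (cint_sum (m := prod_sf mm4 mu_sf) mP fP); last by move=> y _; exact: bb.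
transitivity (\sum_(y <- quads (ball N)) (if S y == 0 then ((2 * pi) ^+ 4)%:C else 0) * cintegral mu (DT T) (c y)).
  apply: eq_bigr => y _; rewrite -torus_int.
  exact: (cint_prod (m1 := mm4) (m2 := mu_sf) m4 mT f4 fT (torus_cbm (S y)) (cc y)).
have -> : (fun t => quad (ball N) (u1 t) (u2 t) (u3 t) (u4 t)) =
    (fun t => \sum_(y <- quads (ball N) | S y == 0) c y t) by apply/funext => t; exact: quadE.
rewrite (cint_sum (m := mu) mT fT) ?mulr_sumr; last by move=> y _; exact: cc.
rewrite [RHS]big_mkcond; apply: eq_bigr => y _; rewrite /S.
by case: ifP => _; rewrite ?mul0r.
Qed.

(** The Fourier coefficient at [xi] of the product of three trigonometric polynomials. *)
Definition trip s (f1 f2 f3 : freq -> R[i]) (xi : freq) : R[i] :=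
  \sum_(A <- s) \sum_(B <- s) \sum_(C <- s | A + B + C == xi) f1 A * f2 B * f3 C.

Lemma quad_trip s (f1 f2 f3 f4 : freq -> R[i]) :
  quad s f1 f2 f3 f4 = \sum_(D <- s) trip s f1 f2 f3 (- D) * f4 D.
Proof.
rewrite /quad /trip; under [RHS]eq_bigr do rewrite mulr_suml.
rewrite [RHS]exchange_big /=; apply: eq_bigr => A _.
under [RHS]eq_bigr do rewrite mulr_suml.
rewrite [RHS]exchange_big /=; apply: eq_bigr => B _.
under [RHS]eq_bigr do rewrite mulr_suml big_mkcond.
rewrite [RHS]exchange_big /=; apply: eq_bigr => C _; rewrite big_mkcond.
by apply: eq_bigr => D _; rewrite -[A + B + C == - D]addr_eq0.
Qed.

Lemma fourier_trip N (u1 u2 u3 : R -> freq -> R[i]) t xi :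
  fourier (fun x => partial_sum N u1 t x * partial_sum N u2 t x * partial_sum N u3 t x) xi =
  trip (ball N) (u1 t) (u2 t) (u3 t) xi.
Proof.
have [f4 m4] := mu4_finite; pose mm4 := prod_sf mm3 mu_sf.
pose c A B C := u1 t A * u2 t B * u3 t C.
rewrite /fourier.
have -> : (fun x => partial_sum N u1 t x * partial_sum N u2 t x * partial_sum N u3 t x * expi (- dotprod xi x)) =
   (fun x => \sum_(A <- ball N) \sum_(B <- ball N) \sum_(C <- ball N)
      c A B C * expi (dotprod (A + B + C - xi) x)).
  apply/funext => x; rewrite !partial_sumE sum_prod3 mulr_suml; apply: eq_bigr => A _.
  rewrite mulr_suml; apply: eq_bigr => B _; rewrite mulr_suml; apply: eq_bigr => C _.
  by rewrite /c !dotprodD dotprodN !expiD; ring.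
have bb A B C : cbm (@torus R) (fun x => c A B C * expi (dotprod (A + B + C - xi) x)).
  by apply: cbmM; [exact: cbm_cst|exact: torus_cbm].
rewrite (cint_sum (m := mm4) m4 f4); last by move=> A _; do 2 apply: cbm_sum => ? _; exact: bb.
rewrite mulr_sumr; apply: eq_bigr => A _.
rewrite (cint_sum (m := mm4) m4 f4); last by move=> B _; apply: cbm_sum => ? _; exact: bb.
rewrite mulr_sumr; apply: eq_bigr => B _.
rewrite (cint_sum (m := mm4) m4 f4); last by move=> C _; exact: bb.
rewrite mulr_sumr [RHS]big_mkcond; apply: eq_bigr => C _.
rewrite (cintZ (m := mm4) m4 f4) ?torus_int; last exact: torus_cbm.
rewrite subr_eq0; case: ifP => _; last by rewrite !mulr0.
rewrite mulrCA; have -> : ((2 * pi) ^- 4)%:C * ((2 * pi) ^+ 4)%:C = 1 :> R[i].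
  apply: Ceq; rewrite !(CreM, CimM, Cre_real, Cim_real) ?mulr0 ?mul0r ?addr0 ?subr0 //.
  by rewrite mulVf // expf_neq0 // lt0r_neq0 ?pi2_gt0.
by rewrite mulr1.
Qed.

Lemma trip_tr N s (f1 f2 f3 : freq -> R[i]) xi : uniq s -> {subset ball N <= s} ->
  trip s (tr N f1) (tr N f2) (tr N f3) xi = trip (ball N) f1 f2 f3 xi.
Proof.
move=> us sub; rewrite /trip.
transitivity (\sum_(A <- s) tr N f1 A * (\sum_(B <- s) tr N f2 B * (\sum_(C <- s) tr N f3 C *
    (if A + B + C == xi then 1 else 0)))).
  apply: eq_bigr => A _; rewrite mulr_sumr; apply: eq_bigr => B _.
  rewrite !mulr_sumr big_mkcond; apply: eq_bigr => C _.
  by case: ifP => _; rewrite ?mulr0 // mulr1 mulrA.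
rewrite sum_tr //; apply: eq_bigr => A _; rewrite sum_tr // mulr_sumr; apply: eq_bigr => B _.
rewrite sum_tr // !mulr_sumr [RHS]big_mkcond; apply: eq_bigr => C _.
by case: ifP => _; rewrite ?mulr0 // mulr1 mulrA.
Qed.

End Torus.

(** * Partial Fourier sums *)

Section PartialSums.
Context {R : realType}.
Local Notation mu := (@lebesgue_measure R).
Local Notation DT T := (`[0, T[%classic : set R).
Local Notation ball := (@ball R).
Implicit Types (u w : R -> freq -> R[i]) (p : pred freq).

Definition pr p (f : freq -> R[i]) (A : freq) : R[i] := if p A then f A else 0.

Lemma free_profile u t : free (profile u t) t = u t.
Proof. by apply/funext => A; rewrite /free /profile mulrA expiNK mul1r. Qed.

Lemma pr_free p (f : freq -> R[i]) t : pr p (free f t) = free (pr p f) t.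
Proof. by apply/funext => A; rewrite /pr /free; case: ifP; rewrite ?mulr0. Qed.

Lemma pr_sg b p (f : freq -> R[i]) : (forall A, p (- A) = p A) -> pr p (sg b f) = sg b (pr p f).
Proof.
move=> pN; case: b => //; apply/funext => A; rewrite /= /pr /refl pN; case: ifP => //.
by rewrite conjc0.
Qed.

Lemma ballN N A : (- A \in ball N) = (A \in ball N).
Proof.
by rewrite !mem_ball !sqnormE /sq !cE !sqrrN.
Qed.

Lemma ball_mono N M : (N <= M)%N -> {subset ball N <= ball M}.
Proof.
move=> NM A; rewrite !mem_ball => /le_trans; apply.
by rewrite lerXn2r ?nnegrE // ler_nat.
Qed.

Lemma sqrt_le3 (x y : R) : 0 <= x -> 0 <= y -> x <= 9 * y -> Num.sqrt x <= 3 * Num.sqrt y.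
Proof.
move=> x0 y0 xy; have -> : 3 = Num.sqrt 9 :> R.
  by have -> : 9 = 3 ^+ 2 :> R by [ring]; rewrite sqrtr_sqr ger0_norm.
by rewrite -sqrtrM ?ler_wsqrtr.
Qed.

Definition mass p (W : freq -> R) (s : seq freq) (B : freq -> R) : R :=
  \sum_(A <- s) (if p A then W A * B A else 0).

Definition Wm (A : freq) : R := (1 + sqnorm A)^-1.
Definition Wp (A : freq) : R := 1 + sqnorm A.

Lemma Wp_gt0 A : 0 < Wp A. Proof. by rewrite /Wp ltr_wpDr ?sqnorm_ge0. Qed.
Lemma Wm_gt0 A : 0 < Wm A. Proof. by rewrite invr_gt0; exact: Wp_gt0. Qed.

Lemma mass_ge0 p W s B : (forall A, 0 < W A) -> (forall A, 0 <= B A) -> 0 <= mass p W s B.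
Proof. by move=> W0 B0; apply: sumr_ge0 => A _; case: ifP => // _; rewrite mulr_ge0 // ltW. Qed.

Definition prB p (B : freq -> R) (A : freq) : R := if p A then B A else 0.

Lemma mass_lev p s (B : freq -> R) : (forall A, 0 <= B A) ->
  (\sum_(A <- s) 4 ^- lev A * prB p B A <= 9 * mass p Wm s B) /\
  (\sum_(A <- s) 4 ^+ lev A * prB p B A <= 9 * mass p Wp s B).
Proof.
move=> B0; rewrite /mass !mulr_sumr; split; apply: ler_sum => A _; rewrite /prB;
  case: ifP => _; rewrite ?mulr0 // mulrA ler_wpM2r //.
  rewrite /Wm ler_pdivlMr ?Wp_gt0 // mulrC ler_pdivrMr ?exprn_gt0 //.
  have := @lev_japanese R A; have : 0 <= 4 ^+ lev A :> R by rewrite exprn_ge0.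
  by rewrite /Wp; lra.
by have := @japanese_lev R A; have := Wp_gt0 A; rewrite /Wp; lra.
Qed.

Definition Lam T s b (f1 f2 f3 : R -> freq -> R[i]) (f4 : R -> freq -> R[i]) : R[i] :=
  cintegral mu (DT T) (fun t => quad s (f1 t) (f2 t) (f3 t) (sg b (f4 t))).

Lemma pr_wvar T p (v : R -> freq -> R[i]) (B : freq -> R) A : wvar T (B A) (fun t => v t A) ->
  wvar T (prB p B A) (fun t => pr p (v t) A).
Proof. by move=> wv; rewrite /prB /pr; case: (p A) => //; exact: wvar0. Qed.

(** Each factor has its own frequency projection, so that two truncations can be compared one factor
    at a time. *)
Lemma Lam_est : exists C : R, 0 < C /\
  forall T b s v1 v2 v3 v4 (p1 p2 p3 p4 : pred freq) (B1 B2 B3 B4 : freq -> R) (r : R),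
  0 < T <= 1 -> uniq s -> (forall A, (- A \in s) = (A \in s)) -> 0 < r ->
  (forall A, 0 <= B1 A) -> (forall A, 0 <= B2 A) -> (forall A, 0 <= B3 A) -> (forall A, 0 <= B4 A) ->
  (forall A, wvar T (B1 A) (fun x => v1 x A)) -> (forall A, wvar T (B2 A) (fun x => v2 x A)) ->
  (forall A, wvar T (B3 A) (fun x => v3 x A)) -> (forall A, wvar T (B4 A) (fun x => v4 x A)) ->
  (forall A, p1 A -> A \in s) -> (forall A, p2 A -> A \in s) ->
  (forall A, p3 A -> A \in s) -> (forall A, p4 A -> A \in s) ->
  r = 1 \/ (forall x A, v2 x A != 0 -> T * 4 ^+ lev A <= r ^+ 7) ->
  normc (Lam T s b (fun t => free (pr p1 (v1 t)) t) (fun t => free (pr p2 (v2 t)) t)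
    (fun t => free (pr p3 (v3 t)) t) (fun t => free (pr p4 (v4 t)) t)) <=
  C * r * (Num.sqrt (mass p1 Wm s B1) * Num.sqrt (mass p2 Wp s B2) *
     Num.sqrt (mass p3 Wp s B3) * Num.sqrt (mass p4 Wp s B4)).
Proof.
have [C [C0 qb]] := @quad_bound R; exists (C * 81); split; first exact: mulr_gt0.
move=> T b s v1 v2 v3 v4 p1 p2 p3 p4 B1 B2 B3 B4 r T01 us sN r0 B10 B20 B30 B40 w1 w2 w3 w4 s1 s2 s3 s4 hr.
have pB p (B : freq -> R) : (forall A, 0 <= B A) -> forall A, 0 <= prB p B A.
  by move=> B0 A; rewrite /prB; case: ifP.
have ps p (v : R -> freq -> R[i]) : (forall A, p A -> A \in s) -> forall x A, pr p (v x) A != 0 -> A \in s.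
  by move=> h x A; rewrite /pr; case: (boolP (p A)) => [/h //|_]; rewrite eqxx.
have hr' : r = 1 \/ (forall x A, pr p2 (v2 x) A != 0 -> T * 4 ^+ lev A <= r ^+ 7).
  case: hr => [->|h]; [by left|right=> x A].
  by rewrite /pr; case: (p2 A) => [/h //|]; rewrite eqxx.
apply: le_trans (qb T s b _ _ _ _ _ _ _ _ r T01 us sN r0 (pB p1 _ B10) (pB p2 _ B20) (pB p3 _ B30) (pB p4 _ B40)
  (fun A _ => pr_wvar p1 (w1 A)) (fun A _ => pr_wvar p2 (w2 A)) (fun A _ => pr_wvar p3 (w3 A)) (fun A _ => pr_wvar p4 (w4 A))
  (ps _ _ s1) (ps _ _ s2) (ps _ _ s3) (ps _ _ s4) hr') _.
have nn (W : freq -> R) p (B : freq -> R) : (forall A, 0 <= W A) -> (forall A, 0 <= B A) -> 0 <= \sum_(A <- s) W A * prB p B A.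
  by move=> W0 B0; apply: sumr_ge0 => A _; rewrite mulr_ge0 // pB.
have m1 := sqrt_le3 (nn _ p1 _ _ B10) (mass_ge0 p1 s Wm_gt0 B10) (mass_lev p1 s B10).1.
have m2 := sqrt_le3 (nn _ p2 _ _ B20) (mass_ge0 p2 s Wp_gt0 B20) (mass_lev p2 s B20).2.
have m3 := sqrt_le3 (nn _ p3 _ _ B30) (mass_ge0 p3 s Wp_gt0 B30) (mass_lev p3 s B30).2.
have m4 := sqrt_le3 (nn _ p4 _ _ B40) (mass_ge0 p4 s Wp_gt0 B40) (mass_lev p4 s B40).2.
have q0 n : 0 <= 4 ^+ n :> R by exact: exprn_ge0.
have q1 n : 0 <= 4 ^- n :> R by rewrite invr_ge0.
have {}m1 := m1 (fun A => q1 _); have {}m2 := m2 (fun A => q0 _).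
have {}m3 := m3 (fun A => q0 _); have {}m4 := m4 (fun A => q0 _).
have Cr : 0 <= C * r by rewrite mulr_ge0 // ltW.
have -> : C * 81 * r = C * r * 81 by ring.
rewrite -[leRHS]mulrA ler_wpM2l //.
have -> : 81 * (Num.sqrt (mass p1 Wm s B1) * Num.sqrt (mass p2 Wp s B2) *
     Num.sqrt (mass p3 Wp s B3) * Num.sqrt (mass p4 Wp s B4)) =
   (3 * Num.sqrt (mass p1 Wm s B1)) * (3 * Num.sqrt (mass p2 Wp s B2)) *
     (3 * Num.sqrt (mass p3 Wp s B3)) * (3 * Num.sqrt (mass p4 Wp s B4)) by ring.
by do 3 (apply: ler_pM; rewrite ?mulr_ge0 ?sqrtr_ge0 //).
Qed.

Lemma eq_quad_in s (f1 f2 f3 f4 g1 g2 g3 g4 : freq -> R[i]) : {in s, f1 =1 g1} -> {in s, f2 =1 g2} ->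
  {in s, f3 =1 g3} -> {in s, f4 =1 g4} -> quad s f1 f2 f3 f4 = quad s g1 g2 g3 g4.
Proof.
move=> e1 e2 e3 e4; rewrite /quad big_seq [RHS]big_seq; apply: eq_bigr => A As.
rewrite big_seq [RHS]big_seq; apply: eq_bigr => B Bs; rewrite big_seq [RHS]big_seq; apply: eq_bigr => D Ds.
rewrite big_seq_cond [RHS]big_seq_cond; apply: eq_bigr => E /andP[Es _].
by rewrite e1 ?e2 ?e3 ?e4.
Qed.

Lemma quad_telescope s (f1 f2 f3 f4 t1 t2 t3 t4 : freq -> R[i]) :
  quad s f1 f2 f3 f4 - quad s t1 t2 t3 t4 =
  quad s (fun A => f1 A - t1 A) f2 f3 f4 + quad s t1 (fun A => f2 A - t2 A) f3 f4 +
  quad s t1 t2 (fun A => f3 A - t3 A) f4 + quad s t1 t2 t3 (fun A => f4 A - t4 A).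
Proof.
rewrite !quadE -sumrB -!big_split /=; apply: eq_bigr => y _; ring.
Qed.

Lemma quad_tr_sub N M (f1 f2 f3 f4 : freq -> R[i]) : (N <= M)%N ->
  quad (ball M) (tr N f1) (tr N f2) (tr N f3) (tr N f4) = quad (ball N) f1 f2 f3 f4.
Proof.
move=> NM; have sub := ball_mono NM; rewrite !quad_trip.
transitivity (\sum_(D <- ball M) tr N f4 D * trip (ball N) f1 f2 f3 (- D)).
  by apply: eq_bigr => D _; rewrite (trip_tr _ _ _ _ (uniq_ball M) sub) mulrC.
by rewrite (sum_tr _ _ (uniq_ball M) sub); apply: eq_bigr => D _; rewrite mulrC.
Qed.

Lemma bounded_tail (a : nat -> R) (n : R) : {homo a : i j / (i <= j)%N >-> i <= j} -> (forall i, a i <= n) ->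
  forall e, 0 < e -> exists N, forall i j, (N <= i)%N -> a j - a i <= e.
Proof.
move=> am an e e0.
have hs : has_sup (range a) by split; [exists (a 0%N), 0%N|exists n => _ [i _ <-]].
have [_ [N _ <-] hN] := sup_adherent e0 hs.
exists N => i j Ni; have h1 : a j <= sup (range a) by apply: sup_upper_bound => //; exists j.
by have := am _ _ Ni; lra.
Qed.

Lemma mass_ball_mono W (B : freq -> R) : (forall A, 0 < W A) -> (forall A, 0 <= B A) ->
  {homo (fun N => \sum_(A <- ball N) W A * B A) : i j / (i <= j)%N >-> i <= j}.
Proof.
move=> W0 B0 i j ij /=; rewrite [leRHS](bigID (fun A => A \in ball i)) /= -[leLHS]addr0 lerD //; last first.
  by apply: sumr_ge0 => A _; rewrite mulr_ge0 // ltW.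
rewrite -[leRHS]big_filter le_eqVlt; apply/orP; left; apply/eqP; apply: perm_big.
apply: uniq_perm; [exact: uniq_ball|exact/filter_uniq/uniq_ball|move=> A; rewrite [RHS]mem_filter].
by apply/idP/andP => [h|[]//]; split=> //; exact: ball_mono ij _ h.
Qed.

Lemma mass_le p M W (B : freq -> R) : (forall A, 0 < W A) -> (forall A, 0 <= B A) ->
  mass p W (ball M) B <= \sum_(A <- ball M) W A * B A.
Proof. by move=> W0 B0; apply: ler_sum => A _; case: ifP => // _; rewrite mulr_ge0 // ltW. Qed.

Lemma mass_tail N M W (B : freq -> R) : (N <= M)%N ->
  mass (fun A => (A \in ball M) && (A \notin ball N)) W (ball M) B =
  \sum_(A <- ball M) W A * B A - \sum_(A <- ball N) W A * B A.
Proof.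
move=> NM; set m := mass _ _ _ _.
suff -> : \sum_(A <- ball M) W A * B A = \sum_(A <- ball N) W A * B A + m by rewrite addrAC subrr add0r.
rewrite [LHS](bigID (fun A => A \in ball N)) /=; congr (_ + _).
  rewrite -[LHS]big_filter; apply: perm_big; apply: uniq_perm; [exact/filter_uniq/uniq_ball|exact: uniq_ball|].
  move=> A; rewrite [LHS]mem_filter; apply/andP/idP => [[]//|h]; split=> //; exact: ball_mono NM _ h.
rewrite /m /mass [LHS]big_mkcond /= big_seq [RHS]big_seq; apply: eq_bigr => A As.
by rewrite As /=.
Qed.

Definition ybnd (W : freq -> R) (B : freq -> R) (n : R) : Prop :=
  [/\ 0 <= n, forall A, 0 <= B A & forall S : seq freq, uniq S -> \sum_(A <- S) W A * B A <= n ^+ 2].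

Lemma sqrt_le_of (x n : R) : 0 <= n -> x <= n ^+ 2 -> Num.sqrt x <= n.
Proof. by move=> n0 h; rewrite -(ger0_norm n0) -sqrtr_sqr ler_wsqrtr. Qed.

Lemma sqrt_mass p M W B n : (forall A, 0 < W A) -> ybnd W B n -> Num.sqrt (mass p W (ball M) B) <= n.
Proof.
move=> W0 [n0 B0 h]; apply: sqrt_le_of => //; apply: le_trans (mass_le _ _ W0 B0) _.
exact: h (uniq_ball _).
Qed.

Lemma pr_in (N : nat) (f : freq -> R[i]) : {in ball N, f =1 pr (fun A => A \in ball N) f}.
Proof. by move=> A h; rewrite /pr h. Qed.

Lemma Lam_bound : exists C : R, 0 < C /\
  forall T b v1 v2 v3 v4 (B1 B2 B3 B4 : freq -> R) (n1 n2 n3 n4 r : R) N,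
  0 < T <= 1 -> 0 < r ->
  ybnd Wm B1 n1 -> ybnd Wp B2 n2 -> ybnd Wp B3 n3 -> ybnd Wp B4 n4 ->
  (forall A, wvar T (B1 A) (fun x => v1 x A)) -> (forall A, wvar T (B2 A) (fun x => v2 x A)) ->
  (forall A, wvar T (B3 A) (fun x => v3 x A)) -> (forall A, wvar T (B4 A) (fun x => v4 x A)) ->
  r = 1 \/ (forall x A, v2 x A != 0 -> T * 4 ^+ lev A <= r ^+ 7) ->
  normc (Lam T (ball N) b (fun t => free (v1 t) t) (fun t => free (v2 t) t)
    (fun t => free (v3 t) t) (fun t => free (v4 t) t)) <= C * r * (n1 * n2 * n3 * n4).
Proof.
have [C [C0 le]] := Lam_est; exists C; split=> // T b v1 v2 v3 v4 B1 B2 B3 B4 n1 n2 n3 n4 r N T01 r0 y1 y2 y3 y4 w1 w2 w3 w4 hr.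
pose p A := A \in ball N.
have -> : Lam T (ball N) b (fun t => free (v1 t) t) (fun t => free (v2 t) t)
    (fun t => free (v3 t) t) (fun t => free (v4 t) t) =
  Lam T (ball N) b (fun t => free (pr p (v1 t)) t) (fun t => free (pr p (v2 t)) t)
    (fun t => free (pr p (v3 t)) t) (fun t => free (pr p (v4 t)) t).
  apply: cint_eq => t _; rewrite -!pr_free -pr_sg; last by move=> A; rewrite /p ballN.
  by apply: eq_quad_in; exact: pr_in.
have [_ b1 _] := y1; have [_ b2 _] := y2; have [_ b3 _] := y3; have [_ b4 _] := y4.
apply: le_trans (le T b (ball N) v1 v2 v3 v4 p p p p B1 B2 B3 B4 r T01 (uniq_ball N) (ballN N) r0
  b1 b2 b3 b4 w1 w2 w3 w4 (fun _ h => h) (fun _ h => h) (fun _ h => h) (fun _ h => h) hr) _.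
apply: ler_wpM2l; first by rewrite mulr_ge0 // ltW.
have [a1 a2 a3 a4] := And4 (sqrt_mass p N Wm_gt0 y1) (sqrt_mass p N Wp_gt0 y2) (sqrt_mass p N Wp_gt0 y3) (sqrt_mass p N Wp_gt0 y4).
by do 3 (apply: ler_pM; rewrite ?mulr_ge0 ?sqrtr_ge0 //).
Qed.

(** In the telescoped difference one factor is restricted to frequencies outside [ball N], and the
    corresponding tail of a convergent sum is small. So [N0] depends on the bounds [B1] to [B4] but
    not on the functions; this gives convergence of the Duhamel integrals uniformly in time. *)
Lemma Lam_cauchy T (B1 B2 B3 B4 : freq -> R) (n1 n2 n3 n4 : R) : 0 < T <= 1 ->
  ybnd Wm B1 n1 -> ybnd Wp B2 n2 -> ybnd Wp B3 n3 -> ybnd Wp B4 n4 ->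
  forall e : R, 0 < e -> exists N0, forall b v1 v2 v3 v4,
  (forall A, wvar T (B1 A) (fun x => v1 x A)) -> (forall A, wvar T (B2 A) (fun x => v2 x A)) ->
  (forall A, wvar T (B3 A) (fun x => v3 x A)) -> (forall A, wvar T (B4 A) (fun x => v4 x A)) ->
  forall N M, (N0 <= N <= M)%N ->
  normc (Lam T (ball M) b (fun t => free (v1 t) t) (fun t => free (v2 t) t)
      (fun t => free (v3 t) t) (fun t => free (v4 t) t) -
    Lam T (ball N) b (fun t => free (v1 t) t) (fun t => free (v2 t) t)
      (fun t => free (v3 t) t) (fun t => free (v4 t) t)) <= e.
Proof.
move=> T01 y1 y2 y3 y4 e e0; have [C [C0 le]] := Lam_est.
have [m1 b1 h1] := y1; have [m2 b2 h2] := y2; have [m3 b3 h3] := y3; have [m4 b4 h4] := y4.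
pose P := n2 * n3 * n4 + n1 * n3 * n4 + n1 * n2 * n4 + n1 * n2 * n3.
have P0 : 0 <= P by rewrite /P !addr_ge0 // !mulr_ge0.
have CP : 0 < C * P + 1 by rewrite ltr_wpDl // mulr_ge0 // ltW.
pose d := e / (C * P + 1); have d0 : 0 < d by rewrite divr_gt0.
have dd0 : 0 < d ^+ 2 by rewrite exprn_gt0.
have tail W B n : (forall A, 0 < W A) -> ybnd W B n -> exists N0, forall N M, (N0 <= N <= M)%N ->
    Num.sqrt (mass (fun A => (A \in ball M) && (A \notin ball N)) W (ball M) B) <= d.
  move=> W0 [n0 B0 hS].
  have [N0 hN] := bounded_tail (mass_ball_mono W0 B0) (fun i => hS _ (uniq_ball i)) dd0.
  by exists N0 => N M /andP[? NM]; apply: sqrt_le_of; [exact: ltW|rewrite mass_tail //; exact: hN].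
have [N1 t1] := tail _ _ _ Wm_gt0 y1; have [N2 t2] := tail _ _ _ Wp_gt0 y2.
have [N3 t3] := tail _ _ _ Wp_gt0 y3; have [N4 t4] := tail _ _ _ Wp_gt0 y4.
exists (maxn (maxn N1 N2) (maxn N3 N4)) => b v1 v2 v3 v4 w1 w2 w3 w4 N M /andP[].
rewrite !geq_max => /andP[/andP[k1 k2] /andP[k3 k4]] NM.
have {}t1 := t1 N M; rewrite k1 NM in t1; have {}t1 := t1 isT.
have {}t2 := t2 N M; rewrite k2 NM in t2; have {}t2 := t2 isT.
have {}t3 := t3 N M; rewrite k3 NM in t3; have {}t3 := t3 isT.
have {}t4 := t4 N M; rewrite k4 NM in t4; have {}t4 := t4 isT.
pose pM A := A \in ball M; pose pN A := A \in ball N.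
pose pd A := (A \in ball M) && (A \notin ball N).
have pMN A : pM (- A) = pM A by exact: ballN.
have pNN A : pN (- A) = pN A by exact: ballN.
have pdN A : pd (- A) = pd A by rewrite /pd !ballN.
have pNM A : pN A -> A \in ball M by exact: ball_mono.
have pdM A : pd A -> A \in ball M by case/andP.
pose E q1 q2 q3 q4 := Lam T (ball M) b (fun t => free (pr q1 (v1 t)) t) (fun t => free (pr q2 (v2 t)) t)
    (fun t => free (pr q3 (v3 t)) t) (fun t => free (pr q4 (v4 t)) t).
have Eb (q1 q2 q3 q4 : pred freq) : (forall A, q1 A -> A \in ball M) -> (forall A, q2 A -> A \in ball M) ->
    (forall A, q3 A -> A \in ball M) -> (forall A, q4 A -> A \in ball M) ->
    normc (E q1 q2 q3 q4) <= C * (Num.sqrt (mass q1 Wm (ball M) B1) * Num.sqrt (mass q2 Wp (ball M) B2) *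
     Num.sqrt (mass q3 Wp (ball M) B3) * Num.sqrt (mass q4 Wp (ball M) B4)).
  move=> s1 s2 s3 s4; rewrite -[C in leRHS]mulr1.
  exact: (le T b (ball M) v1 v2 v3 v4 q1 q2 q3 q4 B1 B2 B3 B4 1 T01 (uniq_ball M) (ballN M) ltr01
     b1 b2 b3 b4 w1 w2 w3 w4 s1 s2 s3 s4 (or_introl erefl)).
have mD : measurable (DT T) := measurable_itv _.
have fD : (mu (DT T) < +oo)%E := lebesgue_itv_finite _ _.
have cv (v : R -> freq -> R[i]) B q : (forall A, wvar T (B A) (fun x => v x A)) -> forall A, cbm (DT T) (fun t => free (pr q (v t)) t A).
  by move=> wv; apply: (@cbm_free R T (fun t => pr q (v t))) => A; exact: wvar_cbm (pr_wvar q (wv A)).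
have cQ q1 q2 q3 q4 : cbm (DT T) (fun t => quad (ball M) (free (pr q1 (v1 t)) t) (free (pr q2 (v2 t)) t)
    (free (pr q3 (v3 t)) t) (sg b (free (pr q4 (v4 t)) t))).
  apply: cbm_quad; [exact: cv w1|exact: cv w2|exact: cv w3|].
  by apply: (@cbm_sg R T b (fun t => free (pr q4 (v4 t)) t)); exact: cv w4.
have EM : Lam T (ball M) b (fun t => free (v1 t) t) (fun t => free (v2 t) t)
      (fun t => free (v3 t) t) (fun t => free (v4 t) t) = E pM pM pM pM.
  apply: cint_eq => t _; rewrite -!pr_free -pr_sg //.
  by apply: eq_quad_in; exact: pr_in.
have EN : Lam T (ball N) b (fun t => free (v1 t) t) (fun t => free (v2 t) t)
      (fun t => free (v3 t) t) (fun t => free (v4 t) t) = E pN pN pN pN.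
  by apply: cint_eq => t _; rewrite -(quad_tr_sub _ _ _ _ NM) -!pr_free -pr_sg.
have split4 : E pM pM pM pM = E pN pN pN pN + (E pd pM pM pM + E pN pd pM pM + E pN pN pd pM + E pN pN pN pd).
  rewrite /E /Lam -!(cintD (m := mu) mD fD); do ?[exact: cQ | apply: cbmD].
  apply: cint_eq => t _; apply/eqP; rewrite addrC -subr_eq quad_telescope; apply/eqP.
  rewrite -!pr_free -!pr_sg //.
  have dif (f : freq -> R[i]) : {in ball M, (fun A => pr pM f A - pr pN f A) =1 pr pd f}.
    move=> A AM; rewrite /pr /pM /pN /pd AM /=; case: (A \in ball N); by rewrite ?subrr ?subr0.
  by congr (_ + _ + _ + _); apply: eq_quad_in => //; exact: dif.
rewrite EM EN split4 addrAC subrr add0r.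
have q1 q := sqrt_mass q M Wm_gt0 y1; have q2 q := sqrt_mass q M Wp_gt0 y2.
have q3 q := sqrt_mass q M Wp_gt0 y3; have q4 q := sqrt_mass q M Wp_gt0 y4.
have s0 := @sqrtr_ge0 R; have d00 := ltW d0.
have pm (a1 a2 a3 a4 c1 c2 c3 c4 : R) : 0 <= a1 -> 0 <= a2 -> 0 <= a3 -> 0 <= a4 ->
    a1 <= c1 -> a2 <= c2 -> a3 <= c3 -> a4 <= c4 -> C * (a1 * a2 * a3 * a4) <= C * (c1 * c2 * c3 * c4).
  move=> *; rewrite ler_pM2l //; by do 3 (apply: ler_pM; rewrite ?mulr_ge0 //).
have f1 := le_trans (Eb pd pM pM pM pdM (fun _ h => h) (fun _ h => h) (fun _ h => h)) (pm _ _ _ _ _ _ _ _ (s0 _) (s0 _) (s0 _) (s0 _) t1 (q2 _) (q3 _) (q4 _)).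
have f2 := le_trans (Eb pN pd pM pM pNM pdM (fun _ h => h) (fun _ h => h)) (pm _ _ _ _ _ _ _ _ (s0 _) (s0 _) (s0 _) (s0 _) (q1 _) t2 (q3 _) (q4 _)).
have f3 := le_trans (Eb pN pN pd pM pNM pNM pdM (fun _ h => h)) (pm _ _ _ _ _ _ _ _ (s0 _) (s0 _) (s0 _) (s0 _) (q1 _) (q2 _) t3 (q4 _)).
have f4 := le_trans (Eb pN pN pN pd pNM pNM pNM pdM) (pm _ _ _ _ _ _ _ _ (s0 _) (s0 _) (s0 _) (s0 _) (q1 _) (q2 _) (q3 _) t4).
apply: le_trans (normcD _ _) _; apply: le_trans (lerD (normcD _ _) (lexx _)) _.
apply: le_trans (lerD (lerD (normcD _ _) (lexx _)) (lexx _)) _.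
apply: le_trans (lerD (lerD (lerD f1 f2) f3) f4) _.
apply: le_trans (_ : _ <= d * (C * P + 1)) _; last by rewrite /d divfK // lt0r_neq0.
rewrite -subr_ge0; apply: le_trans d00 _; rewrite le_eqVlt; apply/orP; left; apply/eqP.
by rewrite /P; ring.
Qed.

End PartialSums.

(** * U^2 functions *)

Section U2Bound.
Context {R : realType}.
Implicit Types (T : R) (F V : R -> R[i]).

Lemma cvgc (f : nat -> R[i]) (l : R[i]) :
  (forall e : R, 0 < e -> exists N, forall n, (N <= n)%N -> normc (f n - l) <= e) ->
  (f : nat -> R[i]^o) @ \oo --> (l : R[i]^o).
Proof.
move=> h; apply/cvgrPdist_le => e e0.
have [re ie] : 0 < Cre e /\ Cim e = 0 by move: e0; rewrite ltcE /= => /andP[/eqP -> ->].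
have [N hN] := h _ re; exists N => // n Nn.
have -> : e = (Cre e)%:C by apply: Ceq; rewrite ?Cre_real ?Cim_real.
have := hN n Nn; rewrite normc_distC => hn.
by rewrite -[X in X <= _]/((normc (l - f n))%:C) lecR.
Qed.

Definition right_cont T F : Prop := forall x, 0 <= x < T -> forall e, 0 < e ->
  exists2 d, 0 < d & forall y, x <= y < x + d -> y < T -> normc (F y - F x) <= e.

(** The last point of [pts] up to [x]. The default 0 is not reached when [pts] contains 0 and
    [x >= 0]. *)
Definition rep (pts : seq R) (x : R) : R :=
  xget 0 [set p | [/\ p \in pts, p <= x & forall q, q \in pts -> q <= x -> q <= p]].

Lemma repE pts x p : p \in pts -> p <= x -> (forall q, q \in pts -> q <= x -> q <= p) -> rep pts x = p.
Proof.
move=> pp px pm; apply: xget_subset1; first by split.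
move=> a b [a1 a2 a3] [b1 b2 b3]; apply/eqP; rewrite eq_le a3 // b3 //.
Qed.

Lemma rep_cut pts x y : (forall p, p \in pts -> (p <= x) = (p <= y)) -> rep pts x = rep pts y.
Proof.
move=> h; congr xget; apply/seteqP; split=> p [p1 p2 p3]; split=> //.
- by rewrite -h.
- by move=> q qp qy; apply: p3 => //; rewrite h.
- by rewrite h.
- by move=> q qp qy; apply: p3 => //; rewrite -h.
Qed.

(* Stop whenever [F] has moved by [e]: a chain of such stopping times of maximal
   length cannot be extended, so [F] stays [e]-close to its last stopped value. *)
Lemma stopping T F (e : R) (N : nat) : 0 < T -> 0 < e -> right_cont T F ->
  (forall n t, chain T (fun x y => e <= normc (F y - F x)) n t -> (n <= N)%N) ->
  exists pts : seq R, [/\ (size pts <= N.+1)%N, 0 \in pts, (forall p, p \in pts -> 0 <= p < T) &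
    forall x, 0 <= x < T -> rep pts x \in pts /\ normc (F x - F (rep pts x)) <= e].
Proof.
move=> T0 e0 rc cN.
pose G J := exists t : nat -> R, [/\ chain T (fun x y => e <= normc (F y - F x)) J t, t 0%N = 0 &
  forall k s, (k < J)%N -> t k <= s < t k.+1 -> normc (F s - F (t k)) <= e].
have G0 : `[< G 0%N >].
  by apply/asboolP; exists (fun _ => 0); split=> //; split=> // k _; rewrite lexx T0.
have GN J : `[< G J >] -> (J <= N)%N by move=> /asboolP[t [ct _ _]]; exact: cN ct.
have [J /asboolP[t [[tT tJ] t0 tc]] Jmax] := ex_maxnP (ex_intro _ 0%N G0) GN.
have tm i j : (i <= j)%N -> (j <= J)%N -> t i <= t j.
  elim: j => [|j IH]; first by rewrite leqn0 => /eqP ->.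
  rewrite leq_eqVlt => /orP[/eqP -> //|]; rewrite ltnS => ij jJ.
  by apply: le_trans (IH ij (ltnW jJ)) (ltW (tJ j jJ).1).
(* Otherwise the infimum [z] of the times after the last stop at which [F] has moved by more than
   [e] could be appended: by right continuity the displacement at [z] itself is at least [e]. *)
have last s : t J <= s -> s < T -> normc (F s - F (t J)) <= e.
  move=> ts sT; rewrite leNgt; apply/negP => big.
  pose E := [set y | t J <= y < T /\ e < normc (F y - F (t J))].
  have Es : E s by split=> //; rewrite ts sT.
  have lE y : E y -> t J <= y by case=> /andP[].
  have hE : has_inf E by split; [exists s|exists (t J) => y /lE].
  pose z := inf E.
  have tz : t J <= z by apply: lb_le_inf => [|y /lE //]; exists s.
  have zs : z <= s by apply: ge_inf Es; exists (t J) => y /lE.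
  have zT : z < T := le_lt_trans zs sT.
  have z0 : 0 <= z by apply: le_trans tz; have /andP[] := tT J (leqnn J).
  have below y : t J <= y < z -> normc (F y - F (t J)) <= e.
    move=> /andP[ty yz]; rewrite leNgt; apply/negP => ye.
    have : z <= y by apply: ge_inf; [exists (t J) => ? /lE|split=> //; rewrite ty (lt_trans yz)].
    by rewrite leNgt yz.
  have jz : e <= normc (F z - F (t J)).
    rewrite leNgt; apply/negP => ze.
    have d0 : 0 < (e - normc (F z - F (t J))) by rewrite subr_gt0.
    have zin : 0 <= z < T by rewrite z0.
    have [d dp hd] := rc z zin _ d0.
    have lb : lbound E (z + d).
      move=> y Ey; rewrite leNgt; apply/negP => yd.
      have zy : z <= y by apply: ge_inf Ey; exists (t J) => ? /lE.
      have [/andP[_ yT] ye] := Ey.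
      have hy := hd y _ yT; rewrite zy yd in hy; have {}hy := hy isT.
      have : normc (F y - F (t J)) <= e.
        have -> : F y - F (t J) = (F y - F z) + (F z - F (t J)) by ring.
        by apply: le_trans (normcD _ _) _; move: hy; lra.
      by rewrite leNgt ye.
    have : z + d <= z by apply: lb_le_inf => //; exists s.
    by rewrite gerDl leNgt dp.
  have tz' : t J < z.
    rewrite lt_neqAle tz andbT; apply/eqP => tzE; move: jz.
    by rewrite -tzE subrr normc0 leNgt e0.
  suff : (J.+1 <= J)%N by rewrite ltnn.
  apply: Jmax; apply/asboolP; exists (fun k => if (k <= J)%N then t k else z); split=> //.
    split=> k kJ.
      by case: ifP => kJ'; [exact: tT|rewrite z0 zT].
    rewrite ltnS in kJ; rewrite kJ; case: ltnP => kJ'; first exact: tJ.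
    have -> : k = J by apply/eqP; rewrite eqn_leq kJ kJ'.
    by split.
  move=> k y; rewrite ltnS => kJ; rewrite kJ; case: ltnP => kJ'; first exact: tc.
  have -> : k = J by apply/eqP; rewrite eqn_leq kJ kJ'.
  exact: below.
exists [seq t k | k <- iota 0 J.+1]; split.
- by rewrite size_map size_iota ltnS; apply: GN; apply/asboolP; exists t.
- by apply/mapP; exists 0%N.
- by move=> p hp; have /mapP[k kJ ->] := hp; apply: tT; move: kJ; rewrite mem_iota add0n ltnS.
move=> x /andP[x0 xT].
have ex : exists k, (k <= J)%N && (t k <= x) by exists 0%N; rewrite t0.
have [k /andP[kJ tkx] kmax] := ex_maxnP ex (fun k h => let: conj a _ := andP h in a).
have kin : t k \in [seq t k | k <- iota 0 J.+1] by apply: map_f; rewrite mem_iota add0n ltnS.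
have kM : forall q, q \in [seq t k | k <- iota 0 J.+1] -> q <= x -> q <= t k.
  move=> q hq; have /mapP[i iJ ->] := hq; move: iJ; rewrite mem_iota add0n ltnS => iJ tix.
  by apply: tm => //; apply: kmax; rewrite tix andbT.
rewrite (repE kin tkx kM).
split=> //; have [kJ'|Jk] := ltnP k J.
  apply: tc => //; rewrite tkx /= ltNge; apply/negP => h.
  by have := kmax k.+1; rewrite kJ' h ltnn => /(_ isT).
have -> : k = J by apply/eqP; rewrite eqn_leq kJ Jk.
by apply: last => //; have -> : J = k by apply/eqP; rewrite eqn_leq kJ Jk.
Qed.

Lemma partition_mono K (t : nat -> \bar R) : (forall k, (k < K)%N -> t k < t k.+1)%E ->
  forall i j, (i <= j)%N -> (j <= K)%N -> (t i <= t j)%E.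
Proof.
move=> h i j; elim: j => [|j IH]; first by rewrite leqn0 => /eqP ->.
rewrite leq_eqVlt => /orP[/eqP -> //|]; rewrite ltnS => ij jK.
exact: le_trans (IH ij (ltnW jK)) (ltW (h j jK)).
Qed.

Lemma cell_sum K (t : nat -> \bar R) (phi : nat -> R[i]) (s : R) i :
  (forall k, (k < K)%N -> t k < t k.+1)%E -> (i < K)%N -> (t i <= s%:E < t i.+1)%E ->
  \sum_(0 <= k < K) (if (t k <= s%:E)%E && (s%:E < t k.+1)%E then phi k else 0) = phi i.
Proof.
move=> h iK /andP[s1 s2]; rewrite big_mkord (bigD1 (Ordinal iK)) //= s1 s2 big1 ?addr0 // => k ki.
have m := partition_mono h; case: ifP => // /andP[k1 k2]; exfalso.
have : (k != i :> nat) by apply: contra ki => /eqP e; apply/eqP/val_inj.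
rewrite neq_ltn => /orP[lt|lt].
  have := lt_le_trans k2 (le_trans (m _ _ lt (ltnW iK)) s1); by rewrite ltxx.
have := le_lt_trans (le_trans (m _ _ lt (ltnW (ltn_ord k))) k1) s2; by rewrite ltxx.
Qed.

(** The coefficients of an atom have squares summing to exactly one. The missing mass [1 - S] is put
    on [[T + j + 1, T + j + 2)]. As [j] grows these intervals move to infinity, so in a series of
    such atoms only finitely many terms are nonzero at any given time outside [[0, T)]. *)
Lemma atom_exists T (pts : seq R) V (m : R) (j : nat) : 0 < T -> uniq pts -> 0 \in pts ->
  (forall p, p \in pts -> 0 <= p < T) ->
  (forall x y, 0 <= x < T -> 0 <= y < T -> (forall p, p \in pts -> (p <= x) = (p <= y)) -> V x = V y) ->
  (forall x, 0 <= x < T -> normc (V x) <= m) -> (size pts)%:R * m ^+ 2 <= 1 ->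
  exists a, [/\ U2_atom a, forall s, 0 <= s < T -> a s = V s,
    forall s, s < 0 -> a s = 0 & forall s, T <= s < T + j.+1%:R -> a s = 0].
Proof.
move=> T0 up p0 pT Vc Vm sm; pose q := sort <=%R pts; pose n := size q.
have qs : sorted <%R q by rewrite lt_sorted_uniq_le sort_uniq up sort_sorted //; exact: le_total.
have nE : n = size pts by rewrite /n size_sort.
have qm x : (x \in q) = (x \in pts) by rewrite mem_sort.
have n0 : (0 < n)%N by rewrite nE; case: (pts) p0.
have qT k : (k < n)%N -> 0 <= nth T q k < T by move=> kn; apply: pT; rewrite -qm mem_nth.
have qlt i k : (i < k)%N -> (k < n)%N -> nth T q i < nth T q k.
  by move=> ik kn; rewrite (lt_sorted_ltn_nth T qs) // inE //; exact: ltn_trans kn.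
pose t k : \bar R := if (k < n)%N then (nth T q k)%:E else if k == n then T%:E
  else if k == n.+1 then (T + j.+1%:R)%:E else (T + j.+2%:R)%:E.
pose S := \sum_(0 <= k < n) normc (V (nth T q k)) ^+ 2.
have S1 : S <= 1.
  apply: le_trans sm; rewrite /S -nE mulr_natl -[n in X in _ <= X]subn0 -sumr_const_nat.
  rewrite !big_mkord; apply: ler_sum => k _.
  by rewrite lerXn2r ?nnegrE ?normc_ge0 ?Vm ?qT // (le_trans (normc_ge0 _) (Vm _ (qT _ (ltn_ord k)))).
pose phi k : R[i] := if (k < n)%N then V (nth T q k) else if k == n then 0 else (Num.sqrt (1 - S))%:C.
have tt k : (k < n.+2)%N -> (t k < t k.+1)%E.
  rewrite ltnS leq_eqVlt => /orP[/eqP ->|].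
    rewrite /t (ltnNge n.+1) leqnSn /= gtn_eqF // eqxx (ltnNge n.+2) (leq_trans (leqnSn n)) //=.
    by rewrite !gtn_eqF // lte_fin ltrD2l ltr_nat.
  rewrite ltnS leq_eqVlt => /orP[/eqP ->|kn].
    by rewrite /t ltnn eqxx (ltnNge n.+1) leqnSn /= gtn_eqF // eqxx lte_fin ltrDl ltr0n.
  rewrite /t kn; case: ltnP => [kn'|nk]; first by rewrite lte_fin qlt.
  have -> : k.+1 = n by apply/eqP; rewrite eqn_leq nk kn.
  by rewrite eqxx lte_fin; have /andP[] := qT k kn.
pose a s := \sum_(0 <= k < n.+2) (if (t k <= s%:E)%E && (s%:E < t k.+1)%E then phi k else 0).
exists a; split.
- exists n.+2, t, phi; split=> //.
    by split=> //; rewrite /t n0 ltNyr.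
  rewrite !big_nat_recr //= /phi ltnn eqxx normc0 expr0n addr0 (ltnNge n.+1) leqnSn /= gtn_eqF //.
  rewrite normc_real ger0_norm ?sqrtr_ge0 // sqr_sqrtr ?subr_ge0 //.
  have -> : \sum_(0 <= k < n) normc (if (k < n)%N then V (nth T q k) else if k == n then 0 else (Num.sqrt (1 - S))%:C) ^+ 2 = S.
    by apply: eq_big_nat => k /andP[_ kn]; rewrite kn.
  by rewrite addrC subrK.
- move=> s /andP[s0 sT].
  have q00 : nth T q 0 <= s.
    have /(nthP T)[i iq ei] : 0 \in q by rewrite qm.
    apply: le_trans s0; rewrite -ei; case: i iq ei => [//|i] iq _; exact/ltW/qlt.
  have ex : exists i, (i < n)%N && (nth T q i <= s) by exists 0%N; rewrite n0.
  have [i /andP[iN is_] imax] := ex_maxnP ex (fun i h => ltnW (let: conj a _ := andP h in a)).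
  have si : (s%:E < t i.+1)%E.
    rewrite /t; case: ltnP => [iN'|ni].
      by rewrite lte_fin ltNge; apply/negP => h; have := imax i.+1; rewrite iN' h ltnn => /(_ isT).
    have -> : i.+1 = n by apply/eqP; rewrite eqn_leq ni iN.
    by rewrite eqxx lte_fin.
  have ti : (t i <= s%:E)%E by rewrite /t iN lee_fin.
  rewrite /a (@cell_sum n.+2 t phi s i tt _ _) ?ti //; last by apply: ltn_trans iN _; exact: leqnSn.
  rewrite /phi iN; apply: Vc; [exact: qT|by rewrite s0|move=> p].
  rewrite -qm => /(nthP T)[k kn <-]; have [ki|ik] := leqP k i.
    have h : nth T q k <= nth T q i by move: ki; rewrite leq_eqVlt => /orP[/eqP -> //|ki]; exact/ltW/qlt.
    by rewrite h (le_trans h is_).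
  have h : nth T q i < nth T q k by exact: qlt.
  rewrite leNgt h /=; apply/esym/negbTE; rewrite -ltNge.
  rewrite ltNge; apply/negP => hs; have := imax k; rewrite kn hs => /(_ isT); by rewrite leqNgt ik.
- move=> s s0; rewrite /a big_nat_cond big1 // => k /andP[/andP[_ kn] _]; case: ifP => // /andP[h _]; exfalso.
  have h0 : (t 0%N <= s%:E)%E by apply: le_trans h; apply: (partition_mono tt) => //; exact: ltnW.
  move: h0; rewrite /t n0 lee_fin => h0; have /andP[h1 _] := qT 0%N n0.
  by have := lt_le_trans s0 (le_trans h1 h0); rewrite ltxx.
- move=> s /andP[sT sj]; rewrite /a (@cell_sum n.+2 t phi s n tt _ _) //.
    by rewrite /phi ltnn eqxx.
  by rewrite /t ltnn eqxx (ltnNge n.+1) leqnSn /= gtn_eqF // eqxx lee_fin lte_fin sT sj.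
Qed.

Lemma crt_cube J n : J%:R <= 16 ^+ n * crt J :> R -> (J <= 64 ^ n)%N.
Proof.
case: J => // J h; have c1 : 1 <= crt J.+1 :> R by exact: crt_ge1.
have c0 : 0 < crt J.+1 :> R by exact: lt_le_trans c1.
have c4 : crt J.+1 <= 4 ^+ n :> R.
  rewrite -(@ler_pXn2r _ 2) ?nnegrE ?exprn_ge0 ?(ltW c0) // -exprM mulnC exprM.
  have -> : 4 ^+ 2 = 16 :> R by [ring]; rewrite -(ler_pM2r c0) -exprSr crt3.
  exact: h.
rewrite -(ler_nat R) -crt3 natrX; have -> : 64%:R = 4 ^+ 3 :> R by [ring].
by rewrite -exprM mulnC exprM lerXn2r ?nnegrE ?exprn_ge0 ?(ltW c0).
Qed.

Lemma U2_restr_le_series T F (w : R -> R[i]) (L : nat -> R) (a : nat -> R -> R[i]) (K : R) :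
  agree_on T w F -> (forall n, 0 <= L n) -> (forall n, \sum_(0 <= j < n) L j <= K) ->
  (forall j, U2_atom (a j)) ->
  (forall s, ((fun n => \sum_(0 <= j < n) (L j)%:C * a j s) : nat -> R[i]^o) @ \oo --> (w s : R[i]^o)) ->
  (U2_restr T F <= K%:E)%E.
Proof.
move=> wF L0 LK ha cv; apply: (@le_trans _ _ (U2_norm w)); first by apply: ereal_inf_lbound; exists w.
apply: (@le_trans _ _ (\sum_(0 <= j <oo) (normc (L j)%:C)%:E)%E).
  by apply: ereal_inf_lbound; exists (fun j => (L j)%:C) => //; exists a.
apply: lime_le; first by apply: is_cvg_nneseries => n _ _; rewrite lee_fin normc_ge0.
apply: nearW => n; rewrite sumEFin lee_fin; apply: le_trans (LK n); apply: ler_sum => j _.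
by rewrite normc_real ger0_norm.
Qed.

(** The threshold [b / 16^n] is reached at most [64^n] times, because [J b / 16^n <= b J^(1/3)]. The
    difference of consecutive approximations has [O(64^n)] pieces of size [O(b 16^(-n))], hence
    [l^2] norm [O(b 2^(-n))]. *)
Lemma U2_of_chains_pos T F (b : R) : 0 < T -> 0 < b -> right_cont T F ->
  (forall x, 0 <= x < T -> normc (F x) <= b) ->
  (forall n t, chain T (fun _ _ => True) n t ->
    \sum_(k < n) normc (F (t k.+1) - F (t k)) <= b * crt n) ->
  (U2_restr T F <= (128 * b)%:E)%E.
Proof.
move=> T0 b0 rc Fb Fc; pose e n := b / 16 ^+ n.
have e0 n : 0 < e n by rewrite divr_gt0 // exprn_gt0.
have cN n J t : chain T (fun x y => e n <= normc (F y - F x)) J t -> (J <= 64 ^ n)%N.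
  move=> [tT tJ]; apply: crt_cube.
  have h : J%:R * e n <= b * crt J.
    apply: le_trans (Fc J t _); last by split=> // k kJ; split=> //; exact: (tJ k kJ).1.
    rewrite mulr_natl -[J in X in X <= _]card_ord -sumr_const.
    by apply: ler_sum => k _; exact: (tJ k (ltn_ord k)).2.
  move: h; rewrite /e mulrCA ler_pM2l // ler_pdivrMr ?exprn_gt0 //.
  by rewrite [_ * crt J]mulrC.
have [P hP] := choice (fun n => stopping T0 (e0 n) rc (cN n)).
pose pi_ n x := F (rep (P n) x).
have rT n x : 0 <= x < T -> 0 <= rep (P n) x < T.
  by move=> xT; have [_ _ h1 h2] := hP n; apply: h1; exact: (h2 x xT).1.
have pe n x : 0 <= x < T -> normc (F x - pi_ n x) <= e n.
  by move=> xT; have [_ _ _ h2] := hP n; exact: (h2 x xT).2.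
pose V n x := if n is m.+1 then pi_ n x - pi_ m x else pi_ 0%N x.
have Vb n x : 0 <= x < T -> normc (V n x) <= 32 * e n.
  move=> xT; case: n => [|n] /=.
    by apply: le_trans (Fb _ (rT 0%N x xT)) _; rewrite /e expr0 divr1; move: b0; lra.
  have -> : pi_ n.+1 x - pi_ n x = (F x - pi_ n x) - (F x - pi_ n.+1 x) by ring.
  apply: le_trans (normcD _ _) _; rewrite normcN.
  have h1 := pe n x xT; have h2 := pe n.+1 x xT.
  have h3 : e n = 16 * e n.+1.
    rewrite /e exprS; have h : 16 ^+ n != 0 :> R by rewrite expf_neq0.
    by field; rewrite h.
  have := e0 n.+1; move: h1 h2; rewrite h3; lra.
pose Q n := undup (P n ++ P n.-1).
have QP n : {subset P n <= Q n} by move=> p pp; rewrite mem_undup mem_cat pp.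
have QP' n : {subset P n.-1 <= Q n} by move=> p pp; rewrite mem_undup mem_cat pp orbT.
have sQ n : (size (Q n))%:R <= 4 * 64 ^+ n :> R.
  have [s1 _ _ _] := hP n; have [s2 _ _ _] := hP n.-1.
  have h : (size (Q n) <= 4 * 64 ^ n)%N.
    apply: leq_trans (size_undup _) _; rewrite size_cat; apply: leq_trans (leq_add s1 s2) _.
    have h1 : (64 ^ n.-1 <= 64 ^ n)%N by rewrite leq_exp2l // leq_pred.
    have h2 : (0 < 64 ^ n)%N by rewrite expn_gt0.
    by move: h1 h2; clear; move: (64 ^ n.-1)%N (64 ^ n)%N => x y; lia.
  by rewrite -natrX -natrM ler_nat.
(* [64 = 2 * 32]: there are at most [4 * 64^n] pieces, with square root [2 * 8^n], each of size at
   most [32 b / 16^n]. *)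
pose L n := 64 * b * 2 ^- n.
have L0 n : 0 < L n by rewrite /L mulr_gt0 ?invr_gt0 ?exprn_gt0 // mulr_gt0.
pose m n : R := (2 * 8 ^+ n)^-1.
have atom n : exists a : R -> R[i], [/\ U2_atom a, forall s : R, 0 <= s < T -> a s = ((L n)^-1)%:C * V n s,
    forall s : R, s < 0 -> a s = 0 & forall s, T <= s < T + n.+1%:R -> a s = 0].
  apply: (@atom_exists T (Q n) (fun s => ((L n)^-1)%:C * V n s) (m n) n) => //.
  - exact: undup_uniq.
  - by apply: QP; have [_ ? _ _] := hP n.
  - move=> p; rewrite mem_undup mem_cat => /orP[pp|pp]; [have [_ _ h _] := hP n|have [_ _ h _] := hP n.-1]; exact: h.
  - move=> x y _ _ h; congr (_ * _).
    have h1 : pi_ n x = pi_ n y by rewrite /pi_; congr F; apply: rep_cut => p /QP; exact: h.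
    have h2 : pi_ n.-1 x = pi_ n.-1 y by rewrite /pi_; congr F; apply: rep_cut => p /QP'; exact: h.
    by clear h; case: n h1 h2 => [|n] /= h1 h2; rewrite ?h1 ?h2.
  - move=> x xT; rewrite normcM normc_real ger0_norm ?invr_ge0 ?(ltW (L0 n)) // mulrC ler_pdivrMr //.
    apply: le_trans (Vb n x xT) _; rewrite /e /m /L.
    have h2 : 2 ^+ n != 0 :> R by rewrite expf_neq0.
    have h8 : 8 ^+ n != 0 :> R by rewrite expf_neq0.
    have -> : 16 ^+ n = 2 ^+ n * 8 ^+ n :> R by rewrite -exprMn; congr (_ ^+ _); ring.
    have -> // : 32 * (b / (2 ^+ n * 8 ^+ n)) = (2 * 8 ^+ n)^-1 * (64 * b * 2 ^- n) by field; rewrite h2 h8.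
  - apply: le_trans (ler_wpM2r (sqr_ge0 _) (sQ n)) _; rewrite /m.
    have h8 : 8 ^+ n != 0 :> R by rewrite expf_neq0.
    have -> : 64 ^+ n = 8 ^+ n * 8 ^+ n :> R by rewrite -exprMn; congr (_ ^+ _); ring.
    by have -> // : 4 * (8 ^+ n * 8 ^+ n) * (2 * 8 ^+ n)^-1 ^+ 2 = 1 :> R by field; rewrite h8.
have [a ha] := choice atom.
(* The [U^2] extension of [F]. Outside [[0, T)] it collects the far steps of the atoms, of which
   only those with index below [Num.bound s] can be nonzero at [s]. *)
pose w (s : R) := if 0 <= s < T then F s else \sum_(0 <= j < Num.bound s) (L j)%:C * a j s.
apply: (@U2_restr_le_series T F w L a).
- by move=> s sT; rewrite /w sT.
- by move=> n; exact: ltW.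
- move=> n; rewrite /L -mulr_sumr big_mkord.
  have h : 0 < 64 * b by rewrite mulr_gt0.
  have := ler_wpM2l (ltW h) (geo_half n); rewrite -mulrA; lra.
- by move=> j; have [] := ha j.
move=> s; apply: cvgc => d d0; rewrite /w; case: ifPn => sT.
  have telesc n : \sum_(0 <= j < n.+1) (L j)%:C * a j s = pi_ n s.
    have tm j : (L j)%:C * a j s = V j s.
      have [_ -> // _ _] := ha j; rewrite mulrA -rmorphM /= divff ?gt_eqF ?L0 // mul1r //.
    elim: n => [|n IH]; first by rewrite big_nat1 tm.
    by rewrite big_nat_recr //= IH tm /=; ring.
  exists (Num.bound (b / d)).+1 => -[//|n] Nn; rewrite telesc normc_distC; apply: le_trans (pe n s sT) _.
  rewrite /e ler_pdivrMr ?exprn_gt0 // mulrC -ler_pdivrMr //.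
  have bd : 0 <= b / d by rewrite divr_ge0 ?(ltW b0) ?(ltW d0).
  apply: le_trans (ltW (archi_boundP bd)) _; rewrite -natrX ler_nat.
  by apply: (@leq_trans n); [exact: Nn|rewrite ltnW // ltn_expl].
exists (Num.bound s) => n sn; rewrite (@big_cat_nat _ _ _ (Num.bound s) 0%N n) //=.
rewrite [X in _ + X - _]big_nat_cond [X in _ + X - _]big1 ?addr0 ?subrr ?normc0 ?(ltW d0) //.
move=> j /andP[/andP[sj _] _]; have [_ _ h1 h2] := ha j; have [s0|s0] := ltP s 0; first by rewrite h1 ?mulr0.
rewrite h2 ?mulr0 //; move: sT; rewrite s0 /= -leNgt => ->/=.
have hb := archi_boundP s0; have : (Num.bound s)%:R <= j.+1%:R :> R by rewrite ler_nat leqW.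
by move: hb T0; lra.
Qed.

Lemma U2_of_chains T F (b : R) : 0 < T -> 0 <= b -> right_cont T F ->
  (forall x, 0 <= x < T -> normc (F x) <= b) ->
  (forall n t, chain T (fun _ _ => True) n t ->
    \sum_(k < n) normc (F (t k.+1) - F (t k)) <= b * crt n) ->
  (U2_restr T F <= (128 * b)%:E)%E.
Proof.
move=> T0 b0 rc Fb Fc; apply/lee_addgt0Pr => d d0.
have -> : ((128 * b)%:E + d%:E = (128 * (b + d / 128))%:E)%E by rewrite -EFinD; congr (_%:E); field.
have d1 : 0 < d / 128 by rewrite divr_gt0.
apply: U2_of_chains_pos => //.
- by rewrite ltr_wpDl.
- by move=> x xT; apply: le_trans (Fb x xT) _; rewrite lerDl ltW.
- move=> n t ct; apply: le_trans (Fc n t ct) _; rewrite ler_wpM2r ?crt_ge0 //.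
  by rewrite lerDl ltW.
Qed.

End U2Bound.

(** * The Duhamel integral *)

Section StepFunctions.
Context {R : realType}.
Local Notation mu := (@lebesgue_measure R).
Local Notation DT T := (`[0, T[%classic : set R).

Lemma crt_le_cube m n (c : R) : 0 <= c -> m%:R <= c ^+ 3 * n%:R -> crt m <= c * crt n :> R.
Proof.
move=> c0 h; rewrite -(@ler_pXn2r _ 3) ?nnegrE ?mulr_ge0 ?crt_ge0 //.
by rewrite exprMn !crt3.
Qed.

Definition ind (x s : R) : R := if s < x then 1 else 0.

(** The value on [[t k, t k.+1)] is [c k]; written with the cutoffs [ind], it turns integrals into
    increments of [ucut]. *)
Definition stepf J (t : nat -> R) (c : nat -> R[i]) (s : R) : R[i] :=
  \sum_(k < J) c k * (ind (t k.+1) s - ind (t k) s)%:C.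

Lemma stepf_le T J t c (b : R) : 0 <= b -> chain T (fun _ _ => True) J t ->
  (forall k, (k < J)%N -> normc (c k) <= b) -> forall s, normc (stepf J t c s) <= b.
Proof.
move=> b0 [_ tJ] cb s; apply: le_trans (normc_sum _ _ _) _.
apply: (@le_trans _ _ (\sum_(k < J) b * (ind (t k.+1) s - ind (t k) s))).
  apply: ler_sum => k _; have [tk _] := tJ k (ltn_ord k).
  have h : 0 <= ind (t k.+1) s - ind (t k) s.
    rewrite /ind; case: (ltP s (t k)) => h; last by case: ifP; rewrite subr0.
    by rewrite (lt_trans h tk) subrr.
  by rewrite normcM normc_real ger0_norm // ler_wpM2r // cb.
rewrite -mulr_sumr -(big_mkord xpredT (fun k => ind (t k.+1) s - ind (t k) s)).
rewrite telescope_sumr //; apply: ler_piMr => //.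
by rewrite /ind; case: ifP => _; case: ifP => _; lra.
Qed.

(* The number of pieces met by an increasing sequence is bounded both by its
   length and by [J + 1]. *)
Lemma stepf_wvar T J t c (b : R) : 0 <= b -> (0 < J)%N -> chain T (fun _ _ => True) J t ->
  (forall k, (k < J)%N -> normc (c k) <= b) ->
  wvar T (16 * b ^+ 2 * crt J ^+ 2) (stepf J t c).
Proof.
move=> b0 J0 ct cb; have sb := stepf_le b0 ct cb.
have J1 : 1 <= crt J :> R by exact: crt_ge1.
have sq1 : 1 <= crt J ^+ 2 :> R by rewrite exprn_ege1.
split=> [x _|n x [_ xlt]].
  have h : normc (stepf J t c x) ^+ 2 <= b ^+ 2 by rewrite lerXn2r ?nnegrE ?normc_ge0.
  apply: le_trans h _; rewrite -[leLHS]mulr1; apply: ler_pM => //; first exact: sqr_ge0.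
  by have := sqr_ge0 b; lra.
(* The number of breakpoints up to [s]: it is monotone, at most [J + 1], and determines the value of
   the step function. *)
pose kap s : nat := (\sum_(k < J.+1) (t k <= s)%R)%N.
have kle u v (k : 'I_J.+1) : u <= v -> ((t k <= u)%R <= (t k <= v)%R)%N.
  by move=> uv; case: (leP (t k) u) => // h; rewrite (le_trans h uv).
have km u v : u <= v -> (kap u <= kap v)%N by move=> uv; apply: leq_sum => k _; exact: kle.
have kJ u : (kap u <= J.+1)%N.
  rewrite -[X in (_ <= X)%N]card_ord -sum1_card; apply: leq_sum => k _; exact: leq_b1.
have keq u v : u <= v -> kap u = kap v -> stepf J t c u = stepf J t c v.
  move=> uv e; have E := leqif_sum (fun (k : 'I_J.+1) (_ : true) => leqif_eq (kle u v k uv)).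
  have /forallP h : [forall k : 'I_J.+1, true ==> ((t k <= u)%R == (t k <= v)%R :> nat)].
    by rewrite -E.2; apply/eqP.
  have hi k : (k < J.+1)%N -> ind (t k) u = ind (t k) v.
    move=> kJ1; have := h (Ordinal kJ1) => /= /eqP; rewrite /ind !ltNge.
    by case: (t k <= u); case: (t k <= v).
  by rewrite /stepf; apply: eq_bigr => k _; rewrite !hi // ?ltnS ?ltn_ord // ltnW // ltnS.
have jump u v : u <= v -> normc (stepf J t c v - stepf J t c u) ^+ 2 <= 4 * b ^+ 2 *
    (minn 1 (kap v - kap u))%:R.
  move=> uv; have [e|ne] := eqVneq (kap u) (kap v).
    by rewrite (keq _ _ uv e) subrr normc0 expr0n mulr_ge0 // mulr_ge0 ?sqr_ge0.
  have -> : minn 1 (kap v - kap u) = 1%N.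
    by have := km _ _ uv; move: ne; move: (kap u) (kap v); clear; lia.
  rewrite mulr1; have -> : 4 * b ^+ 2 = (b + b) ^+ 2 by ring.
  rewrite lerXn2r ?nnegrE ?normc_ge0 ?addr_ge0 //; apply: le_trans (normcD _ _) _.
  by rewrite normcN lerD.
have xle i : (i < n)%N -> x i <= x i.+1 by move=> h; exact/ltW/(xlt i h).1.
apply: (@le_trans _ _ (4 * b ^+ 2 * (minn n J.+1)%:R)).
  apply: (@le_trans _ _ (\sum_(k < n) 4 * b ^+ 2 * (minn 1 (kap (x k.+1) - kap (x k)))%:R)).
    by apply: ler_sum => k _; apply: jump; exact: xle.
  rewrite -mulr_sumr ler_wpM2l ?mulr_ge0 ?sqr_ge0 // -natr_sum ler_nat.
  suff : (forall m, (m <= n)%N -> \sum_(k < m) minn 1 (kap (x k.+1) - kap (x k)) <= minn m (kap (x m)))%N.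
    by move=> /(_ n (leqnn n)) h; apply: leq_trans h _; rewrite leq_min geq_minl (leq_trans (geq_minr _ _) (kJ _)).
  elim=> [|m IH] mn; first by rewrite big_ord0.
  rewrite big_ord_recr /=; have := IH (ltnW mn); have := km _ _ (xle m mn).
  by move: (\sum_(_ < m) _)%N (kap _) (kap _); clear; lia.
have cJ : crt J.+1 <= 2 * crt J :> R.
  apply: crt_le_cube => //; have -> : 2 ^+ 3 = 8%:R :> R by ring.
  by rewrite -natrM ler_nat; move: J0; clear; lia.
(* The minimum of [n] and [J + 1] is at most their weighted geometric mean
   [(J + 1)^(2/3) n^(1/3)]. *)
have mle : (minn n J.+1)%:R <= crt J.+1 ^+ 2 * crt n :> R.
  have h m p : (m <= p)%N -> crt m <= crt p :> R.
    by move=> mp; rewrite -[leRHS]mul1r; apply: crt_le_cube; rewrite ?ler01 // expr1n mul1r ler_nat.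
  have c0 m : 0 <= crt m :> R by exact: crt_ge0.
  have e3 m : m%:R = crt m ^+ 2 * crt m :> R by rewrite -exprSr crt3.
  case: leqP => hn; rewrite [leLHS]e3.
    by apply: ler_wpM2r => //; rewrite lerXn2r ?nnegrE ?c0 // h.
  by apply: ler_wpM2l; [exact: sqr_ge0|exact/h/ltnW].
apply: le_trans (ler_wpM2l _ mle) _; first by rewrite mulr_ge0 ?sqr_ge0.
have h2 : crt J.+1 ^+ 2 <= 4 * crt J ^+ 2 :> R.
  have -> : 4 * crt J ^+ 2 = (2 * crt J) ^+ 2 :> R by ring.
  by rewrite lerXn2r ?nnegrE ?crt_ge0 ?mulr_ge0 ?crt_ge0.
have cn := crt_ge0 n : 0 <= crt n :> R.
have -> : 16 * b ^+ 2 * crt J ^+ 2 * crt n = 4 * b ^+ 2 * (4 * crt J ^+ 2 * crt n) by ring.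
by apply: ler_wpM2l; [rewrite mulr_ge0 ?sqr_ge0|exact: ler_wpM2r].
Qed.

Lemma ind_bm (D : set R) x : measurable D -> bm D (ind x).
Proof.
move=> mD; split; last by exists 1 => s _; rewrite /ind; case: ifP; rewrite ?normr1 ?normr0 ?ler01.
have mI : measurable_fun D (\1_(`]-oo, x[%classic) : R -> R) by exact: measurable_indic.
by apply: eq_measurable_fun mI => s _; rewrite /ind indicE mem_setE in_itv /=; case: ifP.
Qed.

(** For [x] in [[0, T)] this is the primitive of [f] from 0, as an integral over all of [[0, T)], so
    that the rules for a fixed domain apply. *)
Definition ucut T (f : R -> R[i]) (x : R) : R[i] := cintegral mu (DT T) (fun s => (ind x s)%:C * f s).

Lemma ind_cbm (D : set R) x f : measurable D -> cbm D f -> cbm D (fun s => (ind x s)%:C * f s).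
Proof.
move=> mD bf; apply: cbmM => //; split.
  by under eq_fun do rewrite Cre_real; exact: ind_bm.
by under eq_fun do rewrite Cim_real; exact: bm_cst.
Qed.

Lemma Rint_ind T (f : R -> R) x : 0 <= x < T -> bm (DT T) f ->
  Rintegral mu (DT T) (fun s => ind x s * f s) = Rintegral mu `[0, x] f.
Proof.
move=> /andP[x0 xT] bf.
have sub : `[0, x[%classic `<=` DT T.
  by move=> s /=; rewrite !in_itv /= => /andP[-> h]; exact: lt_trans h xT.
have int : mu.-integrable (DT T) (EFin \o f) by apply: bm_integrable => //; exact: lebesgue_itv_finite.
rewrite -Rintegral_itv_bndo_bndc; last by apply: integrableS int.
have -> : `[0, x[%classic = DT T `&` `[0, x[%classic.
  by apply/esym/setIidPr.
rewrite Rintegral_mkcondr; apply: eq_Rintegral => s; rewrite inE /= in_itv /= => /andP[s0 _].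
rewrite /ind patchE mem_setE /= in_itv /= s0 /=; case: ifP => h; rewrite ?mul1r ?mul0r //.
Qed.

Lemma cpxB (x y x' y' : R) : (x - y) +i* (x' - y') = (x +i* x') - (y +i* y') :> R[i].
Proof. by []. Qed.

Lemma cintegral_betweenE T (f : R -> R[i]) a t : 0 <= a < T -> 0 <= t < T -> cbm (DT T) f ->
  cintegral_between a t f = ucut T f t - ucut T f a.
Proof.
move=> aT tT [b1 b2].
have cut x : 0 <= x < T -> ucut T f x = Rintegral mu `[0, x] (fun s => Cre (f s)) +i*
    Rintegral mu `[0, x] (fun s => Cim (f s)).
  move=> xT; rewrite /ucut /cintegral -!(Rint_ind xT) //; congr (_ +i* _); apply: eq_Rintegral => s _.
    by rewrite -/(Cre _) CreM Cre_real Cim_real mul0r subr0.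
  by rewrite -/(Cim _) CimM Cre_real Cim_real mul0r addr0.
have diff x y (g : R -> R) : 0 <= x -> x <= y -> y < T -> bm (DT T) g ->
    Rintegral mu `[x, y] g = Rintegral mu `[0, y] g - Rintegral mu `[0, x] g.
  move=> x0 xy yT bg.
  have int : mu.-integrable (DT T) (EFin \o g) by apply: bm_integrable => //; exact: lebesgue_itv_finite.
  have sub u : 0 <= u -> `[u, y]%classic `<=` DT T.
    by move=> u0 s /=; rewrite !in_itv /= => /andP[h1 h2]; rewrite (le_trans u0 h1) (le_lt_trans h2 yT).
  rewrite Rintegral_itvB ?bnd_simp //; last by apply: integrableS int => //; exact: sub.
  rewrite Rintegral_itv_obnd_cbnd //; apply: integrableS int => //.
  by apply: subset_trans (sub x x0) => s /=; rewrite !in_itv /= => /andP[/ltW -> ->].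
have [a0 a1] := andP aT; have [t0 t1] := andP tT.
rewrite (cut t tT) (cut a aT) /cintegral_between /cintegral; case: leP => at_.
  by rewrite (diff _ _ _ a0 at_ t1 b1) (diff _ _ _ a0 at_ t1 b2) cpxB.
by rewrite (diff _ _ _ t0 (ltW at_) a1 b1) (diff _ _ _ t0 (ltW at_) a1 b2) cpxB opprB.
Qed.

Lemma ucut_lip T (f : R -> R[i]) : cbm (DT T) f -> exists2 M : R, 0 <= M & forall x y, 0 <= x -> x <= y -> y < T ->
  normc (ucut T f y - ucut T f x) <= M * (y - x).
Proof.
move=> bf; have [[_ [M1 h1]] [_ [M2 h2]]] := bf.
have mD : measurable (DT T) := measurable_itv _; have fD := lebesgue_itv_finite 0 T.
pose M := `|M1| + `|M2|; exists (2 * M) => [|x y x0 xy yT]; first by rewrite mulr_ge0 ?addr_ge0.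
have fM s : DT T s -> normc (f s) <= M.
  move=> Ds; apply: le_trans (normc_le_ReIm _) _; apply: lerD.
    by apply: le_trans (h1 s Ds) (ler_norm _).
  by apply: le_trans (h2 s Ds) (ler_norm _).
have bN z : cbm (DT T) (fun s => -1 * ((ind z s)%:C * f s)) by apply: cbmM; [exact: cbm_cst|exact: ind_cbm].
rewrite /ucut -[X in _ + X]mulN1r -(cintZ (m := mu) mD fD); last exact: ind_cbm.
rewrite -(cintD (m := mu) mD fD); [|exact: ind_cbm|exact: bN].
have xT : 0 <= x < T by rewrite x0 (le_lt_trans xy).
have yT' : 0 <= y < T by rewrite (le_trans x0 xy).
have := normc_cint_le (m := mu) mD fD (F := fun s => (ind y s)%:C * f s + -1 * ((ind x s)%:C * f s))
  (g := fun s => ind y s * M - ind x s * M).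
move=> bnd; apply: le_trans (bnd _ _ _) _; clear bnd.
- exact: (cbmD (F := fun s => (ind y s)%:C * f s) (G := fun s => -1 * ((ind x s)%:C * f s)) (ind_cbm y mD bf) (bN x)).
- by apply: bmB; apply: bmM; try exact: ind_bm; exact: bm_cst.
- move=> s Ds; rewrite mulN1r -mulrBl -rmorphB /= -mulrBl normcM normc_real.
  have h : 0 <= ind y s - ind x s.
    by rewrite /ind; case: (ltP s x) => h; [rewrite (lt_le_trans h xy) subrr|case: ifP; rewrite subr0].
  by rewrite ger0_norm // ler_wpM2l // fM.
have bi z : bm (DT T) (fun s => ind z s * M) by apply: bmM; [exact: ind_bm|exact: bm_cst].
have -> : Rintegral mu (DT T) (fun s => ind y s * M - ind x s * M) =
  Rintegral mu (DT T) (fun s => ind y s * M) - Rintegral mu (DT T) (fun s => ind x s * M).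
  by rewrite -(bm_intN (m := mu) mD fD (bi x)) -(bm_intD (m := mu) mD fD (bi y) (bmN (bi x))).
rewrite !Rint_ind //; try exact: bm_cst.
rewrite !Rintegral_cst //= !lebesgue_measure_itv /= !lte_fin.
have len (z : R) : 0 <= z -> fine (if 0 < z then (z%:E - 0%:E)%E else 0%E) = z.
  by move=> z0; case: (ltP 0 z) => /= h; rewrite ?subr0 //; apply/eqP; rewrite eq_le h z0.
by rewrite !len ?(le_trans x0 xy) // -mulrBr mulrA.
Qed.

Lemma complex_cauchy (f : nat -> R[i]) : (forall e : R, 0 < e -> exists N, forall n, (N <= n)%N ->
    normc (f n - f N) <= e) ->
  exists l, forall e : R, 0 < e -> exists N, forall n, (N <= n)%N -> normc (f n - l) <= e.
Proof.
move=> h; have re (g : R[i] -> R) : (forall z w, `|g z - g w| <= normc (z - w)) ->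
    exists l : R, forall e : R, 0 < e -> exists N, forall n, (N <= n)%N -> `|g (f n) - l| <= e.
  move=> gl; have : cvgn (fun n => g (f n)).
    apply: cauchy_cvg; apply: cauchy_exP => e e0; have e2 : 0 < e / 2 by rewrite divr_gt0.
    have [N hN] := h _ e2; exists (g (f N)); exists N => // n /= Nn; rewrite -ball_normE /= distrC.
    by apply: le_lt_trans (gl _ _) _; apply: le_lt_trans (hN n Nn) _; rewrite ltr_pdivrMr //; lra.
  move=> cv; exists (limn (fun n => g (f n))) => e e0.
  have [N _ hN] := (cvgrPdist_le _ _).1 cv e e0.
  by exists N => n Nn; rewrite distrC; exact: hN.
have [r hr] := re (@Cre R) (fun z w => ltac:(rewrite -CreN -CreD; exact: Cre_le_normc)).
have [i hi] := re (@Cim R) (fun z w => ltac:(rewrite -CimN -CimD; exact: Cim_le_normc)).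
exists (r +i* i) => e e0; have e2 : 0 < e / 2 by rewrite divr_gt0.
have [N1 h1] := hr _ e2; have [N2 h2] := hi _ e2; exists (maxn N1 N2) => n; rewrite geq_max => /andP[n1 n2].
apply: le_trans (normc_le_ReIm _) _; rewrite CreD CimD CreN CimN /=.
by have := h1 n n1; have := h2 n n2; lra.
Qed.

End StepFunctions.

Section FiniteSupport.
Context {R : realType}.
Local Notation ball := (@ball R).

Lemma ybnd_finite (S : seq freq) (B : freq -> R) : uniq S -> (forall A, 0 <= B A) ->
  (forall A, A \notin S -> B A = 0) -> ybnd Wp B (Num.sqrt (\sum_(A <- S) Wp A * B A)).
Proof.
move=> uS B0 BS; have WB A : 0 <= Wp A * B A by rewrite mulr_ge0 // ltW // Wp_gt0.
split=> [|//|S' uS']; first exact: sqrtr_ge0.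
rewrite sqr_sqrtr ?sumr_ge0 // (bigID (fun A => A \in S)) /= [X in _ + X]big1 ?addr0; last first.
  by move=> A /BS ->; rewrite mulr0.
rewrite -big_filter [leRHS](bigID (fun A => A \in S')) /= -[X in _ <= X + _]big_filter.
have -> : \sum_(A <- [seq x <- S' | x \in S]) Wp A * B A = \sum_(A <- [seq x <- S | x \in S']) Wp A * B A.
  apply: perm_big; apply: uniq_perm; rewrite ?filter_uniq // => A.
  by rewrite [LHS]mem_filter [RHS]mem_filter andbC.
by rewrite lerDl sumr_ge0.
Qed.

Lemma ball_ex (D : freq) : exists N0, forall N, (N0 <= N)%N -> D \in ball N.
Proof.
have s0 := @sqnorm_ge0 R D; exists (Num.bound (sqnorm D : R)) => N hN; rewrite mem_ball.
have h := archi_boundP s0; have hN' : (Num.bound (sqnorm D : R))%:R <= N%:R :> R by rewrite ler_nat.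
have h2 : N%:R <= N%:R ^+ 2 :> R by rewrite -natrX ler_nat; case: (N) => // n; rewrite -mulnn leq_pmulr.
exact: le_trans (le_trans (ltW h) hN') h2.
Qed.

Lemma ball_sumN N (h : freq -> R[i]) : \sum_(D <- ball N) h (- D) = \sum_(D <- ball N) h D.
Proof.
rewrite -(big_map -%R xpredT h); apply: perm_big; apply: uniq_perm.
- by rewrite map_inj_uniq ?uniq_ball //; exact: oppr_inj.
- exact: uniq_ball.
move=> A; rewrite -[in RHS](opprK A) ballN; apply/mapP/idP => [[B hB ->]|hA]; first by rewrite opprK.
by exists (- A); rewrite ?opprK // ballN // -ballN.
Qed.

End FiniteSupport.

(** * Duality for the Duhamel integral *)

Section DuhamelBound.
Context {R : realType}.
Local Notation mu := (@lebesgue_measure R).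
Local Notation DT T := (`[0, T[%classic : set R).
Local Notation ball := (@ball R).

Lemma conj_real (x : R) : (x%:C)^*%C = x%:C.
Proof. by apply: Ceq; rewrite ?Cre_conj ?Cim_conj ?Cre_real ?Cim_real ?oppr0. Qed.

Lemma conjM (z w : R[i]) : (z * w)^*%C = z^*%C * w^*%C.
Proof. exact: rmorphM. Qed.

(** This is [z / |z|], with value 0 at 0 since the inverse of 0 is 0. *)
Definition phase (z : R[i]) : R[i] := z * ((normc z)^-1)%:C.

Lemma phase_le z : normc (phase z) <= 1.
Proof.
rewrite /phase normcM normc_real ger0_norm ?invr_ge0 ?normc_ge0 //.
by have [->|z0] := eqVneq (normc z) 0; rewrite ?mul0r ?divff ?ler01.
Qed.

Lemma phaseM z : (phase z)^*%C * z = (normc z)%:C.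
Proof.
have zz : z^*%C * z = (normc z ^+ 2)%:C.
  by apply: Ceq; rewrite sqr_normc ?CreM ?CimM ?Cre_conj ?Cim_conj ?Cre_real ?Cim_real; ring.
have -> : (phase z)^*%C = z^*%C * ((normc z)^-1)%:C by rewrite /phase rmorphM; congr (_ * _); exact: conj_real.
rewrite mulrAC zz -rmorphM /=; congr (_%:C).
by have [->|z0] := eqVneq (normc z) 0; rewrite ?expr0n ?mul0r // expr2 mulfK.
Qed.

Lemma seq_max (P : freq -> nat -> Prop) (S : seq freq) :
  (forall D, exists N0, forall N, (N0 <= N)%N -> P D N) -> exists N, forall D, D \in S -> P D N.
Proof.
move=> h; have [f hf] := choice h; exists (\max_(D <- S) f D)%N => D DS; apply: hf.
by apply: (leq_bigmax_seq D).
Qed.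

Lemma sum_subset (S S' : seq freq) (h : freq -> R[i]) : uniq S -> uniq S' -> {subset S <= S'} ->
  (forall D, D \notin S -> h D = 0) -> \sum_(D <- S') h D = \sum_(D <- S) h D.
Proof.
move=> uS uS' sub h0; rewrite (bigID (fun D => D \in S)) /= [X in _ + X]big1 ?addr0; last first.
  by move=> A /h0.
rewrite -[LHS]big_filter; apply: perm_big; apply: uniq_perm; rewrite ?filter_uniq // => A.
by rewrite [LHS]mem_filter; apply/andP/idP => [[]//|hA]; split=> //; exact: sub.
Qed.

Lemma cintB T (f g : R -> R[i]) : cbm (DT T) f -> cbm (DT T) g ->
  cintegral mu (DT T) (fun s => f s - g s) = cintegral mu (DT T) f - cintegral mu (DT T) g.
Proof.
move=> bf bg; have mD : measurable (DT T) := measurable_itv _; have fD := lebesgue_itv_finite 0 T.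
have bN : cbm (DT T) (fun s => -1 * g s) by apply: cbmM => //; exact: cbm_cst.
rewrite -[X in _ = _ + X]mulN1r -(cintZ (m := mu) mD fD (-1) bg) -(cintD (m := mu) mD fD bf bN).
by apply: cint_eq => s _; rewrite mulN1r.
Qed.

Lemma ucutZ T (c : R[i]) f x : cbm (DT T) f -> ucut T (fun s => c * f s) x = c * ucut T f x.
Proof.
move=> bf; have mD : measurable (DT T) := measurable_itv _; have fD := lebesgue_itv_finite 0 T.
rewrite /ucut -(cintZ (m := mu) mD fD c (ind_cbm x mD bf)).
by apply: cint_eq => s _; rewrite mulrCA.
Qed.

Lemma stepf_cbm T J t (c : nat -> R[i]) : cbm (DT T) (stepf J t c).
Proof.
have mD : measurable (DT T) := measurable_itv _.
apply: cbm_sum => k _.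
apply: (cbmM (F := fun _ => c k) (G := fun s => (ind (t k.+1) s - ind (t k) s)%:C)); first exact: cbm_cst.
have h : bm (DT T) (fun s => ind (t k.+1) s - ind (t k) s) by apply: bmB; exact: ind_bm.
by split; [exact: h|exact: bm_cst].
Qed.

Lemma cbm_profile T u (B : freq -> R) : (forall A, wvar T (B A) (fun t => profile u t A)) ->
  forall A, cbm (DT T) (fun t => u t A).
Proof.
move=> wu A; apply: cbm_eq (cbm_free (v := profile u) (fun A => wvar_cbm (wu A)) A) => t _.
by rewrite free_profile.
Qed.

Lemma cbm_trip T s (f1 f2 f3 : R -> freq -> R[i]) D :
  (forall A, cbm (DT T) (fun x => f1 x A)) -> (forall A, cbm (DT T) (fun x => f2 x A)) ->
  (forall A, cbm (DT T) (fun x => f3 x A)) -> cbm (DT T) (fun t => trip s (f1 t) (f2 t) (f3 t) D).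
Proof.
move=> b1 b2 b3; apply: cbm_sum => A _; apply: cbm_sum => B _; apply: cbm_sum => C _.
by apply: cbmM; [exact: cbmM|].
Qed.

Context (T a : R) (u1 u2 u3 : R -> freq -> R[i]) (B1 B2 B3 : freq -> R) (n1 n2 n3 K : R).
Context (T01 : 0 < T <= 1) (aT : 0 <= a < T).
Context (y1 : ybnd Wm B1 n1) (y2 : ybnd Wp B2 n2) (y3 : ybnd Wp B3 n3).
Context (w1 : forall A, wvar T (B1 A) (fun t => profile u1 t A)).
Context (w2 : forall A, wvar T (B2 A) (fun t => profile u2 t A)).
Context (w3 : forall A, wvar T (B3 A) (fun t => profile u3 t A)).
Context (K0 : 0 <= K).
Context (hK : forall N v B n, ybnd Wp B n -> (forall A, wvar T (B A) (fun t => v t A)) ->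
  normc (Lam T (ball N) true u1 u2 u3 (fun t => free (v t) t)) <= K * n).

Let mD : measurable (DT T) := measurable_itv _.
Let fD := lebesgue_itv_finite 0 T.

(** The coefficient at [D] of [e^(- i s Delta)] applied to the truncated product. Its primitive
    [Phi] is, up to a constant, the profile of the truncated Duhamel integral. *)
Definition dens N D s : R[i] := expi (s * sqnorm D) * trip (ball N) (u1 s) (u2 s) (u3 s) D.
Definition Phi N D x : R[i] := ucut T (dens N D) x.

Lemma dens_cbm N D : cbm (DT T) (dens N D).
Proof.
apply: cbmM; first exact: expi_bm.
by apply: cbm_trip; [exact: cbm_profile w1|exact: cbm_profile w2|exact: cbm_profile w3].
Qed.

Lemma duhamel_Phi N t D : 0 <= t < T ->
  duhamel3_N a u1 u2 u3 t D N = expi (- (t * sqnorm D)) * (Phi N D t - Phi N D a).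
Proof.
move=> tT; rewrite /duhamel3_N /duhamel.
transitivity (cintegral_between a t (fun s => expi (- (t * sqnorm D)) * dens N D s)).
  congr cintegral_between; apply/funext => s; rewrite fourier_trip /dens mulrA -expiD; congr (expi _ * _).
  by ring.
rewrite (cintegral_betweenE aT tT); last by apply: cbmM; [exact: cbm_cst|exact: dens_cbm].
by rewrite !ucutZ ?mulrBr //; exact: dens_cbm.
Qed.

Lemma Lam_pair N v : (forall A, cbm (DT T) (fun t => v t A)) ->
  Lam T (ball N) true u1 u2 u3 (fun t => free (v t) t) =
  \sum_(D <- ball N) cintegral mu (DT T) (fun s => (v s D)^*%C * dens N D s).
Proof.
move=> bv; rewrite /Lam.
have bF D : xpredT D -> cbm (DT T) (fun s => (v s D)^*%C * dens N D s).
  by move=> _; apply: cbmM; [exact: (cbm_conj (bv D))|exact: dens_cbm].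
rewrite -(cint_sum (m := mu) mD fD (ball N) bF).
apply: cint_eq => s _; rewrite quad_trip.
rewrite -(ball_sumN N (fun D => (v s D)^*%C * dens N D s)); apply: eq_bigr => D _.
by rewrite /sg /refl /free /dens conjM conj_expi opprK; ring.
Qed.

Lemma Lam_step N (J : freq -> nat) (t : freq -> nat -> R) (c : freq -> nat -> R[i]) :
  Lam T (ball N) true u1 u2 u3 (fun s => free (fun D => stepf (J D) (t D) (c D) s) s) =
  \sum_(D <- ball N) \sum_(k < J D) (c D k)^*%C * (Phi N D (t D k.+1) - Phi N D (t D k)).
Proof.
rewrite (@Lam_pair N (fun s D => stepf (J D) (t D) (c D) s)); last by move=> D; exact: stepf_cbm.
apply: eq_bigr => D _.
have bi x : cbm (DT T) (fun s => (ind x s)%:C * dens N D s) by exact: ind_cbm mD (dens_cbm N D).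
have bd (k : nat) : cbm (DT T) (fun s => (ind (t D k.+1) s)%:C * dens N D s - (ind (t D k) s)%:C * dens N D s).
  apply: cbm_eq (_ : cbm (DT T) (fun s => (ind (t D k.+1) s)%:C * dens N D s + -1 * ((ind (t D k) s)%:C * dens N D s))).
    by move=> s _; rewrite mulN1r.
  by apply: cbmD => //; apply: cbmM; [exact: cbm_cst|].
transitivity (cintegral mu (DT T) (fun s => \sum_(k < J D) (c D k)^*%C *
    ((ind (t D k.+1) s)%:C * dens N D s - (ind (t D k) s)%:C * dens N D s))).
  apply: cint_eq => s _; rewrite /stepf rmorph_sum mulr_suml; apply: eq_bigr => k _.
  rewrite rmorphM -mulrA; congr (_ * _); rewrite -mulrBl -rmorphB; congr (_ * _).
  by apply: Ceq; rewrite ?Cre_conj ?Cim_conj ?Cre_real ?Cim_real ?oppr0.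
have bF (k : 'I_(J D)) : xpredT k -> cbm (DT T) (fun s => (c D k)^*%C *
    ((ind (t D k.+1) s)%:C * dens N D s - (ind (t D k) s)%:C * dens N D s)).
  by move=> _; apply: cbmM; [exact: cbm_cst|exact: bd].
rewrite (cint_sum (m := mu) mD fD (index_enum _) bF).
by apply: eq_bigr => k _; rewrite (cintZ (m := mu) mD fD _ (bd k)) cintB.
Qed.

(** An increment of [Phi] is the pairing with the indicator of [[x, y)] at the single frequency [D].
    All these test functions share one variation bound, so the [N0] of [Lam_cauchy] serves all [x]
    and [y]. *)
Lemma Phi_cauchy D (e : R) : 0 < e -> exists N0, forall N, (N0 <= N)%N -> forall x y, 0 <= x < T -> 0 <= y < T ->
  normc ((Phi N D y - Phi N D x) - (Phi N0 D y - Phi N0 D x)) <= e.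
Proof.
move=> e0; pose b A : R := (A == D)%:R.
have yb := @ybnd_finite R [:: D] (fun A => 16 * b A ^+ 2 * crt 1 ^+ 2) isT.
have {}yb : ybnd Wp (fun A => 16 * b A ^+ 2 * crt 1 ^+ 2) _ := yb
  (fun A => mulr_ge0 (mulr_ge0 (ltac:(by []) : 0 <= 16) (sqr_ge0 _)) (sqr_ge0 _))
  (fun A => ltac:(by rewrite inE /b => /negbTE ->; rewrite expr0n mulr0 mul0r)).
have [N1 h1] := Lam_cauchy T01 y1 y2 y3 yb e0; have [N2 h2] := @ball_ex R D.
exists (maxn N1 N2) => N NN.
have key x y : 0 <= x -> x < y -> y < T ->
    normc ((Phi N D y - Phi N D x) - (Phi (maxn N1 N2) D y - Phi (maxn N1 N2) D x)) <= e.
  move=> x0 xy yT; pose t (k : nat) := if k is 0%N then x else y.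
  pose c A (k : nat) : R[i] := (b A)%:C.
  have cE A k : (c A k)^*%C = (b A)%:C by exact: conj_real.
  have bD : (b D)%:C = 1 :> R[i] by rewrite /b eqxx.
  have bA A : A != D -> (b A)%:C = 0 :> R[i] by rewrite /b => /negbTE ->.
  pose v s A := stepf 1 t (c A) s.
  have ch : chain T (fun _ _ => True) 1 t.
    split=> [[|k] _ /=|[|k] //]; first by rewrite x0 (lt_trans xy).
    by rewrite (le_trans x0 (ltW xy)).
  have b0 A : 0 <= b A by rewrite /b.
  have wv A : wvar T (16 * b A ^+ 2 * crt 1 ^+ 2) (fun s => v s A).
    by apply: stepf_wvar => // k _; rewrite normc_real ger0_norm.
  have Lv M : D \in ball M -> Lam T (ball M) true (fun t => free (profile u1 t) t) (fun t => free (profile u2 t) t)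
      (fun t => free (profile u3 t) t) (fun t => free (v t) t) = Phi M D y - Phi M D x.
    move=> DM; have fp u : (fun t => free (profile u t) t) = u by apply/funext => s; exact: free_profile.
    rewrite !fp (Lam_step M (fun _ => 1%N) (fun _ => t) c) (sum_subset (S := [:: D])) ?uniq_ball // => [|A|A].
    - by rewrite big_seq1 big_ord1 ?cE ?conj_real bD mul1r.
    - by rewrite inE => /eqP ->.
    - by rewrite inE big_ord1 => AD; rewrite ?cE ?conj_real (bA A AD) mul0r.
  rewrite -!Lv; [|by apply: h2; rewrite leq_maxr|by apply: h2; apply: leq_trans NN; rewrite leq_maxr].
  by apply: h1 => //; rewrite leq_maxl NN.
move=> x y /andP[x0 xT] /andP[y0_ yT].
have [xy|yx|->] := ltgtP x y; first exact: key; last by rewrite !subrr normc0 ltW.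
rewrite -normcN; set z := - _; have -> : z = (Phi N D x - Phi N D y) - (Phi (maxn N1 N2) D x - Phi (maxn N1 N2) D y).
  by rewrite /z; ring.
exact: key.
Qed.

Definition uniform_lim D (F : R -> R[i]) : Prop := forall e : R, 0 < e -> exists N0, forall N, (N0 <= N)%N ->
  forall x, 0 <= x < T -> normc (Phi N D x - Phi N D a - F x) <= e.

Lemma Phi_lim D : exists F, uniform_lim D F.
Proof.
have pt x : exists l : R[i], 0 <= x < T -> forall e : R, 0 < e -> exists N, forall n, (N <= n)%N ->
    normc (Phi n D x - Phi n D a - l) <= e.
  have [xT|xT] := boolP (0 <= x < T); last by exists 0.
  have [l hl] := @complex_cauchy R (fun n => Phi n D x - Phi n D a)
    (fun e e0 => let: ex_intro N hN := Phi_cauchy D e0 in ex_intro _ N (fun n hn => hN n hn a x aT xT)).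
  by exists l.
have [F hF] := choice pt; exists F => e e0; have e3 : 0 < e / 3 by rewrite divr_gt0.
have [N0 h0] := Phi_cauchy D e3; exists N0 => N NN x xT.
have [M hM] := hF x xT _ e3; pose M' := maxn M N0.
have h1 := h0 N NN a x aT xT; have h2 := h0 M' (leq_maxr _ _) a x aT xT; have h3 := hM M' (leq_maxl _ _).
have -> : Phi N D x - Phi N D a - F x = (Phi N D x - Phi N D a - (Phi N0 D x - Phi N0 D a)) +
  - (Phi M' D x - Phi M' D a - (Phi N0 D x - Phi N0 D a)) + (Phi M' D x - Phi M' D a - F x) by ring.
apply: le_trans (normcD _ _) _; apply: le_trans (lerD (normcD _ _) (lexx _)) _; rewrite normcN.
by move: h1 h2 h3; lra.
Qed.

Lemma duhamel_lim D F t : uniform_lim D F -> 0 <= t < T ->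
  (duhamel3_N a u1 u2 u3 t D) @ \oo --> (expi (- (t * sqnorm D)) * F t : R[i]^o).
Proof.
move=> hF tT; apply: cvgc => e e0; have [N0 h0] := hF e e0; exists N0 => N NN.
by rewrite duhamel_Phi // -mulrBr normcM normc_expi mul1r; exact: h0.
Qed.

Lemma profile_duhamel3 D F t : uniform_lim D F -> 0 <= t < T ->
  profile (duhamel3 a u1 u2 u3) t D = F t.
Proof.
move=> hF tT; rewrite /profile /duhamel3 (cvg_lim (@norm_hausdorff _ _) (duhamel_lim hF tT)).
by rewrite mulrA expi_add_opp mul1r.
Qed.

(** A uniform limit of Lipschitz functions is continuous; this is what the stopping times need. *)
Lemma lim_right_cont D F : uniform_lim D F -> right_cont T F.
Proof.
move=> hF x /andP[x0 xT] e e0; have e3 : 0 < e / 3 by rewrite divr_gt0.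
have [N h] := hF _ e3; have {}h := h N (leqnn N).
have [M M0 hM] := ucut_lip (dens_cbm N D).
have M1 : 0 < M + 1 by rewrite ltr_wpDl.
exists (e / 3 / (M + 1)); first by rewrite divr_gt0.
move=> y /andP[xy yd] yT; have y0_ := le_trans x0 xy.
have h1 := h y; rewrite y0_ yT in h1; have {}h1 := h1 isT.
have h2 := h x; rewrite x0 xT in h2; have {}h2 := h2 isT.
have h3 := hM x y x0 xy yT; rewrite -/(Phi N D y) -/(Phi N D x) in h3.
have h4 : M * (y - x) <= e / 3.
  apply: (@le_trans _ _ ((M + 1) * (y - x))).
    by rewrite ler_wpM2r ?subr_ge0 // lerDl.
  by rewrite mulrC -ler_pdivlMr // ltW // ltrBlDl.
have -> : F y - F x = - (Phi N D y - Phi N D a - F y) + (Phi N D x - Phi N D a - F x) + (Phi N D y - Phi N D x) by ring.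
apply: le_trans (normcD _ _) _; apply: le_trans (lerD (normcD _ _) (lexx _)) _; rewrite normcN.
by move: h1 h2 h3 h4; lra.
Qed.

(** The variation along a chain, normalized by the growth [J^(1/3)] that [U2_of_chains] admits. *)
Definition varq (G : R -> R[i]) J (t : nat -> R) : R :=
  (\sum_(k < J) normc (G (t k.+1) - G (t k))) / crt J.

(* Duality: the test function is a step function for each frequency, with jumps at
   the points of the chain and the phases of the increments. *)
Lemma var_sum (F : freq -> R -> R[i]) (J : freq -> nat) (t : freq -> nat -> R) (S : seq freq) :
  uniq S -> (forall D, uniform_lim D (F D)) ->
  (forall D, (0 < J D)%N) -> (forall D, chain T (fun _ _ => True) (J D) (t D)) ->
  \sum_(D <- S) Wm D * varq (F D) (J D) (t D) ^+ 2 <= 16 * K ^+ 2.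
Proof.
move=> uS hF J0 ct; set X := \sum_(D <- S) _.
pose dF D k := F D (t D k.+1) - F D (t D k).
pose V D := \sum_(k < J D) normc (dF D k).
pose q D : R := crt (J D).
have q0 D : 0 < q D by exact: (lt_le_trans ltr01 (@crt_ge1 R _ (J0 D))).
have V0 D : 0 <= V D by apply: sumr_ge0 => k _; exact: normc_ge0.
have vE D : varq (F D) (J D) (t D) = V D / q D by [].
(* With steps of this height the limiting pairing equals [X], while the square of the weighted bound
   for the test function is [16 X]. Hence [X <= 4 K sqrt X]. *)
pose b D := if D \in S then Wm D * V D / q D ^+ 2 else 0.
have b0 D : 0 <= b D.
  by rewrite /b; case: ifP => // _; rewrite divr_ge0 ?sqr_ge0 // mulr_ge0 // ltW // Wm_gt0.
pose c D (k : nat) := (b D)%:C * phase (dF D k).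
have cb D k : normc (c D k) <= b D.
  by rewrite /c normcM normc_real ger0_norm // ler_piMr // phase_le.
have c0 D k : D \notin S -> c D k = 0 by rewrite /c /b => /negbTE ->; rewrite mul0r.
pose B D := 16 * b D ^+ 2 * crt (J D) ^+ 2.
have BE D : B D = 16 * b D ^+ 2 * q D ^+ 2 by [].
have B0 D : 0 <= B D by rewrite /B; apply: mulr_ge0; [apply: mulr_ge0 => //|]; exact: sqr_ge0.
have BS D : D \notin S -> B D = 0 by rewrite /B /b => /negbTE ->; rewrite expr0n mulr0 mul0r.
have yb := ybnd_finite uS B0 BS.
have X0 : 0 <= X by apply: sumr_ge0 => D _; rewrite mulr_ge0 ?sqr_ge0 // ltW // Wm_gt0.
have BX : \sum_(D <- S) Wp D * B D = 16 * X.
  rewrite /X mulr_sumr big_seq [RHS]big_seq; apply: eq_bigr => D DS; rewrite BE /b DS vE /Wm -/(Wp D).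
  have := q0 D; have := @Wp_gt0 R D; move: (Wp D) (q D) (V D) => w z v w0 z0.
  have w1_ : w != 0 by rewrite gt_eqF.
  have z1 : z != 0 by rewrite gt_eqF.
  field; rewrite ?w1_ ?z1 //.
have n4E : Num.sqrt (\sum_(D <- S) Wp D * B D) = 4 * Num.sqrt X.
  rewrite BX (_ : 16 = 4 ^+ 2); last by ring.
  by rewrite sqrtrM ?sqr_ge0 // sqrtr_sqr ger0_norm.
have XE : X%:C = \sum_(D <- S) \sum_(k < J D) (c D k)^*%C * dF D k.
  rewrite /X rmorph_sum big_seq [RHS]big_seq; apply: eq_bigr => D DS.
  transitivity ((b D * V D)%:C).
    congr (_%:C); rewrite /b DS vE; have := q0 D; move: (q D) => z z0.
    by field; rewrite gt_eqF.
  rewrite /V mulr_sumr rmorph_sum; apply: eq_bigr => k _.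
  by rewrite /c conjM conj_real -mulrA phaseM -rmorphM.
suff le : X <= K * (4 * Num.sqrt X).
  have s0 := sqrtr_ge0 X; have sX := sqr_sqrtr X0; rewrite -sX; rewrite -{1}sX in le.
  have [s1|s1] := eqVneq (Num.sqrt X) 0; first by rewrite s1 expr0n mulr_ge0 // sqr_ge0.
  have sp : 0 < Num.sqrt X by rewrite lt_neqAle eq_sym s1.
  have s4 : Num.sqrt X <= 4 * K.
    by rewrite -(ler_pM2r sp) -expr2; apply: le_trans le _; rewrite mulrA [K * 4]mulrC.
  have -> : 16 * K ^+ 2 = (4 * K) ^+ 2 by ring.
  by rewrite lerXn2r ?nnegrE // mulr_ge0.
pose L := \sum_(D <- S) \sum_(k < J D) b D * 2.
have L0 : 0 <= L by apply: sumr_ge0 => D _; apply: sumr_ge0 => k _; rewrite mulr_ge0.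
(* The pairing is bounded at each truncation [N]; passing from [Phi N] to the limit [F] on the
   finite set [S] costs at most [L e <= d]. *)
apply/ler_addgt0Pr => d d0; pose e := d / (L + 1).
have L1 : 0 < L + 1 by rewrite ltr_wpDl.
have e0 : 0 < e by rewrite divr_gt0.
have ex D : exists N0, forall N, (N0 <= N)%N -> D \in ball N /\ (forall x : R, 0 <= x < T ->
    normc (Phi N D x - Phi N D a - F D x) <= e).
  have [N1 h1] := @ball_ex R D; have [N2 h2] := hF D e e0; exists (maxn N1 N2) => N.
  by rewrite geq_max => /andP[l1 l2]; split; [exact: h1|exact: h2].
have [N hN] := seq_max S ex.
have LE := Lam_step N J t c.
have hL := hK N yb (fun A => stepf_wvar (b0 A) (J0 A) (ct A) (fun k _ => cb A k)).
rewrite n4E in hL; rewrite LE in hL.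
have rE : \sum_(D <- ball N) \sum_(k < J D) (c D k)^*%C * (Phi N D (t D k.+1) - Phi N D (t D k)) =
  \sum_(D <- S) \sum_(k < J D) (c D k)^*%C * (Phi N D (t D k.+1) - Phi N D (t D k)).
  apply: sum_subset => //; first exact: uniq_ball.
    by move=> D /hN[].
  by move=> D DS; rewrite big1 // => k _; rewrite c0 // conjc0 mul0r.
rewrite rE in hL.
rewrite -[leLHS]ger0_norm // -normc_real.
have dl : normc (X%:C - \sum_(D <- S) \sum_(k < J D) (c D k)^*%C * (Phi N D (t D k.+1) - Phi N D (t D k))) <= d.
  rewrite XE -sumrB; apply: le_trans (normc_sum _ _ _) _.
  apply: (@le_trans _ _ (L * e)); last first.
    by rewrite /e mulrCA ler_piMr ?(ltW d0) // ler_pdivrMr // mul1r lerDl.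
  rewrite /L mulr_suml big_seq [leRHS]big_seq; apply: ler_sum => D DS; have [_ hD] := hN D DS.
  rewrite -sumrB mulr_suml; apply: le_trans (normc_sum _ _ _) _; apply: ler_sum => k _.
  rewrite -mulrBr normcM normc_conj -mulrA; apply: ler_pM; rewrite ?normc_ge0 //.
  have tk (i : nat) : (i <= J D)%N -> 0 <= t D i < T by exact: (ct D).1.
  have h1 := hD _ (tk k.+1 (ltn_ord k)); have h2 := hD _ (tk k (ltnW (ltn_ord k))).
  have -> : dF D k - (Phi N D (t D k.+1) - Phi N D (t D k)) =
    - (Phi N D (t D k.+1) - Phi N D a - F D (t D k.+1)) + (Phi N D (t D k) - Phi N D a - F D (t D k)).
    by rewrite /dF; ring.
  by apply: le_trans (normcD _ _) _; rewrite normcN; move: h1 h2; lra.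
set Y := \sum_(D <- S) _ in hL dl.
have -> : X%:C = Y + (X%:C - Y) by ring.
apply: le_trans (normcD _ _) _; exact: lerD.
Qed.

Lemma crt1 : crt 1 = 1 :> R. Proof. by rewrite /crt powR1. Qed.

Lemma U2_restr_ge0 (v : R -> R[i]) : (0 <= U2_restr T v)%E.
Proof.
apply: le_ereal_inf_tmp => _ [w _ <-]; apply: le_ereal_inf_tmp => _ [l _ <-].
by apply: nneseries_ge0 => n _ _; rewrite lee_fin normc_ge0.
Qed.

(** For each frequency [b D] is the supremum of the normalized variations. A chain attaining at
    least half of it is chosen for every [D], and [var_sum] is applied to all these chains at once,
    so the supremum stands inside the sum over frequencies. The constant is 128 from [U2_of_chains],
    times 2 for the half, times 4 from [var_sum]. *)
Lemma duhamel_bound :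
  (forall t D, 0 <= t < T -> cvgn (duhamel3_N a u1 u2 u3 t D)) /\
  (X_norm (-1) T (duhamel3 a u1 u2 u3) <= (8 * 128 * K)%:E)%E.
Proof.
split=> [t D tT|]; first by have [F hF] := Phi_lim D; exact: (cvgP _ (duhamel_lim hF tT)).
have [T0 _] := andP T01; have [a0 a1] := andP aT.
have [F [hF FE]] : exists F : freq -> R -> R[i], (forall D, uniform_lim D (F D)) /\
    forall D, (fun t => profile (duhamel3 a u1 u2 u3) t D) = F D.
  exists (fun D t => profile (duhamel3 a u1 u2 u3) t D); split=> // D.
  have [G hG] := Phi_lim D; move=> e e0; have [N0 h0] := hG e e0; exists N0 => N NN x xT.
  by rewrite (profile_duhamel3 hG xT); exact: h0.
have Fa D : F D a = 0.
  apply/eqP; rewrite -normc_eq0 eq_le normc_ge0 andbT; apply/ler_addgt0Pr => e e0; rewrite add0r.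
  by have [N h] := hF D e e0; have := h N (leqnn N) a aT; rewrite subrr sub0r normcN.
pose E D := [set y | exists p : nat * (nat -> R), [/\ (0 < p.1)%N, chain T (fun _ _ => True) p.1 p.2 &
  y = varq (F D) p.1 p.2]].
have vq0 D J t : 0 <= varq (F D) J t.
  by rewrite divr_ge0 ?crt_ge0 // sumr_ge0 // => k _; exact: normc_ge0.
pose pair (x y : R) (k : nat) := if k is 0%N then x else y.
have pairc x y : 0 <= x -> x < y -> y < T -> chain T (fun _ _ => True) 1 (pair x y).
  move=> x0 xy yT; split=> [[|k] _ /=|[|k] //]; first by rewrite x0 (lt_trans xy).
  by rewrite (le_trans x0 (ltW xy)).
have E1 D : E D (varq (F D) 1 (pair 0 (T / 2))).
  exists (1%N, pair 0 (T / 2)); split=> //=; apply: pairc => //; first by rewrite divr_gt0.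
  by rewrite ltr_pdivrMr //; lra.
(* A crude bound at a single frequency, by [z <= 1 + z^2], which makes the supremum finite. *)
have Eub D : ubound (E D) (1 + 16 * K ^+ 2 * Wp D).
  move=> y [[J t] [/= J0 ct ->]].
  have := @var_sum F (fun _ => J) (fun _ => t) [:: D] isT hF (fun _ => J0) (fun _ => ct).
  rewrite big_seq1; set z := varq _ _ _ => hz.
  have hz2 : z ^+ 2 <= 16 * K ^+ 2 * Wp D.
    by rewrite -ler_pdivrMr ?Wp_gt0 // mulrC.
  apply: le_trans (lerD (lexx 1) hz2).
  have := sqr_ge0 (z - 1); have -> : (z - 1) ^+ 2 = z ^+ 2 - 2 * z + 1 by ring.
  by have := vq0 D J t; rewrite -/z; have := sqr_ge0 z; lra.
have Es D : has_sup (E D) by split; [eexists; exact: E1|eexists; exact: Eub].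
pose b D := sup (E D).
have Eb D y : E D y -> y <= b D by move=> Ey; apply: sup_upper_bound => //; exact: Es.
have b0 D : 0 <= b D by apply: le_trans (Eb _ _ (E1 D)); exact: vq0.
have ex D : exists p : nat * (nat -> R), [/\ (0 < p.1)%N, chain T (fun _ _ => True) p.1 p.2 &
    b D / 2 <= varq (F D) p.1 p.2].
  have [bp|bn] := ltP 0 (b D).
    have b2 : 0 < b D / 2 by rewrite divr_gt0.
    have [y [p [p0 pc ->]] hy] := sup_adherent b2 (Es D).
    by exists p; split=> //; move: hy; rewrite -/(b D); lra.
  have [p [p0 pc _]] := E1 D; exists p; split=> //; apply: le_trans (vq0 D p.1 p.2).
  by move: bn; lra.
have [p hp] := choice ex.
have U2b D : (U2_restr T (F D) <= (128 * b D)%:E)%E.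
  have Fd x y : 0 <= x -> x < y -> y < T -> normc (F D y - F D x) <= b D.
    move=> x0 xy yT; have /Eb : E D (varq (F D) 1 (pair x y)).
      by exists (1%N, pair x y); split=> //=; exact: pairc.
    by rewrite /varq big_ord1 crt1 divr1.
  apply: U2_of_chains => //; first exact: lim_right_cont (hF D).
    move=> x /andP[x0 xT]; have [xa|ax|->] := ltgtP x a; last by rewrite Fa normc0.
      by have := Fd x a x0 xa a1; rewrite Fa sub0r normcN.
    by have := Fd a x a0 ax xT; rewrite Fa subr0.
  move=> [|n] t ct; first by rewrite big_ord0 mulr_ge0 // crt_ge0.
  have c0 : 0 < crt n.+1 :> R by exact: (lt_le_trans ltr01 (@crt_ge1 R _ (ltn0Sn n))).
  by rewrite -ler_pdivrMr //; apply: Eb; exists (n.+1, t).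
apply: weighted_l2_le; first by rewrite mulr_ge0.
  by move=> A; exact: U2_restr_ge0.
set kap : R := 128 in U2b *; have k0 : 0 <= kap by []; clearbody kap.
move=> S uS; apply: (@le_trans _ _ (\sum_(A <- S) (Wm A * (kap * b A) ^+ 2)%:E)%E).
  apply: lee_sum => A _; rewrite FE japaneseN2 -/(Wm A) EFinM; apply: lee_pmul; rewrite ?lee_fin ?(ltW (Wm_gt0 _)) //.
    by rewrite expe_ge0 // U2_restr_ge0.
  by rewrite EFin_expe !expe2; apply: lee_pmul; rewrite ?U2_restr_ge0 //; exact: U2b.
rewrite sumEFin lee_fin.
have := @var_sum F (fun D => (p D).1) (fun D => (p D).2) S uS hF
  (fun D => let: And3 h _ _ := hp D in h) (fun D => let: And3 _ h _ := hp D in h).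
set X := \sum_(D <- S) _ => hX.
have h : \sum_(A <- S) Wm A * (kap * b A) ^+ 2 <= (2 * kap) ^+ 2 * X.
  rewrite mulr_sumr; apply: ler_sum => A _; have [_ _ h] := hp A; have bA := b0 A.
  rewrite [leRHS]mulrCA -exprMn; apply: ler_wpM2l; first exact/ltW/Wm_gt0.
  have key : kap * b A <= 2 * kap * varq (F A) (p A).1 (p A).2.
    by rewrite [2 * kap]mulrC -mulrA; apply: ler_wpM2l => //; move: h; move: (varq _ _ _) => z; lra.
  have l0 : 0 <= kap * b A by rewrite mulr_ge0.
  by rewrite ler_pXn2r // nnegrE //; exact: le_trans l0 key.
apply: le_trans h _; have -> : (8 * kap * K) ^+ 2 = (2 * kap) ^+ 2 * (16 * K ^+ 2) by ring.
by apply: ler_wpM2l => //; exact: sqr_ge0.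
Qed.

End DuhamelBound.

(** * The estimates *)

Section Final.
Context {R : realType}.
Local Notation mu := (@lebesgue_measure R).
Local Notation DT T := (`[0, T[%classic : set R).
Local Notation ball := (@ball R).
Implicit Types (u : R -> freq -> R[i]).

Definition has_bound (W : freq -> R) T u (n : R) : Prop :=
  exists B, ybnd W B n /\ forall A, wvar T (B A) (fun t => profile u t A).

Lemma has_bound_p (b : bool) T u f : (b -> is_free_on T u f) -> (size_norm b 1 T u f < +oo)%E ->
  has_bound Wp T u (fine (size_norm b 1 T u f)).
Proof.
move=> fr fn; have [B [B0 wB hB]] := size_norm_ybound fr fn; exists B; split=> //; split=> //.
  by rewrite fine_ge0 // size_norm_ge0.
move=> S uS; apply: le_trans (hB S uS); rewrite le_eqVlt; apply/orP; left; apply/eqP.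
by apply: eq_bigr => A _; rewrite japanese2.
Qed.

Lemma has_bound_m (b : bool) T u f : (b -> is_free_on T u f) -> (size_norm b (-1) T u f < +oo)%E ->
  has_bound Wm T u (fine (size_norm b (-1) T u f)).
Proof.
move=> fr fn; have [B [B0 wB hB]] := size_norm_ybound fr fn; exists B; split=> //; split=> //.
  by rewrite fine_ge0 // size_norm_ge0.
move=> S uS; apply: le_trans (hB S uS); rewrite le_eqVlt; apply/orP; left; apply/eqP.
by apply: eq_bigr => A _; rewrite japaneseN2.
Qed.

Lemma has_bound_ge0 W T u n : has_bound W T u n -> 0 <= n.
Proof. by move=> [B [[]]]. Qed.

Lemma has_bound_cbm W T u n : has_bound W T u n -> forall A, cbm (DT T) (fun t => u t A).
Proof. by move=> [B [_ w]]; exact: cbm_profile w. Qed.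

Lemma free_profileE u : (fun t => free (profile u t) t) = u.
Proof. by apply/funext => t; exact: free_profile. Qed.

(** The truncated integrals are Cauchy by [Lam_cauchy], so the bound passes to the limit; [(2 pi)^4]
    is the volume of the torus. *)
Lemma quad_integral_le T u1 u2 u3 u4 n1 n2 n3 n4 (c : R) : 0 < T <= 1 ->
  has_bound Wm T u1 n1 -> has_bound Wp T u2 n2 -> has_bound Wp T u3 n3 -> has_bound Wp T u4 n4 ->
  (forall N, normc (Lam T (ball N) false u1 u2 u3 u4) <= c) ->
  cvgn (quad_integral_N T u1 u2 u3 u4) /\ normc (quad_integral T u1 u2 u3 u4) <= (2 * pi) ^+ 4 * c.
Proof.
move=> T01 h1 h2 h3 h4 hc; pose p : R := (2 * pi) ^+ 4.
have p0 : 0 < p by rewrite exprn_gt0 // pi2_gt0.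
have QE N : quad_integral_N T u1 u2 u3 u4 N = p%:C * Lam T (ball N) false u1 u2 u3 u4.
  by apply: quad_integral_NE; [exact: has_bound_cbm h1|exact: has_bound_cbm h2|exact: has_bound_cbm h3|exact: has_bound_cbm h4].
have [B1 [y1 w1]] := h1; have [B2 [y2 w2]] := h2; have [B3 [y3 w3]] := h3; have [B4 [y4 w4]] := h4.
have cauchy (e : R) : 0 < e -> exists N, forall n, (N <= n)%N ->
    normc (quad_integral_N T u1 u2 u3 u4 n - quad_integral_N T u1 u2 u3 u4 N) <= e.
  move=> e0; have ep : 0 < e / p by rewrite divr_gt0.
  have [N hN] := Lam_cauchy T01 y1 y2 y3 y4 ep; exists N => n Nn.
  have := hN false (profile u1) (profile u2) (profile u3) (profile u4) w1 w2 w3 w4 N n.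
  rewrite leqnn Nn !free_profileE => /(_ isT) h.
  by rewrite !QE -mulrBr normcM normc_real gtr0_norm // mulrC -ler_pdivlMr.
have [l hl] := complex_cauchy cauchy.
have cv := cvgc hl; split; first exact: cvgP cv.
rewrite /quad_integral (cvg_lim (@norm_hausdorff _ _) cv); apply/ler_addgt0Pr => e e0.
have [N hN] := hl e e0; have {}hN := hN N (leqnn N).
have -> : l = quad_integral_N T u1 u2 u3 u4 N + - (quad_integral_N T u1 u2 u3 u4 N - l) by rewrite opprB addrCA subrr addr0.
apply: le_trans (normcD _ _) _; rewrite normcN; apply: lerD => //.
by rewrite QE normcM normc_real gtr0_norm // ler_pM2l.
Qed.

Lemma quad_add2 s (f1 f2 g2 f3 f4 : freq -> R[i]) :
  quad s f1 (fun A => f2 A + g2 A) f3 f4 = quad s f1 f2 f3 f4 + quad s f1 g2 f3 f4.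
Proof. by rewrite !quadE -big_split /=; apply: eq_bigr => y _; ring. Qed.

Lemma Lam_add2 T s b u1 u2 w2 u3 u4 : (forall A, cbm (DT T) (fun t => u1 t A)) ->
  (forall A, cbm (DT T) (fun t => u2 t A)) -> (forall A, cbm (DT T) (fun t => w2 t A)) ->
  (forall A, cbm (DT T) (fun t => u3 t A)) -> (forall A, cbm (DT T) (fun t => u4 t A)) ->
  Lam T s b u1 (fun t A => u2 t A + w2 t A) u3 u4 = Lam T s b u1 u2 u3 u4 + Lam T s b u1 w2 u3 u4.
Proof.
move=> c1 c2 c2' c3 c4; have mD : measurable (DT T) := measurable_itv _; have fD := lebesgue_itv_finite 0 T.
have c4' := cbm_sg b c4; rewrite /Lam -(cintD (m := mu) mD fD (cbm_quad s c1 c2 c3 c4') (cbm_quad s c1 c2' c3 c4')).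
by apply: cint_eq => t _; exact: quad_add2.
Qed.

Definition tau (T M : R) : R := T `^ (1 / 7) * M `^ (3 / 5).

Lemma tau_gt0 T M : 0 < T -> 1 <= M -> 0 < tau T M.
Proof. by move=> T0 M1; rewrite mulr_gt0 ?powR_gt0 // (lt_le_trans ltr01). Qed.

(* [7 * 3 / 5 >= 2], so the seventh power of [tau] dominates [T M^2]. *)
Lemma tau7 T M : 0 < T -> 1 <= M -> T * M ^+ 2 <= tau T M ^+ 7.
Proof.
move=> T0 M1; have M0 : 0 <= M by apply: le_trans M1.
have e (x : R) (z : R) : 0 <= x -> (x `^ z) ^+ 7 = x `^ (z * 7).
  by move=> x0; rewrite -powR_mulrn ?powR_ge0 // -powRrM.
rewrite exprMn !e ?(ltW T0) // [1 / 7 * 7](_ : _ = 1) ?powRr1 ?(ltW T0) //; last by field.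
by rewrite ler_pM2l // -powR_mulrn // ler_powR //; lra.
Qed.

(** The cutoff vanishes for [|A| > 2 M], so [4^lev A <= 4 (1 + 4 M^2) <= 20 M^2], and [16^7] absorbs
    the 20. *)
Lemma lp_low_supp (eta : R -> R) M (c : freq -> R[i]) A T : lp_cutoff eta -> 0 < T -> 1 <= M ->
  lp_low eta M c A != 0 -> T * 4 ^+ lev A <= (16 * tau T M) ^+ 7.
Proof.
move=> he T0 M1 nz; have M0 : 0 < M by apply: lt_le_trans M1.
have s0 := @sqnorm_ge0 R A.
have hs : sqnorm A <= 4 * M ^+ 2 :> R.
  rewrite leNgt; apply/negP => h; move: nz; rewrite /lp_low.
  have [_ _ ->] := he (Num.sqrt (sqnorm A) / M); first by rewrite mul0r eqxx.
  rewrite ltr_pdivlMr // -(@ltr_pXn2r _ 2) ?nnegrE ?sqrtr_ge0 ?mulr_ge0 ?(ltW M0) //.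
  by rewrite sqr_sqrtr // exprMn (_ : 2 ^+ 2 = 4) //; ring.
have M2 : 1 <= M ^+ 2 by rewrite exprn_ege1.
have hl := @japanese_lev R A.
have h20 : 4 ^+ lev A <= 20 * M ^+ 2 :> R by move: hl hs M2; move: (4 ^+ _) (M ^+ 2) (sqnorm A) => x y z; lra.
have t7 := tau7 T0 M1.
apply: le_trans (ler_wpM2l (ltW T0) h20) _; rewrite exprMn mulrCA; apply: ler_pM => //.
- by rewrite mulr_ge0 ?(ltW T0) // sqr_ge0.
- rewrite (exprD _ 2 5) (_ : 16 ^+ 2 = 256); last by ring.
  have : 1 <= 16 ^+ 5 :> R by rewrite exprn_ege1 // ler1n.
  by lra.
Qed.

(** The general bound takes [r = 1]; the low frequency bound takes [r = 16 * tau T M], admissible by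
    [lp_low_supp]. *)
Lemma Lam_bound_low (eta : R -> R) : lp_cutoff eta -> exists C : R, 0 < C /\
  (forall T b u1 u2 u3 u4 n1 n2 n3 n4 N, 0 < T <= 1 -> has_bound Wm T u1 n1 -> has_bound Wp T u2 n2 ->
    has_bound Wp T u3 n3 -> has_bound Wp T u4 n4 ->
    normc (Lam T (ball N) b u1 u2 u3 u4) <= C * (n1 * n2 * n3 * n4)) /\
  (forall T M b u1 u2 u3 u4 n1 n2 n3 n4 N, 0 < T <= 1 -> 1 <= M -> has_bound Wm T u1 n1 ->
    has_bound Wp T (fun t => lp_low eta M (u2 t)) n2 -> has_bound Wp T u3 n3 -> has_bound Wp T u4 n4 ->
    normc (Lam T (ball N) b u1 (fun t => lp_low eta M (u2 t)) u3 u4) <= C * tau T M * (n1 * n2 * n3 * n4)).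
Proof.
move=> he; have [C [C0 hC]] := @Lam_bound R; exists (16 * C); split; first by rewrite mulr_gt0.
split=> [T b u1 u2 u3 u4 n1 n2 n3 n4 N T01 h1 h2 h3 h4|T M b u1 u2 u3 u4 n1 n2 n3 n4 N T01 M1 h1 h2 h3 h4].
  have P0 : 0 <= n1 * n2 * n3 * n4.
    by rewrite !mulr_ge0 ?(has_bound_ge0 h1) ?(has_bound_ge0 h2) ?(has_bound_ge0 h3) ?(has_bound_ge0 h4).
  have [B1 [y1 w1]] := h1; have [B2 [y2 w2]] := h2; have [B3 [y3 w3]] := h3; have [B4 [y4 w4]] := h4.
  have := hC T b (profile u1) (profile u2) (profile u3) (profile u4) B1 B2 B3 B4 n1 n2 n3 n4 1 N
    T01 ltr01 y1 y2 y3 y4 w1 w2 w3 w4 (or_introl erefl).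
  rewrite !free_profileE mulr1 => h; apply: le_trans h _; apply: ler_wpM2r => //.
  by move: C0; lra.
have [T0 _] := andP T01; have t0 := tau_gt0 T0 M1.
have [B1 [y1 w1]] := h1; have [B2 [y2 w2]] := h2; have [B3 [y3 w3]] := h3; have [B4 [y4 w4]] := h4.
have r0 : 0 < 16 * tau T M by rewrite mulr_gt0.
have := hC T b (profile u1) (profile (fun t => lp_low eta M (u2 t))) (profile u3) (profile u4) B1 B2 B3 B4 n1 n2 n3 n4
  (16 * tau T M) N T01 r0 y1 y2 y3 y4 w1 w2 w3 w4.
rewrite !free_profileE => h; have -> : 16 * C * tau T M = C * (16 * tau T M) by ring.
apply: h; right => x A nz; apply: (lp_low_supp he T0 M1 (c := u2 x)).
by move: nz; apply: contraNneq => h; rewrite /profile h mulr0.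
Qed.

Lemma duhamel_estimates (eta : R -> R) : lp_cutoff eta -> exists C : R, 0 < C /\
  forall T M a u1 u2 u3 n1 n2 n3, 0 < T <= 1 -> 1 <= M -> 0 <= a < T ->
  has_bound Wm T u1 n1 -> has_bound Wp T u2 n2 -> has_bound Wp T u3 n3 ->
  [/\ forall t D, 0 <= t < T -> cvgn (duhamel3_N a u1 u2 u3 t D),
    (X_norm (-1) T (duhamel3 a u1 u2 u3) <= (C * (n1 * n2 * n3))%:E)%E &
    forall nl nh, has_bound Wp T (fun t => lp_low eta M (u2 t)) nl ->
      has_bound Wp T (fun t => lp_high eta M (u2 t)) nh ->
      (X_norm (-1) T (duhamel3 a u1 u2 u3) <= (C * (n1 * (tau T M * nl + nh) * n3))%:E)%E].
Proof.
move=> he; have [C [C0 [hC hL]]] := Lam_bound_low he; exists (8 * 128 * C); split; first by rewrite !mulr_gt0.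
move=> T M a u1 u2 u3 n1 n2 n3 T01 M1 aT h1 h2 h3; have [T0 _] := andP T01; have t0 := tau_gt0 T0 M1.
have m1 := has_bound_ge0 h1; have m2 := has_bound_ge0 h2; have m3 := has_bound_ge0 h3.
have [B1 [y1 w1]] := h1; have [B2 [y2 w2]] := h2; have [B3 [y3 w3]] := h3.
have hv v B n : ybnd Wp B n -> (forall A, wvar T (B A) (fun t => v t A)) ->
    has_bound Wp T (fun t => free (v t) t) n.
  move=> yB wB; exists B; split=> // A.
  have -> // : (fun t => profile (fun t => free (v t) t) t A) = (fun t => v t A).
  by apply/funext => t; rewrite /profile /free mulrA expi_add_opp mul1r.
have dh K := @duhamel_bound R T a u1 u2 u3 B1 B2 B3 n1 n2 n3 K T01 aT y1 y2 y3 w1 w2 w3.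
have k0 : 0 <= C * (n1 * n2 * n3) by rewrite !mulr_ge0 // ltW.
have [cv Xb] := dh _ k0 (fun N v B n yB wB => ltac:(rewrite -mulrA; exact: hC T01 h1 h2 h3 (hv v B n yB wB))).
split=> //; first by rewrite -[8 * 128 * C * _]mulrA.
move=> nl nh hl hh; have ml := has_bound_ge0 hl; have mh := has_bound_ge0 hh.
have k0' : 0 <= C * (n1 * (tau T M * nl + nh) * n3).
  apply: mulr_ge0; first exact: ltW.
  by do 2![apply: mulr_ge0 => //]; apply: addr_ge0 => //; apply: mulr_ge0 => //; exact: ltW.
have [|_ Xb'] := dh _ k0'; last by rewrite -[8 * 128 * C * _]mulrA.
move=> N v B n yB wB; have h4 := hv v B n yB wB.
have -> : u2 = (fun t A => lp_low eta M (u2 t) A + lp_high eta M (u2 t) A).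
  by apply/funext => t; apply/funext => A; rewrite /lp_high addrC subrK.
rewrite Lam_add2; [|exact: has_bound_cbm h1|exact: has_bound_cbm hl|exact: has_bound_cbm hh|exact: has_bound_cbm h3|exact: has_bound_cbm h4].
apply: le_trans (normcD _ _) _.
have e1 := hL T M true u1 u2 u3 _ n1 nl n3 n N T01 M1 h1 hl h3 h4.
have e2 := hC T true u1 _ u3 _ n1 nh n3 n N T01 h1 hh h3 h4.
apply: le_trans (lerD e1 e2) _; rewrite le_eqVlt; apply/orP; left; apply/eqP; ring.
Qed.

Lemma lp_low_free (eta : R -> R) T M u f : is_free_on T u f ->
  is_free_on T (fun t => lp_low eta M (u t)) (lp_low eta M f).
Proof. by move=> h t tT xi; rewrite /lp_low h // /free mulrCA. Qed.

Lemma lp_high_free (eta : R -> R) T M u f : is_free_on T u f ->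
  is_free_on T (fun t => lp_high eta M (u t)) (lp_high eta M f).
Proof.
move=> h t tT xi; rewrite /lp_high (lp_low_free eta M h tT) h // /free mulrBr //.
Qed.

Lemma mule3_fin (x y z : \bar R) : x \is a fin_num -> y \is a fin_num -> z \is a fin_num ->
  (x * y * z)%E = (fine x * fine y * fine z)%:E.
Proof. by move=> fx fy fz; rewrite -{1}(fineK fx) -{1}(fineK fy) -{1}(fineK fz) -!EFinM. Qed.

(** An infinite low or high norm makes the right-hand side infinite unless [n1] or [n3] is zero. In
    that case the product is 0 by convention, and the last hypothesis, supplied by the estimate
    without splitting, bounds the left-hand side by 0. *)
Lemma lee_mul_infty (C t : R) (x n1 nl nh n3 : \bar R) : 0 < C -> 0 < t ->
  n1 \is a fin_num -> n3 \is a fin_num -> (0 <= n1)%E -> (0 <= n3)%E -> (0 <= nl)%E -> (0 <= nh)%E ->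
  (nl = +oo \/ nh = +oo)%E -> (n1 = 0 \/ n3 = 0 -> x <= 0)%E ->
  (x <= C%:E * (n1 * (t%:E * nl + nh) * n3))%E.
Proof.
move=> C0 t0 f1 f3 p1 p3 pl ph inf hx.
have tl : (0 <= t%:E * nl)%E by rewrite mule_ge0 // lee_fin ltW.
have rhs0 : (0 <= C%:E * (n1 * (t%:E * nl + nh) * n3))%E.
  by rewrite !mule_ge0 // ?adde_ge0 // lee_fin ltW.
have [z1|z1] := eqVneq n1 0%E; first by apply: le_trans rhs0; apply: hx; left.
have [z3|z3] := eqVneq n3 0%E; first by apply: le_trans rhs0; apply: hx; right.
have q1 : (0 < n1)%E by rewrite lt_neqAle eq_sym z1.
have q3 : (0 < n3)%E by rewrite lt_neqAle eq_sym z3.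
have -> : (t%:E * nl + nh = +oo)%E.
  case: inf => ->; first by rewrite gt0_muley ?lte_fin // addye // gt_eqF // (lt_le_trans _ ph) // ltNyr.
  by rewrite addey // gt_eqF // (lt_le_trans _ tl) // ltNyr.
by rewrite gt0_muley // gt0_mulye // gt0_muley ?lte_fin // leey.
Qed.

Lemma EFin_duh (c x a l h b : R) : (c * (a * (x * l + h) * b))%:E =
  (c%:E * (a%:E * (x%:E * l%:E + h%:E) * b%:E))%E.
Proof. by []. Qed.

Lemma duhamel_size_norm (eta : R -> R) : lp_cutoff eta -> exists C : R, 0 < C /\
  forall T M0 a : R, 0 < T <= 1 -> 1 <= M0 -> 0 <= a < T ->
  forall (b1 b2 b3 : bool) u1 u2 u3 (f1 f2 f3 : freq -> R[i]),
  (b1 -> is_free_on T u1 f1) -> (b2 -> is_free_on T u2 f2) -> (b3 -> is_free_on T u3 f3) ->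
  let n1 := size_norm b1 (-1) T u1 f1 in
  let n2 := size_norm b2 1 T u2 f2 in
  let n2low := size_norm b2 1 T (fun t => lp_low eta M0 (u2 t)) (lp_low eta M0 f2) in
  let n2high := size_norm b2 1 T (fun t => lp_high eta M0 (u2 t)) (lp_high eta M0 f2) in
  let n3 := size_norm b3 1 T u3 f3 in
  (n1 < +oo)%E -> (n2 < +oo)%E -> (n3 < +oo)%E ->
  [/\ forall t xi, 0 <= t < T -> cvgn (duhamel3_N a u1 u2 u3 t xi),
    (X_norm (-1) T (duhamel3 a u1 u2 u3) <= C%:E * (n1 * ((tau T M0)%:E * n2low + n2high) * n3))%E &
    (X_norm (-1) T (duhamel3 a u1 u2 u3) <= C%:E * (n1 * n2 * n3))%E].
Proof.
move=> he; have [C [C0 hC]] := duhamel_estimates he; exists C; split=> //.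
move=> T M0 a T01 M1 aT b1 b2 b3 u1 u2 u3 f1 f2 f3 fr1 fr2 fr3 n1 n2 nl nh n3 i1 i2 i3.
have p1 : (0 <= n1)%E := size_norm_ge0 _ _ _ _ _; have p2 : (0 <= n2)%E := size_norm_ge0 _ _ _ _ _.
have p3 : (0 <= n3)%E := size_norm_ge0 _ _ _ _ _; have pl : (0 <= nl)%E := size_norm_ge0 _ _ _ _ _.
have ph : (0 <= nh)%E := size_norm_ge0 _ _ _ _ _.
have fin (x : \bar R) : (0 <= x)%E -> (x < +oo)%E -> x \is a fin_num by move=> x0 xi; rewrite ge0_fin_numE.
have h1 := has_bound_m fr1 i1; have h2 := has_bound_p fr2 i2; have h3 := has_bound_p fr3 i3.
have [cv Xb Xlh] := hC T M0 a u1 u2 u3 _ _ _ T01 M1 aT h1 h2 h3.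
have Xb' : (X_norm (-1) T (duhamel3 a u1 u2 u3) <= C%:E * (n1 * n2 * n3))%E.
  by rewrite mule3_fin ?fin // -EFinM.
have [T0 _] := andP T01; have t0 := tau_gt0 T0 M1.
split=> //; have [il|il] := ltP nl +oo%E; last first.
  apply: lee_mul_infty => //; rewrite ?fin //; first by left; apply/eqP; rewrite eq_le leey il.
  by case=> z; apply: le_trans Xb' _; rewrite z ?mul0e ?mule0 ?mul0e ?mule0.
have [ih|ih] := ltP nh +oo%E; last first.
  apply: lee_mul_infty => //; rewrite ?fin //; first by right; apply/eqP; rewrite eq_le leey ih.
  by case=> z; apply: le_trans Xb' _; rewrite z ?mul0e ?mule0 ?mul0e ?mule0.
have hl := has_bound_p (fun b => lp_low_free eta M0 (fr2 b)) il.
have hh := has_bound_p (fun b => lp_high_free eta M0 (fr2 b)) ih.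
have := Xlh _ _ hl hh.
have fl := fin _ pl il; have fh := fin _ ph ih; have g1 := fin _ p1 i1; have g3 := fin _ p3 i3.
rewrite -/nl -/nh -/n1 -/n3 => h; apply: le_trans h _.
by rewrite EFin_duh !fineK.
Qed.

Lemma mule4_fin (x y z w : \bar R) : x \is a fin_num -> y \is a fin_num -> z \is a fin_num ->
  w \is a fin_num -> (x * y * z * w)%E = (fine x * fine y * fine z * fine w)%:E.
Proof. by move=> fx fy fz fw; rewrite (mule3_fin fx fy fz) -[in LHS](fineK fw) -EFinM. Qed.

Lemma quad_integral_Y_norm (eta : R -> R) : lp_cutoff eta -> exists C : R, 0 < C /\
  forall T M0 : R, 0 < T <= 1 -> 1 <= M0 -> forall u1 u2 u3 g,
  let Pu2 := fun t => lp_low eta M0 (u2 t) in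
  (Y_norm (-1) T u1 < +oo)%E -> (Y_norm 1 T u3 < +oo)%E -> (Y_norm 1 T g < +oo)%E ->
  ((Y_norm 1 T u2 < +oo)%E -> cvgn (quad_integral_N T u1 u2 u3 g) /\
    ((normc (quad_integral T u1 u2 u3 g))%:E
      <= C%:E * (Y_norm (-1) T u1 * Y_norm 1 T u2 * Y_norm 1 T u3 * Y_norm 1 T g))%E) /\
  ((Y_norm 1 T Pu2 < +oo)%E -> cvgn (quad_integral_N T u1 Pu2 u3 g) /\
    ((normc (quad_integral T u1 Pu2 u3 g))%:E
      <= (C * tau T M0)%:E * (Y_norm (-1) T u1 * Y_norm 1 T Pu2 * Y_norm 1 T u3 * Y_norm 1 T g))%E).
Proof.
move=> he; have [C [C0 [hC hL]]] := Lam_bound_low he; exists ((2 * pi) ^+ 4 * C).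
split; first by rewrite mulr_gt0 // exprn_gt0 // pi2_gt0.
move=> T M0 T01 M1 u1 u2 u3 g Pu2 i1 i3 i4.
have fin s u : (Y_norm s T u < +oo)%E -> Y_norm s T u \is a fin_num.
  by move=> h; rewrite ge0_fin_numE // weighted_l2_ge0.
have nf u f : false -> is_free_on T u f by [].
pose z : freq -> R[i] := fun _ => 0.
have h1 := has_bound_m (nf u1 z) i1; have h3 := has_bound_p (nf u3 z) i3; have h4 := has_bound_p (nf g z) i4.
split=> i2.
  have h2 := has_bound_p (nf u2 z) i2.
  have [cv le] := quad_integral_le T01 h1 h2 h3 h4 (fun N => hC T false u1 u2 u3 g _ _ _ _ N T01 h1 h2 h3 h4).
  by split=> //; rewrite mule4_fin ?fin // -EFinM lee_fin -[leRHS]mulrA.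
have h2 := has_bound_p (nf Pu2 z) i2.
have [cv le] := quad_integral_le T01 h1 h2 h3 h4 (fun N => hL T M0 false u1 u2 u3 g _ _ _ _ N T01 M1 h1 h2 h3 h4).
by split=> //; rewrite mule4_fin ?fin // -EFinM lee_fin -!mulrA; rewrite -!mulrA in le.
Qed.

End Final.

Theorem lemma2p1 (R : realType) (eta : R -> R) (Heta : lp_cutoff eta) :
  exists C : R, 0 < C /\
  forall T M0 a : R, 0 < T <= 1 -> 1 <= M0 -> 0 <= a < T ->
  let Plow := lp_low eta M0 in
  let Phigh := lp_high eta M0 in
  [/\ (* high frequency estimate *)
      forall u1 u2 u3 g : R -> freq -> R[i],
        (Y_norm (-1) T u1 < +oo)%E -> (Y_norm 1 T u2 < +oo)%E ->
        (Y_norm 1 T u3 < +oo)%E -> (Y_norm 1 T g < +oo)%E ->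
        cvgn (quad_integral_N T u1 u2 u3 g) /\
        ((Normc.normc (quad_integral T u1 u2 u3 g))%:E
          <= C%:E * (Y_norm (-1) T u1 * Y_norm 1 T u2
                     * Y_norm 1 T u3 * Y_norm 1 T g))%E,
      (* low frequency estimate *)
      forall u1 u2 u3 g : R -> freq -> R[i],
        let Pu2 := fun t => Plow (u2 t) in
        (Y_norm (-1) T u1 < +oo)%E -> (Y_norm 1 T Pu2 < +oo)%E ->
        (Y_norm 1 T u3 < +oo)%E -> (Y_norm 1 T g < +oo)%E ->
        cvgn (quad_integral_N T u1 Pu2 u3 g) /\
        ((Normc.normc (quad_integral T u1 Pu2 u3 g))%:E
          <= (C * T `^ (1 / 7) * M0 `^ (3 / 5))%:E
             * (Y_norm (-1) T u1 * Y_norm 1 T Pu2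
                * Y_norm 1 T u3 * Y_norm 1 T g))%E,
      (* Duhamel form *)
      forall u1 u2 u3 : R -> freq -> R[i],
        (Y_norm (-1) T u1 < +oo)%E -> (Y_norm 1 T u2 < +oo)%E ->
        (Y_norm 1 T u3 < +oo)%E ->
        [/\ forall t xi, 0 <= t < T -> cvgn (duhamel3_N a u1 u2 u3 t xi),
            (X_norm (-1) T (duhamel3 a u1 u2 u3)
              <= C%:E * (Y_norm (-1) T u1
                 * ((T `^ (1 / 7) * M0 `^ (3 / 5))%:E
                      * Y_norm 1 T (fun t => Plow (u2 t))
                    + Y_norm 1 T (fun t => Phigh (u2 t)))
                 * Y_norm 1 T u3))%E
          & (X_norm (-1) T (duhamel3 a u1 u2 u3)
              <= C%:E * (Y_norm (-1) T u1 * Y_norm 1 T u2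
                         * Y_norm 1 T u3))%E]
    & (* Duhamel form, where u_j is the free evolution of f_j whenever b_j *)
      forall (b1 b2 b3 : bool) (u1 u2 u3 : R -> freq -> R[i])
             (f1 f2 f3 : freq -> R[i]),
        (b1 -> is_free_on T u1 f1) -> (b2 -> is_free_on T u2 f2) ->
        (b3 -> is_free_on T u3 f3) ->
        let n1 := size_norm b1 (-1) T u1 f1 in
        let n2 := size_norm b2 1 T u2 f2 in
        let n2low := size_norm b2 1 T (fun t => Plow (u2 t)) (Plow f2) in
        let n2high := size_norm b2 1 T (fun t => Phigh (u2 t)) (Phigh f2) in
        let n3 := size_norm b3 1 T u3 f3 in
        (n1 < +oo)%E -> (n2 < +oo)%E -> (n3 < +oo)%E ->
        [/\ forall t xi, 0 <= t < T -> cvgn (duhamel3_N a u1 u2 u3 t xi),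
            (X_norm (-1) T (duhamel3 a u1 u2 u3)
              <= C%:E * (n1 * ((T `^ (1 / 7) * M0 `^ (3 / 5))%:E * n2low
                               + n2high) * n3))%E
          & (X_norm (-1) T (duhamel3 a u1 u2 u3)
              <= C%:E * (n1 * n2 * n3))%E]].
Proof.
have [C1 [C10 h1]] := duhamel_size_norm Heta; have [C2 [C20 h2]] := quad_integral_Y_norm Heta.
exists (C1 + C2); split; first exact: addr_gt0.
move=> T M0 a T01 M1 aT Plow Phigh; have [T0 _] := andP T01; have t0 := tau_gt0 T0 M1.
have le1 (y : \bar R) : (0 <= y -> C1%:E * y <= (C1 + C2)%:E * y)%E.
  by move=> y0; rewrite lee_wpmul2r // lee_fin lerDl ltW.
have le2 (y : \bar R) : (0 <= y -> C2%:E * y <= (C1 + C2)%:E * y)%E.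
  by move=> y0; rewrite lee_wpmul2r // lee_fin lerDr ltW.
have Y0 s u : (0 <= Y_norm s T u)%E by exact: weighted_l2_ge0.
have pos (n1 nl nh n3 : \bar R) : (0 <= n1 -> 0 <= nl -> 0 <= nh -> 0 <= n3 ->
    0 <= n1 * ((T `^ (1 / 7) * M0 `^ (3 / 5))%:E * nl + nh) * n3)%E.
  by move=> p1 pl ph p3; rewrite !mule_ge0 ?adde_ge0 ?mule_ge0 // lee_fin ltW.
have part4 := h1 T M0 a T01 M1 aT.
split.
- move=> u1 u2 u3 g i1 i2 i3 i4; have [/(_ i2)[cv le] _] := h2 T M0 T01 M1 u1 u2 u3 g i1 i3 i4.
  by split=> //; apply: le_trans le (le2 _ _); rewrite !mule_ge0.
- move=> u1 u2 u3 g Pu2 i1 i2 i3 i4; have [_ /(_ i2)[cv le]] := h2 T M0 T01 M1 u1 u2 u3 g i1 i3 i4.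
  split=> //; apply: le_trans le _; rewrite -[(C1 + C2) * _ * _]mulrA.
  by rewrite lee_wpmul2r ?mule_ge0 // lee_fin ler_wpM2r ?(ltW t0) // lerDr ltW.
- move=> u1 u2 u3 i1 i2 i3; pose z : freq -> R[i] := fun _ => 0.
  have [cv Xl Xb] := part4 false false false u1 u2 u3 z z z (fun h => ltac:(by []))
    (fun h => ltac:(by [])) (fun h => ltac:(by [])) i1 i2 i3.
  split=> //; first by apply: le_trans Xl (le1 _ _); apply: pos; exact: Y0.
  by apply: le_trans Xb (le1 _ _); apply: mule_ge0; [apply: mule_ge0|]; exact: Y0.
move=> b1 b2 b3 u1 u2 u3 f1 f2 f3 fr1 fr2 fr3 n1 n2 n2low n2high n3 i1 i2 i3.
have [cv Xl Xb] := part4 b1 b2 b3 u1 u2 u3 f1 f2 f3 fr1 fr2 fr3 i1 i2 i3.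
split=> //; first by apply: le_trans Xl (le1 _ _); apply: pos; exact: size_norm_ge0.
by apply: le_trans Xb (le1 _ _); rewrite !mule_ge0 // size_norm_ge0.
Qed.
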